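(* Let $(u_t,v_t)$ be a solution of the symbiotic branching model on $\mathbb{Z}^d$ with transition rates $(a(i,j))_{i,j\in\mathbb{Z}^d}$, correlation $\varrho>0$, and homogeneous initial conditions $u_0=v_0\equiv1$. Then for $\kappa\varrho>\frac{1}{\bar G_\infty}$, the map $$\gamma_2:\Big[\tfrac{1}{\varrho\bar G_\infty},\infty\Big)\to\mathbb{R}_{\ge0},\qquad \kappa\mapsto\gamma_2(\kappa)=\gamma_2(\kappa,\varrho),$$ has the following properties: i) $\gamma_2$ is strictly convex; ii) $\gamma_2(\kappa)\le\kappa\varrho$ for all $\kappa$, and $\frac{\gamma_2(\kappa)}{\kappa\varrho}\to1$ as $\kappa\to\infty$; iii) if $\bar p_t(0,0)\sim ct^{-\alpha}$ as $t\to\infty$, with $\alpha\le1$, then, as $\kappa\to0$, $$\gamma_2(\kappa)\sim\begin{cases}(c\,\Gamma(1-\alpha)\,\kappa\varrho)^{1/(1-\alpha)}&:0<\alpha<1,\\[1ex] \exp\big(-(c\kappa\varrho)^{-1}+o(\kappa^{-1})\big)&:\alpha=1;\end{cases}$$ iv) if $\bar p_t(0,0)\sim ct^{-\alpha}$ as $t\to\infty$, with $\alpha>1$, then, as $\kappa\searrow\frac{1}{\bar G_\infty\varrho}>0$, $$\gamma_2(\kappa)\sim\begin{cases}\Big(\frac{(\kappa\varrho-1/\bar G_\infty)\,\bar G_\infty^2(\alpha-1)}{c\,\Gamma(2-\alpha)}\Big)^{1/(\alpha-1)}&:1<\alpha<2,\\[1ex] \frac{\bar G_\infty^2}{c}\,(\kappa\varrho-1/\bar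 G_\infty)\Big(\log\frac{1}{\kappa\varrho-1/\bar G_\infty}\Big)^{-1}&:\alpha=2,\\[1ex] \frac{\bar G_\infty^2}{\bar H_\infty}\,(\kappa\varrho-1/\bar G_\infty)&:\alpha>2.\end{cases}$$
   Context: Symbiotic branching model: fix $d\ge 1$, $\kappa>0$, $\varrho\in[-1,1]$ and rates $(a(i,j))_{i,j\in\mathbb{Z}^d}$ with $0\le a(i,j)<\infty$, $\sum_{j}a(i,j)=1$ for all $i$, and $a(i,j)=a(0,j-i)$. Fix a positive summable function $\omega$ on $\mathbb{Z}^d$ with $\sum_i\omega(i)a(i,j)\le K\omega(j)$ for all $j$ and some finite $K$, and let $E=\{f:\mathbb{Z}^d\to\mathbb{R}_{\ge0}\mid\sum_j f(j)\omega(j)<\infty\}$ (the choice of $\omega$ is immaterial). A solution is a weak solution with almost surely continuous paths in $E\times E$ of $$du(t,i)=\sum_{j}a(i,j)(u(t,j)-u(t,i))\,dt+\sqrt{\kappa u(t,i)v(t,i)}\,dW^1_t(i),$$ $$dv(t,i)=\sum_{j}a(i,j)(v(t,j)-v(t,i))\,dt+\sqrt{\kappa u(t,i)v(t,i)}\,dW^2_t(i),$$ for $i\in\mathbb{Z}^d$, where $W^1(i),W^2(i)$, $i\in\mathbb{Z}^d$, are standard Brownian motions with $\langle W^n(i),W^m(j)\rangle_t=\varrho t$ if $i=j,\ n\ne m$; $=t$ if $i=j,\ n=m$; $=0$ otherwise. Second Lyapunov exponent: $\gamma_2(\kappa,\varrho)=\lim_{t\to\infty}\frac1t\log\mathbb{E}[u(t,k)^2]$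 (independent of $k$, same with $v$ in place of $u$). Symmetrization: let $X^1,X^2$ be independent continuous-time Markov processes on $\mathbb{Z}^d$ with transition rates $(a(i,j))$; $\bar X_t=X^1_t-X^2_t$, with transition probabilities $\bar p_t(i,j)$. $\bar G_\infty=\int_0^\infty\bar p_t(0,0)\,dt\in(0,\infty]$ (with $1/\infty=0$), $\bar H_\infty=\int_0^\infty t\,\bar p_t(0,0)\,dt$. $h_1\sim h_2$ means $\lim h_1/h_2=1$; $\Gamma$ is the Gamma function.
   Formalization: Strict convexity i) is stated only for a(0,0)<1: when a(i,j)=1 if i=j and 0 otherwise (no migration), which the assumptions allow, γ₂(κ)=κϱ is linear and i) fails; all other items are stated without this condition. *)

(* Defs.v *)
From mathcomp Require Import all_boot all_order all_algebra.
From mathcomp Require Import all_classical all_reals all_analysis.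
Set Implicit Arguments.
Unset Strict Implicit.
Unset Printing Implicit Defensive.
Import Order.TTheory GRing.Theory Num.Theory.
Import numFieldNormedType.Exports.
Local Open Scope classical_set_scope.
Local Open Scope ring_scope.

Notation sites d := 'rV[int]_d.

(* Sum of an absolutely summable real family over an arbitrary index type;
   the value is irrelevant when the family is not absolutely summable. *)
Definition rsum (R : realType) (T : choiceType) (f : T -> R) : R :=
  fine (\esum_(i in [set: T]) (Num.max (f i) 0)%:E) -
  fine (\esum_(i in [set: T]) (Num.max (- f i) 0)%:E).

(* `h1 ~ h2 along F' in the sense that the quotient tends to 1. *)
Definition asymp_equiv (R : realType) (F : set_system R) (h1 h2 : R -> R) :=
  h1 x / h2 x @[x --> F] --> (1 : R).

Definition strictly_convex_on (R : realType) (D : set R) (f : R -> R) :=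
  forall x y l : R, D x -> D y -> x != y -> 0 < l < 1 ->
    f (l * x + (1 - l) * y) < l * f x + (1 - l) * f y.

Definition Gamma (R : realType) (x : R) : R :=
  \int[@lebesgue_measure R]_(t in `]0, +oo[) (t `^ (x - 1) * expR (- t)).

Record migration_rates (R : realType) (d : nat) (a : sites d -> sites d -> R)
    : Prop := MigrationRates {
  rates_ge0 : forall i j, 0 <= a i j ;
  rates_sum1 : forall i, (\esum_(j in [set: sites d]) (a i j)%:E = 1)%E ;
  rates_shift : forall i j, a i j = a 0 (j - i) }.

Record admissible_weight (R : realType) (d : nat)
    (a : sites d -> sites d -> R) (om : sites d -> R)
    : Prop := AdmissibleWeight {
  weight_gt0 : forall i, 0 < om i ;
  weight_summable : (\esum_(i in [set: sites d]) (om i)%:E < +oo)%E ;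
  weight_bound : exists K : R, forall j,
    (\esum_(i in [set: sites d]) (om i * a i j)%:E <= (K * om j)%:E)%E }.

Definition state_space (R : realType) (d : nat) (om : sites d -> R)
    : set (sites d -> R) :=
  [set f | (forall i, 0 <= f i) /\
           (\esum_(j in [set: sites d]) (f j * om j)%:E < +oo)%E].

Definition weighted_dist (R : realType) (d : nat) (om f g : sites d -> R)
    : \bar R :=
  \esum_(j in [set: sites d]) (`|f j - g j| * om j)%:E.

Definition path_continuous (R : realType) (d : nat) (om : sites d -> R)
    (f : R -> sites d -> R) :=
  forall t : R, 0 <= t ->
    weighted_dist om (f s) (f t) @[s --> within [set s | 0 <= s] (nbhs t)]
      --> (0 : \bar R).

Definition migration (R : realType) (d : nat) (a : sites d -> sites d -> R)
    (f : sites d -> R) (i : sites d) : R :=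
  rsum (fun j => a i j * (f j - f i)).

Definition filtration (R : realType) (disp : measure_display)
    (O : measurableType disp) (F : R -> set (set O)) : Prop :=
  [/\ forall t : R, 0 <= t -> sigma_algebra [set: O] (F t),
      forall s t : R, 0 <= s -> s <= t -> F s `<=` F t
    & forall t : R, 0 <= t -> F t `<=` measurable].

Definition adapted (R : realType) (disp : measure_display)
    (O : measurableType disp) (F : R -> set (set O)) (X : R -> O -> R) : Prop :=
  forall t : R, 0 <= t -> forall B : set R, measurable B -> F t (X t @^-1` B).

(* [0 :: s] lists the points of a partition of `[0, t] *)
Definition pt (R : realType) (s : seq R) (k : nat) : R := nth 0 (0 :: s) k.

Definition cvg_prob_along_partitions (R : realType) (disp : measure_display)
    (O : measurableType disp) (P : probability O R) (t : R)
    (S : seq R -> O -> R) (L : O -> R) : Prop :=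
  forall eps eta : R, 0 < eps -> 0 < eta ->
  exists2 del : R, 0 < del & forall s : seq R, itv_partition 0 t s ->
    (forall k, (k < size s)%N -> pt s k.+1 - pt s k < del) ->
    (P [set w | (eps <= `|S s w - L w|)%R] <= eta%:E)%E.

Definition is_bracket (R : realType) (disp : measure_display)
    (O : measurableType disp) (P : probability O R)
    (X Y : R -> O -> R) (t : R) (L : O -> R) : Prop :=
  cvg_prob_along_partitions P t
    (fun s w => \sum_(k < size s) (X (pt s k.+1) w - X (pt s k) w) *
                                  (Y (pt s k.+1) w - Y (pt s k) w)) L.

(* [L] is (a version of) the Ito integral of [H] against [W] over `[0, t]. For
   integrands that are adapted with continuous paths, the only ones used below,
   the Ito integral is the limit in probability of left-endpoint sums. *)
Definition is_Ito_integral (R : realType) (disp : measure_display)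
    (O : measurableType disp) (P : probability O R)
    (H W : R -> O -> R) (t : R) (L : O -> R) : Prop :=
  measurable_fun [set: O] L /\
  cvg_prob_along_partitions P t
    (fun s w => \sum_(k < size s)
       H (pt s k) w * (W (pt s k.+1) w - W (pt s k) w)) L.

Record standard_brownian (R : realType) (disp : measure_display)
    (O : measurableType disp) (P : probability O R)
    (F : R -> set (set O)) (W : R -> O -> R) : Prop := StandardBrownian {
  brownian_adapted : adapted F W ;
  brownian_start : {ae P, forall w, W 0 w = 0} ;
  brownian_continuous : {ae P, forall w, {within `[0, +oo[, continuous (W^~ w)}} ;
  (* increments are independent of the past, with law N(0, t - s) *)
  brownian_increment : forall (s t : R) (A : set O) (B : set R),
    0 <= s -> s < t -> F s A -> measurable B ->
    (P (A `&` [set w | B (W t w - W s w)%R]) =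
     P A * normal_prob 0 (Num.sqrt (t - s)) B)%E }.

Definition SBM_equation (R : realType) (d : nat)
    (a : sites d -> sites d -> R) (kappa : R)
    (disp : measure_display) (O : measurableType disp) (P : probability O R)
    (u v x : R -> O -> sites d -> R) (W : sites d -> R -> O -> R) : Prop :=
  forall (t : R) (i : sites d), 0 <= t ->
  exists2 L : O -> R,
    is_Ito_integral P (fun s w => Num.sqrt (kappa * u s w i * v s w i))
                    (W i) t L
  & {ae P, forall w,
      x t w i = x 0 w i
        + \int[lebesgue_measure]_(s in `[0, t]) migration a (x s w) i + L w}.

Record SBM_driven (R : realType) (d : nat)
    (a : sites d -> sites d -> R) (om : sites d -> R) (kappa rho : R)
    (disp : measure_display) (O : measurableType disp) (P : probability O R)
    (u v : R -> O -> sites d -> R)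
    (F : R -> set (set O)) (W : 'I_2 -> sites d -> R -> O -> R)
    : Prop := SBMDriven {
  SBM_filtration : filtration F ;
  SBM_brownian : forall n i, standard_brownian P F (W n i) ;
  SBM_bracket : forall n m i j (t : R), 0 <= t ->
    is_bracket P (W n i) (W m j) t
      (fun=> if i == j then (if n == m then t else rho * t) else 0) ;
  SBM_adapted_u : forall i, adapted F (fun t w => u t w i) ;
  SBM_adapted_v : forall i, adapted F (fun t w => v t w i) ;
  SBM_state : {ae P, forall w, forall t : R, 0 <= t ->
    state_space om (u t w) /\ state_space om (v t w)} ;
  SBM_paths : {ae P, forall w,
    path_continuous om (u^~ w) /\ path_continuous om (v^~ w)} ;
  SBM_eq_u : SBM_equation a kappa P u v u (W 0) ;
  SBM_eq_v : SBM_equation a kappa P u v v (W 1) }.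

Definition SBM_solution (R : realType) (d : nat)
    (a : sites d -> sites d -> R) (om : sites d -> R) (kappa rho : R)
    (disp : measure_display) (O : measurableType disp) (P : probability O R)
    (u v : R -> O -> sites d -> R) : Prop :=
  exists (F : R -> set (set O)) (W : 'I_2 -> sites d -> R -> O -> R),
    SBM_driven a om kappa rho P u v F W.

Definition homogeneous_start (R : realType) (d : nat)
    (disp : measure_display) (O : measurableType disp) (P : probability O R)
    (u v : R -> O -> sites d -> R) : Prop :=
  {ae P, forall w, forall i, u 0 w i = 1 /\ v 0 w i = 1}.

(* The quotient is taken in \bar R, so that convergence to a finite [g] entails
   that the second moments are eventually finite and positive. *)
Definition is_second_Lyapunov (R : realType)
    (disp : measure_display) (O : measurableType disp) (P : probability O R)
    (X : R -> O -> R) (g : R) : Prop :=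
  ((t^-1)%:E * lne 'E_P[fun w => (X t w ^+ 2)%R])%E @[t --> +oo] --> g%:E.

Record transition_function (R : realType) (d : nat)
    (p : R -> sites d -> sites d -> R) : Prop := TransitionFunction {
  trans_ge0 : forall (t : R) i j, 0 <= t -> 0 <= p t i j ;
  trans_sum1 : forall (t : R) i, 0 <= t ->
    (\esum_(j in [set: sites d]) (p t i j)%:E = 1)%E ;
  trans_0 : forall i j, p 0 i j = (i == j)%:R ;
  trans_chapman_kolmogorov : forall (s t : R) i j, 0 <= s -> 0 <= t ->
    (\esum_(k in [set: sites d]) (p s i k * p t k j)%:E = (p (s + t) i j)%:E)%E }.

(* The jump rate from i to j != i is [a i j]; since each row of [a] sums to 1,
   the diagonal entry of the rate matrix is [a i i - 1]. *)
Definition has_rates (R : realType) (d : nat)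
    (a : sites d -> sites d -> R) (p : R -> sites d -> sites d -> R) :=
  forall i j, (p h i j - (i == j)%:R) / h @[h --> 0^'+] --> a i j - (i == j)%:R.

Definition cylinder (R : realType) (d : nat) (T : Type)
    (X : R -> T -> sites d) (h : seq (R * sites d)) : set T :=
  [set w | forall q, q \in h -> X q.1 w = q.2].

Definition times_in (R : realType) (d : nat) (D : set R)
    (h : seq (R * sites d)) : Prop := forall q, q \in h -> D q.1.

Definition markov_with_rates (R : realType) (d : nat)
    (a : sites d -> sites d -> R)
    (disp : measure_display) (T : measurableType disp) (Q : probability T R)
    (X : R -> T -> sites d) : Prop :=
  (forall (t : R) i, 0 <= t -> measurable [set w | X t w = i]) /\
  exists p : R -> sites d -> sites d -> R,
    [/\ transition_function p, has_rates a p
      & forall (s t : R) (i j : sites d) (h : seq (R * sites d)),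
          0 <= s -> s <= t -> times_in `[0, s] h ->
          (Q (cylinder X h `&` [set w | X s w = i] `&` [set w | X t w = j]) =
           Q (cylinder X h `&` [set w | X s w = i]) * (p (t - s) i j)%:E)%E].

Definition independent_processes (R : realType) (d : nat)
    (disp : measure_display) (T : measurableType disp) (Q : probability T R)
    (X Y : R -> T -> sites d) : Prop :=
  forall g h : seq (R * sites d),
    times_in `[0, +oo[ g -> times_in `[0, +oo[ h ->
    (Q (cylinder X g `&` cylinder Y h) = Q (cylinder X g) * Q (cylinder Y h))%E.

(* [pbar t i j] is the probability that X1 - X2, started at i, is at j at time
   t; the starting point is realized by starting X1 at i and X2 at 0. *)
Definition symmetrized_transition (R : realType) (d : nat)
    (a : sites d -> sites d -> R) (pbar : R -> sites d -> sites d -> R)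
    : Prop :=
  forall i : sites d,
  exists (disp : measure_display) (T : measurableType disp)
    (Q : probability T R) (X1 X2 : R -> T -> sites d),
    [/\ markov_with_rates a Q X1 /\ markov_with_rates a Q X2,
        independent_processes Q X1 X2,
        Q [set w | X1 0 w = i] = 1%E /\ Q [set w | X2 0 w = 0] = 1%E
      & forall (t : R) j, 0 <= t ->
          ((pbar t i j)%:E = Q [set w | (X1 t w - X2 t w)%R = j])%E].

Definition Gbar (R : realType) (d : nat)
    (pbar : R -> sites d -> sites d -> R) : \bar R :=
  (\int[lebesgue_measure]_(t in `[0%R, +oo[) (pbar t 0 0)%:E)%E.

Definition Hbar (R : realType) (d : nat)
    (pbar : R -> sites d -> sites d -> R) : \bar R :=
  (\int[lebesgue_measure]_(t in `[0%R, +oo[) (t * pbar t 0 0)%:E)%E.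

(* 1 / Gbar, with 1 / +oo = 0 (the inverse of \bar R) *)
Definition invGbar (R : realType) (d : nat)
    (pbar : R -> sites d -> sites d -> R) : R :=
  fine ((Gbar pbar)^-1)%E.

Definition supercritical (R : realType) (d : nat)
    (pbar : R -> sites d -> sites d -> R) (rho : R) : set R :=
  `[invGbar pbar / rho, +oo[.

Definition power_decay (R : realType) (d : nat)
    (pbar : R -> sites d -> sites d -> R) (c alpha : R) : Prop :=
  asymp_equiv +oo (fun t => pbar t 0 0) (fun t => c * t `^ (- alpha)).

(* Main.v *)
From HB Require Import structures.
Require Import Defs.
From mathcomp Require Import all_boot all_order all_algebra.
From mathcomp Require Import all_classical all_reals all_analysis.
From mathcomp Require Import measurable_realfun.
From mathcomp Require Import ring lra zify.
Set Implicit Arguments.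
Unset Strict Implicit.
Unset Printing Implicit Defensive.
Import Order.TTheory GRing.Theory Num.Theory.
Import numFieldNormedType.Exports.
Local Open Scope classical_set_scope.
Local Open Scope ring_scope.

(* By Ito's formula, the mixed moment E[u_t(i) v_t(j)] solves the linear equation
whose operator is the generator of the difference walk plus kappa*rho at the
origin, and rho E[u_t(i)^2] <= E[u_t(i) v_t(i)] <= E[u_t(i)^2]. Let 1/phi(l) be the
Laplace transform at l of pbar_t(0,0). Comparison with (G_l + eps)/eps for l above
and with a multiple of G_l at the root l of phi(l) = kappa*rho, G_l being the
resolvent of the walk, identifies gamma_2 as this root, i.e. as the inverse of phi.
By the renewal equation, phi is increasing, strictly concave and satisfies
l <= phi(l) <= l + 2, which gives i) and ii); iii) and iv) follow from Abelian
theorems for the Laplace transforms of pbar and, if the walk is transient, of its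
tail. *)

(** A solution carries no moment bound, and its stochastic integrals and brackets are only limits in
    probability along partitions. The coefficients are therefore multiplied by the indicator [chi N]
    that the weighted norms have stayed below [N]; left-endpoint sums with such bounded coefficients
    are martingales and satisfy a product rule in expectation. Bounded second moments turn
    convergence in probability into weak convergence, which suffices for a Gronwall bound uniform in
    [N]; with that bound the truncation errors vanish in mean square and the moment equations become
    exact. The factor exp(2t) absorbs the diagonal of the two-walker generator, so a positive
    operator remains and comparison rests on monotonicity and on the weight [om]. The difference
    walk jumps at rate 2, so its resolvent at l is a power series in 1/(l+2) and phi(l) = l + 2 -
    psi(l), where psi has nonnegative first-return coefficients: monotonicity and concavity are read
    off termwise. The formula for pbar_t(0,0) has to be derived from the Markov property and from
    one-sided derivatives of the transition function at time 0. *)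

(** * Elementary inequalities and limits *)

Lemma normM_le_sqrD (R : realFieldType) (a b : R) : `|a| * `|b| <= a ^+ 2 + b ^+ 2.
Proof.
have := sqr_ge0 (`|a| - `|b|); rewrite sqrrB !real_normK ?num_real//.
have := sqr_ge0 a; have := sqr_ge0 b; rewrite -mulr_natr; lra.
Qed.

Lemma sqrD_le2 (R : realFieldType) (a b : R) :
 (a + b) ^+ 2 <= 2 * a ^+ 2 + 2 * b ^+ 2.
Proof. by have := sqr_ge0 (a - b); nra. Qed.

Lemma quadratic_ge0 (R : realFieldType) (A B C : R) : 0 <= A -> 0 <= C ->
 (forall s, 0 <= A + 2 * s * B + s ^+ 2 * C) -> B ^+ 2 <= A * C.
Proof.
move=> A0 C0 H.
have [C00|C00] := eqVneq C 0.
 rewrite C00 mulr0; have [->|B0] := eqVneq B 0; first by rewrite expr0n.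
 (* For [C = 0] the expression takes the value -1 at this point, so [B] must vanish. *)
 have := H (- (A + 1) / (2 * B)); rewrite C00 mulr0 addr0.
 rewrite (_ : 2 * (- (A + 1) / (2 * B)) * B = - (A + 1)); last by field.
 lra.
have {}C0 : 0 < C by rewrite lt_neqAle eq_sym C00.
have := H (- B / C).
rewrite (_ : _ + _ = A - B ^+ 2 / C); last by field.
by rewrite subr_ge0 ler_pdivrMr.
Qed.

Lemma abs_le_young (R : realFieldType) (del x : R) : 0 < del ->
 `|x| <= del * x ^+ 2 + (4 * del)^-1.
Proof.
move=> del0; have : 0 <= (2 * del * `|x| - 1) ^+ 2 / (4 * del).
 by rewrite mulr_ge0 ?sqr_ge0// invr_ge0 mulr_ge0// ltW.
rewrite (_ : _ / _ = del * `|x| ^+ 2 - `|x| + (4 * del)^-1); last first. by field; rewrite gt_eqF.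
by rewrite real_normK ?num_real//; lra.
Qed.

Lemma sum3_le (R : realFieldType) (e a b : R) : a <= e -> b <= e ->
 e + (a + b) <= 3 * e.
Proof. lra. Qed.

Lemma cvg_to_ge (U : Type) (F : set_system U) (FF : ProperFilter F)
 (R : realFieldType) (f : U -> R) (l a : R) :
 f x @[x --> F] --> l -> (\forall x \near F, a <= f x) -> a <= l.
Proof. by move=> fl af; rewrite -(cvg_lim _ fl)//; apply: limr_ge => //; apply/cvgP: fl. Qed.

Lemma cvg_to_le (U : Type) (F : set_system U) (FF : ProperFilter F)
 (R : realFieldType) (f : U -> R) (l a : R) :
 f x @[x --> F] --> l -> (\forall x \near F, f x <= a) -> l <= a.
Proof. by move=> fl af; rewrite -(cvg_lim _ fl)//; apply: limr_le => //; apply/cvgP: fl. Qed.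

Lemma cvg_uniq (U : Type) (F : set_system U) (FF : ProperFilter F)
 (R : realFieldType) (f : U -> R) (l l' : R) :
 f x @[x --> F] --> l -> f x @[x --> F] --> l' -> l = l'.
Proof. by move=> fl fl'; rewrite -(cvg_lim _ fl)// -(cvg_lim _ fl'). Qed.

Lemma cvg_norm_le (U : Type) (F : set_system U) (FF : ProperFilter F)
 (R : realFieldType) (f : U -> R) (l a : R) :
 f x @[x --> F] --> l -> (\forall x \near F, `|f x| <= a) -> `|l| <= a.
Proof.
move=> fl fa; rewrite ler_norml; apply/andP; split.
 by apply: (cvg_to_ge _ fl); apply: filterS fa => x; rewrite ler_norml => /andP[].
by apply: (cvg_to_le _ fl); apply: filterS fa => x; rewrite ler_norml => /andP[].
Qed.

Lemma cvgn_dist_le (R : realType) (u v : nat -> R) (l : R) :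
 (forall n, `|u n - l| <= v n) -> v n @[n --> \oo] --> 0 ->
 u n @[n --> \oo] --> l.
Proof.
move=> uv v0; apply/cvgrPdist_le => e e0.
move/cvgrPdist_le : v0 => /(_ e e0); apply: filterS => n.
rewrite sub0r normrN distrC => h; apply: le_trans (uv n) _.
exact: le_trans (ler_norm _) h.
Qed.

Lemma cvgn_eps (R : realType) (u : nat -> R) (l : R) :
 (u n @[n --> \oo] --> l) <->
 (forall e : R, 0 < e -> exists N, forall n, (N <= n)%N -> `|u n - l| <= e).
Proof.
split=> [/cvgrPdist_le h e /h[N _ hN]|h]. by exists N => n Nn; rewrite distrC; exact: hN.
apply/cvgrPdist_le => e /h[N hN]; exists N => // n /= Nn.
by rewrite distrC; exact: hN.
Qed.

(** * Real-valued integrals and convergence theorems *)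

Section integrable_functions.
Context d (T : measurableType d) (R : realType).
Variables (mu : {measure set T -> \bar R}) (D : set T).
Hypothesis mD : measurable D.
Implicit Types f g : T -> R.

Definition itg f := mu.-integrable D (EFin \o f).

Lemma itg_meas f : itg f -> measurable_fun D f.
Proof. by move=> /integrableP[/measurable_EFinP]. Qed.

Lemma itgD f g : itg f -> itg g -> itg (fun x => f x + g x).
Proof. by move=> hf hg; apply: (eq_integrable mD _ _ _ (integrableD mD hf hg)). Qed.

Lemma itgB f g : itg f -> itg g -> itg (fun x => f x - g x).
Proof. by move=> hf hg; apply: (eq_integrable mD _ _ _ (integrableB mD hf hg)). Qed.

Lemma itgZ c f : itg f -> itg (fun x => c * f x).
Proof. by move=> hf; apply: (eq_integrable mD _ _ _ (integrableZl mD c hf)). Qed.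

Lemma itgZr c f : itg f -> itg (fun x => f x * c).
Proof. by move=> hf; under eq_fun do rewrite mulrC; exact: itgZ. Qed.

Lemma itg_norm f : itg f -> itg (fun x => `|f x|).
Proof. by move=> hf; apply: (eq_integrable mD _ _ _ (integrable_abse hf)). Qed.

Lemma itg_le f g : measurable_fun D f -> (forall x, D x -> `|f x| <= g x) ->
 itg g -> itg f.
Proof.
move=> mf fg; apply: le_integrable => //; first exact/measurable_EFinP.
by move=> x Dx /=; rewrite lee_fin (le_trans (fg _ Dx))// ler_norm.
Qed.

Lemma itg_sum I (s : seq I) (p : pred I) (h : I -> T -> R) :
 (forall i, p i -> itg (h i)) -> itg (fun x => \sum_(i <- s | p i) h i x).
Proof.
move=> hh; rewrite /itg (_ : EFin \o _ =
 (fun x => (\sum_(i <- s | p i) (EFin \o h i) x)%E)).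
 by apply: integrable_sum => //.
by apply/funext => x; rewrite /= sumEFin.
Qed.

Lemma eq_itg f g : (forall x, D x -> f x = g x) -> itg f -> itg g.
Proof.
by move=> fg; apply: eq_integrable => // x /set_mem Dx /=; rewrite fg.
Qed.

Lemma Rint_ext f g : (forall x, D x -> f x = g x) ->
 \int[mu]_(x in D) f x = \int[mu]_(x in D) g x.
Proof. by move=> fg; apply: eq_Rintegral => x /set_mem; exact: fg. Qed.

Lemma Rint_sum I (s : seq I) (p : pred I) (h : I -> T -> R) :
 (forall i, p i -> itg (h i)) ->
 \int[mu]_(x in D) (\sum_(i <- s | p i) h i x) =
 \sum_(i <- s | p i) \int[mu]_(x in D) h i x.
Proof.
move=> hh; elim: s => [|i s IH].
 rewrite big_nil; under Rint_ext do rewrite big_nil.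
 by rewrite Rintegral_cst// mul0r.
rewrite big_cons; case: ifPn => pi.
 under Rint_ext do rewrite big_cons pi.
 rewrite RintegralD ?IH//; [exact: hh|exact: itg_sum].
by rewrite -IH; apply: Rint_ext => x _; rewrite big_cons (negbTE pi).
Qed.

Lemma EFin_Rint f : itg f ->
 ((\int[mu]_(x in D) f x)%:E = \int[mu]_(x in D) (f x)%:E)%E.
Proof. by move=> hf; rewrite /Rintegral fineK//; exact: integrable_fin_num. Qed.

Lemma ge0_itg f : measurable_fun D f -> (forall x, D x -> 0 <= f x) ->
 (\int[mu]_(x in D) (f x)%:E < +oo)%E -> itg f.
Proof.
move=> mf f0 fy; apply/integrableP; split; first exact/measurable_EFinP.
rewrite (_ : (\int[mu]_(x in D) `|_| = \int[mu]_(x in D) (f x)%:E)%E)//.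
by apply: eq_integral => x /set_mem Dx; rewrite /= ger0_norm// f0.
Qed.

Lemma Rint_mono_cvg (F : nat -> T -> R) f (C : R) :
 (forall n, itg (F n)) -> (forall n x, D x -> 0 <= F n x) ->
 (forall x, D x -> {homo F^~ x : m n / (m <= n)%N >-> m <= n}) ->
 (forall x, D x -> F n x @[n --> \oo] --> f x) ->
 (forall n, \int[mu]_(x in D) F n x <= C) ->
 itg f /\ \int[mu]_(x in D) F n x @[n --> \oo] --> \int[mu]_(x in D) f x.
Proof.
move=> hF F0 Fnd Ff FC.
have mf : measurable_fun D f by apply: (@measurable_fun_cvg _ _ _ _ F) => // n; exact: itg_meas.
have f0 x : D x -> 0 <= f x by move=> Dx; apply: (cvg_to_ge _ (Ff _ Dx)); apply: nearW => n; exact: F0.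
have H := @cvg_monotone_convergence _ T R mu D mD (fun n x => (F n x)%:E)
 (fun n => proj2 (measurable_EFinP _ _) (itg_meas (hF n)))
 (fun n x Dx => F0 n x Dx)
 (fun x Dx m n mn => Fnd x Dx m n mn).
have E : (\int[mu]_(x in D) (fun x0 => limn (fun n => (F n x0)%:E)) x
  = \int[mu]_(x in D) (f x)%:E)%E.
 apply: eq_integral => x /set_mem Dx; apply/cvg_lim => //.
 by apply/cvg_EFin; [exact: nearW|exact: Ff].
rewrite /= E in H.
have fC : (\int[mu]_(x in D) (f x)%:E <= C%:E)%E.
 apply: (cvge_to_le H); apply: nearW => n.
 by rewrite -EFin_Rint// lee_fin.
have fi : itg f by apply: ge0_itg => //; apply: le_lt_trans fC _; rewrite ltry.
by split=> //; apply: fine_cvg; rewrite EFin_Rint.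
Qed.

Lemma Rint_dom_cvg (F : nat -> T -> R) f g :
 (forall n, measurable_fun D (F n)) ->
 (forall x, D x -> F n x @[n --> \oo] --> f x) ->
 itg g -> (forall n x, D x -> `|F n x| <= g x) ->
 itg f /\ \int[mu]_(x in D) F n x @[n --> \oo] --> \int[mu]_(x in D) f x.
Proof.
move=> mF Ff ig Fg.
have mf : measurable_fun D f by apply: (@measurable_fun_cvg _ _ _ _ F).
have [] := @dominated_convergence _ T R mu D mD (fun n x => (F n x)%:E)
 (EFin \o f) (EFin \o g).
- by move=> n; exact/measurable_EFinP.
- exact/measurable_EFinP.
- apply: aeW => x Dx; apply/cvg_EFin; [exact: nearW|exact: Ff].
- exact: ig.
- by apply: aeW => x n Dx; rewrite /= lee_fin Fg.
by move=> fi _ H; split=> //; apply: fine_cvg; rewrite EFin_Rint.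
Qed.

End integrable_functions.

Lemma eq_mean d (T : measurableType d) (R : realType) (P : {measure set T -> \bar R}) (f g : T -> R) :
 (forall w, f w = g w) -> \int[P]_w f w = \int[P]_w g w.
Proof. by move=> fg; apply: eq_Rintegral => w _; exact: fg. Qed.

Lemma mI (R : realType) (i : interval R) : measurable ([set` i] : set (measurableTypeR R)).
Proof. exact: measurable_itv. Qed.

Lemma eq_ler (R : numDomainType) (x y : R) : x = y -> x <= y.
Proof. by move->. Qed.

Lemma near_ge (R : realType) (a : R) : \forall x \near +oo, a <= x.
Proof. by apply: nbhs_pinfty_ge; exact: num_real. Qed.

(** * Square-integrable functions on a set of finite measure *)

Section square_integrable.
Context d (T : measurableType d) (R : realType).
Variables (mu : {measure set T -> \bar R}) (D : set T).
Hypothesis mD : measurable D.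
Hypothesis finD : (mu D < +oo)%E.
Implicit Types f g : T -> R.

Definition L2 f := measurable_fun D f /\ itg mu D (fun x => f x ^+ 2).

Lemma itg_cst c : itg mu D (fun=> c).
Proof.
apply/integrableP; split; first exact: measurable_cst.
by rewrite integral_cst// lte_mul_pinfty// ?lee_fin// ltry.
Qed.

Lemma itg_bd f (C : R) : measurable_fun D f -> (forall x, D x -> `|f x| <= C) ->
 itg mu D f.
Proof. by move=> mf fC; apply: (itg_le mD mf fC); exact: itg_cst. Qed.

Lemma L2_mul f g : L2 f -> L2 g -> itg mu D (fun x => f x * g x).
Proof.
move=> [mf f2] [mg g2]; apply: (itg_le mD _ _ (itgD mD f2 g2)). exact: measurable_funM.
move=> x _; rewrite normrM.
exact: normM_le_sqrD.
Qed.

Lemma L2_bd f (C : R) : measurable_fun D f -> (forall x, D x -> `|f x| <= C) -> L2 f.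
Proof.
move=> mf fC; split=> //; apply: (@itg_bd _ (C ^+ 2)); first exact: measurable_funX.
move=> x Dx; rewrite normrX lerXn2r ?nnegrE// ?(le_trans _ (fC _ Dx))//; exact: fC.
Qed.

Lemma L2_cst c : L2 (fun=> c).
Proof. exact: (@L2_bd _ `|c|). Qed.

Lemma L2_itg f : L2 f -> itg mu D f.
Proof.
move=> f2; apply: (eq_itg mD _ (L2_mul f2 (L2_cst 1))) => x _.
by rewrite mulr1.
Qed.

Lemma L2D f g : L2 f -> L2 g -> L2 (fun x => f x + g x).
Proof.
move=> hf hg; split; first by apply: measurable_funD; [case: hf|case: hg].
apply: (eq_itg mD _ (itgD mD (itgD mD (proj2 hf) (itgZ mD 2 (L2_mul hf hg))) (proj2 hg))).
by move=> x _ /=; rewrite sqrrD mulr_natl.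
Qed.

Lemma L2Z c f : L2 f -> L2 (fun x => c * f x).
Proof.
move=> [mf hf]; split; first exact: measurable_funM.
by apply: (eq_itg mD _ (itgZ mD (c ^+ 2) hf)) => x _; rewrite exprMn.
Qed.

Lemma L2N f : L2 f -> L2 (fun x => - f x).
Proof. by move=> hf; under eq_fun do rewrite -mulN1r; exact: L2Z. Qed.

Lemma L2B f g : L2 f -> L2 g -> L2 (fun x => f x - g x).
Proof. by move=> hf hg; apply: L2D => //; exact: L2N. Qed.

Lemma L2_sum I (s : seq I) (p : pred I) (h : I -> T -> R) :
 (forall i, p i -> L2 (h i)) -> L2 (fun x => \sum_(i <- s | p i) h i x).
Proof.
move=> hh; elim: s => [|i s IH]. by under eq_fun do rewrite big_nil; exact: L2_cst.
case: (boolP (p i)) => pi; last first. by under eq_fun do rewrite big_cons (negbTE pi).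
under eq_fun do rewrite big_cons pi.
by apply: L2D => //; exact: hh.
Qed.

Lemma L2_bM (b : T -> R) (C : R) f : measurable_fun D b -> (forall x, D x -> `|b x| <= C) ->
 L2 f -> L2 (fun x => b x * f x).
Proof.
move=> mb bC [mf hf]; split; first exact: measurable_funM.
apply: (itg_le mD _ _ (itgZ mD (C ^+ 2) hf)). by apply: measurable_funX; exact: measurable_funM.
move=> x Dx; rewrite exprMn ger0_norm; last by apply: mulr_ge0; exact: sqr_ge0.
rewrite ler_wpM2r ?sqr_ge0// -(@real_normK _ (b x)) ?num_real//.
rewrite lerXn2r ?nnegrE//; last exact: bC.
exact: le_trans (bC _ Dx).
Qed.

Lemma eq_L2 f g : (forall x, D x -> f x = g x) -> L2 f -> L2 g.
Proof.
move=> fg [mf hf]; split. by apply: eq_measurable_fun mf => x /set_mem; exact: fg.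
by apply: (eq_itg mD _ hf) => x Dx; rewrite fg.
Qed.

Lemma L2_sqrD f g : L2 f -> L2 g ->
 \int[mu]_(x in D) ((f x + g x) ^+ 2) = \int[mu]_(x in D) (f x ^+ 2)
  + 2 * \int[mu]_(x in D) (f x * g x) + \int[mu]_(x in D) (g x ^+ 2).
Proof.
move=> hf hg; have fg := L2_mul hf hg.
have [_ f2] := hf; have [_ g2] := hg.
rewrite -RintegralZl// -RintegralD//; last exact: itgZ.
rewrite -RintegralD//; last by apply: itgD => //; exact: itgZ.
by apply: (@Rint_ext _ _ R mu D) => x _; rewrite sqrrD mulr_natl.
Qed.

Lemma L2_sqrZ c f : L2 f -> \int[mu]_(x in D) ((c * f x) ^+ 2) =
 c ^+ 2 * \int[mu]_(x in D) (f x ^+ 2).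
Proof.
move=> [_ hf]; rewrite -RintegralZl//.
by apply: (@Rint_ext _ _ R mu D) => x _; rewrite exprMn.
Qed.

Lemma L2_sqr_ge0 f : 0 <= \int[mu]_(x in D) (f x ^+ 2).
Proof. by apply: Rintegral_ge0 => x _; exact: sqr_ge0. Qed.

Lemma L2_CS f g : L2 f -> L2 g -> (\int[mu]_(x in D) (f x * g x)) ^+ 2 <=
 \int[mu]_(x in D) (f x ^+ 2) * \int[mu]_(x in D) (g x ^+ 2).
Proof.
move=> hf hg.
have H s : 0 <= \int[mu]_(x in D) (f x ^+ 2)
  + 2 * s * \int[mu]_(x in D) (f x * g x) + s ^+ 2 * \int[mu]_(x in D) (g x ^+ 2).
 rewrite -L2_sqrZ// -mulrA -RintegralZl//; last exact: L2_mul.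
 under [X in _ + 2 * X]Rint_ext do rewrite mulrCA.
 by rewrite -L2_sqrD//; [exact: L2_sqr_ge0|exact: L2Z].
exact: quadratic_ge0 (L2_sqr_ge0 f) (L2_sqr_ge0 g) H.
Qed.

Lemma L2_CS_norm f g : L2 f -> L2 g -> `|\int[mu]_(x in D) (f x * g x)| <=
 Num.sqrt (\int[mu]_(x in D) (f x ^+ 2)) * Num.sqrt (\int[mu]_(x in D) (g x ^+ 2)).
Proof.
move=> hf hg; rewrite -sqrtr_sqr -sqrtrM ?L2_sqr_ge0// ler_wsqrtr//.
exact: L2_CS.
Qed.

Lemma L2_sqrD_le f g : L2 f -> L2 g ->
 \int[mu]_(x in D) ((f x + g x) ^+ 2) <=
 2 * \int[mu]_(x in D) (f x ^+ 2) + 2 * \int[mu]_(x in D) (g x ^+ 2).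
Proof.
move=> hf hg; rewrite -!RintegralZl//; [|exact: (proj2 hg)|exact: (proj2 hf)].
have [_ f2] := hf; have [_ g2] := hg.
rewrite -RintegralD//; [|exact: itgZ|exact: itgZ].
apply: le_Rintegral => //; first exact: (proj2 (L2D hf hg)). by apply: itgD => //; exact: itgZ.
by move=> x _; exact: sqrD_le2.
Qed.

End square_integrable.

(** * From convergence in probability to weak convergence *)

Section weak_convergence.
Context d (T : measurableType d) (R : realType) (P : probability T R).
Local Notation setT := [set: T].

Definition cvg_prob_on (A : set T) (V : nat -> T -> R) :=
 forall eps eta : R, 0 < eps -> 0 < eta -> exists N, forall n, (N <= n)%N ->
  (P (A `&` [set w | eps <= `|V n w|]%R) <= eta%:E)%E.

Lemma P_finT : (P setT < +oo)%E.
Proof. by rewrite probability_setT ltry. Qed.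

Lemma Rint_cstP (c : R) : \int[P]_w c = c.
Proof.
rewrite /Rintegral integral_cst//=.
transitivity (fine (c%:E * 1)%E); last by rewrite mule1.
by congr (fine (_ * _)%E); exact: probability_setT.
Qed.

(** Uniform integrability from bounded second moments: on [A], |V| is at most e' where it is small,
    and elsewhere Young's inequality bounds it by del V^2 + 1/(4 del). The convergence in
    probability is known on [A] only, hence the condition that [Z] vanishes off [A]. *)
Lemma weak_cvg0 (A : set T) (Z : T -> R) (V : nat -> T -> R) (K C : R) :
 measurable A -> measurable_fun setT Z -> (forall w, `|Z w| <= K) ->
 (forall w, ~ A w -> Z w = 0) ->
 (forall n, L2 P setT (V n)) ->
 (forall n, \int[P]_w (V n w ^+ 2) <= C) ->
 cvg_prob_on A V ->
 \int[P]_w (Z w * V n w) @[n --> \oo] --> 0.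
Proof.
move=> mA mZ ZK ZA V2 VC cV.
have K0 : 0 <= K by apply: le_trans (ZK point).
have C0 : 0 <= C by apply: le_trans (VC 0%N); exact: L2_sqr_ge0.
apply/cvgn_eps => e e0.
have [e' e'E] : exists e', e' = e / (3 * (K + 1)) by eexists.
have e'0 : 0 < e' by rewrite e'E divr_gt0// mulr_gt0// ltr_wpDl.
have [del delE] : exists del, del = e' / (C + 1) by eexists.
have del0 : 0 < del by rewrite delE divr_gt0// ltr_wpDl.
(* The three terms of the bound are to contribute at most e' each: del times the second moment by
   the choice of [del], and the probability of [B] divided by 4 del by this threshold. *)
have [N hN] := cV e' (4 * del * e') e'0 (mulr_gt0 (mulr_gt0 (ltr0Sn _ 3) del0) e'0).
exists N => n /hN {}hN; rewrite subr0.
set B := A `&` _ in hN.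
have mV := proj1 (V2 n).
have mB : measurable B.
 apply: measurableI => //; rewrite -[X in measurable X]setTI.
 have : measurable_fun setT (fun w => `|V n w|) by exact: measurableT_comp.
 by move=> /(_ measurableT `[e', +oo[%classic (measurable_itv _));
   rewrite /preimage/=; congr (measurable (_ `&` _));
   apply/seteqP; split => x /=; rewrite in_itv/= andbT.
have iV := proj2 (V2 n).
have iB : itg P setT (\1_B : T -> R).
 by apply: (@itg_bd _ _ _ _ _ _ P_finT _ 1) => // x _; rewrite ger0_norm// indicE; case: (_ \in _).
have iZV : itg P setT (fun w => Z w * V n w).
 apply: L2_itg => //; first exact: P_finT.
 by apply: (L2_bM measurableT mZ _ (V2 n)) => // x _; exact: ZK.
apply: le_trans (le_normr_Rintegral _ iZV) _ => //.
apply: (@le_trans _ _ (\int[P]_w (K * (e' + (del * V n w ^+ 2 + (4 * del)^-1 * \1_B w))))).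
 apply: le_Rintegral => //; first exact: itg_norm.
  apply: itgZ => //; apply: itgD => //; first exact: itg_cst P_finT _.
  by apply: itgD => //; exact: itgZ.
 move=> w _; rewrite normrM.
 have r0 : 0 <= del * V n w ^+ 2 by rewrite mulr_ge0 ?sqr_ge0 ?ltW.
 have i0 : 0 <= (4 * del)^-1 * \1_B w :> R by rewrite mulr_ge0// invr_ge0 mulr_ge0// ltW.
 have [Aw|Aw] := pselect (A w); last first. by rewrite ZA// normr0 mul0r mulr_ge0// addr_ge0 ?addr_ge0// ltW.
 apply: ler_pM => //; have [Vw|Vw] := leP e' `|V n w|; last first.
  by apply: ltW; apply: lt_le_trans Vw _; rewrite lerDl addr_ge0.
 have -> : \1_B w = 1 :> R by rewrite indicE mem_set.
 by rewrite mulr1 (le_trans (abs_le_young (V n w) del0))// lerDr ltW.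
rewrite RintegralZl//; last first.
 apply: itgD => //; first exact: itg_cst P_finT _.
 by apply: itgD => //; exact: itgZ.
rewrite RintegralD//; [|exact: itg_cst P_finT _|by apply: itgD => //; exact: itgZ].
rewrite RintegralD//; [|exact: itgZ|exact: itgZ].
rewrite RintegralZl// RintegralZl//.
rewrite Rint_cstP.
have -> : \int[P]_w \1_B w = fine (P B) by rewrite /Rintegral integral_indic// setIT.
have PB : fine (P B) <= 4 * del * e'. rewrite -lee_fin fineK//; exact: fin_num_measure.
have h1 : del * \int[P]_w (V n w ^+ 2) <= e'.
 apply: (@le_trans _ _ (del * (C + 1))); last by rewrite delE divfK// gt_eqF// ltr_wpDl.
 by rewrite ler_pM2l// (le_trans (VC n))// lerDl.
have h2 : (4 * del)^-1 * fine (P B) <= e' by rewrite mulrC ler_pdivrMr ?mulr_gt0// mulrC (le_trans PB)// mulrC.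
apply: (@le_trans _ _ (K * (3 * e'))); first by rewrite ler_wpM2l// sum3_le.
apply: (@le_trans _ _ ((K + 1) * (3 * e'))); first by rewrite ler_wpM2r ?lerDl// mulr_ge0// ltW.
by rewrite e'E; apply: eq_ler; field; rewrite gt_eqF// ltr_wpDl.
Qed.

End weak_convergence.

(** * Measurability with respect to a sub-sigma-algebra *)

Section sub_sigma_algebra.
Context (T : pointedType) (R : realType).
Implicit Types (G : set (set T)) (Z : T -> R).

Definition sub_meas G Z := forall B : set R, measurable B -> G (Z @^-1` B).

(** A filtration here is a family of bare sets of sets. Passing to the type that carries the algebra
    as its own measurable structure makes the closure properties of measurable functions available
    for [sub_meas]. *)
Lemma sub_measP G Z : sigma_algebra [set: T] G ->
 sub_meas G Z <-> measurable_fun [set: g_sigma_algebraType G] (Z : g_sigma_algebraType G -> R).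
Proof.
move=> sG; have GE : <<s G>> = G by exact: sigma_algebra_id.
split=> [h _ B mB|h B mB]. by rewrite setTI /measurable/= GE; exact: h.
by have := h measurableT B mB; rewrite setTI /measurable/= GE.
Qed.

Lemma sub_measS G G' Z : G `<=` G' -> sub_meas G Z -> sub_meas G' Z.
Proof. by move=> GG' h B /h/GG'. Qed.

Section closure.
Variable G : set (set T).
Hypothesis sG : sigma_algebra [set: T] G.

Lemma sub_meas_cst c : sub_meas G (fun=> c).
Proof. by apply/(sub_measP _ sG). Qed.

Lemma sub_measD Z1 Z2 : sub_meas G Z1 -> sub_meas G Z2 ->
 sub_meas G (fun w => Z1 w + Z2 w).
Proof.
move=> /(sub_measP _ sG) h1 /(sub_measP _ sG) h2; apply/(sub_measP _ sG).
exact: measurable_funD.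
Qed.

Lemma sub_measM Z1 Z2 : sub_meas G Z1 -> sub_meas G Z2 ->
 sub_meas G (fun w => Z1 w * Z2 w).
Proof.
move=> /(sub_measP _ sG) h1 /(sub_measP _ sG) h2; apply/(sub_measP _ sG).
exact: measurable_funM.
Qed.

Lemma sub_measB Z1 Z2 : sub_meas G Z1 -> sub_meas G Z2 ->
 sub_meas G (fun w => Z1 w - Z2 w).
Proof.
move=> /(sub_measP _ sG) h1 /(sub_measP _ sG) h2; apply/(sub_measP _ sG).
exact: measurable_funB.
Qed.

Lemma sub_meas_comp (f : R -> R) Z : measurable_fun [set: R] f -> sub_meas G Z ->
 sub_meas G (fun w => f (Z w)).
Proof.
move=> mf /(sub_measP _ sG) h1; apply/(sub_measP _ sG).
exact: measurableT_comp.
Qed.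

Lemma sub_meas_cvg (Zn : nat -> T -> R) Z : (forall n, sub_meas G (Zn n)) ->
 (forall w, Zn n w @[n --> \oo] --> Z w) -> sub_meas G Z.
Proof.
move=> h hc; apply/(sub_measP _ sG).
apply: (@measurable_fun_cvg _ (g_sigma_algebraType G) R setT (Zn : nat -> g_sigma_algebraType G -> R)) => [|w _]; last exact: hc.
by move=> n; apply/(sub_measP _ sG).
Qed.

Lemma sub_meas_sum I (s : seq I) (p : pred I) (Zi : I -> T -> R) :
 (forall i, p i -> sub_meas G (Zi i)) ->
 sub_meas G (fun w => \sum_(i <- s | p i) Zi i w).
Proof.
move=> h; elim: s => [|i s IH]. by under eq_fun do rewrite big_nil; exact: sub_meas_cst.
case: (boolP (p i)) => pi; last first. by under eq_fun do rewrite big_cons (negbTE pi).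
under eq_fun do rewrite big_cons pi.
by apply: sub_measD => //; exact: h.
Qed.

Lemma sub_meas_indic A : G A -> sub_meas G (\1_A : T -> R).
Proof.
move=> GA; apply/(sub_measP _ sG).
apply: (@measurable_indic _ (g_sigma_algebraType G)).
by rewrite /measurable/=; exact: sub_sigma_algebra.
Qed.

End closure.
End sub_sigma_algebra.

Lemma sub_meas_measurable d (T : measurableType d) (R : realType) (G : set (set T))
 (Z : T -> R) : G `<=` measurable -> sub_meas G Z -> measurable_fun [set: T] Z.
Proof. by move=> GT h _ B mB; rewrite setTI; apply: GT; exact: h. Qed.

(** * Densities and moments of centred normal laws *)

Section density.
Local Open Scope ereal_scope.
Context d (T : measurableType d) (R : realType).
Variables (mu nu : {measure set T -> \bar R}) (p : T -> R).
Hypothesis p0 : forall x, (0 <= p x)%R.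
Hypothesis mp : measurable_fun [set: T] p.
Hypothesis nuE : forall A, measurable A -> nu A = \int[mu]_(x in A) (p x)%:E.

Import HBNNSimple.

(** Monotone convergence along simple approximations of [f] on both sides; on a level set the
    identity is [nuE]. *)
Lemma ge0_integral_density (f : T -> \bar R) :
 measurable_fun [set: T] f -> (forall x, 0 <= f x) ->
 \int[nu]_x f x = \int[mu]_x (f x * (p x)%:E).
Proof.
move=> mf f0; have mE : measurable [set: T] by exact: measurableT.
pose h := nnsfun_approx mE mf.
have -> : \int[nu]_x f x = lim (\int[nu]_x (EFin \o h n) x @[n --> \oo]).
 have fE x : f x = lim ((EFin \o h n) x @[n --> \oo]) by apply/esym/cvg_lim => //; exact: cvg_nnsfun_approx.
 under eq_integral do rewrite fE.
 apply: monotone_convergence => //.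
 - by move=> n; apply/measurable_EFinP; exact/measurable_funP.
 - by move=> n x Ex //=; rewrite lee_fin.
 - by move=> x Ex a b ab; rewrite lee_fin; exact/lefP/nd_nnsfun_approx.
have -> : \int[mu]_x (f x * (p x)%:E) =
  lim (\int[mu]_x ((EFin \o h n) x * (p x)%:E) @[n --> \oo]).
 have fg x : f x * (p x)%:E = lim (((EFin \o h n) x * (p x)%:E) @[n --> \oo]).
  by apply/esym/cvg_lim => //; apply: cvgeZr => //; exact: cvg_nnsfun_approx.
 under eq_integral do rewrite fg.
 apply: monotone_convergence => [//| | |].
 - move=> n; apply/emeasurable_funM; last exact/measurable_EFinP.
  by apply/measurable_EFinP; exact/measurable_funP.
 - by move=> n x Ex /=; rewrite mule_ge0 ?lee_fin.
 - by move=> x Ex a b ab/=; rewrite lee_wpmul2r ?lee_fin//; exact/lefP/nd_nnsfun_approx.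
suff suf n : \int[mu]_x ((EFin \o h n) x * (p x)%:E) =
  \int[nu]_x (EFin \o h n) x.
 by under [in RHS]eq_fun do rewrite suf.
transitivity (\int[nu]_x
  (\sum_(y \in range (h n)) (y * \1_(h n @^-1` [set y]) x)%:E)); last first.
 by apply: eq_integral => t tE; rewrite /= fimfunE -fsumEFin.
have indich m r : measurable_fun [set: T] (fun x => (r * \1_(h m @^-1` [set r]) x)%:E).
 by apply: (measurable_comp measurableT) => //; exact: measurable_funM.
rewrite ge0_integral_fsum//; last by move=> m y Ey; exact: nnfun_muleindic_ge0.
transitivity (\int[mu]_x (\sum_(y \in range (h n))
  (y * \1_(h n @^-1` [set y]) x)%:E * (p x)%:E)).
 under [RHS]eq_integral => x xE.
  rewrite -ge0_mule_fsuml => [|y]; last exact: nnfun_muleindic_ge0.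
  rewrite fsumEFin // -(fimfunE _ x); over.
 by [].
rewrite ge0_integral_fsum//; last 2 first.
 - by move=> y; apply: emeasurable_funM => //; exact/measurable_EFinP.
 - by move=> m y Ey; rewrite mule_ge0//; [exact: nnfun_muleindic_ge0|rewrite lee_fin].
apply: eq_fsbigr => r rhn.
under [RHS]eq_integral do rewrite EFinM.
rewrite integralZl_indic_nnsfun => //.
under eq_integral do rewrite EFinM -muleA.
rewrite ge0_integralZl//.
- under eq_integral do rewrite muleC.
 rewrite (eq_integral ((EFin \o p) \_ (h n @^-1` [set r]))); last first. by move=> x xE; rewrite epatch_indic.
 by rewrite -integral_mkcond integral_indic// setIT nuE.
- by apply: emeasurable_funM; exact/measurable_EFinP.
- by move=> t Et; rewrite mule_ge0 ?lee_fin.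
- by move: rhn; rewrite inE => -[t _ <-]; rewrite lee_fin.
Qed.

End density.

Section normal_moments.
Context (R : realType) (sigma : R).
Hypothesis s0 : 0 < sigma.
Local Notation N := (@normal_prob R 0 sigma).
Local Notation mu := (@lebesgue_measure R).

Lemma normal_pdf0E (s x : R) : 0 < s ->
 normal_pdf 0 s x = normal_peak s * expR (- x ^+ 2 / (2 * s ^+ 2)).
Proof.
move=> sp; rewrite normal_pdfE ?gt_eqF// /normal_fun subr0.
by rewrite -(mulr_natl (s ^+ 2)).
Qed.

Lemma ge0_integral_normal (f : R -> \bar R) :
 measurable_fun [set: R] f -> (forall x, (0 <= f x)%E) ->
 (\int[N]_x f x = \int[mu]_x (f x * (normal_pdf 0 sigma x)%:E))%E.
Proof.
move=> mf f0; apply: ge0_integral_density => //. exact: normal_pdf_ge0.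
exact: measurable_normal_pdf.
Qed.

Lemma expR_ge_half_sqr (y : R) : 0 <= y -> y ^+ 2 <= 2 * expR y.
Proof.
move=> y0; have := expR_ge1Dxn 1 y0.
rewrite (_ : 2`!%:R = 2)// => h.
have : 0 <= 2 * expR y - 2 * (1 + y ^+ 2 / 2) by rewrite subr_ge0 ler_pM2l.
by rewrite (_ : 2 * (1 + y ^+ 2 / 2) = 2 + y ^+ 2); [lra|field].
Qed.

(* [x^4 exp(-x^2/(2 s^2)) <= 32 s^4 exp(-x^2/(4 s^2))], and the right-hand side
  is a multiple of the density of variance [2 s^2] *)
Lemma normal_moment4 : (\int[N]_x ((x ^+ 4)%:E) <= (64 * sigma ^+ 4)%:E)%E.
Proof.
pose tau := Num.sqrt 2 * sigma.
have t0 : 0 < tau by rewrite mulr_gt0.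
have tE : tau ^+ 2 = 2 * sigma ^+ 2 by rewrite exprMn sqr_sqrtr.
rewrite ge0_integral_normal; last 2 first.
- by apply/measurable_EFinP; exact: measurable_funX.
- by move=> x; rewrite lee_fin exprn_even_ge0.
apply: (@le_trans _ _ (\int[mu]_x ((64 * sigma ^+ 4)%:E * (normal_pdf 0 tau x)%:E))%E); last first.
 rewrite integralZl//; last exact: integrable_normal_pdf.
 by rewrite integral_normal_pdf mule1.
apply: ge0_le_integral => //.
- move=> x _; rewrite -EFinM lee_fin mulr_ge0 ?normal_pdf_ge0//.
 by rewrite exprn_even_ge0.
- apply: emeasurable_funM; apply/measurable_EFinP; first exact: measurable_funX. exact: measurable_normal_pdf.
- apply: emeasurable_funM; apply/measurable_EFinP => //. exact: measurable_normal_pdf.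
move=> x _; rewrite -!EFinM lee_fin !normal_pdf0E// tE.
have -> : normal_peak sigma = Num.sqrt 2 * normal_peak tau.
 rewrite /normal_peak tE (_ : 2 * sigma ^+ 2 * pi *+ 2 = 2 * (sigma ^+ 2 * pi *+ 2)); last first.
  by rewrite -[2 * _ * pi]mulrA mulrnAr.
 by rewrite sqrtrM// invfM mulrA divff ?gt_eqF// mul1r.
set pk := normal_peak tau.
have pk0 : 0 <= pk by exact: normal_peak_ge0.
rewrite [leLHS](_ : _ = pk * (Num.sqrt 2 * x ^+ 4 * expR (- x ^+ 2 / (2 * sigma ^+ 2)))); last by ring.
rewrite [leRHS](_ : _ = pk * (64 * sigma ^+ 4 * expR (- x ^+ 2 / (2 * (2 * sigma ^+ 2))))); last by ring.
apply: ler_wpM2l => //.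
(* In terms of [y] the claim is that sqrt 2 times y^2 exp(-y) is at most 4, and y^2 <= 2 exp(y) is
   the quadratic term of the exponential series. *)
set y := x ^+ 2 / (4 * sigma ^+ 2).
have y0 : 0 <= y by apply: divr_ge0; [exact: sqr_ge0|apply: mulr_ge0 => //; exact: sqr_ge0].
have -> : - x ^+ 2 / (2 * sigma ^+ 2) = - y - y by rewrite /y; field; rewrite gt_eqF.
have -> : - x ^+ 2 / (2 * (2 * sigma ^+ 2)) = - y by rewrite /y; field; rewrite gt_eqF.
have -> : x ^+ 4 = 16 * sigma ^+ 4 * y ^+ 2 by rewrite /y; field; rewrite gt_eqF.
rewrite expRD [leLHS](_ : _ = (16 * sigma ^+ 4 * expR (- y)) *
  (Num.sqrt 2 * (y ^+ 2 * expR (- y)))); last by ring.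
rewrite [leRHS](_ : _ = (16 * sigma ^+ 4 * expR (- y)) * 4); last by ring.
apply: ler_wpM2l; first by rewrite !mulr_ge0 ?expR_ge0 ?exprn_ge0// ltW.
have h1 : Num.sqrt 2 <= 2 :> R by rewrite -(@ler_pXn2r _ 2)// ?nnegrE ?ltW// sqr_sqrtr// expr2; lra.
have h2 : y ^+ 2 * expR (- y) <= 2 by rewrite expRN ler_pdivrMr ?expR_gt0// expR_ge_half_sqr.
apply: (@le_trans _ _ (2 * 2)); last by lra.
by apply: ler_pM => //; rewrite ?sqrtr_ge0// mulr_ge0 ?sqr_ge0 ?expR_ge0.
Qed.

Lemma itg_normal_X4 : itg N setT (fun x => x ^+ 4).
Proof.
apply: ge0_itg; [exact: exprn_measurable| |].
 by move=> x _; rewrite exprn_even_ge0.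
by apply: le_lt_trans normal_moment4 _; rewrite ltry.
Qed.

Lemma L2_normal_sqr : L2 N setT (fun x => x ^+ 2).
Proof.
split; first exact: exprn_measurable.
by apply: eq_itg itg_normal_X4 => // x _; rewrite -exprM.
Qed.

Lemma L2_normal_id : L2 N setT id.
Proof.
split; first exact: measurable_id.
by apply: L2_itg L2_normal_sqr => //; exact: P_finT.
Qed.

(** The density is even and Lebesgue measure is invariant under reflection, so the positive and the
    negative part have the same integral. *)
Lemma normal_mean0 : \int[N]_x x = 0.
Proof.
have iN : itg N setT id by apply: L2_itg L2_normal_id => //; exact: P_finT.
have sym (f : R -> \bar R) : measurable_fun [set: R] f -> (forall x, (0 <= f x)%E) ->
  (\int[N]_x f x = \int[N]_x f (- x)%R)%E.
 move=> mf f0.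
 have mfN : measurable_fun [set: R] (f \o -%R) by exact: measurableT_comp.
 rewrite !ge0_integral_normal//.
 have mh : measurable_fun [set: R] (fun x : R => f x * (normal_pdf 0 sigma x)%:E)%E.
  apply: emeasurable_funM => //; apply/measurable_EFinP.
  exact: measurable_normal_pdf.
 have h0 x : (0 <= f x * (normal_pdf 0 sigma x)%:E)%E by rewrite mule_ge0 ?lee_fin ?normal_pdf_ge0.
 transitivity (\int[mu]_x ((fun y : R => f y * (normal_pdf 0 sigma y)%:E) (- x)%R))%E; last first.
  apply: eq_integral => x _ /=; congr (_ * _%:E)%E.
  by rewrite !normal_pdf0E// sqrrN.
 have -> : (\int[mu]_x (f x * (normal_pdf 0 sigma x)%:E) =
  \int[pushforward mu (-%R : _ -> measurableTypeR R)]_x (f x * (normal_pdf 0 sigma x)%:E))%E.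
  by apply: eq_measure_integral => A mA _; exact/esym/lebesgue_measureN.
 by rewrite ge0_integral_pushforward.
have mM : measurable_fun [set: R] (fun x : R => Num.max x 0) by exact: measurable_maxr.
have mM' : measurable_fun [set: R] (fun x : R => Num.max (- x) 0).
 by apply: measurable_maxr => //; exact: measurable_funN.
have i1 : itg N setT (fun x => Num.max x 0).
 apply: (itg_le measurableT _ _ (itg_norm measurableT iN)) => [|x _]; first exact: mM.
 by rewrite maxEle; case: ifPn; rewrite ?normr0.
have i2 : itg N setT (fun x => Num.max (- x) 0).
 apply: (itg_le measurableT _ _ (itg_norm measurableT iN)) => [|x _]; first exact: mM'.
 by rewrite maxEle; case: ifPn; rewrite ?normr0 ?normrN.
have E : \int[N]_x Num.max x 0 = \int[N]_x Num.max (- x) 0.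
 rewrite /Rintegral (sym (fun x => (Num.max x 0)%:E))//; first exact/measurable_EFinP.
 by move=> x; rewrite lee_fin le_max lexx orbT.
transitivity (\int[N]_x (Num.max x 0 - Num.max (- x) 0)); last by rewrite RintegralB// E subrr.
apply: Rint_ext => x _; rewrite !maxEle oppr_le0.
by case: (leP 0 x) => [x0|/ltW x0]; case: (leP x 0) => x0'; lra.
Qed.

End normal_moments.

(** * Products with an independent centred factor *)

Section independence.
Context d (T : measurableType d) (R : realType) (P : probability T R).
Local Notation RR := (measurableTypeR R).
Variables (N : probability RR R) (Z X : T -> RR).
Hypothesis mZ : measurable_fun [set: T] Z.
Hypothesis mX : measurable_fun [set: T] X.
Hypothesis ZX : forall A B : set RR, measurable A -> measurable B ->
 (P (Z @^-1` A `&` X @^-1` B) = P (Z @^-1` A) * N B)%E.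

Let Zf : {mfun T >-> RR} := HB.pack Z (isMeasurableFun.Build _ _ _ _ Z mZ).
Let mZX : measurable_fun [set: T] (fun w => (Z w, X w) : RR * RR).
Proof. exact: measurable_fun_pair. Qed.
Let ZXf : {mfun T >-> (RR * RR)%type} :=
 HB.pack (fun w => (Z w, X w)) (isMeasurableFun.Build _ _ _ _ _ mZX).
Let m1 := distribution P Zf.
Let m2 := distribution P ZXf.

(** The joint law of [Z] and [X] factorizes on rectangles, and rectangles determine a product
    measure. *)
Let prodE (f : RR * RR -> \bar R) : (\int[m1 \x N]_z f z = \int[m2]_z f z)%E.
Proof. by apply: eq_measure_integral => A mA _; apply: product_measure_unique. Qed.

Let mmul : measurable_fun [set: RR * RR] (fun z : RR * RR => z.1 * z.2 : R).
Proof.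
by apply: measurable_funM; [exact: measurable_fst|exact: measurable_snd].
Qed.

Let mmulE : measurable_fun [set: RR * RR] (fun z : RR * RR => (z.1 * z.2)%:E).
Proof. exact/measurable_EFinP. Qed.

Let mabsE : measurable_fun [set: RR * RR] (fun z : RR * RR => `|(z.1 * z.2)%:E|%E).
Proof. exact: measurableT_comp. Qed.

Let mnorm : measurable_fun [set: RR] (fun z : RR => `|z|%:E).
Proof. by apply/measurable_EFinP; exact: (@normr_measurable R setT). Qed.

Lemma indep_mul_itg : itg P setT Z -> itg N setT id ->
 itg P setT (fun w => Z w * X w).
Proof.
move=> iZ iN; apply/integrableP; split. by apply/measurable_EFinP; exact: measurable_funM.
have := @ge0_integral_distribution _ _ _ _ _ P ZXf _ mabsE (fun=> abse_ge0 _).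
rewrite -/m2 -prodE => E.
rewrite (_ : (\int[P]_x `|_| = \int[P]_x (((fun z : RR * RR => `|(z.1 * z.2)%:E|) \o ZXf) x))%E)// -E.
rewrite fubini_tonelli1//.
have -> : fubini_F N (fun z : RR * RR => `|(z.1 * z.2)%:E|%E) =
  (fun z : RR => (`|z|%:E * \int[N]_y `|y|%:E)%E).
 apply/funext => x; rewrite /fubini_F/=.
 rewrite -ge0_integralZl//.
 by apply: eq_integral => y _; rewrite /= normrM EFinM.
have mg : measurable_fun [set: RR] (fun z : RR => (`|z|%:E * \int[N]_y `|y|%:E)%E). exact: emeasurable_funM.
rewrite (ge0_integral_distribution Zf)//; last first. by move=> z; rewrite mule_ge0//; apply: integral_ge0.
rewrite ge0_integralZr//; last 2 first.
- by apply: (measurableT_comp mnorm).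
- by apply: integral_ge0.
have [_ h1] := integrableP _ _ _ iZ; have [_ h2] := integrableP _ _ _ iN.
apply: lte_mul_pinfty => //; first by apply: integral_ge0.
by rewrite fin_numElt; apply/andP; split => //; apply: lt_le_trans (integral_ge0 _ _).
Qed.

Lemma indep_mul_mean : itg P setT Z -> itg N setT id -> \int[N]_x x = 0 ->
 \int[P]_w (Z w * X w) = 0.
Proof.
move=> iZ iN N0; have iZX := indep_mul_itg iZ iN.
have E := @integral_distribution _ _ _ _ _ P ZXf _ mmulE iZX.
rewrite /Rintegral (_ : (\int[P]_x _ = \int[P]_x (((fun z : RR * RR => (z.1 * z.2)%:E) \o ZXf) x))%E)// -E.
rewrite -/m2 -prodE -integral12_prod_meas1.
 have -> : fubini_F N (fun z : RR * RR => (z.1 * z.2)%:E) = cst 0%E; last by rewrite integral0.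
 apply/funext => x; rewrite /fubini_F/=.
 under eq_integral do rewrite EFinM.
 rewrite integralZl//.
 have -> : (\int[N]_y y%:E = 0)%E by move: N0; rewrite -(EFin_Rint _ iN)// => ->.
 by rewrite mule0.
apply/integrableP; split=> //.
rewrite prodE (ge0_integral_distribution ZXf)//.
by have [_] := integrableP _ _ _ iZX.
Qed.

End independence.

Lemma sqr_sum_le (R : realFieldType) n (x : nat -> R) :
 (\sum_(k < n) x k) ^+ 2 <= n%:R * \sum_(k < n) x k ^+ 2.
Proof.
case: n => [|n]; first by rewrite !big_ord0 mulr0 expr0n.
elim: n => [|n IH]; first by rewrite !big_ord_recr !big_ord0/= !add0r mul1r.
rewrite big_ord_recr/= [X in _ * X]big_ord_recr/=; move: IH.
set S := \sum_(i < _) _; set Q := \sum_(i < _) _.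
move: (x n.+1) => y SQ.
have n0 : 0 < n.+1%:R :> R by rewrite ltr0n.
have h : 0 <= Q + n.+1%:R * y ^+ 2 - 2 * S * y.
 rewrite -(pmulr_rge0 _ n0); apply: le_trans (sqr_ge0 (S - n.+1%:R * y)) _.
 by move: SQ; set m := n.+1%:R; nra.
rewrite -[in leRHS]addn1 natrD mulrDl mul1r; move: SQ h.
by set m := n.+1%:R; nra.
Qed.

(** * Partitions given by increasing sequences *)

Section partitions.
Context (R : realType).

Lemma mkseq_partition (p : nat -> R) n t : p 0%N = 0 -> p n = t ->
 (forall k, (k < n)%N -> p k < p k.+1) ->
 itv_partition 0 t (mkseq (fun k => p k.+1) n).
Proof.
move=> p0 pn pS; split; last first.
 case: n pn {pS} => [|n] <-; first by rewrite /mkseq/= p0.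
 by rewrite /mkseq -addn1 iotaD map_cat/= last_cat/= addn1.
rewrite -p0; apply/(pathP 0) => k; rewrite size_mkseq => kn.
rewrite nth_mkseq//; case: k kn => [|k] kn /=; first exact: pS.
by rewrite nth_mkseq ?(ltnW kn)//; exact: pS.
Qed.

Lemma pt_mkseq (p : nat -> R) n k : p 0%N = 0 -> (k <= n)%N ->
 pt (mkseq (fun k => p k.+1) n) k = p k.
Proof.
by move=> p0; rewrite /pt; case: k => [|k] //= kn; rewrite nth_mkseq.
Qed.

Lemma sum_pt_mkseq (p : nat -> R) n (V : nmodType) (f : R -> R -> V) : p 0%N = 0 ->
 \sum_(k < size (mkseq (fun k => p k.+1) n))
  f (pt (mkseq (fun k => p k.+1) n) k) (pt (mkseq (fun k => p k.+1) n) k.+1) =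
 \sum_(k < n) f (p k) (p k.+1).
Proof.
move=> p0; rewrite size_mkseq; apply: eq_bigr => k _.
by rewrite !pt_mkseq// ltnW.
Qed.

End partitions.

(** * Brownian increments against the past *)

Section brownian.
Context disp (O : measurableType disp) (R : realType) (P : probability O R).
Variable F : R -> set (set O).
Hypothesis hF : filtration F.
Local Notation mu := (@lebesgue_measure R).

Let sF t : 0 <= t -> sigma_algebra [set: O] (F t).
Proof. by case: hF => h _ _; exact: h. Qed.

Lemma filt_le s t Z : 0 <= s -> s <= t -> sub_meas (F s) Z -> @sub_meas O R (F t) Z.
Proof. by case: hF => _ h _ s0 st; apply: sub_measS; exact: h. Qed.

Lemma filt_meas t (Z : O -> R) : 0 <= t -> sub_meas (F t) Z ->
 measurable_fun [set: O] Z.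
Proof. by case: hF => _ _ h t0; apply: sub_meas_measurable; exact: h. Qed.

Lemma filt_cst t (c : R) : 0 <= t -> sub_meas (F t) (fun=> c : R).
Proof. by move=> t0; apply: sub_meas_cst; exact: sF. Qed.

Lemma filt_mul t (Z1 Z2 : O -> R) : 0 <= t -> sub_meas (F t) Z1 -> sub_meas (F t) Z2 ->
 sub_meas (F t) (fun w => Z1 w * Z2 w).
Proof. by move=> t0; apply: sub_measM; exact: sF. Qed.

Section one_motion.
Variable W : R -> O -> R.
Hypothesis hW : standard_brownian P F W.

Lemma bm_incr_sub s t : 0 <= s -> s <= t -> sub_meas (F t) (fun w => W t w - W s w).
Proof.
move=> s0 st; have t0 := le_trans s0 st.
apply: sub_measB; first exact: sF. exact: (brownian_adapted hW).
by apply: (filt_le s0 st); exact: (brownian_adapted hW).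
Qed.

Lemma bm_incr_meas s t : 0 <= s -> s <= t ->
 measurable_fun [set: O] (fun w => W t w - W s w).
Proof.
by move=> s0 st; apply: filt_meas (bm_incr_sub s0 st); exact: le_trans st.
Qed.

Let sig s t : s < t -> 0 < Num.sqrt (t - s) :> R.
Proof. by rewrite sqrtr_gt0 subr_gt0. Qed.

Let indep s t Z : 0 <= s -> s < t -> sub_meas (F s) Z -> forall A B : set R,
 measurable A -> measurable B ->
 (P (Z @^-1` A `&` (fun w => W t w - W s w)%R @^-1` B) =
  P (Z @^-1` A) * normal_prob 0 (Num.sqrt (t - s)) B)%E.
Proof.
move=> s0 st hZ A B mA mB.
by rewrite -(brownian_increment hW s0 st _ mB)//; exact: hZ.
Qed.

Lemma bm_mul_mean s t Z : 0 <= s -> s <= t -> sub_meas (F s) Z -> itg P setT Z ->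
 \int[P]_w (Z w * (W t w - W s w)) = 0.
Proof.
move=> s0; rewrite le_eqVlt => /predU1P[->|st] hZ iZ.
 by under Rint_ext do rewrite subrr mulr0; rewrite Rint_cstP.
apply: (@indep_mul_mean _ _ _ P (normal_prob 0 (Num.sqrt (t - s))) Z (fun w => W t w - W s w)) => //.
- exact: filt_meas hZ.
- exact: bm_incr_meas (ltW st).
- exact: indep.
- by apply: L2_itg (L2_normal_id (sig st)) => //; exact: P_finT.
- exact: normal_mean0 (sig st).
Qed.

(** A fourth moment of the order of the squared length is what keeps the bracket sums bounded in
    mean square. The constant is inherited from [normal_moment4]. *)
Lemma bm_moment4 s t : 0 <= s -> s <= t ->
 itg P setT (fun w => (W t w - W s w) ^+ 4) /\
 \int[P]_w ((W t w - W s w) ^+ 4) <= 64 * (t - s) ^+ 2.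
Proof.
move=> s0; rewrite le_eqVlt => /predU1P[->|st].
 under eq_fun do rewrite subrr expr0n/=.
 split; first exact: itg_cst (P_finT P) 0.
 by rewrite Rint_cstP subrr expr0n/= mulr0.
set X := fun w => W t w - W s w.
have mX : measurable_fun [set: O] X by exact: bm_incr_meas (ltW st).
pose Xf : {mfun O >-> measurableTypeR R} := HB.pack X (isMeasurableFun.Build _ _ _ _ (X : O -> measurableTypeR R) mX).
have h0 (x : R) : 0 <= x ^+ 4 by rewrite exprn_even_ge0.
have E : (\int[P]_w (X w ^+ 4)%:E =
  \int[@normal_prob R 0 (Num.sqrt (t - s))]_x (x ^+ 4)%:E)%E.
 rewrite -(ge0_integral_distribution Xf (f := fun x => (x ^+ 4)%:E)); last 2 first.
 - by apply/measurable_EFinP; exact: (@exprn_measurable R setT 4).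
 - by move=> x; rewrite lee_fin.
 apply: eq_measure_integral => B mB _.
 rewrite /distribution /pushforward/=.
 (* Independence from a constant, tested on the full event, yields the law of the increment
    itself. *)
 have := @indep s t (fun=> 0) s0 st (filt_cst 0 s0) setT B measurableT mB.
 by rewrite preimage_setT setTI probability_setT mul1e.
have h : (\int[P]_w (X w ^+ 4)%:E <= (64 * (t - s) ^+ 2)%:E)%E.
 rewrite E; apply: le_trans (normal_moment4 (sig st)) _; rewrite lee_fin.
 by rewrite (exprM _ 2 2) sqr_sqrtr// subr_ge0 ltW.
have iX : itg P setT (fun w => X w ^+ 4).
 apply: ge0_itg => [|//|]; first exact: measurable_funX.
 by apply: le_lt_trans h _; rewrite ltry.
by split=> //; rewrite -lee_fin EFin_Rint.
Qed.

Lemma bm_L2_sqr s t : 0 <= s -> s <= t -> L2 P setT (fun w => (W t w - W s w) ^+ 2).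
Proof.
move=> s0 st; split; first by apply: measurable_funX; exact: bm_incr_meas.
by apply: eq_itg (proj1 (bm_moment4 s0 st)) => // w _; rewrite -exprM.
Qed.

Lemma bm_L2 s t : 0 <= s -> s <= t -> L2 P setT (fun w => W t w - W s w).
Proof.
move=> s0 st; split; first exact: bm_incr_meas.
by apply: L2_itg (bm_L2_sqr s0 st) => //; exact: P_finT.
Qed.

End one_motion.

Definition bdd_sub t (Z : O -> R) := sub_meas (F t) Z /\ exists C : R, forall w, `|Z w| <= C.

Lemma bdd_meas t Z : 0 <= t -> bdd_sub t Z -> measurable_fun [set: O] Z.
Proof. by move=> t0 [hZ _]; exact: filt_meas hZ. Qed.

Lemma bdd_cst t c : 0 <= t -> bdd_sub t (fun=> c).
Proof. by move=> t0; split; [exact: filt_cst|exists `|c|]. Qed.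

Lemma bdd_le s t Z : 0 <= s -> s <= t -> bdd_sub s Z -> bdd_sub t Z.
Proof. by move=> s0 st [hZ bZ]; split=> //; exact: filt_le hZ. Qed.

Lemma bdd_mul t Z1 Z2 : 0 <= t -> bdd_sub t Z1 -> bdd_sub t Z2 ->
 bdd_sub t (fun w => Z1 w * Z2 w).
Proof.
move=> t0 [h1 [C1 b1]] [h2 [C2 b2]]; split; first exact: filt_mul.
by exists (C1 * C2) => w; rewrite normrM ler_pM.
Qed.

Lemma bdd_L2M t Z X : 0 <= t -> bdd_sub t Z -> L2 P setT X ->
 L2 P setT (fun w => Z w * X w).
Proof.
move=> t0 bZ hX; have mZ := bdd_meas t0 bZ; case: bZ => _ [C bC].
by apply: (L2_bM measurableT mZ _ hX) => w _; exact: bC.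
Qed.

Section two_motions.
Variables (W W' : R -> O -> R).
Hypotheses (hW : standard_brownian P F W) (hW' : standard_brownian P F W').
Variable p : nat -> R.
Hypotheses (p0 : forall k, 0 <= p k) (pS : forall k, p k <= p k.+1).

Let pmono : {homo p : m n / (m <= n)%N >-> m <= n}.
Proof. exact/nondecreasing_seqP. Qed.

Definition incr (V : R -> O -> R) k w := V (p k.+1) w - V (p k) w.

Lemma incr_L2M V k Z : standard_brownian P F V -> bdd_sub (p k) Z ->
 L2 P setT (fun w => Z w * incr V k w).
Proof. by move=> hV bZ; apply: (bdd_L2M (p0 k)) => //; exact: bm_L2. Qed.

Lemma incr_sum_L2 V n Z : standard_brownian P F V -> (forall k, bdd_sub (p k) (Z k)) ->
 L2 P setT (fun w => \sum_(k < n) Z k w * incr V k w).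
Proof.
by move=> hV bZ; apply: (L2_sum measurableT (P_finT P)) => k _; exact: incr_L2M (bZ k).
Qed.

Lemma incr_ortho V V' k l Z Z' : standard_brownian P F V -> standard_brownian P F V' ->
 (k < l)%N -> bdd_sub (p k) Z -> bdd_sub (p l) Z' ->
 \int[P]_w ((Z w * incr V k w) * (Z' w * incr V' l w)) = 0.
Proof.
move=> hV hV' kl bZ bZ'.
under Rint_ext do rewrite mulrA.
apply: (bm_mul_mean hV' (p0 l) (pS l)).
 apply: filt_mul => //; last by case: bZ'.
 apply: (filt_le (p0 k.+1) (pmono kl)).
 apply: filt_mul => //; first by apply: (filt_le (p0 k) (pS k)); case: bZ.
 exact: bm_incr_sub.
under eq_fun do rewrite mulrC.
have : L2 P setT (fun w => Z' w * (Z w * incr V k w)) by apply: (bdd_L2M (p0 l)) => //; exact: incr_L2M.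
by apply: L2_itg => //; exact: P_finT.
Qed.

(** In a term with two different indices the later increment is centred given everything before it,
    so only the diagonal survives. *)
Lemma incr_sum_mul n Z Z' : (forall k, bdd_sub (p k) (Z k)) ->
 (forall k, bdd_sub (p k) (Z' k)) ->
 \int[P]_w ((\sum_(k < n) Z k w * incr W k w) * (\sum_(k < n) Z' k w * incr W' k w)) =
 \sum_(k < n) \int[P]_w (Z k w * Z' k w * (incr W k w * incr W' k w)).
Proof.
move=> bZ bZ'.
have iM k l : itg P setT (fun w => (Z k w * incr W k w) * (Z' l w * incr W' l w)).
 by apply: L2_mul => //; [exact: (incr_L2M hW (bZ k))|exact: (incr_L2M hW' (bZ' l))].
transitivity (\sum_(k < n) \sum_(l < n) \int[P]_w
  ((Z k w * incr W k w) * (Z' l w * incr W' l w))).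
 under Rint_ext do rewrite mulr_suml.
 rewrite (Rint_sum measurableT); last first.
  move=> k _; under eq_fun do rewrite mulr_sumr.
  by apply: itg_sum => // l _; exact: iM.
 apply: eq_bigr => k _; under Rint_ext do rewrite mulr_sumr.
 by rewrite (Rint_sum measurableT)// => l _; exact: iM.
apply: eq_bigr => k _; rewrite (bigD1 k)//= big1 ?addr0. by apply: eq_mean => w; ring.
move=> l; rewrite neq_ltn => /orP[lk|kl]; last exact: incr_ortho.
by under Rint_ext do rewrite mulrC; exact: incr_ortho.
Qed.

End two_motions.
End brownian.

Lemma sum_telescope (R : zmodType) (f : nat -> R) n :
 \sum_(k < n) (f k.+1 - f k) = f n - f 0%N.
Proof. by rewrite -(big_mkord xpredT (fun k => f k.+1 - f k)) telescope_sumr. Qed.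

(** * Conditional covariance of increments from the bracket *)

Section bracket.
Context disp (O : measurableType disp) (R : realType) (P : probability O R).
Variable F : R -> set (set O).
Hypothesis hF : filtration F.
Variables (W W' : R -> O -> R) (c : R).
Hypotheses (hW : standard_brownian P F W) (hW' : standard_brownian P F W').
Hypothesis hbr : forall t, 0 <= t -> is_bracket P W W' t (fun=> c * t).

Let incr_meas V p k : standard_brownian P F V -> 0 <= p k -> p k <= p k.+1 ->
 measurable_fun [set: O] (incr p V k).
Proof. by move=> hV h1 h2; exact: (bm_incr_meas hF hV h1 h2). Qed.

Lemma incr_mul_L2 s t : 0 <= s -> s <= t ->
 L2 P setT (fun w => (W t w - W s w) * (W' t w - W' s w)) /\
 \int[P]_w (((W t w - W s w) * (W' t w - W' s w)) ^+ 2) <= 64 * (t - s) ^+ 2.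
Proof.
move=> s0 st.
have [i1 b1] := bm_moment4 hF hW s0 st; have [i2 b2] := bm_moment4 hF hW' s0 st.
have m1 := bm_incr_meas hF hW s0 st; have m2 := bm_incr_meas hF hW' s0 st.
have le w : ((W t w - W s w) * (W' t w - W' s w)) ^+ 2 <=
  2^-1 * (W t w - W s w) ^+ 4 + 2^-1 * (W' t w - W' s w) ^+ 4.
 rewrite exprMn (exprM _ 2 2) (exprM (W' t w - W' s w) 2 2).
 by have := sqr_ge0 ((W t w - W s w) ^+ 2 - (W' t w - W' s w) ^+ 2); nra.
have ii : itg P setT (fun w => 2^-1 * (W t w - W s w) ^+ 4 + 2^-1 * (W' t w - W' s w) ^+ 4).
 by apply: itgD => //; exact: itgZ.
have LL : L2 P setT (fun w => (W t w - W s w) * (W' t w - W' s w)).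
 split; first exact: measurable_funM.
 apply: (itg_le measurableT _ _ ii). by apply: measurable_funX; exact: measurable_funM.
 by move=> w _; rewrite ger0_norm ?sqr_ge0.
split=> //; apply: (@le_trans _ _ (\int[P]_w (2^-1 * (W t w - W s w) ^+ 4 + 2^-1 * (W' t w - W' s w) ^+ 4))).
 by apply: le_Rintegral => //; case: LL.
rewrite RintegralD//; [|exact: itgZ|exact: itgZ].
by rewrite !RintegralZl//; lra.
Qed.

Definition ugrid s t n (k : nat) : R := s + k%:R * ((t - s) / n%:R).

Lemma ugrid_S s t n k : ugrid s t n k.+1 = ugrid s t n k + (t - s) / n%:R.
Proof. by rewrite /ugrid -addrA -[in LHS]addn1 natrD mulrDl mul1r. Qed.

Lemma ugrid0 s t n : ugrid s t n 0 = s.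
Proof. by rewrite /ugrid mul0r addr0. Qed.

Lemma ugridn s t n : ugrid s t n.+1 n.+1 = t.
Proof. by rewrite /ugrid mulrCA divff ?mulr1 ?subrKC// pnatr_eq0. Qed.

Definition qsum (s t : R) n w := \sum_(k < n)
 incr (ugrid s t n) W k w * incr (ugrid s t n) W' k w.

Lemma mesh_small (a del : R) : 0 < del -> exists N, forall n, (N <= n)%N ->
 a / n.+1%:R < del.
Proof.
move=> del0; have [N hN] : exists N, a / del < N%:R.
 exists (Num.bound `|a / del|); apply: le_lt_trans (ler_norm _) _.
 by rewrite archi_boundP.
exists N => n Nn; rewrite ltr_pdivrMr ?ltr0n// mulrC -ltr_pdivrMr//.
by apply: lt_le_trans hN _; rewrite ler_nat ltnW.
Qed.

Let measB (p : nat -> R) n (C : R) (eps : R) : (forall k, 0 <= p k) -> (forall k, p k <= p k.+1) ->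
 measurable [set w | eps <= `|\sum_(k < n) incr p W k w * incr p W' k w - C|].
Proof.
move=> p0 pS.
have m : measurable_fun [set: O] (fun w => `|\sum_(k < n) incr p W k w * incr p W' k w - C|).
 apply: measurableT_comp => //; apply: measurable_funB => //.
 by apply: measurable_sum => k; apply: measurable_funM; [exact: incr_meas hW _ _|exact: incr_meas hW' _ _].
have := m measurableT `[eps, +oo[%classic (measurable_itv _).
rewrite setTI; congr measurable; apply/seteqP; split => w /=; rewrite in_itv/= andbT//.
Qed.

Lemma qsum_cvg_from0 t : 0 < t -> cvg_prob_on P setT
 (fun n w => qsum 0 t n.+1 w - c * t).
Proof.
move=> t0 eps eta e0 eta0.
have [del del0 hdel] := hbr (ltW t0) e0 eta0.
have [N hN] := mesh_small t del0; exists N => n Nn; rewrite setTI.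
pose p := ugrid 0 t n.+1.
have p0 : p 0%N = 0 by exact: ugrid0.
have pn : p n.+1 = t by exact: ugridn.
have pS k : p k < p k.+1 by rewrite /p ugrid_S ltrDl subr0 divr_gt0// ltr0n.
have := hdel (mkseq (fun k => p k.+1) n.+1) (mkseq_partition p0 pn (fun k _ => pS k)).
have -> : [set w | eps <= `|qsum 0 t n.+1 w - c * t|] = [set w | eps <= `|\sum_(k < size (mkseq (fun k => p k.+1) n.+1))
  (W (pt (mkseq (fun k => p k.+1) n.+1) k.+1) w - W (pt (mkseq (fun k => p k.+1) n.+1) k) w) *
  (W' (pt (mkseq (fun k => p k.+1) n.+1) k.+1) w - W' (pt (mkseq (fun k => p k.+1) n.+1) k) w) - c * t|].
 apply/funext => w /=; rewrite (sum_pt_mkseq n.+1 (fun a b => (W b w - W a w) * (W' b w - W' a w)) p0).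
 by [].
apply=> k; rewrite size_mkseq => kn.
by rewrite !pt_mkseq// ?(ltnW kn)// /p ugrid_S addrC addKr subr0; exact: hN.
Qed.

(** The bracket is given over intervals that start at 0. Joining the uniform grids of [0, s] and
    [s, t] gives a fine partition of [0, t]; subtracting the convergent part over [0, s] leaves the
    sum over [s, t], each part with half of the tolerances. *)
Lemma qsum_cvg s t : 0 <= s -> s < t -> cvg_prob_on P setT
 (fun n w => qsum s t n.+1 w - c * (t - s)).
Proof.
rewrite le_eqVlt => /predU1P[<-|s0] st. by under eq_fun do under eq_fun do rewrite subr0; exact: qsum_cvg_from0.
move=> eps eta e0 eta0.
have e20 : 0 < eps / 2 by rewrite divr_gt0.
have eta20 : 0 < eta / 2 by rewrite divr_gt0.
have [N1 hN1] := qsum_cvg_from0 s0 e20 eta20.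
have [del del0 hdel] := hbr (ltW (lt_trans s0 st)) e20 eta20.
have [N2 hN2] := mesh_small s del0; have [N3 hN3] := mesh_small (t - s) del0.
exists (N1 + (N2 + N3))%N => n Nn; rewrite setTI.
have {}hN1 : (P [set w | (eps / 2 <= `|qsum 0 s n.+1 w - c * s|)%R] <= (eta / 2)%:E)%E.
 by rewrite -[X in P X]setTI; apply: hN1; apply: leq_trans Nn; exact: leq_addr.
have {}hN2 : s / n.+1%:R < del by apply: hN2; apply: leq_trans Nn; apply: leq_trans (leq_addl N1 _); exact: leq_addr.
have {}hN3 : (t - s) / n.+1%:R < del by apply: hN3; apply: leq_trans Nn; apply: leq_trans (leq_addl N1 _); exact: leq_addl.
pose p1 := ugrid 0 s n.+1; pose p2 := ugrid s t n.+1.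
pose p k := if (k <= n.+1)%N then p1 k else p2 (k - n.+1)%N.
have p0 : p 0%N = 0 by rewrite /p/=; exact: ugrid0.
have pn : p (n.+1 + n.+1)%N = t by rewrite /p addnK -[X in (_ <= X)%N]addn0 leq_add2l ltn0; exact: ugridn.
have pl k : (k <= n.+1)%N -> p k = p1 k by rewrite /p => ->.
have pr k : p (n.+1 + k)%N = p2 k.
 rewrite /p; case: ifPn => h; last by rewrite addKn.
 have -> : k = 0%N by apply/eqP; rewrite -leqn0 -(leq_add2l n.+1) addn0.
 by rewrite addn0 /p1 /p2 ugridn ugrid0.
have p1S k : p1 k < p1 k.+1 by rewrite /p1 ugrid_S ltrDl subr0 divr_gt0// ltr0n.
have p2S k : p2 k < p2 k.+1 by rewrite /p2 ugrid_S ltrDl divr_gt0// ?ltr0n// subr_gt0.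
have pS k : p k < p k.+1.
 have [kn|kn] := ltnP k n.+1; first by rewrite !pl// ltnW.
 by rewrite -(subnKC kn) -addnS !pr.
have step k : p k.+1 - p k < del.
 have [kn|kn] := ltnP k n.+1. by rewrite !pl// 1?ltnW// /p1 ugrid_S addrC addKr subr0.
 by rewrite -(subnKC kn) -addnS !pr /p2 ugrid_S addrC addKr.
have := hdel (mkseq (fun k => p k.+1) (n.+1 + n.+1)) (mkseq_partition p0 pn (fun k _ => pS k)).
have -> : [set w | eps / 2 <= `|\sum_(k < size (mkseq (fun k => p k.+1) (n.+1 + n.+1)))
  (W (pt (mkseq (fun k => p k.+1) (n.+1 + n.+1)) k.+1) w - W (pt (mkseq (fun k => p k.+1) (n.+1 + n.+1)) k) w) *
  (W' (pt (mkseq (fun k => p k.+1) (n.+1 + n.+1)) k.+1) w - W' (pt (mkseq (fun k => p k.+1) (n.+1 + n.+1)) k) w) - c * t|] =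
 [set w | eps / 2 <= `|qsum 0 s n.+1 w + qsum s t n.+1 w - c * t|].
 apply/funext => w /=.
 rewrite (sum_pt_mkseq (n.+1 + n.+1) (fun a b => (W b w - W a w) * (W' b w - W' a w)) p0).
 rewrite big_split_ord/=; congr (is_true (_ <= `|_ + _ - _|)).
  by apply: eq_bigr => k _; rewrite /incr !pl// ltnW.
 by apply: eq_bigr => k _; rewrite /incr -addnS !pr.
move=> /(_ _)/wrap[|h2].
 move=> k; rewrite size_mkseq => kn.
 by rewrite !pt_mkseq// ?(ltnW kn).
set A := [set w | _ <= _] in hN1; set B := [set w | _ <= _] in h2.
have mpos (a b : R) m : 0 <= a -> a < b -> (forall k, 0 <= ugrid a b m.+1 k) /\
  (forall k, ugrid a b m.+1 k <= ugrid a b m.+1 k.+1).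
 move=> a0 ab; split=> k; last by rewrite ugrid_S lerDl divr_ge0// subr_ge0 ltW.
 by rewrite addr_ge0// mulr_ge0// divr_ge0// subr_ge0 ltW.
have [a1 a2] := mpos 0 s n (lexx _) s0; have [b1 b2] := mpos s t n (ltW s0) st.
have mA : measurable A by exact: measB.
have mB : measurable B.
 have m : measurable_fun [set: O] (fun w => `|qsum 0 s n.+1 w + qsum s t n.+1 w - c * t|).
  apply: measurableT_comp => //; apply: measurable_funB => //; apply: measurable_funD;
  by apply: measurable_sum => k; apply: measurable_funM; [exact: incr_meas hW _ _|exact: incr_meas hW' _ _].
 have := m measurableT `[eps / 2, +oo[%classic (measurable_itv _).
 by rewrite setTI; congr measurable; apply/seteqP; split => w /=; rewrite in_itv/= andbT.
have mC : measurable [set w | eps <= `|qsum s t n.+1 w - c * (t - s)|] by exact: measB.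
apply: (@le_trans _ _ (P (A `|` B))%E).
 apply: le_measure; rewrite ?inE//; first exact: measurableU.
 move=> w /= hw; have [Aw|Aw] := leP (eps / 2) `|qsum 0 s n.+1 w - c * s|; first by left.
 right => /=; move: hw Aw; rewrite (_ : qsum s t n.+1 w - c * (t - s) =
  (qsum 0 s n.+1 w + qsum s t n.+1 w - c * t) - (qsum 0 s n.+1 w - c * s)); last by ring.
 rewrite /B/=; move: (qsum 0 s n.+1 w + qsum s t n.+1 w - c * t) (qsum 0 s n.+1 w - c * s) => x y h1 h3.
 by have := le_trans h1 (ler_normB x y); lra.
apply: le_trans (measureU2 _ _ _) _ => //.
by rewrite (splitr eta) EFinD leeD.
Qed.

(** The bracket sums over [s, t] converge in probability to c (t - s) and are bounded in mean
    square, so they converge weakly against [Z]. By orthogonality of increments their mean against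
    [Z] is the same for every grid and equals that of the single product of increments, which is
    thereby identified. *)
Lemma incr_bracket s t Z : 0 <= s -> s <= t -> bdd_sub F s Z ->
 \int[P]_w (Z w * ((W t w - W s w) * (W' t w - W' s w))) = c * (t - s) * \int[P]_w Z w.
Proof.
move=> s0; rewrite le_eqVlt => /predU1P[->|st] bZ.
 under Rint_ext do rewrite !subrr mul0r mulr0.
 by rewrite Rint_cstP subrr mulr0 mul0r.
have mZ := bdd_meas hF s0 bZ; have [_ [K ZK]] := bZ.
pose V n w := qsum s t n.+1 w - c * (t - s).
have p0 n k : 0 <= ugrid s t n.+1 k by rewrite addr_ge0// mulr_ge0// divr_ge0// subr_ge0 ltW.
have pS n k : ugrid s t n.+1 k <= ugrid s t n.+1 k.+1 by rewrite ugrid_S lerDl divr_ge0// subr_ge0 ltW.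
have ps n k : s <= ugrid s t n.+1 k by rewrite lerDl mulr_ge0// divr_ge0// subr_ge0 ltW.
have Q2 n : L2 P setT (qsum s t n.+1).
 by apply: (L2_sum measurableT (P_finT P)) => k _; exact: (proj1 (incr_mul_L2 (p0 n k) (pS n k))).
(* By Cauchy-Schwarz over the n+1 cells the second moment is at most n+1 times the sum of the n+1
   cell contributions, each of order ((t-s)/(n+1))^2; the powers of n+1 cancel. *)
have Qb n : \int[P]_w (qsum s t n.+1 w ^+ 2) <= 64 * (t - s) ^+ 2.
 apply: (@le_trans _ _ (\int[P]_w (n.+1%:R * \sum_(k < n.+1)
   (incr (ugrid s t n.+1) W k w * incr (ugrid s t n.+1) W' k w) ^+ 2))).
  apply: le_Rintegral => //; first exact: (proj2 (Q2 n)).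
   apply: itgZ => //; apply: itg_sum => // k _.
   exact: (proj2 (proj1 (incr_mul_L2 (p0 n k) (pS n k)))).
  move=> w _; exact: (sqr_sum_le n.+1 (fun k => incr (ugrid s t n.+1) W k w * incr (ugrid s t n.+1) W' k w)).
 rewrite RintegralZl//; last first.
  apply: itg_sum => // k _.
  exact: (proj2 (proj1 (incr_mul_L2 (p0 n k) (pS n k)))).
 rewrite (Rint_sum measurableT); last first.
  by move=> k _; exact: (proj2 (proj1 (incr_mul_L2 (p0 n k) (pS n k)))).
 apply: (@le_trans _ _ (n.+1%:R * \sum_(k < n.+1) (64 * ((t - s) / n.+1%:R) ^+ 2))).
  rewrite ler_wpM2l//; apply: ler_sum => k _.
  apply: le_trans (proj2 (incr_mul_L2 (p0 n k) (pS n k))) _.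
  by rewrite ugrid_S addrC addKr.
 rewrite sumr_const card_ord -[X in _ * X]mulr_natl; apply: eq_ler.
 have m0 : n.+1%:R != 0 :> R by rewrite pnatr_eq0.
 by move: m0; move: (n.+1%:R : R) => m m0; field.
(* The increments over [s, t] telescope along the grid; [incr_sum_mul] with the coefficients [Z] and
   1 removes the off-diagonal products. *)
have ZQ n : \int[P]_w (Z w * qsum s t n.+1 w) =
  \int[P]_w (Z w * ((W t w - W s w) * (W' t w - W' s w))).
 have bZk k : bdd_sub F (ugrid s t n.+1 k) Z by exact: bdd_le bZ.
 have b1k k : bdd_sub F (ugrid s t n.+1 k) (fun=> 1 : R) by exact: bdd_cst.
 have := incr_sum_mul hF hW hW' (p0 n) (pS n) n.+1 (Z := fun=> Z) (Z' := fun _ _ => 1) bZk b1k.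
 have tel V' w : \sum_(k < n.+1) incr (ugrid s t n.+1) V' k w = V' t w - V' s w.
  have := sum_telescope (fun k => V' (ugrid s t n.+1 k) w) n.+1.
  by rewrite ugridn ugrid0.
 under Rint_ext.
  move=> w _; rewrite -mulr_sumr tel.
  under eq_bigr do rewrite mul1r.
  rewrite tel -mulrA; over.
 move=> ->; under [RHS]eq_bigr do under Rint_ext do rewrite mulr1.
 rewrite -(Rint_sum measurableT). by apply: eq_mean => w; rewrite /qsum mulr_sumr.
 move=> k _; apply: (L2_itg measurableT (P_finT P)); apply: (bdd_L2M hF s0) => //.
 exact: (proj1 (incr_mul_L2 (p0 n k) (pS n k))).
have V2 n : L2 P setT (V n) by apply: L2B => //; exact: L2_cst measurableT (P_finT P) _.
have h0 : \int[P]_w (Z w * V n w) @[n --> \oo] --> 0.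
 apply: (@weak_cvg0 _ _ _ P setT Z V K (2 * (64 * (t - s) ^+ 2) + 2 * (c * (t - s)) ^+ 2)) => //.
 - by move=> w /(_ I).
 - move=> n; rewrite /V; have h := L2_cst measurableT (P_finT P) (- (c * (t - s))).
  apply: (le_trans (L2_sqrD_le measurableT (Q2 n) h)).
  by rewrite Rint_cstP sqrrN lerD2r ler_pM2l.
 - exact: qsum_cvg.
have : \int[P]_w (Z w * V n w) @[n --> \oo] -->
  \int[P]_w (Z w * ((W t w - W s w) * (W' t w - W' s w))) - c * (t - s) * \int[P]_w Z w.
 apply: cvg_near_cst; apply: nearW => n; rewrite -(ZQ n).
 have iZ : itg P setT Z by exact: (@itg_bd _ _ _ _ _ measurableT (P_finT P) _ K).
 rewrite -RintegralZl//.
 rewrite -RintegralB//; last exact: itgZ. by apply: eq_mean => w; rewrite /V; ring.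
 by apply: (L2_itg measurableT (P_finT P)); exact: (bdd_L2M hF s0).
by move=> /cvg_uniq-/(_ _ h0) h; apply/eqP; rewrite -subr_eq0 h.
Qed.

End bracket.

Local Notation "'\iint[' P ]_ ( r , w < t ) F" := (\int[lebesgue_measure]_(r in `[0, t]) \int[P]_w F)
 (at level 36, r name, w name, t at level 10, F at level 36).

(** * Dyadic grids and Riemann sums *)

Section dyadic_grid.
Context (R : realType).
Local Notation mu := (@lebesgue_measure R).
Implicit Types (f : R -> R) (s r : R).

Definition gfl n r : R := (Num.truncn (r * 2 ^+ n))%:R / 2 ^+ n.

(** The grid is stopped at [s]: later points all equal [s] and their increments vanish, so the one
    index range [T * 2 ^ n] serves every [s <= T]. *)
Definition gpt n s k : R := Num.min (k%:R / 2 ^+ n) s.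

Let h0 n : 0 < 2 ^+ n :> R.
Proof. by rewrite exprn_gt0. Qed.

Lemma gfl_ge0 n r : 0 <= gfl n r.
Proof. by rewrite divr_ge0// ltW. Qed.

Lemma gfl_le n r : 0 <= r -> gfl n r <= r.
Proof.
move=> r0; rewrite ler_pdivrMr// truncn_le mulr_ge0//; exact: ltW.
Qed.

Lemma gfl_gt n r : r < gfl n r + 2 ^- n.
Proof.
by rewrite /gfl -[X in _ + X]mul1r -mulrDl natr1 ltr_pdivlMr//; exact: truncnS_gt.
Qed.

Lemma gfl_dist n r : 0 <= r -> `|gfl n r - r| <= 2 ^- n.
Proof.
move=> r0; have := gfl_le n r0; have := gfl_gt n r.
by rewrite ler_norml => h1 h2; apply/andP; split; lra.
Qed.

Lemma cvg_exp2V : (2 ^- n : R) @[n --> \oo] --> (0 : R).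
Proof.
have := @cvg_geometric R 1 (2^-1); rewrite ger0_norm// invf_lt1// ltr1n => /(_ isT).
apply: cvg_trans; apply: near_eq_cvg; apply: nearW => n.
by rewrite /geometric/= mul1r exprVn.
Qed.

Lemma gfl_cvg r : 0 <= r -> gfl n r @[n --> \oo] --> r.
Proof. by move=> r0; apply: cvgn_dist_le cvg_exp2V => n; exact: gfl_dist. Qed.

Lemma gpt_ge0 n s k : 0 <= s -> 0 <= gpt n s k.
Proof. by move=> s0; rewrite le_min s0 andbT divr_ge0// ltW. Qed.

Lemma gptS n s k : gpt n s k <= gpt n s k.+1.
Proof.
rewrite le_min ge_min ler_pM2r ?invr_gt0// ler_nat leqnSn/=.
by rewrite ge_min lexx orbT.
Qed.

Lemma gpt_mono n s : {homo gpt n s : k l / (k <= l)%N >-> k <= l}.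
Proof. by apply/nondecreasing_seqP => k; exact: gptS. Qed.

Lemma gpt_le n s k : gpt n s k <= s.
Proof. by rewrite ge_min lexx orbT. Qed.

Lemma gpt0 n s : 0 <= s -> gpt n s 0 = 0.
Proof. by move=> s0; rewrite /gpt mul0r; apply/min_idPl. Qed.

Lemma gptJ n (T : nat) s : s <= T%:R -> gpt n s (T * 2 ^ n) = s.
Proof.
move=> sT; rewrite /gpt natrM natrX mulfK ?gt_eqF//; apply/min_idPr => //.
Qed.

Lemma gpt_step n s k : gpt n s k.+1 - gpt n s k <= 2 ^- n.
Proof.
rewrite /gpt -natr1 mulrDl mul1r.
have : 0 <= 2 ^- n :> R by rewrite invr_ge0 ltW.
move: (k%:R / 2 ^+ n) => x; move: (2 ^- n) => h hh.
by rewrite !minEle; case: ifPn; case: ifPn; rewrite -?ltNge; lra.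
Qed.

(* the grid interval [k/2^n, (k+1)/2^n[ containing r < s, as seen by gpt *)
Lemma gfl_gpt n s r : 0 <= r -> r < s ->
 let k := Num.truncn (r * 2 ^+ n) in
 [/\ gpt n s k = gfl n r, gpt n s k <= r & r < gpt n s k.+1].
Proof.
move=> r0 rs k; have kr := gfl_le n r0; have kr' := gfl_gt n r.
have E : gpt n s k = gfl n r by rewrite /gpt; apply/min_idPl; exact: ltW (le_lt_trans kr rs).
split=> //; first by rewrite E.
by rewrite lt_min rs andbT -natr1 mulrDl mul1r.
Qed.

Lemma gfl_trunc_lt n (T : nat) r : 0 <= r -> r < T%:R ->
 (Num.truncn (r * 2 ^+ n) < T * 2 ^ n)%N.
Proof.
move=> r0 rT; rewrite truncn_lt_nat; last by apply: mulr_ge0 => //; exact: ltW.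
by rewrite natrM natrX ltr_pM2r.
Qed.

(** The cells are half open, so the end point [s] lies in none of them and needs its own indicator;
    that term has measure zero when integrated. *)
Lemma step_sumE n (T : nat) s f r : 0 <= s -> s <= T%:R -> 0 <= r <= s ->
 f (gfl n r) = \sum_(k < T * 2 ^ n)
   f (gpt n s k) * \1_(`[gpt n s k, gpt n s k.+1[%classic : set R) r
  + f (gfl n s) * \1_([set s] : set R) r.
Proof.
move=> s0 sT /andP[r0]; rewrite le_eqVlt => /predU1P[->|rs].
 rewrite big1 ?add0r; last first.
  move=> k _; rewrite indicE memNset ?mulr0//= in_itv/= => /andP[_].
  by rewrite ltNge gpt_le.
 by rewrite indicE mem_set ?mulr1.
rewrite [\1_([set s]) r]indicE memNset ?mulr0 ?addr0; last by move=> /= rs'; rewrite rs' ltxx in rs.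
have [E kr rk] := gfl_gpt n r0 rs; set k0 := Num.truncn _ in E kr rk.
have k0J : (k0 < T * 2 ^ n)%N by apply: gfl_trunc_lt => //; exact: lt_le_trans sT.
rewrite (bigD1 (Ordinal k0J))//= big1 ?addr0.
 by rewrite indicE mem_set ?mulr1 ?E//= in_itv/=; apply/andP; split; rewrite // -E.
move=> k; rewrite -val_eqE/= neq_ltn => /orP[kk|kk]; rewrite indicE memNset ?mulr0//= in_itv/= => /andP[h1 h2].
 by move: h2; rewrite ltNge (le_trans _ kr)// gpt_mono.
by move: h1; rewrite leNgt (lt_le_trans rk)// gpt_mono.
Qed.

Lemma step_itg n (T : nat) s f : 0 <= s -> s <= T%:R ->
 itg mu `[0, s] (fun r => f (gfl n r)) /\
 \int[mu]_(r in `[0, s]) f (gfl n r) =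
  \sum_(k < T * 2 ^ n) f (gpt n s k) * (gpt n s k.+1 - gpt n s k).
Proof.
move=> s0 sT.
have mI : measurable (`[0, s]%classic : set (measurableTypeR R)) by [].
have ii (a b : R) : itg mu `[0, s] (\1_(`[a, b[%classic : set R) : R -> R).
 apply: (@itg_bd _ _ _ _ _ _ _ _ 1) => //; last by move=> x _; rewrite indicE ger0_norm//; case: (_ \in _).
  by rewrite /= lebesgue_measure_itv/=; case: ifP; rewrite // -EFinD ltry.
have i1 : itg mu `[0, s] (\1_([set s] : set R) : R -> R).
 apply: (@itg_bd _ _ _ _ _ _ _ _ 1) => //; last by move=> x _; rewrite indicE ger0_norm//; case: (_ \in _).
 by rewrite /= lebesgue_measure_itv/=; case: ifP; rewrite // -EFinD ltry.
have E x : `[0, s]%classic x -> \sum_(k < T * 2 ^ n)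
   f (gpt n s k) * \1_(`[gpt n s k, gpt n s k.+1[%classic : set R) x
  + f (gfl n s) * \1_([set s] : set R) x = f (gfl n x).
 by rewrite /= in_itv/= => xs; rewrite -(step_sumE _ _ s0 sT xs).
split.
 apply: (eq_itg mI E); apply: itgD => //; last exact: itgZ.
 by apply: itg_sum => // k _; exact: itgZ.
rewrite -(@Rint_ext _ _ R mu _ _ _ E) RintegralD//; last 2 first.
- by apply: itg_sum => // k _; exact: itgZ.
- exact: itgZ.
rewrite (Rint_sum mI); last by move=> k _; exact: itgZ.
rewrite RintegralZl// [X in _ + _ * X](_ : _ = 0).
 rewrite mulr0 addr0; apply: eq_bigr => k _.
 transitivity (f (gpt n s k) * \int[mu]_(x in `[0, s]) (\1_(`[gpt n s k, gpt n s k.+1[%classic : set R) x : R)).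
  exact: (RintegralZl _ mI (ii _ _)).
 congr (_ * _).
 rewrite /Rintegral integral_indic//.
 rewrite (_ : `[gpt n s k, gpt n s k.+1[ `&` `[0, s] = `[gpt n s k, gpt n s k.+1[%classic); last first.
  apply/seteqP; split => x /=; rewrite !in_itv/=; first by case.
  move=> /andP[h1 h2]; split; first by rewrite h1.
  by rewrite (le_trans (gpt_ge0 _ _ s0) h1)/= ltW// (lt_le_trans h2)// gpt_le.
 rewrite /= lebesgue_measure_itv/=; case: ifPn => //=.
 by rewrite lte_fin -leNgt => h; apply/eqP; rewrite eq_sym subr_eq0 eq_le h gptS.
rewrite /Rintegral integral_indic// (_ : _ `&` _ = [set s]) /= ?lebesgue_measure_set1//.
by apply/seteqP; split => x /=; rewrite !in_itv/=; [case|move=> ->; rewrite s0 lexx].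
Qed.

(** Continuity along dyadic points from below is all that left-endpoint sums see. The truncation
    indicators [chi] introduced below have it, although they may jump down just after a time. *)
Definition dyadic_cont f := forall r, 0 <= r -> f (gfl n r) @[n --> \oo] --> f r.

Lemma fin_itv (a b : R) : (mu `[a, b] < +oo)%E.
Proof. by rewrite lebesgue_measure_itv/=; case: ifP; rewrite // -EFinD ltry. Qed.

Lemma dyadic_cont_itg (s : R) f C : 0 <= s -> dyadic_cont f ->
 (forall r, 0 <= r <= s -> `|f r| <= C) ->
 itg mu `[0, s] f /\
 \int[mu]_(r in `[0, s]) f (gfl n r) @[n --> \oo] --> \int[mu]_(r in `[0, s]) f r.
Proof.
move=> s0 cf fC.
pose T := Num.bound s.
have sT : s <= T%:R by apply: ltW; rewrite archi_boundP.
apply: (@Rint_dom_cvg _ _ _ _ _ _ _ _ (fun=> C)) => //.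
- by move=> n; have [/itg_meas] := step_itg n f s0 sT.
- by move=> x /=; rewrite in_itv/= => /andP[x0 _]; exact: cf.
- by apply: itg_cst => //; exact: fin_itv.
move=> n x /=; rewrite in_itv/= => /andP[x0 xs]; apply: fC.
by rewrite gfl_ge0 (le_trans (gfl_le n x0)).
Qed.

End dyadic_grid.

(** * Bounded adapted processes and their simple stochastic integrals *)

Section bounded_processes.
Context disp (O : measurableType disp) (R : realType) (P : probability O R).
Variable F : R -> set (set O).
Hypothesis hF : filtration F.
Variable T : nat.
Local Notation mu := (@lebesgue_measure R).
Implicit Types (G : R -> O -> R) (W : R -> O -> R) (C : R).

(** The bound is required up to the horizon [T] only, whereas adaptedness and dyadic continuity
    refer to the whole half line; values frozen at earlier dyadic times stay in the class. *)
Definition bproc G C := [/\ forall t, 0 <= t -> sub_meas (F t) (G t),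
 forall w, dyadic_cont (fun r => G r w)
 & forall r w, 0 <= r <= T%:R -> `|G r w| <= C].

Lemma bproc_bdd G C t : bproc G C -> 0 <= t <= T%:R -> bdd_sub F t (G t).
Proof.
move=> [h1 _ h3] /andP[t0 tT]; split; first exact: h1.
by exists C => w; apply: h3; rewrite t0.
Qed.

Lemma bproc_meas G C t : bproc G C -> 0 <= t -> measurable_fun [set: O] (G t).
Proof. by move=> [h1 _ _] t0; apply: (filt_meas hF t0); exact: h1. Qed.

Lemma bproc_ge0 G C : bproc G C -> 0 <= C.
Proof.
by move=> [_ _ h]; apply: le_trans (h 0 point _); rewrite ?normr_ge0// lexx ler0n.
Qed.

Lemma bproc_L2 G C t : bproc G C -> 0 <= t <= T%:R -> L2 P setT (G t).
Proof.
move=> bG tT; have [_ _ h] := bG.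
apply: (@L2_bd _ _ _ _ _ measurableT (P_finT P) _ C) => [|w _]; last exact: h.
by apply: bproc_meas bG _; case/andP: tT.
Qed.

Lemma bproc_itg G C t : bproc G C -> 0 <= t <= T%:R -> itg P setT (G t).
Proof. by move=> bG tT; apply: (L2_itg measurableT (P_finT P)); exact: bproc_L2 bG tT. Qed.

Lemma bproc_mul G G' C C' : bproc G C -> bproc G' C' ->
 bproc (fun r w => G r w * G' r w) (C * C').
Proof.
move=> [a1 a2 a3] [b1 b2 b3]; split.
- by move=> t t0; apply: (filt_mul hF t0); [exact: a1|exact: b1].
- by move=> w r r0; apply: cvgM; [exact: a2|exact: b2].
- by move=> r w rT; rewrite normrM; apply: ler_pM => //; [exact: a3|exact: b3].
Qed.

Lemma gfl_itv n r (t : R) : 0 <= r <= t -> 0 <= gfl n r <= t.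
Proof. by move=> /andP[r0 rt]; rewrite gfl_ge0 (le_trans (gfl_le _ r0)). Qed.

Lemma bproc_exp_cont G C Z : bproc G C -> itg P setT Z ->
 forall r, 0 <= r <= T%:R ->
 \int[P]_w (Z w * G (gfl n r) w) @[n --> \oo] --> \int[P]_w (Z w * G r w).
Proof.
move=> bG iZ r rT; have [a1 a2 a3] := bG; have r0 : 0 <= r by case/andP: rT.
apply: (proj2 (@Rint_dom_cvg _ _ _ _ _ measurableT _ _ (fun w => C * `|Z w|) _ _ _ _)).
- move=> n; apply: measurable_funM; first exact: itg_meas iZ. by apply: (bproc_meas bG); exact: gfl_ge0.
- by move=> w _; apply: cvgMl_tmp; exact: a2.
- by apply: itgZ => //; exact: itg_norm.
- move=> n w _; rewrite normrM mulrC ler_wpM2r//; apply: a3; exact: gfl_itv.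
Qed.

Lemma mulZ_itg G C Z r : bproc G C -> itg P setT Z -> 0 <= r <= T%:R ->
 itg P setT (fun w => Z w * G r w).
Proof.
move=> bG iZ rT; have [_ _ a3] := bG.
apply: (itg_le measurableT _ _ (itgZ measurableT C (itg_norm measurableT iZ))).
 apply: measurable_funM; first exact: itg_meas iZ.
 by apply: (bproc_meas bG); case/andP: rT.
by move=> w _; rewrite normrM mulrC ler_wpM2r//; exact: a3.
Qed.

Lemma bproc_exp_bd G C Z r : bproc G C -> itg P setT Z -> 0 <= r <= T%:R ->
 `|\int[P]_w (Z w * G r w)| <= C * \int[P]_w `|Z w|.
Proof.
move=> bG iZ rT; have iZG := mulZ_itg bG iZ rT; have [_ _ a3] := bG.
apply: le_trans (le_normr_Rintegral measurableT iZG) _.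
have iN := itg_norm measurableT iZ.
rewrite -RintegralZl//; apply: le_Rintegral => //.
- exact: itg_norm.
- exact: itgZ.
- by move=> w _; rewrite normrM mulrC ler_wpM2r//; exact: a3.
Qed.

Lemma cont_itg (s : R) (f : R -> R) C : 0 <= s ->
 (forall r, 0 <= r <= s -> f (gfl n r) @[n --> \oo] --> f r) ->
 (forall r, 0 <= r <= s -> `|f r| <= C) ->
 itg mu `[0, s] f /\
 \int[mu]_(r in `[0, s]) f (gfl n r) @[n --> \oo] --> \int[mu]_(r in `[0, s]) f r.
Proof.
move=> s0 cf fC.
have sT : s <= (Num.bound s)%:R by apply: ltW; rewrite archi_boundP.
apply: (@Rint_dom_cvg _ _ _ _ _ _ _ _ (fun=> C)) => //.
- by move=> n; have [/itg_meas] := step_itg n f s0 sT.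
- by apply: itg_cst => //; exact: fin_itv.
by move=> n x /=; rewrite in_itv/= => xs; apply: fC; exact: gfl_itv.
Qed.

Lemma bproc_exp_itg G C Z s : bproc G C -> itg P setT Z -> 0 <= s <= T%:R ->
 itg mu `[0, s] (fun r => \int[P]_w (Z w * G r w)).
Proof.
move=> bG iZ /andP[s0 sT].
have hr r : 0 <= r <= s -> 0 <= r <= T%:R by move=> /andP[-> /le_trans->].
apply: (proj1 (cont_itg s0 _ _)) => r /hr; first exact: bproc_exp_cont bG iZ r.
exact: bproc_exp_bd bG iZ.
Qed.

Definition tint G s w := \int[mu]_(r in `[0, s]) G r w.

Lemma bproc_path_itg G C s w : bproc G C -> 0 <= s <= T%:R ->
 itg mu `[0, s] (fun r => G r w).
Proof.
move=> [_ a2 a3] /andP[s0 sT].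
apply: (proj1 (dyadic_cont_itg s0 (a2 w) (C := C) _)) => r /andP[r0 rs].
by apply: a3; rewrite r0 (le_trans rs).
Qed.

Lemma tint_cvg G C s w : bproc G C -> 0 <= s <= T%:R ->
 \sum_(k < T * 2 ^ n) G (gpt n s k) w * (gpt n s k.+1 - gpt n s k) @[n --> \oo] -->
 tint G s w.
Proof.
move=> [_ a2 a3] /andP[s0 sT].
have h r : 0 <= r <= s -> `|G r w| <= C by move=> /andP[r0 rs]; apply: a3; rewrite r0 (le_trans rs).
have [_] := dyadic_cont_itg s0 (a2 w) h.
apply: cvg_trans; apply: near_eq_cvg; apply: nearW => n.
by have [_] := step_itg n (G^~ w) s0 sT.
Qed.

Lemma sum_gpt_bd (g : nat -> R) C n s : 0 <= s <= T%:R -> (forall k, `|g k| <= C) ->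
 `|\sum_(k < T * 2 ^ n) g k * (gpt n s k.+1 - gpt n s k)| <= C * s.
Proof.
move=> /andP[s0 sT] gC; apply: le_trans (ler_norm_sum _ _ _) _.
apply: (@le_trans _ _ (\sum_(k < T * 2 ^ n) C * (gpt n s k.+1 - gpt n s k))).
 apply: ler_sum => k _; have h : 0 <= gpt n s k.+1 - gpt n s k by rewrite subr_ge0 gptS.
 by rewrite normrM (ger0_norm h) ler_wpM2r.
by rewrite -mulr_sumr sum_telescope gptJ// gpt0// subr0.
Qed.

Lemma gpt_itv n (s : R) k : 0 <= s <= T%:R -> 0 <= gpt n s k <= T%:R.
Proof. by move=> /andP[s0 sT]; rewrite gpt_ge0//= (le_trans (gpt_le _ _ _)). Qed.

Lemma tint_bd G C s w : bproc G C -> 0 <= s <= T%:R -> `|tint G s w| <= C * s.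
Proof.
move=> bG sT; apply: (cvg_norm_le _ (tint_cvg (w := w) bG sT)).
apply: nearW => n; apply: (@sum_gpt_bd (fun k => G (gpt n s k) w) C n s sT) => k.
by have [_ _ h] := bG; apply: h; exact: gpt_itv.
Qed.

Lemma tint_sub G C s : bproc G C -> 0 <= s <= T%:R -> sub_meas (F s) (tint G s).
Proof.
move=> bG sT; have s0 : 0 <= s by case/andP: sT.
have sF : sigma_algebra [set: O] (F s) by case: hF => h _ _; exact: h.
apply: (sub_meas_cvg sF (Zn := fun n w => \sum_(k < T * 2 ^ n) G (gpt n s k) w * (gpt n s k.+1 - gpt n s k))).
 move=> n; apply: (sub_meas_sum sF) => k _; apply: (sub_measM sF); last exact: filt_cst.
 apply: (filt_le hF (gpt_ge0 n k s0) (gpt_le _ _ _)).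
 by case: bG => h _ _; apply: h; exact: gpt_ge0.
by move=> w; exact: tint_cvg bG sT.
Qed.

(** Both sides are limits of the same Riemann sums, for which the exchange is linearity of a finite
    sum. This works with dyadic continuity in time, without passing through joint measurability of
    [G]. *)
Lemma tint_fubini G C Z s : bproc G C -> itg P setT Z -> 0 <= s <= T%:R ->
 \int[P]_w (Z w * tint G s w) = \iint[P]_(r, w < s) (Z w * G r w).
Proof.
move=> bG iZ sT; have /andP[s0 sT'] := sT.
have hr r : 0 <= r <= s -> 0 <= r <= T%:R by move=> /andP[-> /le_trans->].
have mZ := itg_meas iZ.
pose S n w := \sum_(k < T * 2 ^ n) G (gpt n s k) w * (gpt n s k.+1 - gpt n s k).
have h1 : \int[P]_w (Z w * S n w) @[n --> \oo] --> \int[P]_w (Z w * tint G s w).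
 apply: (proj2 (@Rint_dom_cvg _ _ _ _ _ measurableT _ _ (fun w => C * s * `|Z w|) _ _ _ _)).
 - move=> n; apply: measurable_funM => //; apply: measurable_sum => k.
  by apply: measurable_funM => //; apply: (bproc_meas bG); exact: gpt_ge0.
 - by move=> w _; apply: cvgMl_tmp; exact: tint_cvg bG sT.
 - by apply: itgZ => //; exact: itg_norm.
 - move=> n w _; rewrite normrM mulrC ler_wpM2r//; apply: (@sum_gpt_bd (fun k => G (gpt n s k) w) C n s sT) => k.
  by have [_ _ h] := bG; apply: h; exact: gpt_itv.
apply: (cvg_uniq _ h1).
have [_] := cont_itg s0 (fun r rs => bproc_exp_cont bG iZ (hr r rs)) (fun r rs => bproc_exp_bd bG iZ (hr r rs)).
apply: cvg_trans; apply: near_eq_cvg; apply: nearW => n.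
have [_ ->] := step_itg n (fun r => \int[P]_w (Z w * G r w)) s0 sT'.
rewrite /S; under [RHS]Rint_ext do rewrite mulr_sumr.
have iG k : itg P setT (fun w => Z w * G (gpt n s k) w) by apply: mulZ_itg bG iZ _; exact: gpt_itv.
rewrite (Rint_sum measurableT); last first. by move=> k _; under eq_fun do rewrite mulrA; exact: itgZr.
by apply: eq_bigr => k _; rewrite -(RintegralZr _ measurableT (iG k)); apply: eq_mean => w; rewrite mulrA.
Qed.

(** Left-endpoint sums over the grid stopped at [s]; as a function of [s] this is the stochastic
    integral of the integrand frozen at level [n], hence a martingale in continuous time. *)
Definition SI n G W s w := \sum_(k < T * 2 ^ n)
 G (gpt n s k) w * incr (gpt n s) W k w.

Lemma SI_bdd G C n s : bproc G C -> 0 <= s <= T%:R ->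
 forall k, bdd_sub F (gpt n s k) (G (gpt n s k)).
Proof. by move=> bG sT k; apply: bproc_bdd bG _; exact: gpt_itv. Qed.

Lemma SI_L2 G C W n s : bproc G C -> standard_brownian P F W -> 0 <= s <= T%:R ->
 L2 P setT (SI n G W s).
Proof.
move=> bG hW sT; have s0 : 0 <= s by case/andP: sT.
apply: (incr_sum_L2 hF (fun k => gpt_ge0 n k s0) (gptS n s) (Z := fun k => G (gpt n s k)) _ hW).
exact: SI_bdd bG sT.
Qed.

Lemma SI_isom G G' C C' W W' (c : R) n s : bproc G C -> bproc G' C' ->
 standard_brownian P F W -> standard_brownian P F W' ->
 (forall t : R, 0 <= t -> is_bracket P W W' t (fun=> c * t)) -> 0 <= s <= T%:R ->
 \int[P]_w (SI n G W s w * SI n G' W' s w) =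
 c * \iint[P]_(r, w < s) (G (gfl n r) w * G' (gfl n r) w).
Proof.
move=> bG bG' hW hW' hbr sT; have /andP[s0 sT'] := sT.
have p0 := fun k => gpt_ge0 n k s0; have pS := gptS n s.
rewrite (incr_sum_mul hF hW hW' p0 pS _ (SI_bdd n bG sT) (SI_bdd n bG' sT)).
have [_ ->] := step_itg n (fun r => \int[P]_w (G r w * G' r w)) s0 sT'.
rewrite mulr_sumr; apply: eq_bigr => k _.
rewrite (incr_bracket hF hW hW' hbr (p0 k) (pS k)); first by ring.
by apply: (bdd_mul hF (p0 k)); [exact: SI_bdd bG sT _|exact: SI_bdd bG' sT _].
Qed.

Lemma SI0 n G W w : SI n G W 0 w = 0.
Proof.
have h k : gpt n 0 k = 0 :> R by apply/eqP; rewrite eq_le gpt_le gpt_ge0.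
by apply: big1 => k _; rewrite /incr !h subrr mulr0.
Qed.

(** Term by term for a cell [a, b]: past [t] both summands vanish; starting between [s] and [t] it
    has mean zero; before [s] it is common to both sides; and if it contains [s], the difference
    involves the increment after [s] only. *)
Lemma SI_mart G C W n s t Z : bproc G C -> standard_brownian P F W ->
 0 <= s -> s <= t -> t <= T%:R -> bdd_sub F s Z ->
 \int[P]_w (Z w * SI n G W t w) = \int[P]_w (Z w * SI n G W s w).
Proof.
move=> bG hW s0 st tT bZ; have t0 := le_trans s0 st.
have tT' : 0 <= t <= T%:R by rewrite t0.
have sT' : 0 <= s <= T%:R by rewrite s0 (le_trans st).
have iZ r : 0 <= r <= T%:R -> itg P setT (fun w => Z w * SI n G W r w).
 by move=> rT; apply: (L2_itg measurableT (P_finT P)); apply: (bdd_L2M hF s0) => //; exact: SI_L2 bG hW rT.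
apply/eqP; rewrite -subr_eq0 -RintegralB//; [|exact: iZ|exact: iZ].
pose I r k w := G (gpt n r k) w * incr (gpt n r) W k w.
have iI r k : 0 <= r <= T%:R -> itg P setT (fun w => Z w * I r k w).
 move=> rT; have r0 : 0 <= r by case/andP: rT.
 apply: (L2_itg measurableT (P_finT P)); apply: (bdd_L2M hF s0) => //.
 exact: (incr_L2M hF (fun k => gpt_ge0 n k r0) (gptS n r) hW (SI_bdd n bG rT k)).
transitivity (\int[P]_w (\sum_(k < T * 2 ^ n) (Z w * I t k w - Z w * I s k w)) == 0).
 congr (_ == 0); apply: eq_mean => w.
 by rewrite /SI -mulrBr -sumrB mulr_sumr; apply: eq_bigr => k _; rewrite mulrBr.
rewrite (Rint_sum measurableT); last by move=> k _; apply: itgB => //; exact: iI.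
rewrite big1 ?eqxx// => k _.
pose a : R := k%:R / 2 ^+ n; pose b : R := k.+1%:R / 2 ^+ n.
have ab : a <= b by rewrite ler_pM2r ?invr_gt0 ?exprn_gt0// ler_nat.
have a0 : 0 <= a by rewrite divr_ge0// exprn_ge0.
have gE r : gpt n r k = Num.min a r by [].
have gE' r : gpt n r k.+1 = Num.min b r by [].
have [ta|at_] := leP t a.
 have sa := le_trans st ta.
 under Rint_ext.
  move=> w _; rewrite /I /incr !gE !gE' !min_r// ?subrr; [|exact: le_trans ab|exact: le_trans ab].
  rewrite !mulr0 subrr; over.
 by rewrite Rint_cstP.
have [sa|as_] := leP s a.
 under Rint_ext.
  move=> w _; rewrite /I /incr !gE !gE' (min_r sa) (min_r (le_trans sa ab)) subrr !mulr0 subr0.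
  rewrite (min_l (ltW at_)) mulrA; over.
 have h1 : a <= Num.min b t by rewrite le_min ab ltW.
 have aT : 0 <= a <= T%:R by rewrite a0 (le_trans (ltW at_)).
 apply: (bm_mul_mean hF hW a0 h1).
  by apply: (filt_mul hF a0); [apply: (filt_le hF s0 sa); case: bZ|case: bG => h _ _; exact: h].
 apply: (L2_itg measurableT (P_finT P)); apply: (bdd_L2M hF s0) => //.
 exact: bproc_L2 bG aT.
have [bs|sb] := leP b s.
 under Rint_ext.
  move=> w _; rewrite /I /incr !gE !gE' (min_l bs) (min_l (le_trans bs st)).
  rewrite (min_l (ltW at_)) (min_l (ltW as_)) subrr; over.
 by rewrite Rint_cstP.
under Rint_ext.
 move=> w _; rewrite /I /incr !gE !gE' (min_r (ltW sb)).
 rewrite (min_l (ltW at_)) (min_l (ltW as_)).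
 rewrite (_ : _ - _ = (Z w * G a w) * (W (Num.min b t) w - W s w)); last by ring.
 over.
have h1 : s <= Num.min b t by rewrite le_min (ltW sb).
have aT : 0 <= a <= T%:R by rewrite a0 (le_trans (ltW at_)).
apply: (bm_mul_mean hF hW s0 h1).
 apply: (filt_mul hF s0); first by case: bZ.
 by apply: (filt_le hF a0 (ltW as_)); case: bG => h _ _; exact: h.
apply: (L2_itg measurableT (P_finT P)); apply: (bdd_L2M hF s0) => //.
exact: bproc_L2 bG aT.
Qed.

Lemma SI_mean G C W n s : bproc G C -> standard_brownian P F W -> 0 <= s <= T%:R ->
 \int[P]_w SI n G W s w = 0.
Proof.
move=> bG hW /andP[s0 sT].
have := SI_mart n bG hW (lexx 0) s0 sT (bdd_cst hF 1 (lexx 0)).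
under Rint_ext do rewrite mul1r; move=> ->.
by under Rint_ext do rewrite SI0 mulr0; rewrite Rint_cstP.
Qed.

(** Increments over the finer cells telescope to the coarse increment as long as the integrand stays
    frozen at the coarse level. Sums of different levels can thus be compared on one grid. *)
Lemma SI_refine G W m n s w : (m <= n)%N -> 0 <= s <= T%:R ->
 SI m G W s w = SI n (fun r => G (gfl m r)) W s w.
Proof.
move=> mn /andP[s0 sT]; rewrite /SI.
have JE : (T * 2 ^ n = T * 2 ^ m * 2 ^ (n - m))%N by rewrite -mulnA -expnD subnKC.
rewrite JE -(big_mkord xpredT (fun k => G (gfl m (gpt n s k)) w * incr (gpt n s) W k w)).
rewrite big_nat_mul big_mkord; apply: eq_bigr => a _.
have gm j : gpt n s (j * 2 ^ (n - m)) = gpt m s j.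
 rewrite /gpt; congr Num.min; rewrite -[in 2 ^+ n](subnK mn) exprD natrM natrX.
 by rewrite invfM mulrA mulfK// gt_eqF// exprn_gt0.
transitivity (\sum_(a * 2 ^ (n - m) <= i < a.+1 * 2 ^ (n - m)) G (gpt m s a) w * incr (gpt n s) W i w).
 rewrite -mulr_sumr telescope_sumr; last by rewrite leq_mul2r leqnSn orbT.
 by rewrite !gm.
apply: eq_big_nat => i /andP[ai ia].
have [si|is_] := leP s (i%:R / 2 ^+ n).
 have h j : (i <= j)%N -> gpt n s j = s.
  move=> ij; apply: min_r; apply: le_trans si _.
  by rewrite ler_pM2r ?invr_gt0// ler_nat.
 by rewrite /incr !h// subrr !mulr0.
congr (G _ w * _).
have -> : gpt n s i = i%:R / 2 ^+ n by apply: min_l; exact: ltW.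
have E : gfl m (i%:R / 2 ^+ n) = a%:R / 2 ^+ m :> R.
 rewrite /gfl; congr (_%:R / _); apply/eqP; rewrite truncn_eq; last by rewrite mulr_ge0// ltW.
 have -> : i%:R / 2 ^+ n * 2 ^+ m = i%:R / 2 ^+ (n - m) :> R.
  rewrite -[in 2 ^+ n](subnK mn) exprD; field.
  by rewrite !expf_neq0.
 by rewrite ler_pdivlMr// ltr_pdivrMr// -natrX -!natrM ler_nat ltr_nat ai.
rewrite E; apply: min_l; apply: le_trans (ltW is_).
by rewrite -E gfl_le.
Qed.

(** On [A] the bounded integrand [G] has the same values up to [s] as the true integrand [H], so the
    sums coincide there with those that define the Ito integral. *)
Lemma SI_ito (A : set O) G H W L s : measurable A -> 0 <= s <= T%:R ->
 standard_brownian P F W ->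
 (forall r, 0 <= r -> measurable_fun [set: O] (H r)) ->
 (forall w r, A w -> 0 <= r <= s -> G r w = H r w) ->
 is_Ito_integral P H W s L ->
 cvg_prob_on P A (fun n w => SI n G W s w - L w).
Proof.
move=> mA /andP[s0 sT] hW mH GH [mL hL] eps eta e0 eta0.
have [del del0 hdel] := hL eps eta e0 eta0.
have [N hN] : exists N, forall n, (N <= n)%N -> (2 ^- n : R) < del.
 have /cvgrPdist_lt/(_ _ del0) [N _ hN] := @cvg_exp2V R.
 exists N => n /hN; rewrite sub0r normrN ger0_norm// invr_ge0 exprn_ge0//.
exists N => n /hN {}hN.
have exM : exists k, s <= k%:R / 2 ^+ n :> R. exists (T * 2 ^ n)%N; rewrite natrM natrX mulfK// gt_eqF//.
(* [M] is the first index at which the stopped grid reaches [s]. Up to [M] the points increase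
   strictly, as [itv_partition] requires, and beyond it every increment is zero. *)
have [M sM Mmin] := ex_minnP exM.
have pM : gpt n s M = s by exact: min_r.
have lt k : (k < M)%N -> k%:R / 2 ^+ n < s by move=> kM; rewrite ltNge; apply/negP => /Mmin; rewrite leqNgt kM.
have pS k : (k < M)%N -> gpt n s k < gpt n s k.+1.
 move=> kM; rewrite /gpt (min_l (ltW (lt _ kM))) lt_min lt// andbT.
 by rewrite ltr_pM2r ?invr_gt0// ltr_nat.
have MJ : (M <= T * 2 ^ n)%N by apply: Mmin; rewrite natrM natrX mulfK// gt_eqF.
have SE w : SI n G W s w = \sum_(k < M) G (gpt n s k) w * incr (gpt n s) W k w.
 rewrite /SI -(big_mkord xpredT (fun k => G (gpt n s k) w * incr (gpt n s) W k w)).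
 rewrite (big_cat_nat (leq0n M) MJ)/= [X in _ + X]big1_seq ?addr0 ?big_mkord//.
 move=> k /andP[_]; rewrite mem_index_iota => /andP[Mk _].
 have h j : (M <= j)%N -> gpt n s j = s.
  move=> Mj; apply: min_r; apply: le_trans sM _.
  by rewrite ler_pM2r ?invr_gt0// ler_nat.
 by rewrite /incr !h ?subrr ?mulr0// (leq_trans Mk).
have p0 : gpt n s 0 = 0 by exact: gpt0.
have := hdel (mkseq (fun k => gpt n s k.+1) M) (mkseq_partition p0 pM pS).
move=> /(_ _)/wrap[|].
 move=> k; rewrite size_mkseq => kM; rewrite !pt_mkseq// ?(ltnW kM)//.
 exact: le_lt_trans (gpt_step _ _ _) hN.
set B := [set w | _ <= _] => hB.
have BE : B = [set w | eps <= `|\sum_(k < M) H (gpt n s k) w * incr (gpt n s) W k w - L w|].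
 apply/funext => w; rewrite /B/=.
 by rewrite (sum_pt_mkseq M (fun a b => H a w * (W b w - W a w)) p0).
have mset (f : O -> R) : measurable_fun [set: O] f -> measurable [set w | eps <= `|f w|].
 move=> mf; have m : measurable_fun [set: O] (fun w => `|f w|) by exact: measurableT_comp.
 have := m measurableT `[eps, +oo[%classic (measurable_itv _).
 by rewrite setTI; congr measurable; apply/seteqP; split => w /=; rewrite in_itv/= andbT.
have mB : measurable B.
 rewrite BE; apply: mset; apply: measurable_funB => //; apply: measurable_sum => k.
 apply: measurable_funM; first by apply: mH; exact: gpt_ge0.
 exact: (bm_incr_meas hF hW (gpt_ge0 n k s0) (gptS n s k)).
have E w : A w -> \sum_(k < M) G (gpt n s k) w * incr (gpt n s) W k w =
  \sum_(k < M) H (gpt n s k) w * incr (gpt n s) W k w.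
 by move=> Aw; apply: eq_bigr => k _; rewrite GH// gpt_ge0// gpt_le.
rewrite (_ : A `&` _ = A `&` B); last first.
 by rewrite BE; apply/seteqP; split => w [Aw /=] h; split => //=; move: h; rewrite SE (E w Aw).
apply: le_trans hB; apply: le_measure; rewrite ?inE//; first exact: measurableI.
Qed.

End bounded_processes.

(** * Integration by parts for Lebesgue integrals *)

Section product_of_integrals.
Context (R : realType).
Local Notation RR := (measurableTypeR R).
Local Notation mu := (@lebesgue_measure R).

Lemma itg_mkcond (D : set RR) (f : R -> R) : measurable D -> itg mu D f ->
 itg mu setT (f \_ D).
Proof. by move=> mD; rewrite /itg integrable_mkcond// restrict_EFin. Qed.

Lemma itgS (D E : set RR) (f : R -> R) : measurable D -> measurable E -> E `<=` D ->
 itg mu D f -> itg mu E f.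
Proof. by move=> mD mE ED; apply: integrableS. Qed.

Lemma Rint_cst_itv (s t c : R) : s <= t -> \int[mu]_(r in `[s, t]) c = c * (t - s).
Proof.
move=> st; have mD := mI `[s, t].
rewrite (Rintegral_cst mu mD) /= lebesgue_measure_itv/= lte_fin.
by case: ltP => //= h; rewrite (_ : t - s = 0) ?mulr0//; apply/eqP; rewrite subr_eq0 eq_le h.
Qed.

Lemma Rint_bd_itv (s t C : R) (f : R -> R) : s <= t -> itg mu `[s, t] f ->
 (forall r, s <= r <= t -> `|f r| <= C) -> `|\int[mu]_(r in `[s, t]) f r| <= C * (t - s).
Proof.
move=> st i_f hf; have mD := mI `[s, t].
apply: le_trans (le_normr_Rintegral mD i_f) _.
have fin : (mu (`[s, t]%classic : set RR) < +oo)%E by exact: fin_itv.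
rewrite -(Rint_cst_itv _ st); apply: le_Rintegral => //.
- exact: (itg_norm mD i_f).
- exact: (itg_cst mD fin).
Qed.

Let inner_integral (c : R) (D E : set RR) (g : R -> R) : measurable D -> measurable E -> E `<=` D ->
 itg mu D g -> (\int[mu]_y (c%:E * (((g \_ D) \_ E) y)%:E) = (c * \int[mu]_(q in E) g q)%:E)%E.
Proof.
move=> mD mE ED i_g; have iE := itgS mD mE ED i_g.
rewrite integralZl//; last first.
 by apply: itg_mkcond => //; apply: (itgS measurableT mE (@subsetT _ _)); exact: itg_mkcond.
rewrite EFinM (EFin_Rint mE iE) [in RHS]integral_mkcond; congr (_ * _)%E; apply: eq_integral => y _.
by rewrite /patch; case: ifPn => // yx; rewrite ifT//; move: yx; rewrite !inE; exact: ED.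
Qed.

(** Both iterated integrals are the integral of f(r) g(q) over the triangle q <= r inside the square
    [0, t]^2. *)
Lemma triangle_fubini (t : R) (f g : R -> R) : 0 <= t ->
 itg mu `[0, t] f -> itg mu `[0, t] g ->
 itg mu `[0, t] (fun r => f r * \int[mu]_(q in `[0, r]) g q) /\
 \int[mu]_(r in `[0, t]) (f r * \int[mu]_(q in `[0, r]) g q) =
 \int[mu]_(q in `[0, t]) (g q * \int[mu]_(r in `[q, t]) f r).
Proof.
move=> t0 i_f i_g.
have mD := mI `[0, t].
pose f' := f \_ `[0, t]; pose g' := g \_ `[0, t].
have if' : itg mu setT f' by exact: itg_mkcond.
have ig' : itg mu setT g' by exact: itg_mkcond.
have mf' := itg_meas if'; have mg' := itg_meas ig'.
pose A : set (RR * RR) := [set z | z.2 <= z.1].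
have hA (x y : R) : ((x, y) \in A) = (y <= x) by apply/idP/idP; rewrite in_setE.
have mA : measurable A.
 have m : measurable_fun [set: RR * RR] (fun z : RR * RR => (z.2 : R) <= z.1).
  by apply: measurable_fun_ler; [exact: measurable_snd|exact: measurable_fst].
 have := m measurableT [set true] I; rewrite setTI.
 by congr measurable; apply/seteqP; split => z /=.
pose h (z : RR * RR) : R := f' z.1 * g' z.2 * \1_A z.
have mh : measurable_fun [set: RR * RR] h.
 apply: measurable_funM; last exact: measurable_indic.
 by apply: measurable_funM; [exact: (measurableT_comp mf' measurable_fst)|exact: (measurableT_comp mg' measurable_snd)].
have mhE : measurable_fun [set: RR * RR] (EFin \o h) by exact/measurable_EFinP.
have hfg z : `|h z| <= `|f' z.1| * `|g' z.2|.
 by rewrite /h normrM normrM ler_piMr// ?mulr_ge0// indicE; case: (_ \in _); rewrite ?normr1 ?normr0.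
have ih : (mu \x mu)%E.-integrable setT (EFin \o h).
 apply/integrable12ltyP => //.
 apply: (@le_lt_trans _ _ (\int[mu]_x (`|f' x|%:E * \int[mu]_y `|g' y|%:E)))%E.
  apply: ge0_le_integral => //.
  - by move=> x _; exact: integral_ge0.
  - by apply: (measurable_fun_fubini_tonelli_F (abse \o (EFin \o h))) => //=; exact: measurableT_comp.
  - apply: emeasurable_funM => //; apply/measurable_EFinP; exact: measurableT_comp.
  move=> x _; rewrite -ge0_integralZl//; last first. by apply/measurable_EFinP; exact: measurableT_comp.
  apply: ge0_le_integral => //.
  - apply: measurableT_comp => //; apply/measurable_EFinP. exact: (measurableT_comp mh (measurable_pair1 x)).
  - by apply: emeasurable_funM => //; apply/measurable_EFinP; exact: measurableT_comp.
  - by move=> y _ /=; rewrite -EFinM lee_fin; exact: (hfg (x, y)).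
 rewrite ge0_integralZr//; last 2 first.
 - by apply/measurable_EFinP; exact: measurableT_comp.
 - exact: integral_ge0.
 have [_ h1] := integrableP _ _ _ if'; have [_ h2] := integrableP _ _ _ ig'.
 apply: lte_mul_pinfty => //; first by apply: integral_ge0.
 by rewrite fin_numElt; apply/andP; split => //; apply: lt_le_trans (integral_ge0 _ _).
have FE x : fubini_F mu (EFin \o h) x = (((fun r => f r * \int[mu]_(q in `[0, r]) g q) \_ `[0, t]) x)%:E.
 rewrite /fubini_F/=.
 transitivity (\int[mu]_y ((f' x)%:E * (((g \_ `[0, t]) \_ `[0, x]) y)%:E))%E.
  apply: eq_integral => y _; rewrite -EFinM /h/= -mulrA; congr (_ * _)%:E.
  rewrite /g' /patch indicE hA !mem_setE/=.
  have [y0|y0] := boolP (y \in `[0, t]); rewrite ?mul0r; last by case: ifP.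
  have : (y \in `[0, x]) = (y <= x) by move: y0; rewrite !in_itv/= => /andP[-> _].
  by move=> ->; case: ifP; rewrite ?mulr1 ?mulr0.
 have [x0t|x0t] := boolP (x \in `[0, t]).
  have xt : `[0, x] `<=` `[0, t].
   move: x0t; rewrite in_itv/= => /andP[_ xt] z /=; rewrite !in_itv/= => /andP[-> zx].
   exact: le_trans xt.
  by rewrite (inner_integral _ mD (mI _) xt i_g) /f' /patch mem_setE x0t.
 rewrite /f' /patch mem_setE (negbTE x0t).
 by under eq_integral do rewrite mul0e; rewrite integral0.
have GE y : fubini_G mu (EFin \o h) y = (((fun q => g q * \int[mu]_(r in `[q, t]) f r) \_ `[0, t]) y)%:E.
 rewrite /fubini_G/=.
 transitivity (\int[mu]_x ((g' y)%:E * (((f \_ `[0, t]) \_ `[y, t]) x)%:E))%E.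
  apply: eq_integral => x _; rewrite -EFinM /h/= [f' x * _]mulrC -mulrA; congr (_ * _)%:E.
  rewrite /f' /patch indicE hA !mem_setE/=.
  have [x0|x0] := boolP (x \in `[0, t]); rewrite ?mul0r; last by case: ifP.
  have : (x \in `[y, t]) = (y <= x) by move: x0; rewrite !in_itv/= => /andP[_ ->]; rewrite andbT.
  by move=> ->; case: ifP; rewrite ?mulr1 ?mulr0.
 have [y0t|y0t] := boolP (y \in `[0, t]).
  have yt : `[y, t] `<=` `[0, t].
   move: y0t; rewrite in_itv/= => /andP[y0 _] z /=; rewrite !in_itv/= => /andP[yz ->].
   by rewrite (le_trans y0 yz).
  by rewrite (inner_integral _ mD (mI _) yt i_f) /g' /patch mem_setE y0t.
 rewrite /g' /patch mem_setE (negbTE y0t).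
 by under eq_integral do rewrite mul0e; rewrite integral0.
have iF := integrable_fubini_F ih.
have iFE : itg mu setT ((fun r => f r * \int[mu]_(q in `[0, r]) g q) \_ `[0, t]).
 by apply: eq_integrable iF => // x _; rewrite FE.
split. by rewrite /itg integrable_mkcond// restrict_EFin.
rewrite [LHS]Rintegral_mkcond [RHS]Rintegral_mkcond /Rintegral; congr fine.
transitivity (\int[mu]_x fubini_F mu (EFin \o h) x)%E. by apply: eq_integral => x _; rewrite FE.
rewrite integral12_prod_meas1// -integral21_prod_meas1//.
by apply: eq_integral => x _; rewrite GE.
Qed.

Lemma Rint_split (s t : R) (f : R -> R) : 0 <= s <= t -> itg mu `[0, t] f ->
 \int[mu]_(r in `[0, t]) f r =
 \int[mu]_(r in `[0, s]) f r + \int[mu]_(r in `[s, t]) f r.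
Proof.
move=> /andP[s0 st] i_f; have i2 : itg mu `]s, t] f.
 apply: itgS i_f; [exact: mI|exact: mI|move=> x; rewrite /= !in_itv/= => /andP[sx ->]].
 by rewrite (le_trans s0 (ltW sx)).
by rewrite -(Rintegral_itv_obnd_cbnd i2) -(Rintegral_itvB i_f) ?bnd_simp// addrC subrK.
Qed.

(** The square [0, t]^2 is cut along its diagonal. *)
Lemma Rint_prod (t : R) (f g : R -> R) : 0 <= t ->
 itg mu `[0, t] f -> itg mu `[0, t] g ->
 \int[mu]_(r in `[0, t]) f r * \int[mu]_(r in `[0, t]) g r =
 \int[mu]_(r in `[0, t]) (f r * \int[mu]_(q in `[0, r]) g q) +
 \int[mu]_(r in `[0, t]) (g r * \int[mu]_(q in `[0, r]) f q).
Proof.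
move=> t0 i_f i_g.
have [i1 E1] := triangle_fubini t0 i_f i_g; have [i2 _] := triangle_fubini t0 i_g i_f.
rewrite E1.
have E q : `[0, t]%classic q -> g q * \int[mu]_(r in `[q, t]) f r =
  (\int[mu]_(r in `[0, t]) f r) * g q - g q * \int[mu]_(r in `[0, q]) f r.
 by rewrite /= in_itv/= => qt; rewrite (Rint_split qt i_f); ring.
rewrite (@Rint_ext _ _ R mu _ _ _ E) RintegralB//; last exact: itgZ.
by rewrite RintegralZl// subrK.
Qed.

End product_of_integrals.

(** * Product rule in expectation for simple Ito processes *)

Section ito_products.
Context disp (O : measurableType disp) (R : realType) (P : probability O R).
Variable F : R -> set (set O).
Hypothesis hF : filtration F.
Variable T : nat.
Local Notation mu := (@lebesgue_measure R).
Local Notation bproc := (bproc F T).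
Local Notation SI := (SI T).

(** The leading 1 is the homogeneous initial value. *)
Definition simp n (b G W : R -> O -> R) t w : R := 1 + tint b t w + SI n G W t w.

Lemma nine_sum (a1 a2 m1 m2 c1 c2 q : R) :
 1 + a1 + a2 + (m1 + m2) + c1 + c2 + q = 1 + (a1 + m1 + c1) + (a2 + m2 + c2) + q.
Proof. by ring. Qed.

Lemma tint_dist b (C s t : R) w : bproc b C -> 0 <= s -> s <= t -> t <= T%:R ->
 `|tint b t w - tint b s w| <= C * (t - s).
Proof.
move=> bb s0 st tT.
have tT' : 0 <= t <= T%:R by rewrite (le_trans s0 st).
have i_t := bproc_path_itg w bb tT'.
have st' : 0 <= s <= t by rewrite s0.
rewrite /tint (Rint_split st' i_t) addrC addKr.
have i2 : itg mu `[s, t] (b^~ w).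
 apply: itgS i_t => //.
 by move=> x /=; rewrite !in_itv/= => /andP[sx ->]; rewrite (le_trans s0).
apply: (Rint_bd_itv st i2) => x /andP[sx xt]; case: bb => _ _; apply.
by rewrite (le_trans s0 sx) (le_trans xt tT).
Qed.

(** A bounded process must be adapted and dyadically continuous at all times, while [b] is
    controlled up to [T] only; freezing the integral after [T] reconciles the two. *)
Lemma tint_bproc b (C : R) : bproc b C -> exists b', bproc b' (C * T%:R) /\
 forall s w, 0 <= s <= T%:R -> b' s w = tint b s w.
Proof.
move=> bb; exists (fun s w => tint b (Num.min s T%:R) w).
have C0 := bproc_ge0 bb.
have hs (s : R) : 0 <= s -> 0 <= Num.min s T%:R <= T%:R by move=> s0; rewrite le_min s0 ler0n ge_min lexx orbT.
split; last by move=> s w /andP[_ sT]; rewrite min_l.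
split.
- move=> t t0; apply: (filt_le hF (s := Num.min t T%:R)); first by case/andP: (hs t t0). by rewrite ge_min lexx.
 exact: (tint_sub hF bb (hs t t0)).
- move=> w r r0; apply: (@cvgn_dist_le _ _ (fun n => C * 2 ^- n)); last first.
  by rewrite -[X in _ --> X](mulr0 C); apply: cvgMl_tmp; exact: cvg_exp2V.
 move=> n; have g0 := gfl_ge0 n r; have gr := gfl_le n r0; have gt := gfl_gt n r.
 have /andP[m0 mT] := hs r r0; have /andP[m0' mT'] := hs _ g0.
 have mm : Num.min (gfl n r) T%:R <= Num.min r T%:R by rewrite le_min !ge_min gr lexx orbT.
 rewrite distrC; apply: le_trans (tint_dist w bb m0' mm mT) _.
 apply: ler_wpM2l => //; move: gr gt; move: (gfl n r) (2 ^- n) => x y xr ry.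
 by rewrite !minEle; case: ifPn; case: ifPn; rewrite -?ltNge; lra.
- move=> r w /andP[r0 rT]; apply: le_trans (tint_bd w bb (hs r r0)) _.
 by apply: ler_wpM2l => //; rewrite ge_min lexx orbT.
Qed.

Lemma tint_L2 b (C t : R) : bproc b C -> 0 <= t <= T%:R -> L2 P setT (tint b t).
Proof.
move=> bb tT; have [b' [bb' E]] := tint_bproc bb.
by apply: (eq_L2 measurableT _ (bproc_L2 P hF bb' tT)) => w _; rewrite E.
Qed.

Lemma simp_L2 n b (C : R) G (C' : R) W (t : R) : bproc b C -> bproc G C' -> standard_brownian P F W ->
 0 <= t <= T%:R -> L2 P setT (simp n b G W t).
Proof.
move=> bb bG hW tT; apply: L2D => //; last exact: SI_L2 bG hW tT.
by apply: L2D => //; [exact: L2_cst measurableT (P_finT P) _|exact: tint_L2 bb tT].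
Qed.

Lemma SI_sqr_le n G (C : R) W (t : R) : bproc G C -> standard_brownian P F W ->
 (forall t : R, 0 <= t -> is_bracket P W W t (fun=> t)) -> 0 <= t <= T%:R ->
 \int[P]_w (SI n G W t w ^+ 2) <= C ^+ 2 * T%:R.
Proof.
move=> bG hW hbr tT; have /andP[t0 tT'] := tT.
have hbr1 s : 0 <= s -> is_bracket P W W s (fun=> 1 * s) by rewrite mul1r; exact: hbr.
have := SI_isom hF n bG bG hW hW hbr1 tT; rewrite mul1r.
under Rint_ext do rewrite -expr2; move=> ->.
have bGG := bproc_mul hF bG bG.
have i1 : itg P setT (fun=> 1 : R) by exact: itg_cst measurableT (P_finT P) _.
pose e r := \int[P]_w (G r w * G r w).
have he r : 0 <= r <= T%:R -> `|e r| <= C ^+ 2.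
 move=> rT; have := bproc_exp_bd hF bGG i1 rT.
 under Rint_ext do rewrite mul1r; move=> /le_trans; apply.
 by under Rint_ext do rewrite normr1; rewrite Rint_cstP mulr1 expr2.
have [ii _] := step_itg n e t0 tT'.
apply: le_trans (ler_norm _) _.
apply: (@le_trans _ _ (C ^+ 2 * (t - 0))); last by rewrite subr0 ler_wpM2l// sqr_ge0.
apply: (Rint_bd_itv t0 ii) => x /andP[x0 xt]; apply: he.
by rewrite gfl_ge0 (le_trans (gfl_le _ x0))// (le_trans xt).
Qed.

Section two.
Variables (W W' : R -> O -> R) (c : R).
Hypotheses (hW : standard_brownian P F W) (hW' : standard_brownian P F W').
Hypothesis hbr : forall t : R, 0 <= t -> is_bracket P W W' t (fun=> c * t).
Hypothesis hbrW : forall t : R, 0 <= t -> is_bracket P W W t (fun=> t).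
Hypothesis hbrW' : forall t : R, 0 <= t -> is_bracket P W' W' t (fun=> t).
Variables (b G b' G' : R -> O -> R) (Cb CG Cb' CG' : R).
Hypotheses (bb : bproc b Cb) (bG : bproc G CG) (bb' : bproc b' Cb') (bG' : bproc G' CG').

(** Drift against martingale: by Fubini the mean is an integral over r of E[B_r S_t], and the
    martingale property replaces S_t by S_r. *)
Lemma cross_itg n (t : R) V (C : R) (hV : standard_brownian P F V) H CH (bH : bproc H CH) B :
 bproc B C -> 0 <= t <= T%:R ->
 itg mu `[0, t] (fun r => \int[P]_w (B r w * SI n H V r w)) /\
 \int[P]_w (tint B t w * SI n H V t w) =
 \iint[P]_(r, w < t) (B r w * SI n H V r w).
Proof.
move=> bB tT; have /andP[t0 tT'] := tT.
have iS : itg P setT (SI n H V t) by apply: (L2_itg measurableT (P_finT P)); exact: SI_L2 bH hV tT.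
have mD := mI `[0, t].
have E r : `[0, t]%classic r -> \int[P]_w (SI n H V t w * B r w) = \int[P]_w (B r w * SI n H V r w).
 rewrite /= in_itv/= => /andP[r0 rt].
 transitivity (\int[P]_w (B r w * SI n H V t w)). by apply: eq_mean => w; rewrite mulrC.
 apply: (SI_mart hF n bH hV r0 rt tT').
 by apply: (bproc_bdd bB); rewrite r0 (le_trans rt).
split; first by apply: (eq_itg mD E); exact: bproc_exp_itg bB iS tT.
transitivity (\int[P]_w (SI n H V t w * tint B t w)). by apply: eq_mean => w; rewrite mulrC.
by rewrite (tint_fubini hF bB iS tT); exact: Rint_ext.
Qed.

Lemma simp_exp_split n (r : R) V (hV : standard_brownian P F V) H CH (bH : bproc H CH) B C B' C'
 (bB : bproc B C) (bB' : bproc B' C') : 0 <= r <= T%:R ->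
 \int[P]_w (B r w * simp n B' H V r w) = \int[P]_w B r w +
  \int[P]_w (B r w * tint B' r w) + \int[P]_w (B r w * SI n H V r w).
Proof.
move=> rT; have i1 := bproc_itg P hF bB rT.
have i2 : itg P setT (fun w => B r w * tint B' r w).
 by apply: L2_mul; [by []|exact: bproc_L2 bB rT|exact: tint_L2 bB' rT].
have i3 : itg P setT (fun w => B r w * SI n H V r w).
 by apply: L2_mul; [by []|exact: bproc_L2 bB rT|exact: SI_L2 bH hV rT].
rewrite -RintegralD// -RintegralD//; last exact: itgD.
by apply: eq_mean => w; rewrite /simp; ring.
Qed.

Lemma tint_exp_mul B (C : R) B' (C' t : R) : bproc B C -> bproc B' C' -> 0 <= t <= T%:R ->
 itg mu `[0, t] (fun r => \int[P]_w (B r w * tint B' r w)) /\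
 \int[P]_w tint (fun r w => B r w * tint B' r w) t w =
 \iint[P]_(r, w < t) (B r w * tint B' r w).
Proof.
move=> bB bB' tT; have [D [bD DE]] := tint_bproc bB'.
have bM := bproc_mul hF bB bD.
have hr r : `[0, t]%classic r -> 0 <= r <= T%:R by rewrite /= in_itv/= => /andP[-> /le_trans->//]; case/andP: tT.
have mD := mI `[0, t].
have i1 : itg P setT (fun=> 1 : R) by exact: itg_cst measurableT (P_finT P) _.
have E r : `[0, t]%classic r -> \int[P]_w (1 * (B r w * D r w)) = \int[P]_w (B r w * tint B' r w).
 by move=> /hr rT; apply: eq_mean => w; rewrite mul1r DE.
split; first by apply: (eq_itg mD E); exact: bproc_exp_itg bM i1 tT.
rewrite -(@Rint_ext _ _ R mu _ _ _ E) -(tint_fubini hF bM i1 tT).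
apply: eq_mean => w; rewrite mul1r; apply: Rint_ext => r /hr rT.
by rewrite DE.
Qed.

Lemma tint_exp B (C t : R) : bproc B C -> 0 <= t <= T%:R ->
 itg mu `[0, t] (fun r => \int[P]_w B r w) /\
 \int[P]_w tint B t w = \iint[P]_(r, w < t) B r w.
Proof.
move=> bB tT.
have mD := mI `[0, t].
have i1 : itg P setT (fun=> 1 : R) by exact: itg_cst measurableT (P_finT P) _.
have E r : `[0, t]%classic r -> \int[P]_w (1 * B r w) = \int[P]_w B r w by move=> _; apply: eq_mean => w; rewrite mul1r.
split; first by apply: (eq_itg mD E); exact: bproc_exp_itg bB i1 tT.
rewrite -(@Rint_ext _ _ R mu _ _ _ E) -(tint_fubini hF bB i1 tT).
by apply: eq_mean => w; rewrite mul1r.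
Qed.

(** After expansion, drift against drift is integration by parts, drift against noise is
    [cross_itg], noise against noise is the isometry, and noise alone has mean zero. Regrouping
    produces the two terms in which one drift multiplies the other full process. *)
Lemma simp_mul n (t : R) : 0 <= t <= T%:R ->
 \int[P]_w (simp n b G W t w * simp n b' G' W' t w) =
 1 + \iint[P]_(r, w < t) (b r w * simp n b' G' W' r w)
  + \iint[P]_(r, w < t) (b' r w * simp n b G W r w)
  + c * \iint[P]_(r, w < t) (G (gfl n r) w * G' (gfl n r) w).
Proof.
move=> tT; have mD := mI `[0, t].
have hr r : `[0, t]%classic r -> 0 <= r <= T%:R by rewrite /= in_itv/= => /andP[-> /le_trans->//]; case/andP: tT.
have [ib Eb] := tint_exp bb tT; have [ib' Eb'] := tint_exp bb' tT.
have [ic Ec] := cross_itg n hW' bG' bb tT; have [ic' Ec'] := cross_itg n hW bG bb' tT.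
have [im Em] := tint_exp_mul bb bb' tT; have [im' Em'] := tint_exp_mul bb' bb tT.
have add3 (f g h k : R -> R) : (forall r, `[0, t]%classic r -> f r = g r + h r + k r) ->
  itg mu `[0, t] g -> itg mu `[0, t] h -> itg mu `[0, t] k ->
  \int[mu]_(r in `[0, t]) f r = \int[mu]_(r in `[0, t]) g r +
   \int[mu]_(r in `[0, t]) h r + \int[mu]_(r in `[0, t]) k r.
 move=> fE ig ih ik; rewrite (@Rint_ext _ _ R mu _ _ _ fE).
 by rewrite (RintegralD mD (itgD mD ig ih) ik) (RintegralD mD ig ih).
have E1 : \iint[P]_(r, w < t) (b r w * simp n b' G' W' r w) =
  \int[P]_w tint b t w + \int[P]_w tint (fun r w => b r w * tint b' r w) t w
  + \int[P]_w (tint b t w * SI n G' W' t w).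
 rewrite Eb Em Ec; apply: (add3 _ _ _ _ _ ib im ic) => r /hr rT.
 exact: (simp_exp_split n hW' bG' bb bb' rT).
have E2 : \iint[P]_(r, w < t) (b' r w * simp n b G W r w) =
  \int[P]_w tint b' t w + \int[P]_w tint (fun r w => b' r w * tint b r w) t w
  + \int[P]_w (tint b' t w * SI n G W t w).
 rewrite Eb' Em' Ec'; apply: (add3 _ _ _ _ _ ib' im' ic') => r /hr rT.
 exact: (simp_exp_split n hW bG bb' bb rT).
rewrite E1 E2 -(SI_isom hF n bG bG' hW hW' hbr tT).
have L1 := tint_L2 bb tT; have L1' := tint_L2 bb' tT.
have LS := SI_L2 hF n bG hW tT; have LS' := SI_L2 hF n bG' hW' tT.
have it X : L2 P setT X -> itg P setT X by move=> h; exact: (L2_itg measurableT (P_finT P) h).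
have im2 X Y : L2 P setT X -> L2 P setT Y -> itg P setT (fun w => X w * Y w) by move=> hX hY; exact: L2_mul.
have tt : \int[P]_w (tint b t w * tint b' t w) = \int[P]_w tint (fun r w => b r w * tint b' r w) t w +
  \int[P]_w tint (fun r w => b' r w * tint b r w) t w.
 have ipr B C B' C' : bproc B C -> bproc B' C' -> itg P setT (tint (fun r w => B r w * tint B' r w) t).
  move=> bB bB'; have [D [bD DE]] := tint_bproc bB'.
  have bM := bproc_mul hF bB bD.
  apply: (eq_itg measurableT _ (it _ (tint_L2 bM tT))) => w _.
  by apply: Rint_ext => r /hr rT; rewrite DE.
 rewrite -(RintegralD measurableT (ipr _ _ _ _ bb bb') (ipr _ _ _ _ bb' bb)).
 apply: eq_mean => w; rewrite /tint Rint_prod//.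
 - by case/andP: tT.
 - exact: bproc_path_itg bb tT.
 - exact: bproc_path_itg bb' tT.
have s0 := SI_mean hF n bG hW tT; have s0' := SI_mean hF n bG' hW' tT.
transitivity (\int[P]_w (1 + tint b t w + tint b' t w + tint b t w * tint b' t w
  + tint b t w * SI n G' W' t w + tint b' t w * SI n G W t w + SI n G W t w + SI n G' W' t w
  + SI n G W t w * SI n G' W' t w)).
 by apply: eq_mean => w; rewrite /simp; ring.
have i0 : itg P setT (fun=> 1 : R) by exact: itg_cst measurableT (P_finT P) _.
have ad (f g : O -> R) : itg P setT f -> itg P setT g ->
  \int[P]_w (f w + g w) = \int[P]_w f w + \int[P]_w g w /\ itg P setT (fun w => f w + g w).
 by move=> hf hg; split; [exact: RintegralD|exact: itgD].
have [e1 j1] := ad _ _ i0 (it _ L1).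
have [e2 j2] := ad _ _ j1 (it _ L1').
have [e3 j3] := ad _ _ j2 (im2 _ _ L1 L1').
have [e4 j4] := ad _ _ j3 (im2 _ _ L1 LS').
have [e5 j5] := ad _ _ j4 (im2 _ _ L1' LS).
have [e6 j6] := ad _ _ j5 (it _ LS).
have [e7 j7] := ad _ _ j6 (it _ LS').
have [e8 j8] := ad _ _ j7 (im2 _ _ LS LS').
rewrite e8 e7 e6 e5 e4 e3 e2 e1.
rewrite Rint_cstP tt s0 s0' !addr0.
exact: nine_sum.
Qed.

End two.
End ito_products.

(** * Real-valued sums over countable types *)

Section countable_sums.
Context (R : realType).
Implicit Types (T : countType).

Definition psum T (f : T -> R) (n : nat) : R := \sum_(k < n) oapp f 0 (pickle_inv k).
Definition ssum T (f : T -> R) : R := limn (psum f).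
Definition sm T (f : T -> R) := exists B : R, forall n, psum (fun i => `|f i|) n <= B.

Lemma eq_psum T (f g : T -> R) n : (forall i, f i = g i) -> psum f n = psum g n.
Proof. by move=> /funext->. Qed.

Lemma psumD T (f g : T -> R) n : psum (fun i => f i + g i) n = psum f n + psum g n.
Proof. by rewrite -big_split; apply: eq_bigr => k _; case: pickle_inv => //=; rewrite addr0. Qed.

Lemma psumZ T c (f : T -> R) n : psum (fun i => c * f i) n = c * psum f n.
Proof. by rewrite mulr_sumr; apply: eq_bigr => k _; case: pickle_inv => //=; rewrite mulr0. Qed.

Lemma psumB T (f g : T -> R) n : psum (fun i => f i - g i) n = psum f n - psum g n.
Proof. by rewrite -sumrB; apply: eq_bigr => k _; case: pickle_inv => //=; rewrite subr0. Qed.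

Lemma psum_swap T T' (f : T -> T' -> R) n m :
 psum (fun i => psum (f i) m) n = psum (fun j => psum (f^~ j) n) m.
Proof.
transitivity (\sum_(k < n) \sum_(l < m)
  oapp (fun i => oapp (f i) 0 (pickle_inv l)) 0 (pickle_inv k)).
 by apply: eq_bigr => k _; case: pickle_inv => //=; rewrite big1.
rewrite exchange_big; apply: eq_bigr => l _; case: (pickle_inv l) => //=.
by apply: big1 => k _; case: pickle_inv.
Qed.

Lemma le_psum T (f g : T -> R) n : (forall i, f i <= g i) -> psum f n <= psum g n.
Proof. by move=> fg; apply: ler_sum => k _; case: pickle_inv => /=. Qed.

Lemma psum_ge0 T (f : T -> R) n : (forall i, 0 <= f i) -> 0 <= psum f n.
Proof. by move=> f0; apply: sumr_ge0 => k _; case: pickle_inv => /=. Qed.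

Lemma psum_homo T (f : T -> R) : (forall i, 0 <= f i) ->
 {homo psum f : m n / (m <= n)%N >-> m <= n}.
Proof.
move=> f0 m n /subnK <-; elim: (n - m)%N => // k IH; rewrite addSn.
by apply: (le_trans IH); rewrite /psum big_ord_recr/= lerDl; case: pickle_inv => /=.
Qed.

Lemma norm_psum T (f : T -> R) n : `|psum f n| <= psum (fun i => `|f i|) n.
Proof.
apply: le_trans (ler_norm_sum _ _ _) _.
by apply: ler_sum => k _; case: pickle_inv => //=; rewrite normr0.
Qed.

Lemma cvg_psum I (F : set_system I) {FF : Filter F} T (h : I -> T -> R) f n :
 (forall i, h k i @[k --> F] --> f i) -> psum (h k) n @[k --> F] --> psum f n.
Proof.
move=> hf; elim: n => [|n IH]. by rewrite /psum big_ord0; under eq_fun do rewrite big_ord0; exact: cvg_cst.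
rewrite /psum big_ord_recr; under eq_fun do rewrite big_ord_recr/=.
apply: cvgD; first exact: IH.
by case: pickle_inv => [i|] /=; [exact: hf|exact: cvg_cst].
Qed.

Lemma psum1 T (f : T -> R) y n : (forall x, x != y -> f x = 0) -> (pickle y < n)%N -> psum f n = f y.
Proof.
move=> fy yn; rewrite /psum (bigD1 (Ordinal yn))//= pickleK_inv/= big1 ?addr0// => k kn.
case E : (pickle_inv k) => [x|//]/=; apply: fy; apply: contraNneq kn => xy.
by apply/eqP/val_inj => /=; rewrite -xy; have := @pickle_invK T k; rewrite /ocancel E.
Qed.

Lemma eq_sm T (f g : T -> R) : (forall i, f i = g i) -> sm f -> sm g.
Proof. by move=> /funext->. Qed.

Lemma sm_dom T (f g : T -> R) : sm g -> (forall i, `|f i| <= `|g i|) -> sm f.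
Proof.
by move=> [B gB] fg; exists B => n; apply: le_trans (gB n); exact: le_psum.
Qed.

Lemma smD T (f g : T -> R) : sm f -> sm g -> sm (fun i => f i + g i).
Proof.
move=> [B fB] [C gC]; exists (B + C) => n.
apply: (@le_trans _ _ (psum (fun i => `|f i| + `|g i|) n)). by apply: le_psum => i; exact: ler_normD.
by rewrite psumD lerD.
Qed.

Lemma smZ T c (f : T -> R) : sm f -> sm (fun i => c * f i).
Proof.
move=> [B fB]; exists (`|c| * B) => n.
by rewrite (eq_psum (g := fun i => `|c| * `|f i|)) ?psumZ ?ler_wpM2l// => i; rewrite normrM.
Qed.

Lemma smZr T c (f : T -> R) : sm f -> sm (fun i => f i * c).
Proof. by move=> sf; apply: (eq_sm _ (smZ c sf)) => i; rewrite mulrC. Qed.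

Lemma smB T (f g : T -> R) : sm f -> sm g -> sm (fun i => f i - g i).
Proof.
by move=> sf sg; apply: (eq_sm _ (smD sf (smZ (-1) sg))) => i; rewrite mulN1r.
Qed.

Lemma sm_norm T (f : T -> R) : sm f -> sm (fun i => `|f i|).
Proof. by move=> sf; apply: (sm_dom sf) => i; rewrite normr_id. Qed.

Lemma ge0_sm T (f : T -> R) (B : R) : (forall i, 0 <= f i) ->
 (forall n, psum f n <= B) -> sm f.
Proof.
by move=> f0 fB; exists B => n; rewrite (eq_psum (g := f))// => i; rewrite ger0_norm.
Qed.

Lemma ge0_psum_cvg T (f : T -> R) : (forall i, 0 <= f i) -> sm f ->
 psum f n @[n --> \oo] --> ssum f.
Proof.
move=> f0 [B fB]; apply: nondecreasing_is_cvgn; first exact: psum_homo.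
by exists B => _ [n _ <-]; apply: le_trans (fB n); apply: le_psum => i; exact: ler_norm.
Qed.

Lemma psum_cvg T (f : T -> R) : sm f -> psum f n @[n --> \oo] --> ssum f.
Proof.
move=> sf; apply/cvgP; apply: cvgP.
have c1 : psum (fun i => f i + `|f i|) n @[n --> \oo] --> ssum (fun i => f i + `|f i|).
 apply: ge0_psum_cvg => [i|]; last exact/smD/sm_norm.
 by rewrite addrC -lerBlDr sub0r -normrN ler_norm.
have c2 := ge0_psum_cvg (fun i => normr_ge0 (f i)) (sm_norm sf).
rewrite (_ : psum f = (fun n => psum (fun i => f i + `|f i|) n - psum (fun i => `|f i|) n)). exact: cvgB c1 c2.
by apply/funext => n; rewrite -psumB (eq_psum (g := f))// => i; rewrite addrK.
Qed.

Lemma ssum_uniq T (f : T -> R) l : sm f -> psum f n @[n --> \oo] --> l -> ssum f = l.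
Proof. by move=> sf; apply: cvg_uniq (psum_cvg sf). Qed.

Lemma ssumD T (f g : T -> R) : sm f -> sm g ->
 ssum (fun i => f i + g i) = ssum f + ssum g.
Proof.
move=> sf sg; apply: ssum_uniq; first exact: smD.
under eq_fun do rewrite psumD; exact: cvgD (psum_cvg sf) (psum_cvg sg).
Qed.

Lemma ssumB T (f g : T -> R) : sm f -> sm g ->
 ssum (fun i => f i - g i) = ssum f - ssum g.
Proof.
move=> sf sg; apply: ssum_uniq; first exact: smB.
under eq_fun do rewrite psumB; exact: cvgB (psum_cvg sf) (psum_cvg sg).
Qed.

Lemma ssumZ T c (f : T -> R) : sm f -> ssum (fun i => c * f i) = c * ssum f.
Proof.
move=> sf; apply: ssum_uniq; first exact: smZ.
by under eq_fun do rewrite psumZ; apply: cvgMl_tmp; exact: psum_cvg.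
Qed.

Lemma ssum_ge0 T (f : T -> R) : sm f -> (forall i, 0 <= f i) -> 0 <= ssum f.
Proof.
by move=> sf f0; apply: (cvg_to_ge _ (psum_cvg sf)); apply: nearW => n; exact: psum_ge0.
Qed.

Lemma le_ssum T (f g : T -> R) : sm f -> sm g -> (forall i, f i <= g i) ->
 ssum f <= ssum g.
Proof.
move=> sf sg fg; rewrite -subr_ge0 -ssumB//; apply: ssum_ge0; first exact: smB.
by move=> i; rewrite subr_ge0.
Qed.

Lemma ssum_le T (f : T -> R) (B : R) : sm f -> (forall n, psum f n <= B) -> ssum f <= B.
Proof. by move=> sf fB; apply: (cvg_to_le _ (psum_cvg sf)); exact: nearW. Qed.

Lemma norm_ssum T (f : T -> R) : sm f -> `|ssum f| <= ssum (fun i => `|f i|).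
Proof.
move=> sf; have sn := sm_norm sf; rewrite ler_norml; apply/andP; split; last first.
 by apply: le_ssum => // i; exact: ler_norm.
rewrite -mulN1r -ssumZ//; apply: le_ssum => //; first exact: smZ.
by move=> i; rewrite mulN1r lerNl -normrN ler_norm.
Qed.

Lemma psum_le_ssum T (f : T -> R) n : (forall i, 0 <= f i) -> sm f -> psum f n <= ssum f.
Proof.
move=> f0 sf; apply: (cvg_to_ge _ (psum_cvg sf)); exists n => // m /= nm.
exact: psum_homo.
Qed.

Lemma le_psum1 T (f : T -> R) i : (forall i, 0 <= f i) -> f i <= psum f (pickle i).+1.
Proof.
by move=> f0; rewrite /psum big_ord_recr/= pickleK_inv/= lerDr; exact: psum_ge0.
Qed.

Lemma le_ssum1 T (f : T -> R) i : (forall i, 0 <= f i) -> sm f -> f i <= ssum f.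
Proof. by move=> f0 sf; exact: le_trans (le_psum1 i f0) (psum_le_ssum _ f0 sf). Qed.

Lemma eq_ssum T (f g : T -> R) : (forall i, f i = g i) -> ssum f = ssum g.
Proof. by move=> /funext->. Qed.

Lemma sm_sum T I (s : seq I) (h : I -> T -> R) : (forall i, sm (h i)) ->
 sm (fun x => \sum_(i <- s) h i x).
Proof.
move=> sh; elim: s => [|i s IH].
 by exists 0 => n; apply: le_trans (lexx 0); apply: sumr_le0 => k _; case: pickle_inv => //= x; rewrite big_nil normr0.
by apply: (eq_sm _ (smD (sh i) IH)) => x; rewrite big_cons.
Qed.

Lemma sm0 T : sm (fun _ : T => 0).
Proof. by apply: (@ge0_sm _ _ 0) => // n; apply: sumr_le0 => k _; case: pickle_inv. Qed.

Lemma ssum0 T : ssum (fun _ : T => 0) = 0.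
Proof.
have h := @ssumZ T 0 _ (sm0 T).
by rewrite !mul0r in h.
Qed.

Lemma ssum_sum T I (s : seq I) (h : I -> T -> R) : (forall i, sm (h i)) ->
 ssum (fun x => \sum_(i <- s) h i x) = \sum_(i <- s) ssum (h i).
Proof.
move=> sh; elim: s => [|i s IH]. by rewrite big_nil -[RHS](ssum0 T); apply: eq_ssum => x; rewrite big_nil.
rewrite big_cons -IH -ssumD//; last exact: sm_sum.
by apply: eq_ssum => x; rewrite big_cons.
Qed.

Lemma psum_ssum T T' (f : T -> T' -> R) n : (forall i, sm (f i)) ->
 sm (fun j => psum (f^~ j) n) /\
 psum (fun i => ssum (f i)) n = ssum (fun j => psum (f^~ j) n).
Proof.
move=> sf; pose h (k : 'I_n) j := oapp (f^~ j) 0 (pickle_inv k).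
have sh k : sm (h k) by rewrite /h; case: pickle_inv => /=; [exact: sf|exact: sm0].
split; first exact: sm_sum.
rewrite (ssum_sum _ sh); apply: eq_bigr => k _; rewrite /h.
by case: pickle_inv => //=; rewrite ssum0.
Qed.

Lemma ssum_swap_le T T' (f : T -> T' -> R) : (forall i j, 0 <= f i j) ->
 (forall i, sm (f i)) -> sm (fun i => ssum (f i)) ->
 [/\ forall j, sm (f^~ j), sm (fun j => ssum (f^~ j))
  & ssum (fun j => ssum (f^~ j)) <= ssum (fun i => ssum (f i))].
Proof.
move=> f0 sf sF; have F0 i : 0 <= ssum (f i) by exact: ssum_ge0.
have sj j : sm (f^~ j). apply: (sm_dom sF) => i; rewrite !ger0_norm//; exact: le_ssum1.
have F0' j : 0 <= ssum (f^~ j) by exact: ssum_ge0.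
have h m : psum (fun j => ssum (f^~ j)) m <= ssum (fun i => ssum (f i)).
 have [s1 ->] := psum_ssum m sj; apply: le_ssum => // i.
 exact: psum_le_ssum.
have sF' := ge0_sm F0' h; split => //; exact: ssum_le.
Qed.

(** The inequality of [ssum_swap_le], for the family and for its transpose. *)
Lemma ssum_swap T T' (f : T -> T' -> R) : (forall i j, 0 <= f i j) ->
 (forall i, sm (f i)) -> sm (fun i => ssum (f i)) ->
 [/\ forall j, sm (f^~ j), sm (fun j => ssum (f^~ j))
  & ssum (fun j => ssum (f^~ j)) = ssum (fun i => ssum (f i))].
Proof.
move=> f0 sf sF; have [h1 h2 h3] := ssum_swap_le f0 sf sF; split => //.
apply/eqP; rewrite eq_le h3/=.
by have [] := @ssum_swap_le _ _ (fun j i => f i j) (fun j i => f0 i j) h1 h2.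
Qed.

Lemma esum_psum T (f : T -> R) : (forall i, 0 <= f i) ->
 (\esum_(i in [set: T]) (f i)%:E = limn (fun n => (psum f n)%:E))%E.
Proof.
move=> f0; pose F k : \bar R := (oapp f 0 (pickle_inv k))%:E.
have F0 k : (0 <= F k)%E by rewrite lee_fin; case: pickle_inv => /=.
transitivity (\esum_(k in [set: nat]) F k)%E.
 transitivity (\esum_(i in [set: T]) F (pickle i))%E. by apply: eq_esum => i _; rewrite /F pickleK_inv.
 rewrite -(@esum_image _ _ _ setT (@pickle T)); last by move=> x y _ _; exact: (pcan_inj pickleK).
 rewrite esum_mkcond; apply: eq_esum => k _; case: ifPn => // /negP hk.
 rewrite /F; case E : pickle_inv => [x|//]; exfalso; apply: hk; apply/mem_set.
 by exists x => //; have := @pickle_invK T k; rewrite /ocancel E.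
rewrite -nneseries_esumT//; congr (limn _); apply/funext => n.
by rewrite /psum big_mkord sumEFin.
Qed.

Lemma esum_ssum T (f : T -> R) : (forall i, 0 <= f i) -> sm f ->
 (\esum_(i in [set: T]) (f i)%:E = (ssum f)%:E)%E.
Proof.
move=> f0 sf; rewrite esum_psum//; apply/cvg_lim => //.
by apply: cvg_EFin; [exact: nearW|exact: psum_cvg].
Qed.

Lemma esum_sm T (f : T -> R) : (forall i, 0 <= f i) ->
 (\esum_(i in [set: T]) (f i)%:E < +oo)%E -> sm f.
Proof.
move=> f0 fy.
have nd : nondecreasing_seq (fun n => (psum f n)%:E) by move=> a b ab; rewrite lee_fin; exact: psum_homo.
have E := esum_psum f0; rewrite E in fy.
have fin : limn (fun n => (psum f n)%:E) \is a fin_num.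
 rewrite ge0_fin_numE//; apply: lime_ge; first exact: ereal_nondecreasing_is_cvgn.
 by apply: nearW => n; rewrite lee_fin; exact: psum_ge0.
apply: (@ge0_sm _ _ (fine (limn (fun n => (psum f n)%:E)))) => // n.
rewrite -lee_fin fineK//; rewrite (cvg_lim _ (ereal_nondecreasing_cvgn nd))//.
by apply: ereal_sup_ubound; exists n.
Qed.

Lemma ssum_reindex T (e : T -> T) (f : T -> R) : bijective e -> (forall i, 0 <= f i) ->
 sm f -> sm (fun i => f (e i)) /\ ssum (fun i => f (e i)) = ssum f.
Proof.
move=> be f0 sf; have E := esum_ssum f0 sf.
have E2 : (\esum_(i in [set: T]) (f (e i))%:E = (ssum f)%:E)%E.
 rewrite -E [RHS](@reindex_esum _ _ _ setT setT e)//.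
 by have [g c1 c2] := be; split => // [x y _ _|y _]; [exact: (can_inj c1)|exists (g y)].
have s2 : sm (fun i => f (e i)) by apply: esum_sm => //; rewrite E2 ltry.
split => //; have := esum_ssum (fun i => f0 (e i)) s2; rewrite E2 => -[]//.
Qed.

End countable_sums.

Local Notation "'\S2_' ( i , j '<' L ) F" := (psum (fun i => psum (fun j => F) L) L)
 (at level 41, i name, j name, F at level 41).

(** * Gronwall by iterated exponential bounds *)

Section exponential_gronwall.
Context (R : realType).
Local Notation mu := (@lebesgue_measure R).

Lemma exp_itg (c t : R) : itg mu `[0, t] (fun s => expR (c * s)).
Proof.
apply: continuous_compact_integrable; first exact: segment_compact.
apply: continuous_subspaceT => x; apply: continuous_comp; last exact: continuous_expR.
by apply: cvgMl_tmp; exact: cvg_id.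
Qed.

Lemma Rint_exp (c t : R) : 0 <= t -> c * \int[mu]_(s in `[0, t]) expR (c * s) = expR (c * t) - 1.
Proof.
rewrite le_eqVlt => /predU1P[<-|t0]. by rewrite set_itv1 Rintegral_set1 !mulr0 expR0 subrr.
have dF (x : R) : is_derive x 1 (fun s : R => expR (c * s)) (c * expR (c * x)).
 have h1 : is_derive (c * x) 1 expR (expR (c * x)) by exact: is_derive_expR.
 have h2 : is_derive x 1 (fun s : R => c * s) c.
  by rewrite -[X in is_derive _ _ _ X]mulr1; exact: (@is_deriveZ R R R id c x 1 1 (is_derive_id x 1)).
 by rewrite mulrC; exact: (@is_derive1_comp _ _ _ _ _ _ h1 h2).
rewrite -(RintegralZl (mu := mu)); [|exact: measurable_itv|exact: exp_itg].
rewrite /Rintegral (@continuous_FTC2 _ _ (fun s => expR (c * s)) _ _ t0).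
- by rewrite /= mulr0 expR0.
- apply: continuous_subspaceT => x; apply: cvgMl_tmp.
 apply: continuous_comp; last exact: continuous_expR.
 by apply: cvgMl_tmp; exact: cvg_id.
- have cE (x : R) : {for x, continuous (fun s : R => expR (c * s))}.
  by apply: continuous_comp; [apply: cvgMl_tmp; exact: cvg_id|exact: continuous_expR].
 split => //.
 + by apply: cvg_at_right_filter; exact: cE.
 + by apply: cvg_at_left_filter; exact: cE.
- by move=> x _; rewrite derive1E; have [] := dF x.
Qed.

(* The hypothesis says that bounds of the form [S e^(ct)] improve; iterating it halves [S] each time. *)
Lemma gronwall_iter (q : R -> R -> Prop) (A B c T : R) : 0 <= A -> 0 <= c -> 0 <= T ->
 (forall t S S', q t S -> S <= S' -> q t S') ->
 (forall t, 0 <= t <= T -> q t B) ->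
 (forall S, 0 <= S -> (forall t, 0 <= t <= T -> q t (S * expR (c * t))) ->
   forall t, 0 <= t <= T -> q t (A + S / 2 * expR (c * t))) ->
 forall t, 0 <= t <= T -> forall e, 0 < e -> q t ((2 * A + e) * expR (c * t)).
Proof.
move=> A0 c0 T0 qm qB H t tT e e0.
have e1 (s : R) : 0 <= s -> 1 <= expR (c * s) by move=> s0; rewrite -expR0 ler_expR mulr_ge0.
have E k : forall t, 0 <= t <= T -> q t ((2 * A + `|B| / 2 ^+ k) * expR (c * t)).
 elim: k => [|k IH] s sT; have s1 := e1 s (proj1 (andP sT)).
  apply: (qm _ B); first exact: qB.
  rewrite expr0 divr1; apply: (le_trans (ler_norm _)).
  by have := normr_ge0 B; move: (`|B|) => b b0; nra.
 apply: qm (H _ _ IH s sT) _. by rewrite addr_ge0 ?mulr_ge0 ?divr_ge0 ?exprn_ge0.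
 have E : `|B| / 2 ^+ k / 2 = `|B| / 2 ^+ k.+1 by rewrite exprSr invfM mulrA.
 rewrite -E; move: (`|B| / 2 ^+ k) s1 => b; move: (expR _) => x s1.
 nra.
have [k hk] : exists k, `|B| / 2 ^+ k <= e.
 have : `|B| * 2 ^- n @[n --> \oo] --> `|B| * 0 by apply: cvgMl_tmp; exact: cvg_exp2V.
 rewrite mulr0 => /cvgrPdist_le/(_ _ e0)[k _ /(_ k (leqnn k))].
 by rewrite sub0r normrN => h; exists k; exact: le_trans (ler_norm _) h.
by apply: qm (E k t tT) _; rewrite ler_wpM2r ?expR_ge0// lerD2l.
Qed.

(** With exponent 2C, integrating C S exp(2Cs) returns at most half of S exp(2Ct); this is the
    improvement that [gronwall_iter] iterates. *)
Lemma gronwall_Rint (y : R -> R) (A B C T : R) : 0 <= A -> 0 < C -> 0 <= T ->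
 (forall t, 0 <= t <= T -> y t <= B) ->
 itg mu `[0, T] y ->
 (forall t, 0 <= t <= T -> y t <= A + C * \int[mu]_(s in `[0, t]) y s) ->
 forall t, 0 <= t <= T -> y t <= 2 * A * expR (2 * C * t).
Proof.
move=> A0 C0 T0 yB iy H t tT; apply/ler_addgt0Pr => e e0.
have C2 : 0 < 2 * C by rewrite mulr_gt0.
have E := expR_gt0 (2 * C * t).
have := @gronwall_iter (fun t S => y t <= S) A B (2 * C) T A0 (ltW C2) T0 _ yB _ t tT (e / expR (2 * C * t)) _.
rewrite (_ : _ * expR _ = 2 * A * expR (2 * C * t) + e); last by field; rewrite gt_eqF.
apply; [by move=> ? ? ? ?; exact: le_trans| |exact: divr_gt0].
move=> S S0 hS s sT; apply: (le_trans (H s sT)); rewrite lerD2l.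
have /andP[s0 sT'] := sT.
have iy' : itg mu `[0, s] y.
 apply: itgS iy => //.
 by move=> x /=; rewrite !in_itv/= => /andP[-> /le_trans->].
apply: (@le_trans _ _ (C * \int[mu]_(r in `[0, s]) (S * expR (2 * C * r)))).
 rewrite ler_pM2l//; apply: le_Rintegral => //. by apply: itgZ => //; exact: exp_itg.
 move=> r /=; rewrite in_itv/= => /andP[r0 rs]; apply: hS.
 by rewrite r0 (le_trans rs).
rewrite RintegralZl//; last exact: exp_itg.
have := Rint_exp (2 * C) s0; move: (\int[_]_(_ in _) _) => I h.
have -> : C * (S * I) = S / 2 * (2 * C * I) by field.
rewrite h mulrBr mulr1.
by rewrite gerBl divr_ge0.
Qed.

End exponential_gronwall.

(** * The weighted state space and the migration operator *)

Section state_space_facts.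
Context (R : realType) (S : countType) (a : S -> S -> R) (om : S -> R).
Variable K : R.
Hypotheses (om0 : forall i, 0 < om i) (a0 : forall i j, 0 <= a i j) (K0 : 0 <= K).
Hypothesis hK : forall n j, psum (fun i => om i * a i j) n <= K * om j.
Implicit Types x y : S -> R.

Definition Tm x i := ssum (fun j => a i j * x j).
Definition nrm x := ssum (fun j => om j * x j).
Definition in_space x := (forall i, 0 <= x i) /\ sm (fun j => om j * x j).

Let omw i : 0 <= om i := ltW (om0 i).
Let Kom i : 0 <= K / om i.
Proof. by rewrite divr_ge0. Qed.

(** A single summand of the column bound [hK]. It dominates each row of rates by the weight and so
    makes the migration sum converge at every state. *)
Lemma rate_le i j : a i j <= K / om i * om j.
Proof.
rewrite mulrAC ler_pdivlMr// mulrC; apply: le_trans (hK (pickle i).+1 j).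
by apply: (le_psum1 (f := fun i => om i * a i j)) => k; rewrite mulr_ge0.
Qed.

Lemma a_sm x i : in_space x -> sm (fun j => a i j * x j).
Proof.
move=> [x0 sx]; apply: (sm_dom (smZ (K / om i) sx)) => j.
rewrite !ger0_norm ?mulr_ge0//; last by rewrite invr_ge0.
by rewrite mulrA ler_wpM2r// rate_le.
Qed.

Lemma nrm_ge0 x : in_space x -> 0 <= nrm x.
Proof. by move=> [x0 sx]; apply: ssum_ge0 => // i; rewrite mulr_ge0. Qed.

Lemma Tm_ge0 x i : in_space x -> 0 <= Tm x i.
Proof. by move=> xE; apply: ssum_ge0 => [|j]; [exact: a_sm|case: xE => x0 _; rewrite mulr_ge0]. Qed.

Lemma coord_le x i : in_space x -> x i <= (om i)^-1 * nrm x.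
Proof.
move=> [x0 sx]; rewrite mulrC ler_pdivlMr// mulrC.
by apply: (le_ssum1 (f := fun i => om i * x i)) => // j; rewrite mulr_ge0.
Qed.

Lemma Tm_le x i : in_space x -> Tm x i <= K / om i * nrm x.
Proof.
move=> xE; have [x0 sx] := xE; rewrite /nrm -(ssumZ _ sx); apply: le_ssum.
- exact: a_sm.
- exact: smZ.
- by move=> j; rewrite mulrA ler_wpM2r// rate_le.
Qed.

(** Summing over [i] before [j] brings in the column bound: migration has norm at most [K] on the
    weighted space. *)
Lemma psum_Tm x n : in_space x -> psum (fun i => om i * Tm x i) n <= K * nrm x.
Proof.
move=> xE; have [x0 sx] := xE.
have sf i : sm (fun j => om i * (a i j * x j)) by apply: smZ; exact: a_sm.
rewrite (eq_psum (g := fun i => ssum (fun j => om i * (a i j * x j)))); last first.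
 by move=> i; rewrite /Tm -(ssumZ _ (a_sm i xE)).
have [s1 ->] := psum_ssum n sf; rewrite /nrm -(ssumZ _ sx); apply: le_ssum => //; first exact: smZ.
move=> j; rewrite (eq_psum (g := fun i => x j * (om i * a i j))); last by move=> i; ring.
rewrite psumZ (_ : K * _ = x j * (K * om j)); last by ring.
exact: ler_wpM2l.
Qed.

Lemma psum_nrm x n : in_space x -> psum (fun i => om i * x i) n <= nrm x.
Proof. by move=> [x0 sx]; apply: psum_le_ssum => // i; rewrite mulr_ge0. Qed.

Definition edist x y := ssum (fun j => `|x j - y j| * om j).

Lemma edist_sm x y : in_space x -> in_space y -> sm (fun j => `|x j - y j| * om j).
Proof.
move=> [x0 sx] [y0 sy]; apply: (sm_dom (smB sx sy)) => j.
by rewrite -mulrBr !normrM normr_id mulrC.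
Qed.

Lemma nrm_lip x y : in_space x -> in_space y -> `|nrm x - nrm y| <= edist x y.
Proof.
move=> xE yE; have [x0 sx] := xE; have [y0 sy] := yE; rewrite /nrm -(ssumB sx sy).
apply: le_trans (norm_ssum _) _; first exact: smB.
apply: le_ssum; [exact/sm_norm/smB|exact: edist_sm|] => j.
by rewrite -mulrBr normrM mulrC (ger0_norm (omw j)).
Qed.

Lemma coord_lip x y i : in_space x -> in_space y -> `|x i - y i| <= (om i)^-1 * edist x y.
Proof.
move=> xE yE; rewrite mulrC ler_pdivlMr//.
apply: (le_ssum1 (f := fun i => `|x i - y i| * om i)); last exact: edist_sm.
by move=> j; rewrite mulr_ge0.
Qed.

Lemma Tm_lip x y i : in_space x -> in_space y -> `|Tm x i - Tm y i| <= K / om i * edist x y.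
Proof.
move=> xE yE; have s1 := a_sm i xE; have s2 := a_sm i yE; rewrite /Tm -(ssumB s1 s2).
apply: le_trans (norm_ssum _) _; first exact: smB.
have se := edist_sm xE yE.
rewrite /edist -(ssumZ _ se); apply: le_ssum; [exact/sm_norm/smB|exact: smZ|] => j.
rewrite -mulrBr normrM (ger0_norm (a0 i j)) [`|_| * om j]mulrC mulrA ler_wpM2r//.
exact: rate_le.
Qed.

Lemma gfl_within (t : R) : 0 <= t -> gfl n t @[n --> \oo] --> within [set s | 0 <= s] (nbhs t).
Proof.
move=> t0 A; rewrite /within/= => hA.
have := gfl_cvg t0 hA; rewrite /= /nbhs/= => -[N _ hN].
by exists N => // n /hN; apply; exact: gfl_ge0.
Qed.

Section path.
Variable f : R -> S -> R.
Hypotheses (fE : forall t, 0 <= t -> in_space (f t)).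
Hypothesis fc : forall t : R, 0 <= t ->
 edist (f s) (f t) @[s --> within [set s | 0 <= s] (nbhs t)] --> (0 : R).

Lemma path_dist_cvg (g : (S -> R) -> R) (C t : R) : 0 <= t -> 0 <= C ->
 (forall x y, in_space x -> in_space y -> `|g x - g y| <= C * edist x y) ->
 g (f s) @[s --> within [set s | 0 <= s] (nbhs t)] --> g (f t).
Proof.
move=> t0 C0 gC; apply/cvgrPdist_le => e e0.
have /cvgrPdist_le := fc t0 => /(_ (e / (C + 1))).
rewrite divr_gt0 ?ltr_wpDl// => /(_ isT) h.
have h0 : within [set s : R | 0 <= s] (nbhs t) [set s : R | 0 <= s] by exact: withinT.
apply: filterS2 h h0 => s; rewrite sub0r normrN => hs' s0.
rewrite distrC; apply: le_trans (gC _ _ (fE s0) (fE t0)) _.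
have e1 : edist (f s) (f t) <= e / (C + 1) by exact: le_trans (ler_norm _) hs'.
apply: (le_trans (ler_wpM2l C0 e1)).
rewrite mulrA ler_pdivrMr ?ltr_wpDl// mulrC ler_wpM2l//; last by rewrite lerDl.
exact: ltW.
Qed.

Lemma path_gfl (g : (S -> R) -> R) (C t : R) : 0 <= t -> 0 <= C ->
 (forall x y, in_space x -> in_space y -> `|g x - g y| <= C * edist x y) ->
 g (f (gfl n t)) @[n --> \oo] --> g (f t).
Proof.
move=> t0 C0 gC; exact: (cvg_comp _ _ (gfl_within t0) (path_dist_cvg t0 C0 gC)).
Qed.

Lemma nrm_gfl (t : R) : 0 <= t -> nrm (f (gfl n t)) @[n --> \oo] --> nrm (f t).
Proof.
by move=> t0; apply: (path_gfl t0 ler01) => x y xE yE; rewrite mul1r; exact: nrm_lip.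
Qed.

Lemma coord_gfl (t : R) i : 0 <= t -> f (gfl n t) i @[n --> \oo] --> f t i.
Proof.
move=> t0; apply: (path_gfl (g := fun x => x i) (C := (om i)^-1) t0). by rewrite invr_ge0.
by move=> x y xE yE; exact: coord_lip.
Qed.

Lemma Tm_gfl (t : R) i : 0 <= t -> Tm (f (gfl n t)) i @[n --> \oo] --> Tm (f t) i.
Proof.
move=> t0; apply: (path_gfl (g := fun x => Tm x i) (C := K / om i) t0 (Kom i)).
by move=> x y xE yE; exact: Tm_lip.
Qed.

Lemma nrm_bounded (t : R) : 0 <= t -> exists B, forall s, 0 <= s <= t -> nrm (f s) <= B.
Proof.
move=> t0; have c : {within `[0, t], continuous (fun s => nrm (f s))}.
 apply/subspace_continuousP => x; rewrite /= in_itv/= => /andP[x0 _].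
 have h : nrm (f s) @[s --> within [set s | 0 <= s] (nbhs x)] --> nrm (f x).
  by apply: (path_dist_cvg x0 ler01) => y z yE zE; rewrite mul1r; exact: nrm_lip.
 apply: cvg_trans h; apply: cvg_app; apply: within_subset.
 by move=> s /=; rewrite in_itv/= => /andP[].
have [m _ hm] := EVT_max t0 c.
by exists (nrm (f m)) => s st; apply: hm; rewrite in_itv.
Qed.

End path.
End state_space_facts.

(** * Truncation of the coefficients *)

Section stopped_model.
Context disp (O : measurableType disp) (R : realType) (P : probability O R).
Context (S : countType) (a : S -> S -> R) (om : S -> R) (K kap : R).
Hypotheses (om0 : forall i, 0 < om i) (a0 : forall i j, 0 <= a i j) (K0 : 0 <= K).
Hypothesis hK : forall n j, psum (fun i => om i * a i j) n <= K * om j.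
Hypothesis kap0 : 0 <= kap.
Variables (F : R -> set (set O)) (x : 'I_2 -> R -> O -> S -> R).
Hypothesis hF : filtration F.
Hypothesis xE : forall n (t : R) w, 0 <= t -> in_space om (x n t w).
Hypothesis xc : forall n w (t : R), 0 <= t ->
 edist om (x n s w) (x n t w) @[s --> within [set s | 0 <= s] (nbhs t)] --> (0 : R).
Hypothesis xF : forall n i (t : R), 0 <= t -> sub_meas (F t) (fun w => x n t w i).
Local Notation mu := (@lebesgue_measure R).
Local Notation Tm := (Tm a).
Local Notation nrm := (nrm om).

Let sF (t : R) : 0 <= t -> sigma_algebra [set: O] (F t).
Proof. by case: hF => h _ _; exact: h. Qed.

Definition aproc (H : R -> O -> R) :=
 (forall t, 0 <= t -> sub_meas (F t) (H t)) /\ forall w, dyadic_cont (H^~ w).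

Lemma aproc_cst (c : R) : aproc (fun _ _ => c).
Proof. by split=> [t t0|w r r0]; [exact: filt_cst|exact: cvg_cst]. Qed.

Lemma aprocD H H' : aproc H -> aproc H' -> aproc (fun t w => H t w + H' t w).
Proof.
move=> [h1 h2] [h3 h4]; split=> [t t0|w r r0]. by apply: (sub_measD (sF t0)); [exact: h1|exact: h3].
by apply: cvgD; [exact: h2|exact: h4].
Qed.

Lemma aprocB H H' : aproc H -> aproc H' -> aproc (fun t w => H t w - H' t w).
Proof.
move=> [h1 h2] [h3 h4]; split=> [t t0|w r r0]. by apply: (sub_measB (sF t0)); [exact: h1|exact: h3].
by apply: cvgB; [exact: h2|exact: h4].
Qed.

Lemma aprocM H H' : aproc H -> aproc H' -> aproc (fun t w => H t w * H' t w).
Proof.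
move=> [h1 h2] [h3 h4]; split=> [t t0|w r r0]. by apply: (sub_measM (sF t0)); [exact: h1|exact: h3].
by apply: cvgM; [exact: h2|exact: h4].
Qed.

Lemma aproc_sqrt H : aproc H -> aproc (fun t w => Num.sqrt (H t w)).
Proof.
move=> [h1 h2]; split=> [t t0|w r r0].
 apply: (sub_meas_comp (sF t0)); last exact: h1.
 by apply: continuous_measurable_fun; exact: sqrt_continuous.
exact: (cvg_comp _ _ (h2 w r r0) (@sqrt_continuous R (H r w))).
Qed.

Lemma aproc_x n i : aproc (fun t w => x n t w i).
Proof.
split=> [t|w r r0]; first exact: xF.
by apply: (coord_gfl om0 (fun t => xE n w (t := t)) (xc n w)).
Qed.

Lemma sub_meas_psum t (f : O -> S -> R) n : 0 <= t -> (forall i, sub_meas (F t) (f^~ i)) ->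
 sub_meas (F t) (fun w => psum (f w) n).
Proof.
move=> t0 h; apply: (sub_meas_sum (sF t0)) => k _.
by case: pickle_inv => [i|]; [exact: h|exact: filt_cst].
Qed.

Lemma sub_meas_ssum t (f : O -> S -> R) : 0 <= t -> (forall w, sm (f w)) ->
 (forall i, sub_meas (F t) (f^~ i)) -> sub_meas (F t) (fun w => ssum (f w)).
Proof.
move=> t0 sf h; apply: (sub_meas_cvg (sF t0) (Zn := fun n w => psum (f w) n)).
 by move=> n; exact: sub_meas_psum.
by move=> w; exact: psum_cvg.
Qed.

Lemma aproc_nrm n : aproc (fun t w => nrm (x n t w)).
Proof.
split=> [t t0|w r r0]; last by apply: (nrm_gfl om0 (fun t => xE n w (t := t)) (xc n w)).
apply: (sub_meas_ssum t0) => [w|i]; first by case: (xE n w t0).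
by apply: (sub_measM (sF t0)); [exact: filt_cst|exact: xF].
Qed.

Lemma aproc_Tm n i : aproc (fun t w => Tm (x n t w) i).
Proof.
split=> [t t0|w r r0]; last by apply: (Tm_gfl om0 a0 K0 hK (fun t => xE n w (t := t)) (xc n w)).
apply: (sub_meas_ssum t0) => [w|j]; first by apply: (a_sm om0 a0 K0 hK); exact: xE.
by apply: (sub_measM (sF t0)); [exact: filt_cst|exact: xF].
Qed.

Definition Yt t w := nrm (x ord0 t w) + nrm (x ord_max t w).

Lemma aproc_Y : aproc Yt.
Proof. exact: aprocD (aproc_nrm _) (aproc_nrm _). Qed.

Lemma nrm_Y n (t : R) w : 0 <= t -> nrm (x n t w) <= Yt t w.
Proof.
move=> t0; have h m : 0 <= nrm (x m t w) by apply: nrm_ge0 => //; exact: xE.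
rewrite /Yt; have [->|->] : n = ord0 \/ n = ord_max.
- by case: n => [[|[|//]] hn]; [left|right]; exact: val_inj.
- by rewrite lerDl.
- by rewrite lerDr.
Qed.

(* indicator that [Yt] has stayed below [N] up to time [t]; it is enough to
  look at dyadic times *)
Definition chi (N : nat) (t : R) w : R :=
 \1_[set w | forall n k : nat, k%:R / 2 ^+ n <= t -> Yt (k%:R / 2 ^+ n) w <= N%:R] w.

Lemma chi01 N t w : chi N t w = 0 \/ chi N t w = 1.
Proof. by rewrite /chi indicE; case: (_ \in _); [right|left]. Qed.

Lemma chi_ge0 N t w : 0 <= chi N t w.
Proof. by have [->|->] := chi01 N t w. Qed.

Lemma chi_le1 N t w : chi N t w <= 1.
Proof. by have [->|->] := chi01 N t w. Qed.

Lemma chiM N t w : chi N t w * chi N t w = chi N t w.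
Proof. by have [->|->] := chi01 N t w; rewrite ?mulr0 ?mulr1. Qed.

Lemma chi1P N t w : chi N t w = 1 <->
 (forall n k : nat, k%:R / 2 ^+ n <= t -> Yt (k%:R / 2 ^+ n) w <= N%:R).
Proof.
rewrite /chi indicE; split => [|h]; last by rewrite mem_set.
by case: (boolP (_ \in _)) => [/set_mem//|_ /eqP]; rewrite eq_sym oner_eq0.
Qed.

Lemma chi_decr N s t w : s <= t -> chi N t w <= chi N s w.
Proof.
move=> st; have [->|/chi1P h] := chi01 N t w; first exact: chi_ge0.
by rewrite (proj2 (chi1P N s w)) ?chi_le1// => n k ks; apply: h; exact: le_trans st.
Qed.

Lemma chi_incr N M t w : (N <= M)%N -> chi N t w <= chi M t w.
Proof.
move=> NM; have [->|/chi1P h] := chi01 N t w; first exact: chi_ge0.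
rewrite (proj2 (chi1P M t w)) ?chi_le1// => n k ks; apply: le_trans (h n k ks) _.
by rewrite ler_nat.
Qed.

Lemma chiY N s t w : 0 <= s <= t -> chi N t w = 1 -> Yt s w <= N%:R.
Proof.
move=> /andP[s0 st] /chi1P h; have [_ c] := aproc_Y.
apply: (cvg_to_le _ (c w s s0)); apply: nearW => n; apply: h.
exact: le_trans (gfl_le n s0) st.
Qed.

(** The weighted norms are continuous in time, hence bounded on [0, t] along each path, and the
    truncation is eventually inactive. *)
Lemma chi_cvg1 t w : 0 <= t -> exists N0, forall N, (N0 <= N)%N -> chi N t w = 1.
Proof.
move=> t0; have [B0 h0] := nrm_bounded om0 (fun t => xE ord0 w (t := t)) (xc ord0 w) t0.
have [B1 h1] := nrm_bounded om0 (fun t => xE ord_max w (t := t)) (xc ord_max w) t0.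
exists (Num.bound `|B0 + B1|) => N NB; apply/chi1P => n k kt.
have k0 : 0 <= k%:R / 2 ^+ n :> R by rewrite divr_ge0 ?exprn_ge0.
apply: (@le_trans _ _ (B0 + B1)); first by apply: lerD; [apply: h0|apply: h1]; rewrite k0.
apply: (@le_trans _ _ (Num.bound `|B0 + B1|)%:R); last by rewrite ler_nat.
by apply: le_trans (ler_norm _) _; apply: ltW; apply: archi_boundP.
Qed.

Lemma chi_cvg t w : 0 <= t -> chi N t w @[N --> \oo] --> (1 : R).
Proof.
move=> t0; have [N0 h] := chi_cvg1 w t0.
by apply: cvg_near_cst; exists N0 => // N /= /h ->.
Qed.

Lemma chi_sub N t : 0 <= t -> sub_meas (F t) (chi N t).
Proof.
move=> t0; apply: (sub_meas_indic (sF t0)).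
rewrite (_ : [set w | _] = \bigcap_n \bigcap_k
  [set w | k%:R / 2 ^+ n <= t -> Yt (k%:R / 2 ^+ n) w <= N%:R]); last first.
 by apply/seteqP; split => w /= h; [move=> n _ k _; exact: h|move=> n k; exact: h].
have sg := sF t0.
have cap (A : nat -> set O) : (forall n, F t (A n)) -> F t (\bigcap_n A n).
 move=> hA; rewrite -(setCK (\bigcap_n A n)) setC_bigcap -setTD.
 by case: sg => _ hC hU; apply: (hC); apply: (hU) => n; rewrite -setTD; exact: (hC).
apply: (cap) => n; apply: (cap) => k.
have [kt|kt] := leP (k%:R / 2 ^+ n) t; last first.
 rewrite (_ : [set w | _] = setT); last by apply/seteqP; split.
 by rewrite -setC0 -setTD; case: sg => h0 hC _; exact: hC.
have k0 : 0 <= k%:R / 2 ^+ n :> R by rewrite divr_ge0 ?exprn_ge0.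
have := filt_le hF k0 kt (proj1 aproc_Y _ k0) (B := `]-oo, N%:R]%classic) (measurable_itv _).
by congr (F t _); apply/seteqP; split => w /=; rewrite in_itv/= => h //; exact: h.
Qed.

(** If the indicator is 1 at [r], it is 1 before. If it is 0, the level was exceeded at some dyadic
    time of level [m] not after [r], and this time is also not after [gfl n r] once n >= m. *)
Lemma aproc_chi N : aproc (chi N).
Proof.
split; [exact: chi_sub|move=> w r r0].
have [h|h] := chi01 N r w; last first.
 rewrite h; apply: cvg_near_cst; apply: nearW => n; apply/eqP; rewrite eq_le chi_le1/= -h.
 by apply: chi_decr; exact: gfl_le.
have [m [k [kr hk]]] : exists m k : nat, k%:R / 2 ^+ m <= r /\ N%:R < Yt (k%:R / 2 ^+ m) w.
 apply: contrapT => hn; have : chi N r w = 1.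
  apply/chi1P => n k kr; rewrite leNgt; apply/negP => hY; apply: hn.
  by exists n, k.
 by rewrite h => /esym/eqP; rewrite oner_eq0.
rewrite h; apply: cvg_near_cst; exists m => // n /= mn.
have [//|/chi1P hn] := chi01 N (gfl n r) w.
suff : k%:R / 2 ^+ m <= gfl n r by move=> /hn; rewrite leNgt hk.
have E : k%:R / 2 ^+ m = (k * 2 ^ (n - m))%:R / 2 ^+ n :> R.
 by rewrite -[in 2 ^+ n](subnK mn) exprD natrM natrX invfM mulrA mulfK// gt_eqF.
rewrite E /gfl ler_pM2r ?invr_gt0// ler_nat truncn_ge_nat; last by rewrite mulr_ge0// ltW.
by rewrite -ler_pdivrMr// -E.
Qed.

Lemma bproc_chi T N H C : aproc H -> 0 <= C ->
 (forall (t : R) w, 0 <= t -> Yt t w <= N%:R -> `|H t w| <= C) ->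
 bproc F T (fun t w => chi N t w * H t w) C.
Proof.
move=> hH C0 HC; have [h1 h2] := aprocM (aproc_chi N) hH; split => // r w /andP[r0 rT].
have [->|h] := chi01 N r w; first by rewrite mul0r normr0.
by rewrite h mul1r; apply: HC => //; apply: (chiY _ h); rewrite r0 lexx.
Qed.

Definition site_drift n i t w := Tm (x n t w) i - x n t w i.
Definition vol i t w := Num.sqrt (kap * x ord0 t w i * x ord_max t w i).

Lemma aproc_drift n i : aproc (site_drift n i).
Proof. exact: aprocB (aproc_Tm n i) (aproc_x n i). Qed.

Lemma aproc_vol i : aproc (vol i).
Proof.
apply: aproc_sqrt; apply: aprocM; last exact: aproc_x.
by apply: aprocM; [exact: aproc_cst|exact: aproc_x].
Qed.

Let oi0 i : 0 <= (om i)^-1.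
Proof. by rewrite invr_ge0 ltW. Qed.

Lemma x_bd n i (t : R) w : 0 <= t -> `|x n t w i| <= (om i)^-1 * nrm (x n t w).
Proof.
move=> t0; have [x0 _] := xE n w t0.
by rewrite ger0_norm//; apply: coord_le => //; exact: xE.
Qed.

Definition dcst i := K / om i + (om i)^-1.

Lemma dcst_ge0 i : 0 <= dcst i.
Proof. by rewrite /dcst addr_ge0// divr_ge0// ltW. Qed.

Lemma drift_bd n i (t : R) w : 0 <= t -> `|site_drift n i t w| <= dcst i * nrm (x n t w).
Proof.
move=> t0; apply: le_trans (ler_normB _ _) _; rewrite mulrDl; apply: lerD; last exact: x_bd.
rewrite ger0_norm; first by apply: (Tm_le om0 a0 K0 hK); exact: xE.
by apply: (Tm_ge0 om0 a0 K0 hK); exact: xE.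
Qed.

Lemma vol_sqr i (t : R) w : 0 <= t -> vol i t w ^+ 2 = kap * x ord0 t w i * x ord_max t w i.
Proof.
move=> t0; rewrite sqr_sqrtr// !mulr_ge0//. by case: (xE ord0 w t0).
by case: (xE ord_max w t0).
Qed.

Lemma vol_sqr_bd i (t : R) w : 0 <= t -> vol i t w ^+ 2 <= kap * (om i)^-1 ^+ 2 * Yt t w ^+ 2.
Proof.
move=> t0; rewrite vol_sqr// -mulrA.
rewrite (_ : _ * Yt t w ^+ 2 = kap * (((om i)^-1 * Yt t w) * ((om i)^-1 * Yt t w))); last by ring.
rewrite ler_wpM2l//.
have h n : 0 <= x n t w i <= (om i)^-1 * Yt t w.
 have [x0 _] := xE n w t0; rewrite x0/=; apply: le_trans (ler_norm _) _.
 by apply: le_trans (x_bd n i w t0) _; rewrite ler_wpM2l// nrm_Y.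
have /andP[? ?] := h ord0; have /andP[? ?] := h ord_max.
exact: ler_pM.
Qed.

Lemma Yt_ge0 (t : R) w : 0 <= t -> 0 <= Yt t w.
Proof. by move=> t0; rewrite addr_ge0//; apply: nrm_ge0 => //; exact: xE. Qed.

Lemma vol_bd N i (t : R) w : 0 <= t -> Yt t w <= N%:R ->
 `|vol i t w| <= Num.sqrt kap * (om i)^-1 * N%:R.
Proof.
move=> t0 YN; have v0 : 0 <= vol i t w by exact: sqrtr_ge0.
rewrite ger0_norm// -(@ler_pXn2r _ 2) ?nnegrE//; last by rewrite !mulr_ge0// sqrtr_ge0.
apply: (le_trans (vol_sqr_bd i w t0)); rewrite !exprMn sqr_sqrtr// ler_wpM2l//. by rewrite mulr_ge0// exprn_ge0.
by rewrite ler_pXn2r ?nnegrE// Yt_ge0.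
Qed.

(** The indicator is taken at the current time. As it decreases in time, the cut coefficients agree
    with the true ones on all of [0, t] on the event that it equals 1 at [t]. *)
Definition cut_drift N n i t w := chi N t w * site_drift n i t w.
Definition cut_vol N i t w := chi N t w * vol i t w.

Lemma bproc_cdrift T N n i : bproc F T (cut_drift N n i) (dcst i * N%:R).
Proof.
apply: bproc_chi; [exact: aproc_drift|by rewrite mulr_ge0// dcst_ge0|] => t w t0 YN.
apply: (le_trans (drift_bd _ _ _ t0)); rewrite ler_wpM2l// ?dcst_ge0//.
exact: le_trans (nrm_Y n w t0) YN.
Qed.

Lemma bproc_cvol T N i : bproc F T (cut_vol N i) (Num.sqrt kap * (om i)^-1 * N%:R).
Proof.
apply: bproc_chi; [exact: aproc_vol|by rewrite !mulr_ge0// sqrtr_ge0|] => t w t0 YN.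
exact: vol_bd.
Qed.

Lemma bproc_cx T N n i : bproc F T (fun t w => chi N t w * x n t w i) ((om i)^-1 * N%:R).
Proof.
apply: bproc_chi; [exact: aproc_x|by rewrite mulr_ge0|] => t w t0 YN.
apply: (le_trans (x_bd _ _ _ t0)); rewrite ler_wpM2l//.
exact: le_trans (nrm_Y n w t0) YN.
Qed.

End stopped_model.

(** * Integrability and second moments of simple processes *)

Section expectations_along_time.
Context disp (O : measurableType disp) (R : realType) (P : probability O R).
Variable F : R -> set (set O).
Hypothesis hF : filtration F.
Variable T : nat.
Local Notation mu := (@lebesgue_measure R).
Local Notation bproc := (bproc F T).

Lemma simp_exp_itg n (t : R) V (hV : standard_brownian P F V) H (CH : R) (bH : bproc H CH)
 B (C : R) B' (C' : R) (bB : bproc B C) (bB' : bproc B' C') : 0 <= t <= T%:R ->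
 itg mu `[0, t] (fun r => \int[P]_w (B r w * simp T n B' H V r w)).
Proof.
move=> tT; have mD := mI `[0, t].
have [i1 _] := tint_exp P hF bB tT.
have [i2 _] := tint_exp_mul P hF bB bB' tT.
have [i3 _] := cross_itg hF n hV bH bB tT.
apply: (eq_itg mD _ (itgD mD (itgD mD i1 i2) i3)) => r.
rewrite /= in_itv/= => /andP[r0 rt]; apply/esym.
by apply: (simp_exp_split hF n hV bH bB bB'); rewrite r0 (le_trans rt); case/andP: tT.
Qed.

Lemma simp_sqr_bd V (hV : standard_brownian P F V) H (CH : R) (bH : bproc H CH)
 B (C : R) (bB : bproc B C) :
 (forall t : R, 0 <= t -> is_bracket P V V t (fun=> t)) ->
 exists D, forall n (t : R), 0 <= t <= T%:R -> \int[P]_w (simp T n B H V t w ^+ 2) <= D.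
Proof.
move=> hbr; exists (2 * (1 + C * T%:R) ^+ 2 + 2 * (CH ^+ 2 * T%:R)) => n t tT.
have /andP[t0 tT'] := tT.
have L1 : L2 P setT (fun w => 1 + tint B t w).
 by apply: L2D => //; [exact: L2_cst measurableT (P_finT P) _|exact: (tint_L2 P hF bB tT)].
have L2' := SI_L2 hF n bH hV tT.
apply: le_trans (L2_sqrD_le measurableT L1 L2') _.
apply: lerD; rewrite ler_pM2l//; last exact: (SI_sqr_le hF n bH hV hbr tT).
rewrite -(Rint_cstP P ((1 + C * T%:R) ^+ 2)); apply: le_Rintegral => //.
- by case: L1.
- exact: itg_cst measurableT (P_finT P) _.
move=> w _; rewrite -real_normK ?num_real// ler_pXn2r ?nnegrE//.
 apply: le_trans (ler_normD _ _) _; rewrite normr1 lerD2l.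
 apply: le_trans (tint_bd w bB tT) _; apply: ler_wpM2l => //; exact: bproc_ge0 bB.
by rewrite addr_ge0// mulr_ge0//; exact: bproc_ge0 bB.
Qed.

Lemma eq_cvg_prob_on (A : set O) (V V' : nat -> O -> R) :
 (forall n w, A w -> V n w = V' n w) -> cvg_prob_on P A V -> cvg_prob_on P A V'.
Proof.
move=> VV hV e eta e0 eta0; have [N hN] := hV e eta e0 eta0.
by exists N => n /hN; congr (P _ <= _)%E; apply/seteqP; split => w [Aw] /=; rewrite (VV n w Aw).
Qed.

End expectations_along_time.

Section model.
Context disp (O : measurableType disp) (R : realType) (P : probability O R).
Context (S : countType) (a : S -> S -> R) (om : S -> R) (K kap rho : R).
Variables (F : R -> set (set O)) (x : 'I_2 -> R -> O -> S -> R) (W : 'I_2 -> S -> R -> O -> R).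
Local Notation mu := (@lebesgue_measure R).

Definition cc (n m : 'I_2) (i j : S) : R := if i == j then (if n == m then 1 else rho) else 0.

(* The model after modification on a null set: all paths are continuous and
  start from the constant function [1]. *)
Record regular_model : Prop := RegularModel {
 rm_om : forall i, 0 < om i ;
 rm_a : forall i j, 0 <= a i j ;
 rm_K0 : 0 <= K ;
 rm_K : forall n j, psum (fun i => om i * a i j) n <= K * om j ;
 rm_sm : sm om ;
 rm_kap : 0 <= kap ;
 rm_F : filtration F ;
 rm_E : forall n (t : R) w, 0 <= t -> in_space om (x n t w) ;
 rm_c : forall n w (t : R), 0 <= t ->
  edist om (x n s w) (x n t w) @[s --> within [set s | 0 <= s] (nbhs t)] --> (0 : R) ;
 rm_x : forall n i (t : R), 0 <= t -> sub_meas (F t) (fun w => x n t w i) ;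
 rm_W : forall n i, standard_brownian P F (W n i) ;
 rm_br : forall n m i j (t : R), 0 <= t ->
  is_bracket P (W n i) (W m j) t (fun=> cc n m i j * t) ;
 rm_eq : forall n i (t : R), 0 <= t -> exists (H : R -> O -> R) (L : O -> R),
  [/\ is_Ito_integral P H (W n i) t L, forall r : R, 0 <= r -> measurable_fun [set: O] (H r)
  & {ae P, forall w, (forall r, 0 <= r <= t -> H r w = vol kap x i r w) /\
    x n t w i = 1 + \int[mu]_(r in `[0, t]) site_drift a x n i r w + L w}] }.

End model.

Section more_sums.
Context (R : realType) (S : countType).
Implicit Types f g : S -> R.

Lemma psum_mul f g n m : psum f n * psum g m = psum (fun i => psum (fun j => f i * g j) m) n.
Proof.
rewrite mulrC -psumZ; apply: eq_psum => i.
by rewrite mulrC -psumZ.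
Qed.

Lemma psumZr c f n : psum (fun i => f i * c) n = psum f n * c.
Proof. by rewrite (eq_psum (g := fun i => c * f i)) ?psumZ 1?mulrC// => i; rewrite mulrC. Qed.

Lemma psum_delta_le (i : S) g n : 0 <= g i -> psum (fun j => if i == j then g j else 0) n <= g i.
Proof.
move=> gi0; have E k : oapp (fun j => if i == j then g j else 0) 0 (pickle_inv k) =
  if k == pickle i then g i else 0.
 case: eqP => [->|ki]; first by rewrite pickleK_inv/= eqxx.
 case E: (pickle_inv k) => [j|//] /=; case: eqP => // ij; exfalso; apply: ki.
 by have := @pickle_invK S k; rewrite /ocancel E/= ij.
rewrite /psum; under eq_bigr do rewrite E.
elim: n => [|n IH]; first by rewrite big_ord0.
rewrite big_ord_recr/=; case: eqP => [ni|_]; last by rewrite addr0.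
rewrite big1 ?add0r// => k _; case: eqP => // kn.
by have := ltn_ord k; rewrite kn ni ltnn.
Qed.

Context d (T : measurableType d) (mu : {measure set T -> \bar R}) (D : set T).
Hypothesis mD : measurable D.

Lemma itg_psum (h : S -> T -> R) n : (forall i, itg mu D (h i)) ->
 itg mu D (fun w => psum (h^~ w) n).
Proof.
move=> hh; apply: itg_sum => // k _; case: pickle_inv => [i|] //=.
exact: integrable0.
Qed.

Lemma Rint_psum (h : S -> T -> R) n : (forall i, itg mu D (h i)) ->
 \int[mu]_(w in D) psum (h^~ w) n = psum (fun i => \int[mu]_(w in D) h i w) n.
Proof.
move=> hh; rewrite /psum (Rint_sum mD); last first.
 by move=> k _; case: pickle_inv => [i|] //=; exact: integrable0.
by apply: eq_bigr => k _; case: pickle_inv => [i|] //=; rewrite (Rintegral_cst mu mD) mul0r.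
Qed.

End more_sums.

(** * Frozen integrands and mean-square limits *)

Section more_processes.
Context disp (O : measurableType disp) (R : realType) (P : probability O R).
Variable F : R -> set (set O).
Hypothesis hF : filtration F.
Variable T : nat.
Local Notation mu := (@lebesgue_measure R).
Local Notation bproc := (bproc F T).

Lemma bprocB G G' (C C' : R) : bproc G C -> bproc G' C' ->
 bproc (fun r w => G r w - G' r w) (C + C').
Proof.
move=> [h1 h2 h3] [h4 h5 h6]; split.
- move=> t t0; apply: sub_measB; [by case: hF => h _ _; exact: h|exact: h1|exact: h4].
- by move=> w r r0; apply: cvgB; [exact: h2|exact: h5].
- by move=> r w rT; apply: le_trans (ler_normB _ _) _; apply: lerD; [exact: h3|exact: h6].
Qed.

Lemma gfl_idem m n (r : R) : (m <= n)%N -> 0 <= r -> gfl m (gfl n r) = gfl m r.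
Proof.
move=> mn r0; have e0 j : 0 < 2 ^+ j :> R by rewrite exprn_gt0.
apply/eqP; rewrite eq_le; apply/andP; split.
 rewrite /gfl ler_pM2r ?invr_gt0// ler_nat; apply: le_truncn.
 by rewrite ler_pM2r// gfl_le.
rewrite [in leLHS]/gfl [leRHS]/gfl ler_pM2r ?invr_gt0// ler_nat.
rewrite truncn_ge_nat; last by rewrite mulr_ge0 ?gfl_ge0// ltW.
rewrite -ler_pdivrMr//; set k := Num.truncn _.
have kr : k%:R / 2 ^+ m <= r by exact: gfl_le.
have E : k%:R / 2 ^+ m = (k * 2 ^ (n - m))%:R / 2 ^+ n :> R.
 by rewrite -[in 2 ^+ n](subnK mn) exprD natrM natrX invfM mulrA mulfK// gt_eqF.
rewrite E /gfl ler_pM2r ?invr_gt0// ler_nat truncn_ge_nat; last by rewrite mulr_ge0// ltW.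
by rewrite -ler_pdivrMr// -E.
Qed.

Lemma bproc_gfl k G (C : R) : bproc G C -> bproc (fun r => G (gfl k r)) C.
Proof.
move=> [h1 h2 h3]; split.
- move=> t t0; apply: (filt_le hF (gfl_ge0 k t) (gfl_le k t0)); apply: h1; exact: gfl_ge0.
- move=> w r r0; apply: cvg_near_cst; exists k => // n /= kn. by rewrite gfl_idem.
- by move=> r w rT; apply: h3; exact: gfl_itv.
Qed.

Lemma SI_sub n (G G' W : R -> O -> R) (s : R) w : SI T n G W s w - SI T n G' W s w = SI T n (fun r w => G r w - G' r w) W s w.
Proof. by rewrite /SI -sumrB; apply: eq_bigr => k _; rewrite mulrBl. Qed.

Lemma tint_sqr_le D (C t : R) : bproc D C -> 0 <= t <= T%:R ->
 \int[P]_w (tint D t w ^+ 2) <= t * \iint[P]_(r, w < t) (D r w ^+ 2).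
Proof.
move=> bD tT; have /andP[t0 tT'] := tT.
have bDD := bproc_mul hF bD bD.
have mD := mI `[0, t].
have E' : (fun r => \int[P]_w (D r w ^+ 2)) = (fun r => \int[P]_w (D r w * D r w)).
 by apply/funext => r; apply: eq_mean => w; rewrite expr2.
have [_ h] := tint_exp P hF bDD tT.
have [LT iT] := tint_L2 P hF bD tT.
have L1 := tint_L2 P hF bDD tT.
have i1 := L2_itg measurableT (P_finT P) L1.
rewrite E' -h -(RintegralZl _ measurableT i1).
apply: le_Rintegral => //; first exact: itgZ.
move=> w _; have i2 := bproc_path_itg w bD tT; have i3 := bproc_path_itg w bDD tT.
have fin := @fin_itv R 0 t.
have LD : L2 mu `[0, t] (D^~ w).
 split; first exact: itg_meas i2.
 by apply: (eq_itg mD _ i3) => r _; rewrite expr2.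
have := L2_CS mD LD (L2_cst mD fin 1).
have -> : \int[mu]_(r in `[0, t]) (D r w * 1) = tint D t w by apply: Rint_ext => r _; rewrite mulr1.
have -> : \int[mu]_(r in `[0, t]) (D r w ^+ 2) = tint (fun r w => D r w * D r w) t w.
 by apply: Rint_ext => r _; rewrite expr2.
have -> : \int[mu]_(r in `[0, t]) (1 ^+ 2) = t by rewrite (Rint_cst_itv (1 ^+ 2) t0) expr1n mul1r subr0.
by rewrite mulrC.
Qed.

Lemma exp_gfl_cvg G (C t : R) : bproc G C -> 0 <= t <= T%:R ->
 \iint[P]_(r, w < t) (G (gfl k r) w) @[k --> \oo] -->
 \iint[P]_(r, w < t) (G r w).
Proof.
move=> bG /andP[t0 tT].
have hr r : 0 <= r <= t -> 0 <= r <= T%:R by move=> /andP[-> /le_trans->].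
have i1 : itg P setT (fun=> 1 : R) by exact: itg_cst measurableT (P_finT P) _.
have [_] := cont_itg t0 (fun r rt => bproc_exp_cont hF bG i1 (hr r rt))
  (fun r rt => bproc_exp_bd hF bG i1 (hr r rt)).
have E r : \int[P]_w (1 * G r w) = \int[P]_w G r w by apply: eq_mean => w; rewrite mul1r.
by rewrite (@Rint_ext _ _ R mu _ _ _ (fun r _ => E r)); under eq_fun do rewrite (@Rint_ext _ _ R mu _ _ _ (fun r _ => E _)).
Qed.

Lemma gfl_osc_cvg G (C t : R) : bproc G C -> 0 <= t <= T%:R ->
 \iint[P]_(r, w < t) ((G (gfl k r) w - G r w) ^+ 2) @[k --> \oo] --> (0 : R).
Proof.
move=> bG tT; have /andP[t0 tT'] := tT; have [h1 h2 h3] := bG.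
have mD := mI `[0, t].
have hr r : `[0, t]%classic r -> 0 <= r <= T%:R by rewrite /= in_itv/= => /andP[-> /le_trans->].
have C0 := bproc_ge0 bG.
have bd k r w : 0 <= r <= T%:R -> `|(G (gfl k r) w - G r w) ^+ 2| <= (C + C) ^+ 2.
 move=> rT; rewrite normrX ler_pXn2r ?nnegrE ?addr_ge0//.
 by apply: le_trans (ler_normB _ _) _; apply: lerD; apply: h3 => //; exact: gfl_itv.
have z0 : \int[mu]_(r in `[0, t]) (0 : R) = 0 by rewrite (Rintegral_cst mu mD) mul0r.
rewrite -[X in _ --> X]z0.
have bk k := bprocB (bproc_gfl k bG) bG.
have iP c : itg P setT (fun=> c : R) by exact: itg_cst measurableT (P_finT P) _.
have mPk k r : 0 <= r -> measurable_fun [set: O] (fun w => (G (gfl k r) w - G r w) ^+ 2).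
 by move=> r0; apply: measurable_funX; exact (bproc_meas hF (bk k) r0).
apply: (proj2 (@Rint_dom_cvg _ _ _ _ _ mD _ _ (fun=> (C + C) ^+ 2) _ _ _ _)).
- move=> k; have bkk := bproc_mul hF (bk k) (bk k); have [i1 _] := tint_exp P hF bkk tT.
 apply: (itg_meas (mu := mu)); apply: (eq_itg mD _ i1) => r _.
 by apply: eq_mean => w; rewrite expr2.
- move=> r /hr rT; have /andP[r0 _] := rT.
 rewrite -[X in _ --> X](Rint_cstP P).
 apply: (proj2 (@Rint_dom_cvg _ _ _ _ _ measurableT _ _ (fun=> (C + C) ^+ 2) _ _ _ _)) => //.
 + by move=> k; exact: mPk.
 + move=> w _; have h : G (gfl k r) w - G r w @[k --> \oo] --> (0 : R).
   by rewrite -(subrr (G r w)); apply: cvgB; [exact: h2|exact: cvg_cst].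
  rewrite -(mulr0 0); under eq_fun do rewrite expr2.
  exact (cvgM h h).
 + by move=> k w _; exact: bd.
- by apply: itg_cst => //; exact: fin_itv.
- move=> k r /hr rT; have /andP[r0 _] := rT.
 have i1 : itg P setT (fun w => (G (gfl k r) w - G r w) ^+ 2).
  by apply: (itg_bd measurableT (P_finT P) (mPk k r r0)) => w _; exact: bd.
 apply: le_trans (le_normr_Rintegral measurableT i1) _.
 rewrite -[leRHS](Rint_cstP P); apply: le_Rintegral => //; [exact: itg_norm|exact: iP|].
 by move=> w _; exact: bd.
Qed.

Lemma L2_prod_cvg (X Y : nat -> O -> R) (x y : O -> R) : (forall n, L2 P setT (X n)) ->
 (forall n, L2 P setT (Y n)) -> L2 P setT x -> L2 P setT y ->
 \int[P]_w ((X n w - x w) ^+ 2) @[n --> \oo] --> (0 : R) ->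
 \int[P]_w ((Y n w - y w) ^+ 2) @[n --> \oo] --> (0 : R) ->
 \int[P]_w (X n w * Y n w) @[n --> \oo] --> \int[P]_w (x w * y w).
Proof.
move=> LX LY Lx Ly cX cY.
pose a n := \int[P]_w ((X n w - x w) ^+ 2); pose b n := \int[P]_w ((Y n w - y w) ^+ 2).
pose A := \int[P]_w (x w ^+ 2); pose B := \int[P]_w (y w ^+ 2).
apply: (@cvgn_dist_le _ _ (fun n => Num.sqrt (a n) * Num.sqrt (b n) +
  Num.sqrt (a n) * Num.sqrt B + Num.sqrt A * Num.sqrt (b n))); last first.
 have s0 (f : nat -> R) : f n @[n --> \oo] --> (0 : R) -> Num.sqrt (f n) @[n --> \oo] --> (0 : R).
  by move=> h; rewrite -(@sqrtr0 R); exact: (cvg_comp _ _ h (@sqrt_continuous R 0)).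
 have ca := s0 _ cX; have cb := s0 _ cY.
 rewrite -[X in _ --> X](_ : 0 * 0 + 0 * Num.sqrt B + Num.sqrt A * 0 = 0); last by rewrite !mul0r mulr0 !addr0.
 apply: cvgD; last by apply: cvgMl_tmp.
 by apply: cvgD; [exact: cvgM ca cb|apply: cvgMr_tmp].
move=> n; have L1 := L2B measurableT (LX n) Lx; have L2' := L2B measurableT (LY n) Ly.
have i1 := L2_mul measurableT L1 L2'; have i2 := L2_mul measurableT L1 Ly; have i3 := L2_mul measurableT Lx L2'.
have -> : \int[P]_w (X n w * Y n w) - \int[P]_w (x w * y w) =
  \int[P]_w ((X n w - x w) * (Y n w - y w)) + \int[P]_w ((X n w - x w) * y w) + \int[P]_w (x w * (Y n w - y w)).
 rewrite -(RintegralD measurableT i1 i2) -(RintegralD measurableT (itgD measurableT i1 i2) i3).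
 rewrite -(RintegralB measurableT (L2_mul measurableT (LX n) (LY n)) (L2_mul measurableT Lx Ly)).
 by apply: eq_mean => w; ring.
apply: le_trans (ler_normD _ _) _; apply: lerD; last exact: (L2_CS_norm measurableT Lx L2').
apply: le_trans (ler_normD _ _) _; apply: lerD; last exact: (L2_CS_norm measurableT L1 Ly).
exact: (L2_CS_norm measurableT L1 L2').
Qed.

End more_processes.

(** * Second moments of the truncated model *)

Section stopped_moments.
Context disp (O : measurableType disp) (R : realType) (P : probability O R).
Context (S : countType) (a : S -> S -> R) (om : S -> R) (K kap rho : R).
Variables (F : R -> set (set O)) (x : 'I_2 -> R -> O -> S -> R) (W : 'I_2 -> S -> R -> O -> R).
Hypothesis M : regular_model P a om K kap rho F x W.
Variable T : nat.
Local Notation nrm := (nrm om).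
Local Notation mu := (@lebesgue_measure R).
Local Notation drift := (site_drift a x).
Local Notation vol := (vol kap x).
Local Notation chi := (chi om x).
Local Notation cdrift := (cut_drift a om x).
Local Notation cvol := (cut_vol om kap x).

Let hF := rm_F M.
Let hbrW n i (t : R) : 0 <= t -> is_bracket P (W n i) (W n i) t (fun=> t).
Proof. by move=> t0; have := rm_br M n n i i t0; rewrite /cc !eqxx mul1r. Qed.

(** [N] is the truncation level of the coefficients and [k] the dyadic level of the stochastic
    sum. *)
Definition cut_sol N k n i := simp T k (cdrift N n i) (cvol N i) (W n i).
Local Notation Sx := cut_sol.

Lemma rm_cdrift N n i : bproc F T (cdrift N n i) (dcst om K i * N%:R).
Proof. by case: M => *; exact: bproc_cdrift. Qed.

Lemma rm_cvol N i : bproc F T (cvol N i) (Num.sqrt kap * (om i)^-1 * N%:R).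
Proof. by case: M => *; exact: bproc_cvol. Qed.

Lemma rm_cx N n i : bproc F T (fun t w => chi N t w * x n t w i) ((om i)^-1 * N%:R).
Proof. by case: M => *; exact: bproc_cx. Qed.

Lemma rm_chi N : aproc F (chi N).
Proof. by case: M => *; exact: aproc_chi. Qed.

Lemma chi_meas N (t : R) : 0 <= t -> measurable_fun [set: O] (chi N t).
Proof. by move=> t0; apply: (filt_meas hF t0); case: (rm_chi N) => h _; exact: h. Qed.

Lemma x_meas n i (t : R) : 0 <= t -> measurable_fun [set: O] (fun w => x n t w i).
Proof. by move=> t0; apply: (filt_meas hF t0); exact: (rm_x M). Qed.

Lemma Sx_L2 N k n i (t : R) : 0 <= t <= T%:R -> L2 P setT (cut_sol N k n i t).
Proof. by move=> tT; exact: (simp_L2 hF k (rm_cdrift N n i) (rm_cvol N i) (rm_W M n i) tT). Qed.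

Lemma Sx_bd N n i : exists C, forall k (t : R), 0 <= t <= T%:R ->
 \int[P]_w (cut_sol N k n i t w ^+ 2) <= C.
Proof. exact: (simp_sqr_bd hF (rm_W M n i) (rm_cvol N i) (rm_cdrift N n i) (hbrW n i)). Qed.

(** Where the indicator equals 1 at [t], the cut equation is the true one up to [t], so the sums
    converge in probability to the solution there. Their second moments are bounded in [k], and weak
    convergence against a bounded [Z] living on that event follows. *)
Lemma Sx_weak N n i (t : R) (Z : O -> R) (C : R) : 0 <= t <= T%:R -> measurable_fun [set: O] Z ->
 (forall w, `|Z w| <= C) -> (forall w, chi N t w <> 1 -> Z w = 0) ->
 \int[P]_w (Z w * cut_sol N k n i t w) @[k --> \oo] --> \int[P]_w (Z w * x n t w i).
Proof.
move=> tT mZ ZC Z0; have /andP[t0 tT'] := tT.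
have [H [L [hIto mH [B [mB PB hB]]]]] := rm_eq M n i t0.
have [mL _] := hIto.
pose A := [set w | chi N t w = 1] `&` ~` B.
have mA : measurable A.
 apply: measurableI; last exact: measurableC.
 by have := chi_meas N t0 measurableT (measurable_set1 1); rewrite setTI.
pose V k w := cut_sol N k n i t w - chi N t w * x n t w i.
have LX : L2 P setT (fun w => chi N t w * x n t w i) by exact: (bproc_L2 P hF (rm_cx N n i) tT).
have LV k : L2 P setT (V k) by apply: L2B => //; exact: Sx_L2.
have [D hD] := Sx_bd N n i.
have bdV k : \int[P]_w (V k w ^+ 2) <= 2 * D + 2 * \int[P]_w ((- (chi N t w * x n t w i)) ^+ 2).
 apply: (le_trans (L2_sqrD_le measurableT (Sx_L2 N k n i tT) (L2N measurableT LX))).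
 by rewrite lerD// ler_pM2l//; exact: hD.
have hAB w : A w -> (forall r, 0 <= r <= t -> H r w = vol i r w) /\
   x n t w i = 1 + \int[mu]_(r in `[0, t]) drift n i r w + L w.
 by move=> [_ nB]; apply: contrapT => hn; apply: nB; exact: hB.
have chi1 w r : A w -> 0 <= r <= t -> chi N r w = 1.
 move=> [ct _] /andP[_ rt]; apply/eqP; rewrite eq_le chi_le1/= -ct.
 exact: chi_decr.
have cV : cvg_prob_on P A V.
 apply: (eq_cvg_prob_on _ (SI_ito (T := T) hF (G := cvol N i) mA tT (rm_W M n i) mH _ hIto)).
  move=> k w Aw; have [_ E] := hAB w Aw; rewrite /V E.
  have [ct _] := Aw; rewrite ct mul1r /cut_sol /simp.
  rewrite (_ : tint (cdrift N n i) t w = \int[mu]_(r in `[0, t]) drift n i r w); first by ring.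
  apply: Rint_ext => r; rewrite /= in_itv/= => rt.
  by rewrite /cut_drift (chi1 _ _ Aw rt) mul1r.
 move=> w r Aw rt; have [-> //] := hAB w Aw.
 by rewrite /cut_vol (chi1 _ _ Aw rt) mul1r.
(* The identity between the solution and its integral equation holds off the null set [B] only, so
   the test variable is set to 0 on [B]. *)
pose Z' w := Z w * \1_(~` B) w.
have mI : measurable_fun [set: O] (\1_(~` B) : O -> R) by apply: measurable_indic; exact: measurableC.
have mZ' : measurable_fun [set: O] Z' by exact: measurable_funM.
have I01 w : `|\1_(~` B) w| <= 1 :> R by rewrite indicE; case: (_ \in _); rewrite ?normr1 ?normr0.
have Z'C w : `|Z' w| <= C by apply: le_trans (ZC w); rewrite normrM ler_piMr.
have Z'0 w : ~ A w -> Z' w = 0.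
 move=> nA; rewrite /Z' indicE; case: (boolP (w \in ~` B)) => [/set_mem nB|]; last by rewrite mulr0.
 by rewrite Z0 ?mul0r// => ct; apply: nA; split.
have := weak_cvg0 mA mZ' Z'C Z'0 LV bdV cV.
have LZ X : L2 P setT X -> itg P setT (fun w => Z w * X w).
 by move=> hX; apply: (L2_itg measurableT (P_finT P)); apply: (L2_bM measurableT mZ _ hX) => w _; exact: ZC.
have E k : \int[P]_w (Z' w * V k w) = \int[P]_w (Z w * cut_sol N k n i t w) - \int[P]_w (Z w * x n t w i).
 rewrite (_ : \int[P]_w (Z w * x n t w i) = \int[P]_w (Z w * (chi N t w * x n t w i))); last first.
  apply: eq_mean => w; have [c0|->] := chi01 om x N t w; last by rewrite mul1r.
  by rewrite Z0 ?mul0r// c0 => /esym/eqP; rewrite oner_eq0.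
 rewrite -(RintegralB measurableT (LZ _ (Sx_L2 N k n i tT)) (LZ _ LX)).
 rewrite /Rintegral; congr fine; apply: ae_eq_integral => //.
 - by apply/measurable_EFinP; apply: measurable_funM => //; exact: (proj1 (LV k)).
 - apply/measurable_EFinP; apply: measurable_funB; apply: measurable_funM => //. by case: (Sx_L2 N k n i tT).
  by case: LX.
 exists B; split => // w /= hw; apply: contrapT => nB; apply: hw => _.
 by rewrite /Z' indicE mem_set// mulr1 /V mulrBr.
move=> h; apply/cvgn_eps => e e0; move/cvgn_eps: h => /(_ e e0)[k0 hk0].
by exists k0 => k /hk0; rewrite E subr0.
Qed.

Lemma exp_bound (X Y : O -> R) : L2 P setT X -> L2 P setT Y ->
 `|\int[P]_w (X w * Y w)| <= \int[P]_w (X w ^+ 2) + \int[P]_w (Y w ^+ 2).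
Proof.
move=> hX hY; have i1 := L2_mul measurableT hX hY.
have [_ iX] := hX; have [_ iY] := hY.
apply: le_trans (le_normr_Rintegral measurableT i1) _; rewrite -(RintegralD measurableT iX iY).
apply: le_Rintegral => //; [exact: itg_norm|exact: itgD|].
by move=> w _; rewrite normrM; exact: normM_le_sqrD.
Qed.

(** The cut drift is bounded and vanishes off the truncation event, so it is an admissible test
    variable in [Sx_weak] at each time; the bound in [k] then dominates the time integral. *)
Lemma exp_drift_cvg N n m i j (t : R) : 0 <= t <= T%:R ->
 itg mu `[0, t] (fun r => \int[P]_w (cdrift N n i r w * x m r w j)) /\
 \iint[P]_(r, w < t) (cdrift N n i r w * cut_sol N k m j r w) @[k --> \oo] -->
 \iint[P]_(r, w < t) (cdrift N n i r w * x m r w j).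
Proof.
move=> tT; have /andP[t0 tT'] := tT.
have mD := mI `[0, t].
have hr r : `[0, t]%classic r -> 0 <= r <= T%:R by rewrite /= in_itv/= => /andP[-> /le_trans->].
have bD := rm_cdrift N n i; have [D hD] := Sx_bd N m j.
have main (r : R) : 0 <= r <= T%:R ->
  \int[P]_w (cdrift N n i r w * cut_sol N k m j r w) @[k --> \oo] -->
  \int[P]_w (cdrift N n i r w * x m r w j).
 move=> rT; have /andP[r0 _] := rT; have [_ _ bd] := bD.
 have mZ : measurable_fun [set: O] (cdrift N n i r) by exact (bproc_meas hF bD r0).
 have Zb w : `|cdrift N n i r w| <= dcst om K i * N%:R by exact: bd.
 have cz w : chi N r w <> 1 -> cdrift N n i r w = 0.
  by move=> c1; have [c0|//] := chi01 om x N r w; rewrite /cut_drift c0 mul0r.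
 exact: (Sx_weak rT mZ Zb cz).
apply: (Rint_dom_cvg mD (g := fun=> (dcst om K i * N%:R) ^+ 2 + D)).
- move=> k; apply: itg_meas; apply: (simp_exp_itg hF k (rm_W M m j) (rm_cvol N j) bD (rm_cdrift N m j) tT).
- by move=> r /hr rT; exact: main.
- by apply: itg_cst => //; exact: fin_itv.
- move=> k r /hr rT; have L1 := bproc_L2 P hF bD rT.
 apply: le_trans (exp_bound L1 (Sx_L2 N k m j rT)) _; apply: lerD; last exact: hD.
 rewrite -[leRHS](Rint_cstP P); apply: le_Rintegral => //; first by case: L1.
  exact: itg_cst measurableT (P_finT P) _.
 move=> w _; have [_ _ bd] := bD; rewrite -real_normK ?num_real// ler_pXn2r ?nnegrE//; first exact: bd.
 exact: bproc_ge0 bD.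
Qed.

(* the value of the limit of [E (cut_sol n i * cut_sol m j)] *)
Definition Kval N n m i j t :=
 1 + \iint[P]_(r, w < t) (cdrift N n i r w * x m r w j)
  + \iint[P]_(r, w < t) (cdrift N m j r w * x n r w i)
  + cc rho n m i j * \iint[P]_(r, w < t) (cvol N i r w * cvol N j r w).

Lemma Sx_prod_cvg N n m i j (t : R) : 0 <= t <= T%:R ->
 \int[P]_w (cut_sol N k n i t w * cut_sol N k m j t w) @[k --> \oo] --> Kval N n m i j t.
Proof.
move=> tT; have /andP[t0 tT'] := tT.
have h k : \int[P]_w (cut_sol N k n i t w * cut_sol N k m j t w) =
  1 + \iint[P]_(r, w < t) (cdrift N n i r w * cut_sol N k m j r w)
  + \iint[P]_(r, w < t) (cdrift N m j r w * cut_sol N k n i r w)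
  + cc rho n m i j * \iint[P]_(r, w < t) (cvol N i (gfl k r) w * cvol N j (gfl k r) w).
 exact: (simp_mul hF (rm_W M n i) (rm_W M m j) (@rm_br _ _ _ _ _ _ _ _ _ _ _ _ _ M n m i j)
   (rm_cdrift N n i) (rm_cvol N i) (rm_cdrift N m j) (rm_cvol N j) k tT).
under eq_fun do rewrite h.
apply: cvgD; last first.
 apply: cvgMl_tmp; have bb := bproc_mul hF (rm_cvol N i) (rm_cvol N j).
 have hr r : 0 <= r <= t -> 0 <= r <= T%:R by move=> /andP[-> /le_trans->].
 have i1 : itg P setT (fun=> 1 : R) by exact: itg_cst measurableT (P_finT P) _.
 have [_] := cont_itg t0 (fun r rt => bproc_exp_cont hF bb i1 (hr r rt))
   (fun r rt => bproc_exp_bd hF bb i1 (hr r rt)).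
 have E r : \int[P]_w (1 * (cvol N i r w * cvol N j r w)) = \int[P]_w (cvol N i r w * cvol N j r w).
  by apply: eq_mean => w; rewrite mul1r.
 by rewrite (@Rint_ext _ _ R mu _ _ _ (fun r _ => E r)); under eq_fun do rewrite (@Rint_ext _ _ R mu _ _ _ (fun r _ => E _)).
apply: cvgD; last by have [] := exp_drift_cvg N m n j i tT.
by apply: cvgD; [exact: cvg_cst|have [] := exp_drift_cvg N n m i j tT].
Qed.

Let omw i : 0 <= om i := ltW (rm_om M i).

Let z n L t w := psum (fun i => om i * x n t w i) L.

Lemma rm_vol_sqr i (t : R) w : 0 <= t -> vol i t w ^+ 2 = kap * x ord0 t w i * x ord_max t w i.
Proof. by move=> t0; case: M => *; apply: vol_sqr => //; eauto. Qed.

Lemma rm_cnrm2 N n : bproc F T (fun t w => chi N t w * nrm (x n t w) ^+ 2) (N%:R ^+ 2).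
Proof.
case: M => h1 h2 h3 h4 h5 h6 h7 h8 h9 h10 _ _ _; apply: bproc_chi => //; first last.
- move=> t w t0 YN; rewrite ger0_norm ?sqr_ge0// ler_pXn2r ?nnegrE//. exact: le_trans (nrm_Y h1 h8 n w t0) YN.
 by apply: nrm_ge0 => //; exact: h8.
- under [X in aproc _ X]eq_fun do under eq_fun do rewrite expr2. by apply: (aprocM h7); exact: aproc_nrm.
Qed.

Lemma z_le n L (t : R) w : 0 <= t -> 0 <= z n L t w <= nrm (x n t w).
Proof.
move=> t0; have xE := rm_E M n w t0; rewrite psum_nrm//; last exact: rm_om M.
by rewrite andbT psum_ge0// => i; rewrite mulr_ge0//; case: xE.
Qed.

Lemma chi_nrm N n (t : R) w : 0 <= t -> chi N t w = 1 -> nrm (x n t w) <= N%:R.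
Proof.
move=> t0 c1; case: M => h1 h2 h3 h4 h5 h6 h7 h8 h9 h10 _ _ _.
apply: le_trans (nrm_Y h1 h8 n w t0) _.
by apply: (chiY h1 h7 h8 h9 h10 _ c1); rewrite t0 lexx.
Qed.

Lemma z_meas n L (t : R) : 0 <= t -> measurable_fun [set: O] (z n L t).
Proof.
move=> t0; apply: measurable_sum => k; case: pickle_inv => [i|] //=.
by apply: measurable_funM => //; exact: (x_meas).
Qed.

Let LP := P_finT P.

Lemma cz_bd N n L (t : R) w : 0 <= t -> `|chi N t w * z n L t w| <= N%:R.
Proof.
move=> t0; have /andP[z0 zn] := z_le n L w t0.
have [->|c1] := chi01 om x N t w; first by rewrite mul0r normr0.
by rewrite c1 mul1r ger0_norm// (le_trans zn)// chi_nrm.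
Qed.

(** Weak lower semicontinuity of the mean square. For Q = chi z, pointwise Z_k^2 + Q z >= 2 Q Z_k,
    because chi takes the values 0 and 1; in the limit the cross term becomes twice the mean of Q
    z. *)
Lemma cz2_le N n L (t : R) : 0 <= t <= T%:R ->
 \int[P]_w (chi N t w * z n L t w ^+ 2) <=
 (\S2_(i, j < L) om i * om j * Kval N n n i j t).
Proof.
move=> tT; have /andP[t0 tT'] := tT.
pose Zk k w := psum (fun i => om i * Sx N k n i t w) L.
pose Q w := chi N t w * z n L t w.
have mQ : measurable_fun [set: O] Q by apply: measurable_funM; [exact: (chi_meas)|exact: z_meas].
have Qb w : `|Q w| <= N%:R by exact: cz_bd.
have Q0 w : chi N t w <> 1 -> Q w = 0 by move=> c1; have [c0|//] := chi01 om x N t w; rewrite /Q c0 mul0r.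
have LS k i : L2 P setT (Sx N k n i t) := Sx_L2 N k n i tT.
have LQ : L2 P setT Q by apply: (@L2_bd _ _ _ _ _ measurableT LP _ N%:R).
have LZ k : L2 P setT (Zk k).
 apply: (L2_sum measurableT LP) => l _; case: pickle_inv => [i|] /=; last exact: L2_cst measurableT LP _.
 exact: L2Z.
have iQx i : itg P setT (fun w => Q w * x n t w i).
 have h := L2_mul measurableT LQ (bproc_L2 P hF (rm_cx N n i) tT).
 apply: (eq_itg measurableT _ h) => w _; rewrite /Q mulrACA chiM.
 by rewrite mulrA.
have c1 : \int[P]_w (Zk k w * Zk k w) @[k --> \oo] -->
  (\S2_(i, j < L) om i * om j * Kval N n n i j t).
 have E k : \int[P]_w (Zk k w * Zk k w) =
   (\S2_(i, j < L) om i * om j * \int[P]_w (Sx N k n i t w * Sx N k n j t w)).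
  transitivity (\int[P]_w (\S2_(i, j < L) om i * om j * (Sx N k n i t w * Sx N k n j t w))).
   apply: eq_mean => w; rewrite /Zk psum_mul; apply: eq_psum => i.
   by apply: eq_psum => j; ring.
  rewrite (Rint_psum measurableT); last first.
   by move=> i; apply: itg_psum => // j; apply: itgZ => //; exact: L2_mul.
  apply: eq_psum => i; rewrite (Rint_psum measurableT); last first.
   by move=> j; apply: itgZ => //; exact: L2_mul.
  by apply: eq_psum => j; rewrite RintegralZl//; exact: L2_mul.
 under eq_fun do rewrite E.
 apply: cvg_psum => i; apply: cvg_psum => j; apply: cvgMl_tmp.
 exact (Sx_prod_cvg tT).
have c2 : \int[P]_w (Q w * Zk k w) @[k --> \oo] --> \int[P]_w (Q w * z n L t w).
 have E (f : O -> S -> R) : (forall i, itg P setT (fun w => Q w * f w i)) ->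
   \int[P]_w (Q w * psum (fun i => om i * f w i) L) = psum (fun i => om i * \int[P]_w (Q w * f w i)) L.
  move=> hf; transitivity (\int[P]_w psum (fun i => om i * (Q w * f w i)) L).
   apply: eq_mean => w; rewrite -psumZ; apply: eq_psum => i.
   by rewrite mulrCA.
  rewrite (Rint_psum measurableT) => [|i]; last exact: itgZ.
  by apply: eq_psum => i; rewrite (RintegralZl _ measurableT (hf i)).
 rewrite /z E//.
 have EZ k : \int[P]_w (Q w * Zk k w) = psum (fun i => om i * \int[P]_w (Q w * Sx N k n i t w)) L.
  by rewrite /Zk (E (fun w i => Sx N k n i t w))// => i; exact: L2_mul.
 under eq_fun do rewrite EZ.
 apply: cvg_psum => i; apply: cvgMl_tmp.
 exact (Sx_weak tT mQ Qb Q0).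
have iQz : itg P setT (fun w => Q w * z n L t w).
 rewrite (_ : (fun w => _) = (fun w => psum (fun i => om i * (Q w * x n t w i)) L)).
  by apply: itg_psum => // i; exact: itgZ.
 apply/funext => w; rewrite -psumZ; apply: eq_psum => i.
 by rewrite mulrCA.
rewrite (_ : \int[P]_w (chi N t w * z n L t w ^+ 2) = \int[P]_w (Q w * z n L t w)); last first.
 by apply: eq_mean => w; rewrite /Q expr2 mulrA.
have c4 : \int[P]_w (Zk k w * Zk k w) - (2 * \int[P]_w (Q w * Zk k w) - \int[P]_w (Q w * z n L t w)) @[k --> \oo] -->
  (\S2_(i, j < L) om i * om j * Kval N n n i j t)
   - (2 * \int[P]_w (Q w * z n L t w) - \int[P]_w (Q w * z n L t w)).
 by apply: cvgB c1 _; apply: cvgB; [apply: cvgMl_tmp; exact c2|exact: cvg_cst].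
rewrite -subr_ge0 (_ : _ - _ = (\S2_(i, j < L) om i * om j * Kval N n n i j t)
   - (2 * \int[P]_w (Q w * z n L t w) - \int[P]_w (Q w * z n L t w))); last by ring.
apply: (cvg_to_ge _ c4); apply: nearW => k.
have i2 := L2_mul measurableT (LZ k) (LZ k); have i3 := L2_mul measurableT LQ (LZ k).
rewrite subr_ge0 lerBlDr.
rewrite -(RintegralZl _ measurableT i3) -(RintegralD measurableT i2 iQz).
apply: le_Rintegral => //; [exact: itgZ|exact: itgD|].
move=> w _; rewrite /Q; have [->|->] := chi01 om x N t w. by rewrite !mul0r mulr0 addr0 -expr2 sqr_ge0.
rewrite !mul1r; have := sqr_ge0 (Zk k w - z n L t w).
by move: (Zk k w) (z n L t w) => u v; nra.
Qed.

Lemma drift_sqr_le (B q k n : R) : 0 <= B -> B <= k * n -> 0 <= q -> q <= n ->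
 (B - q) * q <= k * n ^+ 2.
Proof.
move=> B0 Bkn z0 zn; apply: (@le_trans _ _ (B * n)).
 by rewrite mulrBl; apply: (@le_trans _ _ (B * q)); [rewrite gerBl mulr_ge0|rewrite ler_wpM2l].
by rewrite expr2 mulrA ler_wpM2r// (le_trans z0).
Qed.

Let y N (t : R) := \int[P]_w (chi N t w * (nrm (x ord0 t w) ^+ 2 + nrm (x ord_max t w) ^+ 2)).

Lemma nrm2_le n (t : R) w :
 nrm (x n t w) ^+ 2 <= nrm (x ord0 t w) ^+ 2 + nrm (x ord_max t w) ^+ 2.
Proof.
have [->|->] : n = ord0 \/ n = ord_max.
- by case: n => [[|[|//]] hn]; [left|right]; exact: val_inj.
- by rewrite lerDl sqr_ge0.
- by rewrite lerDr sqr_ge0.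
Qed.

Lemma rm_y N : bproc F T (fun t w => chi N t w * (nrm (x ord0 t w) ^+ 2 + nrm (x ord_max t w) ^+ 2))
 (N%:R ^+ 2 + N%:R ^+ 2).
Proof.
have [h1 h2 h3] := rm_cnrm2 N ord0; have [h4 h5 h6] := rm_cnrm2 N ord_max.
have E : (fun t w => chi N t w * (nrm (x ord0 t w) ^+ 2 + nrm (x ord_max t w) ^+ 2)) =
  (fun t w => chi N t w * nrm (x ord0 t w) ^+ 2 + chi N t w * nrm (x ord_max t w) ^+ 2).
 by apply/funext => t; apply/funext => w; rewrite mulrDr.
rewrite E; split.
- move=> t t0; apply: sub_measD; [by case: hF => h _ _; exact: h|exact: h1|exact: h4].
- by move=> w r r0; apply: cvgD; [exact: h2|exact: h5].
- move=> r w rT; apply: le_trans (ler_normD _ _) _; apply: lerD; [exact: h3|exact: h6].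
Qed.

Let rT (t r : R) : 0 <= t <= T%:R -> `[0, t]%classic r -> 0 <= r <= T%:R.
Proof. by move=> /andP[_ tT]; rewrite /= in_itv/= => /andP[-> /le_trans->]. Qed.

Lemma y_itg N (t : R) : 0 <= t <= T%:R -> itg mu `[0, t] (y N).
Proof. by move=> tT; case: (tint_exp P hF (rm_y N) tT). Qed.

Lemma y_le N n (t : R) (c : R) (f : O -> R) : 0 <= t <= T%:R -> 0 <= c -> itg P setT f ->
 (forall w, f w <= chi N t w * (c * nrm (x n t w) ^+ 2)) -> \int[P]_w f w <= c * y N t.
Proof.
move=> tT c0 i_f fc; have iy := bproc_itg P hF (rm_y N) tT.
rewrite /y -(RintegralZl _ measurableT iy); apply: le_Rintegral => //; first exact: itgZ.
move=> w _; apply: (le_trans (fc w)); rewrite mulrCA; apply: ler_wpM2l => //.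
by apply: ler_wpM2l; [exact: chi_ge0|exact: nrm2_le].
Qed.

(** Summed against the weights, each of the two drift terms costs at most [K] by the column bound.
    The volatility term lives on the diagonal, and the sum of om_i^2 u_i v_i is at most the product
    of the two weighted norms. *)
Lemma Kval_sum_le N n L (t : R) : 0 <= t <= T%:R ->
 (\S2_(i, j < L) om i * om j * Kval N n n i j t) <=
 ssum om ^+ 2 + (2 * K + kap) * \int[mu]_(r in `[0, t]) y N r.
Proof.
move=> tT; have /andP[t0 tT'] := tT.
have mD := mI `[0, t].
pose f1 i j r := \int[P]_w (cdrift N n i r w * x n r w j).
pose f2 i j r := \int[P]_w (cvol N i r w * cvol N j r w).
have i1 i j : itg mu `[0, t] (f1 i j) by case: (exp_drift_cvg N n n i j tT).
have i2 i j : itg mu `[0, t] (f2 i j) by case: (tint_exp P hF (bproc_mul hF (rm_cvol N i) (rm_cvol N j)) tT).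
have x0 m i (r : R) w : 0 <= r -> 0 <= x m r w i by move=> r0; case: (rm_E M m w r0).
have cK : 0 <= K := rm_K0 M; have ck : 0 <= kap := rm_kap M.
pose f i j r := om i * om j * (f1 i j r + f1 j i r + cc rho n n i j * f2 i j r).
have iff i j : itg mu `[0, t] (f i j) by apply: itgZ => //; apply: itgD => //; [exact: itgD|exact: itgZ].
have EK i j : om i * om j * Kval N n n i j t =
  om i * om j + \int[mu]_(r in `[0, t]) f i j r.
 rewrite /f (RintegralZl _ mD); last by apply: itgD => //; [exact: itgD|exact: itgZ].
 rewrite (RintegralD mD (itgD mD (i1 i j) (i1 j i)) (itgZ mD _ (i2 i j))).
 rewrite (RintegralD mD (i1 i j) (i1 j i)) (RintegralZl _ mD (i2 i j)) /Kval -/(f1 _ _).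
 by rewrite -!addrA mulrDr mulr1.
have -> : (\S2_(i, j < L) om i * om j * Kval N n n i j t) =
  psum om L * psum om L + \int[mu]_(r in `[0, t]) (\S2_(i, j < L) f i j r).
 rewrite (Rint_psum mD) => [|i]; last exact: itg_psum.
 rewrite psum_mul -psumD; apply: eq_psum => i.
 rewrite (Rint_psum mD)// -psumD; apply: eq_psum => j; exact: EK.
apply: lerD.
 have h := psum_le_ssum L omw (rm_sm M).
 by rewrite expr2 ler_pM// psum_ge0.
rewrite -(RintegralZl _ mD (y_itg N tT)).
apply: le_Rintegral => //.
- by apply: itg_psum => // i; exact: itg_psum.
- by apply: itgZ => //; exact: y_itg.
move=> r rt; have r0T := rT tT rt; have /andP[r0 _] := r0T.
pose b w := psum (fun i => om i * cdrift N n i r w) L.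
have Lc i : L2 P setT (cdrift N n i r) := bproc_L2 P hF (rm_cdrift N n i) r0T.
have LX i : L2 P setT (fun w => chi N r w * x n r w i) := bproc_L2 P hF (rm_cx N n i) r0T.
have ccx i j : itg P setT (fun w => cdrift N n i r w * x n r w j).
 apply: (eq_itg measurableT _ (L2_mul measurableT (Lc i) (LX j))) => w _.
 by rewrite /cut_drift mulrACA chiM mulrA.
have B1 : (\S2_(i, j < L) om i * om j * f1 i j r) <= K * y N r.
 have -> : (\S2_(i, j < L) om i * om j * f1 i j r) =
   \int[P]_w (b w * z n L r w).
  transitivity (\int[P]_w (\S2_(i, j < L) om i * om j * (cdrift N n i r w * x n r w j))).
   rewrite (Rint_psum measurableT) => [|i]; last by apply: itg_psum => // j; exact: itgZ.
   apply: eq_psum => i; rewrite (Rint_psum measurableT) => [|j]; last exact: itgZ.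
   by apply: eq_psum => j; rewrite (RintegralZl _ measurableT (ccx i j)).
  apply: eq_mean => w; rewrite /b /z psum_mul; apply: eq_psum => i.
  by apply: eq_psum => j; ring.
 have Eb w : b w * z n L r w = chi N r w * ((psum (fun i => om i * Tm a (x n r w) i) L - z n L r w) * z n L r w).
  rewrite mulrA; congr (_ * _); rewrite /b /z -psumB -psumZ; apply: eq_psum => i.
  by rewrite /cut_drift /site_drift; ring.
 apply: (y_le (n := n) r0T cK).
  apply: (eq_itg measurableT (f := fun w => (\S2_(i, j < L) om i * om j * (cdrift N n i r w * x n r w j)))).
   move=> w _; rewrite /b /z psum_mul; apply: eq_psum => i.
   by apply: eq_psum => j; ring.
  by apply: itg_psum => // i; apply: itg_psum => // j; exact: itgZ.
 move=> w; rewrite Eb; apply: ler_wpM2l; first exact: chi_ge0.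
 have /andP[z0 zn] := z_le n L w r0.
 have xE := rm_E M n w r0.
 have hT := psum_Tm (rm_om M) (rm_a M) (rm_K0 M) (rm_K M) L xE.
 have n0 := nrm_ge0 (rm_om M) xE.
 have B0 : 0 <= psum (fun i => om i * Tm a (x n r w) i) L.
  by apply: psum_ge0 => i; rewrite mulr_ge0// (Tm_ge0 (rm_om M) (rm_a M) (rm_K0 M) (rm_K M)).
 exact: drift_sqr_le.
have B2 : (\S2_(i, j < L) om i * om j * (cc rho n n i j * f2 i j r)) <= kap * y N r.
 have f20 i j : 0 <= f2 i j r. apply: Rintegral_ge0 => w _; rewrite mulr_ge0// mulr_ge0 ?chi_ge0 ?sqrtr_ge0//.
 have iv i : itg P setT (fun w => chi N r w * vol i r w ^+ 2).
  have Lv := bproc_L2 P hF (rm_cvol N i) r0T.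
  apply: (eq_itg measurableT _ (L2_mul measurableT Lv Lv)) => w _.
  by rewrite /cut_vol mulrACA chiM expr2.
 have ivs : itg P setT (fun w => psum (fun i => om i ^+ 2 * (chi N r w * vol i r w ^+ 2)) L).
  by apply: itg_psum => // i; exact: itgZ.
 apply: (@le_trans _ _ (\int[P]_w psum (fun i => om i ^+ 2 * (chi N r w * vol i r w ^+ 2)) L)).
  rewrite (Rint_psum measurableT) => [|i]; last exact: itgZ.
  apply: le_psum => i; rewrite (RintegralZl _ measurableT (iv i)).
  have -> : \int[P]_w (chi N r w * vol i r w ^+ 2) = f2 i i r.
   by apply: eq_mean => w; rewrite /cut_vol mulrACA chiM expr2.
  rewrite (eq_psum (g := fun j => if i == j then om i * om j * f2 i j r else 0)).
   apply: (le_trans (psum_delta_le L (g := fun j => om i * om j * f2 i j r) (i := i) _)).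
    by rewrite !mulr_ge0.
   by rewrite expr2.
  by move=> j; rewrite /cc eqxx; case: eqP => [->|_]; rewrite ?mul1r// mul0r mulr0.
 have iy := bproc_itg P hF (rm_y N) r0T.
 rewrite /y -(RintegralZl _ measurableT iy); apply: le_Rintegral => //; first exact: itgZ.
 move=> w _; have E0 := rm_E M ord0 w r0; have E1 := rm_E M ord_max w r0.
 have n0 := nrm_ge0 (rm_om M) E0; have n1 := nrm_ge0 (rm_om M) E1.
 apply: (@le_trans _ _ (chi N r w * (kap * (nrm (x ord0 r w) * nrm (x ord_max r w))))).
  apply: (@le_trans _ _ (psum (fun i => chi N r w * (kap * nrm (x ord0 r w)) * (om i * x ord_max r w i)) L)).
   apply: le_psum => i; rewrite rm_vol_sqr//.
   rewrite (_ : _ * _ = chi N r w * (kap * (om i * x ord0 r w i)) * (om i * x ord_max r w i)); last by ring.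
   apply: ler_wpM2r; first by rewrite mulr_ge0// x0.
   apply: ler_wpM2l; first exact: chi_ge0.
   apply: ler_wpM2l => //; apply: (le_ssum1 (f := fun i => om i * x ord0 r w i)); last by case: E0.
   by move=> j; rewrite mulr_ge0// x0.
  rewrite psumZ -!mulrA; apply: ler_wpM2l; first exact: chi_ge0.
  by apply: ler_wpM2l => //; apply: ler_wpM2l => //; exact: (psum_nrm (rm_om M)).
 rewrite mulrCA; apply: ler_wpM2l => //; apply: ler_wpM2l; first exact: chi_ge0.
 have := normM_le_sqrD (nrm (x ord0 r w)) (nrm (x ord_max r w)).
 by rewrite !ger0_norm.
have -> : (2 * K + kap) * y N r = K * y N r + K * y N r + kap * y N r by ring.
have -> : (\S2_(i, j < L) f i j r) =
 (\S2_(i, j < L) om i * om j * f1 i j r) +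
 (\S2_(i, j < L) om i * om j * f1 j i r) +
 (\S2_(i, j < L) om i * om j * (cc rho n n i j * f2 i j r)).
 rewrite -!psumD; apply: eq_psum => i; rewrite -!psumD; apply: eq_psum => j.
 by rewrite /f !mulrDr.
apply: lerD => //; apply: lerD => //.
rewrite psum_swap; apply: le_trans B1; apply: eq_ler.
apply: eq_psum => i; apply: eq_psum => j.
by rewrite [om j * _]mulrC.
Qed.

(** Letting the number of sites grow in [cz2_le] and [Kval_sum_le] closes a Gronwall inequality for
    [y N]. The a priori bound needed to start it depends on [N], but the result does not. *)
Lemma y_bound N (t : R) : 0 <= t <= T%:R ->
 y N t <= 4 * ssum om ^+ 2 * expR (2 * (2 * (2 * K + kap) + 1) * t).
Proof.
have cK : 0 <= K := rm_K0 M; have ck : 0 <= kap := rm_kap M.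
move=> tT; have /andP[t0 tT'] := tT.
have A0 : 0 <= 2 * ssum om ^+ 2 by rewrite mulr_ge0// sqr_ge0.
have TT : 0 <= (T%:R : R) <= T%:R by rewrite ler0n lexx.
have i1 : itg P setT (fun=> 1 : R) by exact: itg_cst measurableT (P_finT P) _.
(* Adding the estimates of the two types doubles both constants; the extra 1 keeps the rate positive
   when [K] and [kap] vanish. *)
have := @gronwall_Rint R (y N) (2 * ssum om ^+ 2) (N%:R ^+ 2 + N%:R ^+ 2) (2 * (2 * K + kap) + 1) T%:R A0 _ (ler0n _ _) _ (y_itg N TT) _ t tT.
rewrite mulrA -natrM; apply.
- by rewrite ltr_wpDl// mulr_ge0// addr_ge0// mulr_ge0.
- move=> s sT; apply: le_trans (ler_norm _) _.
 have := bproc_exp_bd hF (rm_y N) i1 sT.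
 under Rint_ext do rewrite mul1r; move=> /le_trans; apply.
 by under Rint_ext do rewrite normr1; rewrite Rint_cstP mulr1.
move=> s sT; have /andP[s0 sT'] := sT.
have y0 (r : R) : 0 <= y N r by apply: Rintegral_ge0 => w _; rewrite mulr_ge0 ?chi_ge0// addr_ge0// sqr_ge0.
have iy0 : 0 <= \int[mu]_(r in `[0, s]) y N r by apply: Rintegral_ge0 => r _.
suff h n : \int[P]_w (chi N s w * nrm (x n s w) ^+ 2) <=
  ssum om ^+ 2 + (2 * K + kap) * \int[mu]_(r in `[0, s]) y N r.
 have i2 n : itg P setT (fun w => chi N s w * nrm (x n s w) ^+ 2) := bproc_itg P hF (rm_cnrm2 N n) sT.
 have -> : y N s = \int[P]_w (chi N s w * nrm (x ord0 s w) ^+ 2) + \int[P]_w (chi N s w * nrm (x ord_max s w) ^+ 2).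
  rewrite -(RintegralD measurableT (i2 _) (i2 _)); apply: eq_mean => w.
  by rewrite mulrDr.
 have := h ord0; have := h ord_max; move: iy0.
 move: (\int[mu]_(r in `[0, s]) y N r) (\int[P]_w _) (\int[P]_w _) (ssum om ^+ 2) => I a1 a2 A I0 H1 H2.
 by rewrite (_ : 2 * A + _ = (A + (2 * K + kap) * I) + (A + (2 * K + kap) * I) + I); [lra|ring].
have cv : \int[P]_w (chi N s w * z n L s w ^+ 2) @[L --> \oo] --> \int[P]_w (chi N s w * nrm (x n s w) ^+ 2).
 apply: (proj2 (@Rint_dom_cvg _ _ _ _ _ measurableT _ _ (fun=> N%:R ^+ 2) _ _ _ _)).
 - move=> L; apply: measurable_funM; first exact: (chi_meas). by apply: measurable_funX; exact: z_meas.
 - move=> w _; apply: cvgMl_tmp; rewrite expr2; under eq_fun do rewrite expr2.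
  have hz : z n L s w @[L --> \oo] --> nrm (x n s w) by apply: psum_cvg; case: (rm_E M n w s0).
  by apply: cvgM.
 - exact: itg_cst measurableT LP _.
 move=> L w _; have [->|c1] := chi01 om x N s w; first by rewrite mul0r normr0 exprn_ge0.
 have /andP[z0 zn] := z_le n L w s0.
 rewrite c1 mul1r ger0_norm ?sqr_ge0// ler_pXn2r ?nnegrE//.
 by apply: (le_trans zn); apply: chi_nrm.
apply: (cvg_to_le _ cv); apply: nearW => L.
exact: le_trans (cz2_le N n L sT) (Kval_sum_le N n L sT).
Qed.

(** The indicators increase to 1 with [N], so the uniform bound passes to the limit by monotone
    convergence. *)
Lemma nrm2_itg n (t : R) : 0 <= t <= T%:R ->
 itg P setT (fun w => nrm (x n t w) ^+ 2) /\
 \int[P]_w (nrm (x n t w) ^+ 2) <= 4 * ssum om ^+ 2 * expR (2 * (2 * (2 * K + kap) + 1) * t).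
Proof.
move=> tT; have /andP[t0 tT'] := tT.
have i2 N : itg P setT (fun w => chi N t w * nrm (x n t w) ^+ 2) := bproc_itg P hF (rm_cnrm2 N n) tT.
have bd N : \int[P]_w (chi N t w * nrm (x n t w) ^+ 2) <= 4 * ssum om ^+ 2 * expR (2 * (2 * (2 * K + kap) + 1) * t).
 apply: le_trans (y_bound N tT).
 apply: (le_Rintegral measurableT (i2 N) (bproc_itg P hF (rm_y N) tT)).
 by move=> w _; apply: ler_wpM2l; [exact: chi_ge0|exact: nrm2_le].
have [|||h1 h2] := @Rint_mono_cvg _ _ _ P setT measurableT (fun N w => chi N t w * nrm (x n t w) ^+ 2)
  (fun w => nrm (x n t w) ^+ 2) _ i2 _ _ _ bd.
- by move=> N w _; rewrite mulr_ge0 ?chi_ge0// sqr_ge0.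
- by move=> w _ N N' NN; apply: ler_wpM2r; [exact: sqr_ge0|exact: chi_incr].
- move=> w _; rewrite -[X in _ --> X]mul1r; apply: cvgM; last exact: cvg_cst.
 by apply: (chi_cvg (rm_om M) (rm_E M) (rm_c M)).
by split => //; apply: (cvg_to_le _ h2); exact: nearW.
Qed.

Let om0 := rm_om M.

(** * Removing the truncation *)

Definition mcst : R := 4 * ssum om ^+ 2 * expR (2 * (2 * (2 * K + kap) + 1) * T%:R).

Lemma nrm2_bd n (t : R) : 0 <= t <= T%:R ->
 itg P setT (fun w => nrm (x n t w) ^+ 2) /\ \int[P]_w (nrm (x n t w) ^+ 2) <= mcst.
Proof.
move=> tT; have [h1 h2] := nrm2_itg n tT; split => //; apply: (le_trans h2).
apply: ler_wpM2l; first by rewrite mulr_ge0// sqr_ge0.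
rewrite ler_expR; apply: ler_wpM2l; last by case/andP: tT.
by rewrite mulr_ge0// addr_ge0// mulr_ge0// addr_ge0 ?(rm_kap M)// mulr_ge0// (rm_K0 M).
Qed.

(** Pointwise domination by the weighted norms; together with [nrm2_bd] it bounds the mean square
    uniformly on [0, T]. Coordinates, drifts and volatilities all qualify. *)
Let dom (H : R -> O -> R) (c : R) := [/\ 0 <= c,
 forall t : R, 0 <= t -> measurable_fun [set: O] (H t) &
 forall (t : R) w, 0 <= t -> H t w ^+ 2 <= c * (nrm (x ord0 t w) ^+ 2 + nrm (x ord_max t w) ^+ 2)].

Lemma dom_L2 H c (t : R) : dom H c -> 0 <= t <= T%:R ->
 L2 P setT (H t) /\ \int[P]_w (H t w ^+ 2) <= c * (2 * mcst).
Proof.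
move=> [c0 mH hH] tT; have /andP[t0 tT'] := tT.
have [i0 b0] := nrm2_bd ord0 tT; have [i1 b1] := nrm2_bd ord_max tT.
have i2 := itgZ measurableT c (itgD measurableT i0 i1).
have iH : itg P setT (fun w => H t w ^+ 2).
 apply: (itg_le measurableT _ _ i2); first by apply: measurable_funX; exact: mH.
 by move=> w _; rewrite ger0_norm ?sqr_ge0//; exact: hH.
split; first by split => //; exact: mH.
apply: (@le_trans _ _ (\int[P]_w (c * (nrm (x ord0 t w) ^+ 2 + nrm (x ord_max t w) ^+ 2)))).
 by apply: (le_Rintegral measurableT iH i2) => w _; exact: hH.
rewrite (RintegralZl _ measurableT (itgD measurableT i0 i1)) (RintegralD measurableT i0 i1).
by rewrite ler_wpM2l// mulr_natl mulr2n lerD.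
Qed.

Lemma dom_x n i : dom (fun t w => x n t w i) ((om i)^-1 ^+ 2).
Proof.
split=> [|t t0|t w t0]; [exact: sqr_ge0|exact: (x_meas)|].
have oi : 0 <= (om i)^-1 by rewrite invr_ge0.
apply: (@le_trans _ _ (((om i)^-1 * nrm (x n t w)) ^+ 2)).
 rewrite -real_normK ?num_real// ler_pXn2r ?nnegrE//. by apply: x_bd => //; exact: (rm_E M).
 by rewrite mulr_ge0// (nrm_ge0 om0)//; exact: (rm_E M).
by rewrite exprMn ler_wpM2l ?sqr_ge0// nrm2_le.
Qed.

Lemma rm_drift n i : aproc F (drift n i).
Proof. exact: (aproc_drift (rm_om M) (rm_a M) (rm_K0 M) (rm_K M) hF (rm_E M) (rm_c M) (rm_x M) n i). Qed.

Lemma rm_vol i : aproc F (vol i).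
Proof. by case: M => *; exact: aproc_vol. Qed.

Lemma aproc_meas H (t : R) : aproc F H -> 0 <= t -> measurable_fun [set: O] (H t).
Proof. by move=> [h _] t0; apply: (filt_meas hF t0); exact: h. Qed.

Lemma dom_drift n i : dom (drift n i) (dcst om K i ^+ 2).
Proof.
split=> [|t t0|t w t0]; [exact: sqr_ge0|exact (aproc_meas (rm_drift n i) t0)|].
have d0 : 0 <= dcst om K i by rewrite dcst_ge0// (rm_K0 M).
apply: (@le_trans _ _ ((dcst om K i * nrm (x n t w)) ^+ 2)).
 rewrite -real_normK ?num_real// ler_pXn2r ?nnegrE//. by case: M => *; exact: drift_bd.
 by rewrite mulr_ge0// (nrm_ge0 om0)//; exact: (rm_E M).
by rewrite exprMn ler_wpM2l ?sqr_ge0// nrm2_le.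
Qed.

Lemma dom_vol i : dom (vol i) (2 * (kap * (om i)^-1 ^+ 2)).
Proof.
have k0 := rm_kap M.
have c0 : 0 <= kap * (om i)^-1 ^+ 2 by rewrite mulr_ge0// sqr_ge0.
split=> [|t t0|t w t0]; [by rewrite mulr_ge0|exact (aproc_meas (rm_vol i) t0)|].
have h : vol i t w ^+ 2 <= kap * (om i)^-1 ^+ 2 * Yt om x t w ^+ 2 by case: M => *; apply: vol_sqr_bd.
apply: (le_trans h); rewrite (mulrC 2) -(mulrA _ 2); apply: ler_wpM2l => //.
by rewrite mulrDr; exact: sqrD_le2.
Qed.

(** Dominated convergence twice: over the probability space at each fixed time, then over time with
    the uniform second-moment bound. *)
Lemma chi_lim H H' c c' (t : R) : dom H c -> dom H' c' -> 0 <= t <= T%:R ->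
 (forall N, itg mu `[0, t] (fun r => \int[P]_w (chi N r w * (H r w * H' r w)))) ->
 itg mu `[0, t] (fun r => \int[P]_w (H r w * H' r w)) /\
 \iint[P]_(r, w < t) (chi N r w * (H r w * H' r w)) @[N --> \oo] -->
 \iint[P]_(r, w < t) (H r w * H' r w).
Proof.
move=> dH dH' tT iN; have mD := mI `[0, t].
have iHH (r : R) : 0 <= r <= T%:R -> itg P setT (fun w => H r w * H' r w).
 by move=> r0; apply: (L2_mul measurableT); [case: (dom_L2 dH r0)|case: (dom_L2 dH' r0)].
have bd (r : R) : 0 <= r <= T%:R -> \int[P]_w `|H r w * H' r w| <= c * (2 * mcst) + c' * (2 * mcst).
 move=> r0; have [[_ L1] b1] := dom_L2 dH r0; have [[_ L2] b2] := dom_L2 dH' r0.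
 apply: (le_trans _ (lerD b1 b2)); rewrite -(RintegralD measurableT L1 L2).
 apply: (le_Rintegral measurableT (itg_norm measurableT (iHH _ r0)) (itgD measurableT L1 L2)) => w _.
 by rewrite normrM; exact: normM_le_sqrD.
apply: (Rint_dom_cvg mD (g := fun=> c * (2 * mcst) + c' * (2 * mcst))).
- by move=> N; exact (itg_meas (iN N)).
- move=> r /(rT tT) r0; have /andP[r00 _] := r0.
 apply: (proj2 (@Rint_dom_cvg _ _ _ _ _ measurableT _ _ (fun w => `|H r w * H' r w|) _ _ _ _)).
 + by move=> N; apply: measurable_funM; [exact: (chi_meas)|exact (itg_meas (iHH _ r0))].
 + move=> w _; rewrite -[X in _ --> X]mul1r; apply: cvgM; last exact: cvg_cst.
  by apply: (chi_cvg (rm_om M) (rm_E M) (rm_c M)).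
 + exact: (itg_norm measurableT (iHH _ r0)).
 + move=> N w _; rewrite normrM ler_piMl//. by have [->|->] := chi01 om x N r w; rewrite ?normr0 ?normr1.
- by apply: itg_cst => //; exact: fin_itv.
- move=> N r /(rT tT) r0; have /andP[r00 _] := r0; have iH := iHH _ r0.
 have ic : itg P setT (fun w => chi N r w * (H r w * H' r w)).
  apply: (itg_le measurableT _ _ (itg_norm measurableT iH)).
   by apply: measurable_funM; [exact: (chi_meas)|exact (itg_meas iH)].
  move=> w _; rewrite normrM ler_piMl//.
  by have [->|->] := chi01 om x N r w; rewrite ?normr0 ?normr1.
 apply: le_trans (le_normr_Rintegral measurableT ic) _; apply: le_trans (bd r r0).
 apply: (le_Rintegral measurableT (itg_norm measurableT ic) (itg_norm measurableT iH)) => w _.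
 rewrite normrM ler_piMl//.
 by have [->|->] := chi01 om x N r w; rewrite ?normr0 ?normr1.
Qed.

Lemma drift_x_lim n m i j (t : R) : 0 <= t <= T%:R ->
 itg mu `[0, t] (fun r => \int[P]_w (drift n i r w * x m r w j)) /\
 \iint[P]_(r, w < t) (cdrift N n i r w * x m r w j) @[N --> \oo] -->
 \iint[P]_(r, w < t) (drift n i r w * x m r w j).
Proof.
move=> tT.
have E N : (fun r => \int[P]_w (cdrift N n i r w * x m r w j)) =
  (fun r => \int[P]_w (chi N r w * (drift n i r w * x m r w j))).
 by apply/funext => r; apply: eq_mean => w; rewrite /cut_drift mulrA.
have [] := chi_lim (dom_drift n i) (dom_x m j) tT _.
 by move=> N; rewrite -E; case: (exp_drift_cvg N n m i j tT).
move=> h1 h2; split; first exact h1.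
rewrite (funext (fun N => congr1 (fun f => \int[mu]_(r in `[0, t]) f r) (E N))); exact h2.
Qed.

Lemma vol_vol_lim i j (t : R) : 0 <= t <= T%:R ->
 itg mu `[0, t] (fun r => \int[P]_w (vol i r w * vol j r w)) /\
 \iint[P]_(r, w < t) (cvol N i r w * cvol N j r w) @[N --> \oo] -->
 \iint[P]_(r, w < t) (vol i r w * vol j r w).
Proof.
move=> tT.
have E N : (fun r => \int[P]_w (cvol N i r w * cvol N j r w)) =
  (fun r => \int[P]_w (chi N r w * (vol i r w * vol j r w))).
 by apply/funext => r; apply: eq_mean => w; rewrite /cut_vol mulrACA chiM.
have [] := chi_lim (dom_vol i) (dom_vol j) tT _.
 by move=> N; rewrite -E; case: (tint_exp P hF (bproc_mul hF (rm_cvol N i) (rm_cvol N j)) tT).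
move=> h1 h2; split; first exact h1.
rewrite (funext (fun N => congr1 (fun f => \int[mu]_(r in `[0, t]) f r) (E N))); exact h2.
Qed.

Lemma drift_drift_lim n i (t : R) : 0 <= t <= T%:R ->
 itg mu `[0, t] (fun r => \int[P]_w (drift n i r w * drift n i r w)) /\
 \iint[P]_(r, w < t) (cdrift N n i r w * cdrift N n i r w) @[N --> \oo] -->
 \iint[P]_(r, w < t) (drift n i r w * drift n i r w).
Proof.
move=> tT.
have E N : (fun r => \int[P]_w (cdrift N n i r w * cdrift N n i r w)) =
  (fun r => \int[P]_w (chi N r w * (drift n i r w * drift n i r w))).
 by apply/funext => r; apply: eq_mean => w; rewrite /cut_drift mulrACA chiM.
have [] := chi_lim (dom_drift n i) (dom_drift n i) tT _.
 by move=> N; rewrite -E; case: (tint_exp P hF (bproc_mul hF (rm_cdrift N n i) (rm_cdrift N n i)) tT).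
move=> h1 h2; split; first exact h1.
rewrite (funext (fun N => congr1 (fun f => \int[mu]_(r in `[0, t]) f r) (E N))); exact h2.
Qed.

Let mc := mcst.

Let xL2 n i (t : R) : 0 <= t <= T%:R -> L2 P setT (fun w => x n t w i).
Proof. by move=> tT; case: (dom_L2 (dom_x n i) tT). Qed.

Let osc N i k (t : R) := \iint[P]_(r, w < t) ((cvol N i (gfl k r) w - cvol N i r w) ^+ 2).
Let dN N n i (t : R) := \iint[P]_(r, w < t) (drift n i r w * drift n i r w) -
 \iint[P]_(r, w < t) (cdrift N n i r w * cdrift N n i r w).
Let vN N i (t : R) := \iint[P]_(r, w < t) (vol i r w * vol i r w) -
 \iint[P]_(r, w < t) (cvol N i r w * cvol N i r w).

(** The mean-square distance has three sources: drift lost by truncation, oscillation of the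
    volatility over the dyadic cells, and volatility lost by truncation. The factors 2 come from
    (a+b)^2 <= 2a^2 + 2b^2. *)
Let Bnd N k n i (t : R) := 2 * (t * dN N n i t) + 2 * (2 * osc N i k t + 2 * vN N i t).

Lemma chi_mono_diff N N' H (t : R) : (N <= N')%N -> 0 <= t ->
 forall w, (chi N t w * H - chi N' t w * H) ^+ 2 = chi N' t w * H * (chi N' t w * H) - chi N t w * H * (chi N t w * H) :> R.
Proof.
move=> NN t0 w; have := chi_incr om x t w NN.
have [->|->] := chi01 om x N t w; have [->|->] := chi01 om x N' t w => h; try ring.
by move: h; rewrite ler10.
Qed.

(** The truncation events are nested, so the square of the difference of two cut coefficients is the
    difference of their squares, which is controlled by the limit. *)
Lemma stop_diff_le (c : nat -> R -> O -> R) (H : R -> O -> R) (C : nat -> R) N N' (t : R) :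
 (forall N t w, c N t w = chi N t w * H t w) ->
 (forall N, bproc F T (c N) (C N)) -> (N <= N')%N -> 0 <= t <= T%:R ->
 \iint[P]_(r, w < t) (c N' r w * c N' r w) <=
  \iint[P]_(r, w < t) (H r w * H r w) ->
 \iint[P]_(r, w < t) ((c N r w - c N' r w) ^+ 2) <=
 \iint[P]_(r, w < t) (H r w * H r w) -
 \iint[P]_(r, w < t) (c N r w * c N r w).
Proof.
move=> cE bc NN tT hle; have mD := mI `[0, t].
have ic L := tint_exp P hF (bproc_mul hF (bc L) (bc L)) tT.
apply: le_trans (lerB hle (lexx _)); rewrite -(RintegralB mD (proj1 (ic N')) (proj1 (ic N))).
apply: eq_ler; apply: Rint_ext => r.
rewrite /= in_itv/= => /andP[r0 rt].
have r0T : 0 <= r <= T%:R by rewrite r0 (le_trans rt)//; case/andP: tT.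
have Lc L : L2 P setT (c L r) := bproc_L2 P hF (bc L) r0T.
rewrite -(RintegralB measurableT (L2_mul measurableT (Lc N') (Lc N')) (L2_mul measurableT (Lc N) (Lc N))).
by apply: eq_mean => w; rewrite !cE; exact: chi_mono_diff.
Qed.

Lemma stop_sqr_le (c : nat -> R -> O -> R) (H : R -> O -> R) (C : nat -> R) N (t : R) :
 (forall N t w, c N t w = chi N t w * H t w) ->
 (forall N, bproc F T (c N) (C N)) -> 0 <= t <= T%:R ->
 itg mu `[0, t] (fun r => \int[P]_w (H r w * H r w)) ->
 (forall r, 0 <= r <= T%:R -> L2 P setT (H r)) ->
 \iint[P]_(r, w < t) (c N r w * c N r w) <=
  \iint[P]_(r, w < t) (H r w * H r w).
Proof.
move=> cE bc tT iH LH; have mD := mI `[0, t].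
have ic L := tint_exp P hF (bproc_mul hF (bc L) (bc L)) tT.
apply: (le_Rintegral mD (proj1 (ic N)) iH) => r.
rewrite /= in_itv/= => /andP[r0 rt].
have r0T : 0 <= r <= T%:R by rewrite r0 (le_trans rt)//; case/andP: tT.
have Lc : L2 P setT (c N r) := bproc_L2 P hF (bc N) r0T.
apply: (le_Rintegral measurableT (L2_mul measurableT Lc Lc) (L2_mul measurableT (LH r r0T) (LH r r0T))) => w _.
rewrite !cE mulrACA chiM ler_piMl ?chi_le1//.
by rewrite -expr2 sqr_ge0.
Qed.

(** Refining the coarse sum to level k' makes the difference of the two approximations one simple
    Ito process, whose integrand is a frozen minus an unfrozen volatility. The isometry bounds it;
    only the limit as k' grows is compared with [Bnd], because at level k' the integrand is itself
    sampled on the grid. *)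
Lemma Sx_diff_cvg N N' k n i (t : R) : (N <= N')%N -> 0 <= t <= T%:R ->
 exists2 E : nat -> R,
  (forall k', (k <= k')%N -> \int[P]_w ((Sx N k n i t w - Sx N' k' n i t w) ^+ 2) <= E k') &
  exists2 l, E k' @[k' --> \oo] --> l & l <= Bnd N k n i t.
Proof.
move=> NN tT; have /andP[t0 tT'] := tT.
have mD := mI `[0, t].
pose D r w := cdrift N n i r w - cdrift N' n i r w.
pose H r w := cvol N i (gfl k r) w - cvol N' i r w.
have bD := bprocB hF (rm_cdrift N n i) (rm_cdrift N' n i).
have bv L := rm_cvol L i.
have bH := bprocB hF (bproc_gfl hF k (bv N)) (bv N').
have bHH := bproc_mul hF bH bH.
have hbr1 (s : R) : 0 <= s -> is_bracket P (W n i) (W n i) s (fun=> 1 * s).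
 by move=> s0; have := rm_br M n n i i s0; rewrite /cc !eqxx.
exists (fun k' => 2 * (t * \iint[P]_(r, w < t) (D r w ^+ 2)) +
  2 * \iint[P]_(r, w < t) (H (gfl k' r) w * H (gfl k' r) w)).
 move=> k' kk'.
 have E w : Sx N k n i t w - Sx N' k' n i t w = tint D t w + SI T k' H (W n i) t w.
  rewrite /cut_sol /simp (SI_refine _ _ _ kk' tT) -SI_sub.
  have -> : tint D t w = tint (cdrift N n i) t w - tint (cdrift N' n i) t w.
   rewrite /tint -(RintegralB mD)//; first exact: (bproc_path_itg w (rm_cdrift N n i) tT).
   exact: (bproc_path_itg w (rm_cdrift N' n i) tT).
  by ring.
 have LD := tint_L2 P hF bD tT; have LS := SI_L2 hF k' bH (rm_W M n i) tT.
 rewrite (_ : \int[P]_w _ = \int[P]_w ((tint D t w + SI T k' H (W n i) t w) ^+ 2)); last first.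
  by apply: eq_mean => w; rewrite E.
 apply: le_trans (L2_sqrD_le measurableT LD LS) _.
 apply: lerD; rewrite ler_pM2l//; first exact: (tint_sqr_le P hF bD tT).
 rewrite -[leRHS]mul1r -(SI_isom hF k' bH bH (rm_W M n i) (rm_W M n i) hbr1 tT).
 by apply: eq_ler; apply: eq_mean => w; rewrite expr2.
exists (2 * (t * \iint[P]_(r, w < t) (D r w ^+ 2)) +
  2 * \iint[P]_(r, w < t) (H r w * H r w)).
 apply: cvgD; first exact: cvg_cst.
 by apply: cvgMl_tmp; exact (exp_gfl_cvg hF bHH tT).
have LH r : 0 <= r <= T%:R -> L2 P setT (vol i r) by move=> rT'; case: (dom_L2 (dom_vol i) rT').
have LDr r : 0 <= r <= T%:R -> L2 P setT (drift n i r) by move=> rT'; case: (dom_L2 (dom_drift n i) rT').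
apply: lerD; rewrite ler_pM2l//.
 apply: ler_wpM2l => //.
 apply: (stop_diff_le (c := fun L => cdrift L n i) (H := drift n i) (fun _ _ _ => erefl) (fun L => rm_cdrift L n i) NN tT).
 apply: (stop_sqr_le (c := fun L => cdrift L n i) (H := drift n i) N' (fun _ _ _ => erefl) (fun L => rm_cdrift L n i) tT _ LDr).
 by case: (drift_drift_lim n i tT).
have bo := bprocB hF (bproc_gfl hF k (bv N)) (bv N); have bd := bprocB hF (bv N) (bv N').
have [i1 _] := tint_exp P hF (bproc_mul hF bo bo) tT.
have [i2 _] := tint_exp P hF (bproc_mul hF bd bd) tT.
have [i3 _] := tint_exp P hF bHH tT.
apply: (@le_trans _ _ (\int[mu]_(r in `[0, t]) (2 * \int[P]_w ((cvol N i (gfl k r) w - cvol N i r w) * (cvol N i (gfl k r) w - cvol N i r w))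
  + 2 * \int[P]_w ((cvol N i r w - cvol N' i r w) * (cvol N i r w - cvol N' i r w))))).
 apply: (le_Rintegral mD i3 (itgD mD (itgZ mD 2 i1) (itgZ mD 2 i2))) => r.
 rewrite /= in_itv/= => /andP[r0 rt].
 have r0T : 0 <= r <= T%:R by rewrite r0 (le_trans rt).
 have L1 := bproc_L2 P hF bo r0T; have L2' := bproc_L2 P hF bd r0T.
 have := L2_sqrD_le measurableT L1 L2'.
 rewrite !(@Rint_ext _ _ R P _ _ _ (fun w _ => expr2 _)); apply: le_trans.
 by apply: eq_ler; apply: eq_mean => w; rewrite /H; ring.
rewrite (RintegralD mD (itgZ mD 2 i1) (itgZ mD 2 i2)) (RintegralZl _ mD i1) (RintegralZl _ mD i2).
apply: lerD; rewrite ler_pM2l//.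
apply: (@le_trans _ _ (\iint[P]_(r, w < t) ((cvol N i r w - cvol N' i r w) ^+ 2))).
 apply: eq_ler; apply: Rint_ext => r _.
 by apply: eq_mean => w; rewrite expr2.
apply: (stop_diff_le (c := fun L => cvol L i) (H := vol i) (fun _ _ _ => erefl) (fun L => rm_cvol L i) NN tT).
apply: (stop_sqr_le (c := fun L => cvol L i) (H := vol i) N' (fun _ _ _ => erefl) (fun L => rm_cvol L i) tT _ LH).
by case: (vol_vol_lim i i tT).
Qed.

Lemma young_half (b d : R) : b * d <= b ^+ 2 / 2 + d ^+ 2 / 2.
Proof. by have := sqr_ge0 (b - d); nra. Qed.

(** Weak convergence of the finer approximations to the solution is known against bounded variables
    on the truncation event. The error V, cut off in size and restricted to that event, serves as
    its own test variable Z, with Z^2 = Z V; Young's inequality gives E[Z^2] <= E[Z^2]/2 plus half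
    the bound of [Sx_diff_cvg]. Removing the cutoffs concludes. *)
Lemma Sx_dist_le N k n i (t : R) : 0 <= t <= T%:R ->
 \int[P]_w ((Sx N k n i t w - x n t w i) ^+ 2) <= Bnd N k n i t.
Proof.
move=> tT; have /andP[t0 tT'] := tT.
have LS L l := Sx_L2 L l n i tT; have Lx := xL2 n i tT.
have LV : L2 P setT (fun w => Sx N k n i t w - x n t w i) by apply: (L2B measurableT).
have [mV iV] := LV.
(* test against bounded variables vanishing off [chi N' = 1] *)
have key N' m : (N <= N')%N ->
 \int[P]_w (chi N' t w * ((Sx N k n i t w - x n t w i) ^+ 2) *
   (if `|Sx N k n i t w - x n t w i| <= m%:R then 1 else 0)) <= Bnd N k n i t.
 move=> NN; pose V w := Sx N k n i t w - x n t w i.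
 pose I w : R := if `|V w| <= m%:R then 1 else 0.
 pose Z w := chi N' t w * V w * I w.
 have mI : measurable_fun [set: O] I.
  have mb : measurable_fun [set: O] (fun w => `|V w| <= m%:R).
   by apply: measurable_fun_ler => //; exact: measurableT_comp.
  exact: measurable_fun_ifT.
 have mZ : measurable_fun [set: O] Z by apply: measurable_funM => //; apply: measurable_funM => //; exact: (chi_meas).
 have Zm w : `|Z w| <= m%:R.
  rewrite /Z /I; case: (boolP (`|V w| <= m%:R)) => h; last by rewrite mulr0 normr0.
  rewrite mulr1; have [->|->] := chi01 om x N' t w; first by rewrite mul0r normr0.
  by rewrite mul1r.
 have Z0 w : chi N' t w <> 1 -> Z w = 0 by move=> c1; have [c0|//] := chi01 om x N' t w; rewrite /Z c0 !mul0r.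
 have LZ : L2 P setT Z by apply: (@L2_bd _ _ _ _ _ measurableT LP _ m%:R).
 have ZV w : chi N' t w * V w ^+ 2 * I w = Z w * V w by rewrite /Z; ring.
 have ZZ w : Z w ^+ 2 = Z w * V w.
  rewrite /Z /I; have [->|->] := chi01 om x N' t w; case: (_ <= _); rewrite ?mul0r ?mulr0 ?mul1r ?mulr1; ring.
 have -> : \int[P]_w (chi N' t w * V w ^+ 2 * I w) = \int[P]_w (Z w * V w) by apply: eq_mean => w.
 have [E hE [l El lB]] := Sx_diff_cvg k n i NN tT.
 have h k' : \int[P]_w (Z w * (Sx N k n i t w - Sx N' k' n i t w)) =
   \int[P]_w (Z w * Sx N k n i t w) - \int[P]_w (Z w * Sx N' k' n i t w).
  rewrite -(RintegralB measurableT (L2_mul measurableT LZ (LS N k)) (L2_mul measurableT LZ (LS N' k'))).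
  by apply: eq_mean => w; rewrite mulrBr.
 have c1 : \int[P]_w (Z w * (Sx N k n i t w - Sx N' k' n i t w)) @[k' --> \oo] --> \int[P]_w (Z w * V w).
  have -> : \int[P]_w (Z w * V w) = \int[P]_w (Z w * Sx N k n i t w) - \int[P]_w (Z w * x n t w i).
   rewrite -(RintegralB measurableT (L2_mul measurableT LZ (LS N k)) (L2_mul measurableT LZ Lx)).
   by apply: eq_mean => w; rewrite mulrBr.
  rewrite (funext h); apply: cvgB; first exact: cvg_cst.
  exact (Sx_weak tT mZ Zm Z0).
 pose q := \int[P]_w (Z w * V w).
 have qE : \int[P]_w (Z w ^+ 2) = q by apply: eq_mean => w.
 suff : q <= q / 2 + l / 2. move=> qq; apply: le_trans lB; move: qq; rewrite -/q; lra.
 have c2 : q / 2 + E k' / 2 @[k' --> \oo] --> q / 2 + l / 2 by apply: cvgD; [exact: cvg_cst|apply: cvgMr_tmp; exact El].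
 rewrite -subr_ge0; apply: (cvg_to_ge _ (cvgB c2 c1)); exists k => // k' /= kk'.
 rewrite subr_ge0; have LD := L2B measurableT (LS N k) (LS N' k').
 have := hE k' kk'; have [_ iZ] := LZ; have [_ iD] := LD => hEk.
 apply: (@le_trans _ _ (q / 2 + \int[P]_w ((Sx N k n i t w - Sx N' k' n i t w) ^+ 2) / 2)); last first.
  by rewrite lerD2l ler_pM2r ?invr_gt0.
 rewrite -qE -(RintegralZr _ measurableT iZ) -(RintegralZr _ measurableT iD).
 rewrite -(RintegralD measurableT (itgZr measurableT _ iZ) (itgZr measurableT _ iD)).
 apply: (le_Rintegral measurableT (L2_mul measurableT LZ LD) (itgD measurableT (itgZr measurableT _ iZ) (itgZr measurableT _ iD))).
 move=> w _; exact: young_half.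
have c1 : \int[P]_w (chi N' t w * ((Sx N k n i t w - x n t w i) ^+ 2) *
   (if `|Sx N k n i t w - x n t w i| <= N'%:R then 1 else 0)) @[N' --> \oo] --> \int[P]_w ((Sx N k n i t w - x n t w i) ^+ 2).
 apply: (proj2 (@Rint_dom_cvg _ _ _ _ _ measurableT _ _ (fun w => (Sx N k n i t w - x n t w i) ^+ 2) _ _ _ _)) => //.
 - move=> N'; apply: measurable_funM; first by apply: measurable_funM; [exact: (chi_meas)|exact: measurable_funX].
  have mb : measurable_fun [set: O] (fun w => `|Sx N k n i t w - x n t w i| <= N'%:R).
   by apply: measurable_fun_ler => //; exact: measurableT_comp.
  exact: measurable_fun_ifT.
 - move=> w _; set V := Sx N k n i t w - x n t w i.
  have [N0 hN0] := chi_cvg1 (rm_om M) (rm_E M) (rm_c M) w t0.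
  apply: cvg_near_cst; exists (maxn N0 (Num.bound `|V|)) => // N' /=; rewrite geq_max => /andP[NN1 NN2].
  rewrite hN0// mul1r ifT ?mulr1//.
  apply: (@le_trans _ _ (Num.bound `|V|)%:R); last by rewrite ler_nat.
  by apply: ltW; apply: archi_boundP.
 - move=> N' w _; have V0 := sqr_ge0 (Sx N k n i t w - x n t w i).
  have [->|->] := chi01 om x N' t w; case: ifP => _; rewrite ?mul0r ?mulr0 ?mul1r ?mulr1 ?normr0//.
  by rewrite ger0_norm.
apply: (cvg_to_le _ c1); exists N => // N' /= NN; exact: key.
Qed.

Lemma dN_cvg n i (t : R) : 0 <= t <= T%:R -> dN N n i t @[N --> \oo] --> (0 : R).
Proof.
move=> tT; have [_ h] := drift_drift_lim n i tT.
rewrite /dN -[X in _ --> X](subrr (\iint[P]_(r, w < t) (drift n i r w * drift n i r w))).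
by apply: cvgB; [exact: cvg_cst|exact h].
Qed.

Lemma vN_cvg i (t : R) : 0 <= t <= T%:R -> vN N i t @[N --> \oo] --> (0 : R).
Proof.
move=> tT; have [_ h] := vol_vol_lim i i tT.
rewrite /vN -[X in _ --> X](subrr (\iint[P]_(r, w < t) (vol i r w * vol i r w))).
by apply: cvgB; [exact: cvg_cst|exact h].
Qed.

(** For each [N] a dyadic level is chosen at which the oscillations and the distance of the product
    mean to [Kval] are at most 2^-N. Along this diagonal sequence the approximations converge in
    mean square to the coordinates, while [Kval] converges to the right-hand side. *)
Lemma moment_eq n m i j (t : R) : 0 <= t <= T%:R ->
 \int[P]_w (x n t w i * x m t w j) =
 1 + \iint[P]_(r, w < t) (drift n i r w * x m r w j)
  + \iint[P]_(r, w < t) (drift m j r w * x n r w i)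
  + cc rho n m i j * \iint[P]_(r, w < t) (vol i r w * vol j r w).
Proof.
move=> tT.
have small (f : nat -> R) (l e : R) : f k @[k --> \oo] --> l -> 0 < e ->
  exists k0, forall k, (k0 <= k)%N -> `|f k - l| <= e.
 by move=> fl e0; move/cvgn_eps: fl => /(_ e e0).
have ex N : exists k, [/\ osc N i k t <= 2 ^- N, osc N j k t <= 2 ^- N &
  `|\int[P]_w (Sx N k n i t w * Sx N k m j t w) - Kval N n m i j t| <= 2 ^- N].
 have e0 : 0 < 2 ^- N :> R by rewrite invr_gt0 exprn_gt0.
 have [k1 h1] := small _ _ _ (gfl_osc_cvg P hF (rm_cvol N i) tT) e0.
 have [k2 h2] := small _ _ _ (gfl_osc_cvg P hF (rm_cvol N j) tT) e0.
 have [k3 h3] := small _ _ _ (Sx_prod_cvg (N := N) (n := n) (m := m) (i := i) (j := j) tT) e0.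
 exists (maxn k1 (maxn k2 k3)); split.
 - by have := h1 _ (leq_maxl k1 (maxn k2 k3)); rewrite subr0; apply: le_trans; exact: ler_norm.
 - have := h2 (maxn k1 (maxn k2 k3)); rewrite leq_max leq_maxl orbT => /(_ isT).
  by rewrite subr0; apply: le_trans; exact: ler_norm.
 - by apply: h3; rewrite !leq_max leqnn !orbT.
have [k hk] := choice ex.
have c2 : (2 ^- N : R) @[N --> \oo] --> (0 : R) by exact: cvg_exp2V.
have B0 n' i' : (forall N, osc N i' (k N) t <= 2 ^- N) ->
  \int[P]_w ((Sx N (k N) n' i' t w - x n' t w i') ^+ 2) @[N --> \oo] --> (0 : R).
 move=> ho; apply: (@cvgn_dist_le _ _ (fun N => 2 * (t * dN N n' i' t) + 2 * (2 * 2 ^- N + 2 * vN N i' t))).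
  move=> N; rewrite subr0 ger0_norm ?L2_sqr_ge0//; apply: (le_trans (Sx_dist_le N (k N) n' i' tT)).
  by rewrite /Bnd lerD2l ler_pM2l// lerD2r ler_pM2l.
 rewrite -[X in _ --> X](_ : 2 * (t * 0) + 2 * (2 * 0 + 2 * 0) = 0); last by rewrite !mulr0 addr0 mulr0 addr0.
 apply: cvgD; first by do 2 apply: cvgMl_tmp; exact (dN_cvg _ _ tT).
 by apply: cvgMl_tmp; apply: cvgD; apply: cvgMl_tmp; [exact c2|exact (vN_cvg _ tT)].
have h1 := B0 n i (fun N => let: And3 a _ _ := hk N in a).
have h2 := B0 m j (fun N => let: And3 _ a _ := hk N in a).
have cP := L2_prod_cvg (fun N => Sx_L2 N (k N) n i tT) (fun N => Sx_L2 N (k N) m j tT) (xL2 n i tT) (xL2 m j tT) h1 h2.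
apply: (cvg_uniq _ cP).
have cK : Kval N n m i j t @[N --> \oo] -->
 1 + \iint[P]_(r, w < t) (drift n i r w * x m r w j)
  + \iint[P]_(r, w < t) (drift m j r w * x n r w i)
  + cc rho n m i j * \iint[P]_(r, w < t) (vol i r w * vol j r w).
 apply: cvgD; last by apply: cvgMl_tmp; case: (vol_vol_lim i j tT) => _ h; exact h.
 apply: cvgD; last by case: (drift_x_lim m n j i tT) => _ h; exact h.
 by apply: cvgD; [exact: cvg_cst|case: (drift_x_lim n m i j tT) => _ h; exact h].
have cd : \int[P]_w (Sx N (k N) n i t w * Sx N (k N) m j t w) - Kval N n m i j t @[N --> \oo] --> (0 : R).
 by apply: (@cvgn_dist_le _ _ (fun N => 2 ^- N)) => // N; rewrite subr0; case: (hk N).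
exact (cvg_sub0 cd cK).
Qed.

(** * Mixed moments and their mild equation *)

Definition Mom n m i j (t : R) := \int[P]_w (x n t w i * x m t w j).

Lemma Mom_ge0 n m i j (t : R) : 0 <= t -> 0 <= Mom n m i j t.
Proof.
move=> t0; apply: Rintegral_ge0 => w _; apply: mulr_ge0. by case: (rm_E M n w t0).
by case: (rm_E M m w t0).
Qed.

Lemma Mom_itg n m i j (t : R) : 0 <= t <= T%:R -> itg mu `[0, t] (Mom n m i j).
Proof.
move=> tT; case: (chi_lim (dom_x n i) (dom_x m j) tT _) => // N.
have E : (fun r => \int[P]_w (chi N r w * x n r w i * (chi N r w * x m r w j))) =
  (fun r => \int[P]_w (chi N r w * (x n r w i * x m r w j))).
 by apply/funext => r; apply: eq_mean => w; rewrite mulrACA chiM.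
by rewrite -E; case: (tint_exp P hF (bproc_mul hF (rm_cx N n i) (rm_cx N m j)) tT).
Qed.

Lemma psum_Mom n m L (t : R) : 0 <= t <= T%:R ->
 (\S2_(i, j < L) om i * om j * Mom n m i j t) <= mc + mc.
Proof.
move=> tT; have /andP[t0 _] := tT.
have ixx i j : itg P setT (fun w => x n t w i * x m t w j) by apply: (L2_mul measurableT); exact: xL2.
have -> : (\S2_(i, j < L) om i * om j * Mom n m i j t) =
 \int[P]_w (\S2_(i, j < L) om i * om j * (x n t w i * x m t w j)).
 rewrite (Rint_psum measurableT) => [|i]; last by apply: itg_psum => // j; exact: itgZ.
 apply: eq_psum => i; rewrite (Rint_psum measurableT) => [|j]; last exact: itgZ.
 by apply: eq_psum => j; rewrite (RintegralZl _ measurableT (ixx i j)).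
have [i0 b0] := nrm2_bd n tT; have [i1 b1] := nrm2_bd m tT.
apply: le_trans (lerD b0 b1); rewrite -(RintegralD measurableT i0 i1).
apply: (le_Rintegral measurableT _ (itgD measurableT i0 i1)).
 by apply: itg_psum => // i; apply: itg_psum => // j; exact: itgZ.
move=> w _; have E0 := rm_E M n w t0; have E1 := rm_E M m w t0.
have n0 := nrm_ge0 (rm_om M) E0; have n1 := nrm_ge0 (rm_om M) E1.
have p0 k : 0 <= psum (fun i => om i * x k t w i) L by apply: psum_ge0 => i; rewrite mulr_ge0//; case: (rm_E M k w t0).
apply: (@le_trans _ _ (psum (fun i => om i * x n t w i) L * psum (fun i => om i * x m t w i) L)).
 rewrite psum_mul; apply: eq_ler; apply: eq_psum => i.
 by apply: eq_psum => j; ring.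
apply: (@le_trans _ _ (nrm (x n t w) * nrm (x m t w))). by apply: ler_pM => //; exact: (psum_nrm (rm_om M)).
by have := normM_le_sqrD (nrm (x n t w)) (nrm (x m t w)); rewrite !ger0_norm.
Qed.

Lemma exp_Tm n m i j (t : R) : 0 <= t <= T%:R ->
 sm (fun k => a i k * Mom n m k j t) /\
 \int[P]_w (drift n i t w * x m t w j) = ssum (fun k => a i k * Mom n m k j t) - Mom n m i j t.
Proof.
move=> tT; have /andP[t0 _] := tT.
have ixx k : itg P setT (fun w => x n t w k * x m t w j) by apply: (L2_mul measurableT); exact: xL2.
have x0 p w k : 0 <= x p t w k by case: (rm_E M p w t0).
have sa w := a_sm (rm_om M) (rm_a M) (rm_K0 M) (rm_K M) i (rm_E M n w t0).
have iT : itg P setT (fun w => Tm a (x n t w) i * x m t w j).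
 have iD : itg P setT (fun w => drift n i t w * x m t w j).
  by apply: (L2_mul measurableT); [case: (dom_L2 (dom_drift n i) tT)|exact: xL2].
 apply: (eq_itg measurableT _ (itgD measurableT iD (ixx i))) => w _; rewrite /site_drift; ring.
have E L : \int[P]_w (psum (fun k => a i k * (x n t w k * x m t w j)) L) = psum (fun k => a i k * Mom n m k j t) L.
 rewrite (Rint_psum measurableT) => [|k]; last exact: itgZ.
 by apply: eq_psum => k; rewrite (RintegralZl _ measurableT (ixx k)).
have pE w L : psum (fun k => a i k * (x n t w k * x m t w j)) L = psum (fun k => a i k * x n t w k) L * x m t w j.
 by rewrite -psumZr; apply: eq_psum => k; rewrite mulrA.
have ip L : itg P setT (fun w => psum (fun k => a i k * (x n t w k * x m t w j)) L).
 by apply: itg_psum => // k; exact: itgZ.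
have bd L : \int[P]_w (psum (fun k => a i k * (x n t w k * x m t w j)) L) <= \int[P]_w (Tm a (x n t w) i * x m t w j).
 apply: (le_Rintegral measurableT (ip L) iT) => w _; rewrite pE; apply: ler_wpM2r => //.
 by apply: psum_le_ssum (sa w) => k; rewrite mulr_ge0// (rm_a M).
have s1 : sm (fun k => a i k * Mom n m k j t).
 apply: (ge0_sm (B := \int[P]_w (Tm a (x n t w) i * x m t w j))).
  by move=> k; rewrite mulr_ge0 ?Mom_ge0// (rm_a M).
 by move=> L; rewrite -E; exact: bd.
split => //.
have -> : \int[P]_w (drift n i t w * x m t w j) = \int[P]_w (Tm a (x n t w) i * x m t w j) - Mom n m i j t.
 rewrite /Mom -(RintegralB measurableT iT (ixx i)); apply: eq_mean => w.
 by rewrite /site_drift; ring.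
congr (_ - _); apply/esym; apply: ssum_uniq => //.
rewrite -(funext E).
have [|||_ h] := @Rint_mono_cvg _ _ _ P setT measurableT (fun L w => psum (fun k => a i k * (x n t w k * x m t w j)) L)
  (fun w => Tm a (x n t w) i * x m t w j) _ ip _ _ _ bd.
- by move=> L w _; apply: psum_ge0 => k; rewrite !mulr_ge0// (rm_a M).
- by move=> w _; apply: psum_homo => k; rewrite !mulr_ge0// (rm_a M).
- move=> w _; rewrite (funext (pE w)); apply: cvgM; last exact: cvg_cst. exact: psum_cvg.
exact h.
Qed.

(** Integrating factor: expanding the product of the integral forms of exp(2t) and of [f] by
    integration by parts cancels the term -2f. The rate 2 is the total jump rate of two walkers. *)
Lemma mild_form (f h : R -> R) (t : R) : 0 <= t ->
 itg mu `[0, t] f -> itg mu `[0, t] h ->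
 (forall s, 0 <= s <= t -> f s = 1 + \int[mu]_(r in `[0, s]) (h r - 2 * f r)) ->
 itg mu `[0, t] (fun s => expR (2 * s) * h s) /\
 expR (2 * t) * f t = 1 + \int[mu]_(s in `[0, t]) (expR (2 * s) * h s).
Proof.
move=> t0 i_f i_h fE; have mD := mI `[0, t].
have ie := exp_itg 2 t.
have iM (q : R -> R) : itg mu `[0, t] q -> itg mu `[0, t] (fun s => expR (2 * s) * q s).
 move=> iq; apply: (itg_le mD _ _ (itgZ mD (expR (2 * t)) (itg_norm mD iq))).
  by apply: measurable_funM; [exact (itg_meas ie)|exact (itg_meas iq)].
 move=> s; rewrite /= in_itv/= => /andP[s0 st].
 by rewrite normrM ler_wpM2r// ger0_norm ?expR_ge0// ler_expR ler_pM2l.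
split; first exact: iM.
pose g (s : R) := h s - 2 * f s; pose k (s : R) := 2 * expR (2 * s).
have ig : itg mu `[0, t] g by apply: itgB => //; exact: itgZ.
have ik : itg mu `[0, t] k by exact: itgZ.
have Ek s : 0 <= s -> expR (2 * s) = 1 + \int[mu]_(r in `[0, s]) k r.
 move=> s0; rewrite /k (RintegralZl _ _ (exp_itg 2 s)); last exact: measurable_itv.
 by rewrite (Rint_exp 2 s0) addrCA subrr addr0.
have t0t : 0 <= t <= t by rewrite t0 lexx.
have [j1 _] := triangle_fubini t0 ig ik; have [j2 _] := triangle_fubini t0 ik ig.
rewrite (Ek t t0) (fE t t0t) -/g.
have -> : (1 + \int[mu]_(r in `[0, t]) k r) * (1 + \int[mu]_(r in `[0, t]) g r) =
 1 + (\int[mu]_(r in `[0, t]) g r + \int[mu]_(r in `[0, t]) k r +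
 \int[mu]_(r in `[0, t]) g r * \int[mu]_(r in `[0, t]) k r) by ring.
rewrite (Rint_prod t0 ig ik) -(RintegralD mD j1 j2) -(RintegralD mD ig ik).
rewrite -(RintegralD mD (itgD mD ig ik) (itgD mD j1 j2)); congr (1 + _).
apply: Rint_ext => s; rewrite /= in_itv/= => /andP[s0 st].
have st' : 0 <= s <= t by rewrite s0.
have h1 := Ek s s0; have h2 := fE s st'.
transitivity (g s * (1 + \int[mu]_(r in `[0, s]) k r) + k s * (1 + \int[mu]_(r in `[0, s]) g r)); first by ring.
by rewrite -h1 -h2 /g /k; ring.
Qed.

(** The right-hand side of the moment equation without its term -2 Mom. All second moments share the
    diagonal source, which involves the moment of u v at one site. *)
Definition mgen n m i j (s : R) := ssum (fun k => a i k * Mom n m k j s) +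
  ssum (fun k => a j k * Mom n m i k s) + (if i == j then (if n == m then kap else kap * rho) * Mom ord0 ord_max i i s else 0).

Lemma moment_mild n m i j (t : R) : 0 <= t <= T%:R ->
 itg mu `[0, t] (fun s => expR (2 * s) * mgen n m i j s) /\
 expR (2 * t) * Mom n m i j t = 1 + \int[mu]_(s in `[0, t]) (expR (2 * s) * mgen n m i j s).
Proof.
move=> tT; have /andP[t0 tT'] := tT.
have MomC p q k l s : Mom p q k l s = Mom q p l k s by apply: eq_mean => w; rewrite mulrC.
have g1 s : 0 <= s <= T%:R -> mgen n m i j s - 2 * Mom n m i j s =
  \int[P]_w (drift n i s w * x m s w j) + \int[P]_w (drift m j s w * x n s w i)
  + cc rho n m i j * \int[P]_w (vol i s w * vol j s w).
 move=> sT; have /andP[s0 _] := sT.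
 have [_ ->] := exp_Tm n m i j sT; have [_ ->] := exp_Tm m n j i sT.
 rewrite /mgen (MomC m n j i).
 rewrite (eq_ssum (f := fun k => a j k * Mom m n k i s) (g := fun k => a j k * Mom n m i k s)); last first.
  by move=> k; rewrite (MomC m n).
 have -> : cc rho n m i j * \int[P]_w (vol i s w * vol j s w) =
   (if i == j then (if n == m then kap else kap * rho) * Mom ord0 ord_max i i s else 0).
  rewrite /cc; case: eqP => [<-|_]; last by rewrite mul0r.
  have -> : \int[P]_w (vol i s w * vol i s w) = kap * Mom ord0 ord_max i i s.
   have ixx : itg P setT (fun w => x ord0 s w i * x ord_max s w i) by apply: (L2_mul measurableT); exact: xL2.
   rewrite /Mom -(RintegralZl _ measurableT ixx); apply: eq_mean => w.
   by rewrite -expr2 (rm_vol_sqr)// mulrA.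
  by case: eqP => _; ring.
 by ring.
have i1 := proj1 (drift_x_lim n m i j tT); have i2 := proj1 (drift_x_lim m n j i tT).
have i3 := proj1 (vol_vol_lim i j tT); have iM := Mom_itg n m i j tT.
have mD := mI `[0, t].
have hr r : `[0, t]%classic r -> 0 <= r <= T%:R by rewrite /= in_itv/= => /andP[-> /le_trans->].
have i4 := itgD mD (itgD mD i1 i2) (itgZ mD (cc rho n m i j) i3).
have ig : itg mu `[0, t] (mgen n m i j).
 apply: (eq_itg mD _ (itgD mD i4 (itgZ mD 2 iM))) => r /hr r0T.
 by rewrite -(g1 r r0T) subrK.
apply: mild_form => // s sT'; have sT : 0 <= s <= T%:R by have /andP[-> /le_trans->] := sT'.
rewrite {1}/Mom (moment_eq n m i j sT).
have mDs := mI `[0, s].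
have i1s := proj1 (drift_x_lim n m i j sT); have i2s := proj1 (drift_x_lim m n j i sT).
have i3s := proj1 (vol_vol_lim i j sT).
rewrite -(RintegralZl _ mDs i3s) -!addrA; congr (1 + _).
rewrite -(RintegralD mDs i2s (itgZ mDs _ i3s)) -(RintegralD mDs i1s (itgD mDs i2s (itgZ mDs _ i3s))).
apply: Rint_ext => r rs; rewrite g1 ?addrA//.
by move: rs; rewrite /= in_itv/= => /andP[-> /le_trans->]//; case/andP: sT.
Qed.

End stopped_moments.

(** * Translation of the hypotheses on rates and weights *)

Section rates.
Context (R : realType) (d : nat) (a : sites d -> sites d -> R) (om : sites d -> R).
Hypotheses (ha : migration_rates a) (hom : admissible_weight a om).
Implicit Types x : sites d -> R.

Lemma om_sm : sm om.
Proof.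
by apply: esum_sm => [i|]; [apply: ltW; exact: weight_gt0 hom i|exact: weight_summable hom].
Qed.

Lemma rate_sm i : sm (a i).
Proof. by apply: esum_sm => [j|]; [exact: rates_ge0 ha i j|rewrite (rates_sum1 ha) ltry]. Qed.

Lemma rate_ssum i : ssum (a i) = 1.
Proof.
by have := esum_ssum (rates_ge0 ha i) (rate_sm i); rewrite (rates_sum1 ha) => -[].
Qed.

Lemma weight_psum : exists K : R, 0 <= K /\ forall n j, psum (fun i => om i * a i j) n <= K * om j.
Proof.
have [K hK] := weight_bound hom.
have f0 j i : 0 <= om i * a i j by apply: mulr_ge0; [apply: ltW; exact: weight_gt0 hom i|exact: rates_ge0 ha i j].
have h n j : psum (fun i => om i * a i j) n <= K * om j.
 have sj : sm (fun i => om i * a i j) by apply: esum_sm; [exact: f0|apply: le_lt_trans (hK j) _; rewrite ltry].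
 have := hK j; rewrite (esum_ssum (f0 j) sj) lee_fin; apply: le_trans.
 exact: psum_le_ssum (f0 j) sj.
exists K; split => //.
(* The empty partial sum gives 0 <= K om(0), hence [K] is nonnegative. *)
have := h 0%N 0; rewrite /psum big_ord0 pmulr_lge0//; exact: weight_gt0 hom 0.
Qed.

Lemma state_in_space x : state_space om x -> in_space om x.
Proof.
move=> [x0 xy]; split => //; apply: esum_sm => [i|].
 by apply: mulr_ge0 => //; apply: ltW; exact: weight_gt0 hom i.
by under eq_esum do rewrite mulrC.
Qed.

Lemma rsum_ssum (T : countType) (f : T -> R) : sm f -> rsum f = ssum f.
Proof.
move=> sf; rewrite /rsum.
have s1 : sm (fun i => Num.max (f i) 0). apply: (sm_dom sf) => i; case: (leP 0 (f i)) => h; rewrite ?normr0//.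
have s2 : sm (fun i => Num.max (- f i) 0).
 apply: (sm_dom sf) => i; case: (leP 0 (- f i)) => h; rewrite ?normr0// ?normrN//.
have p1 i : 0 <= Num.max (f i) 0 by rewrite le_max lexx orbT.
have p2 i : 0 <= Num.max (- f i) 0 by rewrite le_max lexx orbT.
rewrite (esum_ssum p1 s1) (esum_ssum p2 s2) /= -(ssumB s1 s2); apply: eq_ssum => i.
have [h|h] := leP 0 (f i); first by rewrite max_r ?subr0// lerNl oppr0.
by rewrite max_l ?sub0r ?opprK// lerNr oppr0 ltW.
Qed.

Lemma migrationE K x i : 0 <= K -> (forall n j, psum (fun i => om i * a i j) n <= K * om j) ->
 in_space om x -> migration a x i = Tm a x i - x i.
Proof.
move=> K0 hK xE.
have s1 : sm (fun j => a i j * x j) := a_sm (weight_gt0 hom) (rates_ge0 ha) K0 hK i xE.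
have s2 : sm (fun j => x i * a i j) := smZ (x i) (rate_sm i).
have E : (fun j => a i j * (x j - x i)) = (fun j => a i j * x j - x i * a i j).
 by apply/funext => j; rewrite mulrBr [x i * _]mulrC.
rewrite /migration E (rsum_ssum (smB s1 s2)) (ssumB s1 s2) (ssumZ _ (rate_sm i)) rate_ssum mulr1.
by [].
Qed.

Lemma weighted_dist_cvg (f : R -> sites d -> R) (t : R) : 0 <= t ->
 (forall s, 0 <= s -> in_space om (f s)) -> path_continuous om f ->
 edist om (f s) (f t) @[s --> within [set s | 0 <= s] (nbhs t)] --> (0 : R).
Proof.
move=> t0 fE fc; have h := fc t t0.
have wE s : 0 <= s -> weighted_dist om (f s) (f t) = (edist om (f s) (f t))%:E.
 move=> s0; apply: esum_ssum; last exact: (edist_sm (fE s s0) (fE t t0)).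
 by move=> i; apply: mulr_ge0 => //; apply: ltW; exact: weight_gt0 hom i.
apply: cvg_trans (fine_cvg h); apply: near_eq_cvg.
have h0 : within [set s : R | 0 <= s] (nbhs t) [set s : R | 0 <= s] by exact: withinT.
by apply: filterS h0 => s s0; rewrite /= wE.
Qed.

End rates.

(** * Modification on a null set *)

Section null_modification.
Context disp (O : measurableType disp) (R : realType) (P : probability O R).
Variable B : set O.
Hypotheses (mB : measurable B) (PB : P B = 0%E).

Lemma null_eq (A C : set O) : measurable A -> measurable C -> A `&` ~` B = C `&` ~` B -> P A = P C.
Proof.
move=> mA mC hAC; rewrite (measureDI P mA mB) (measureDI P mC mB) !setDE hAC.
congr (_ + _)%E; rewrite !(subset_measure0 _ _ _ PB) //; try exact: measurableI.
Qed.

(** Sets that agree off [B] with a set of [F t]. A modification on [B] is adapted to this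
    filtration, and since probabilities do not see [B], increments remain independent of the
    enlarged past. *)
Definition augment (F : R -> set (set O)) (t : R) : set (set O) :=
 [set A | measurable A /\ exists2 C, F t C & A `&` ~` B = C `&` ~` B].

Variable F : R -> set (set O).
Hypothesis hF : filtration F.

Lemma augment_le (t : R) : 0 <= t -> F t `<=` augment F t.
Proof. by move=> t0 A FA; split; [case: hF => _ _ h; exact: (h t t0)|exists A]. Qed.

Lemma augment_filtration : filtration (augment F).
Proof.
have [h1 h2 h3] := hF; split.
- move=> t t0; have [s0 sC sU] := h1 t t0; split.
 + by apply: augment_le => //.
 + move=> A [mA [C FC AC]]; split; first exact: measurableD.
  exists (setT `\` C); first exact: sC.
  rewrite !setTD; apply/seteqP; split => w [nA nB]; split => // Cw; apply: nA.
   by have : (C `&` ~` B) w by []; rewrite -AC => -[].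
  by have : (A `&` ~` B) w by []; rewrite AC => -[].
 + move=> A hA; have h n : exists C, F t C /\ A n `&` ~` B = C `&` ~` B.
   by have [_ [C FC AC]] := hA n; exists C.
  have [C hC] := choice h; split; first by apply: bigcup_measurable => n _; case: (hA n).
  exists (\bigcup_k C k); first by apply: sU => n; case: (hC n).
  by rewrite !setI_bigcupl; apply: eq_bigcupr => n _; case: (hC n).
- move=> s t s0 st A [mA [C FC AC]]; split => //; exists C => //; exact: (h2 s t).
- by move=> t t0 A [].
Qed.

Lemma augment_brownian (W : R -> O -> R) : standard_brownian P F W ->
 standard_brownian P (augment F) W.
Proof.
move=> hW; split; [|exact: brownian_start hW|exact: brownian_continuous hW|].
- by move=> t t0 A mA; apply: (augment_le t0); exact: (brownian_adapted hW).
- move=> s t A I s0 st [mA [C FC AC]] mI.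
 have mC : measurable C by case: hF => _ _ h; exact: (h s s0).
 have mW : measurable [set w | I (W t w - W s w)].
  have := bm_incr_meas hF hW s0 (ltW st) measurableT mI.
  by rewrite setTI.
 rewrite (null_eq mA mC AC) -(brownian_increment hW s0 st FC mI).
 apply: null_eq; [exact: measurableI|exact: measurableI|].
 by rewrite setIAC AC setIAC.
Qed.

Definition modif (S : Type) (y : R -> O -> S -> R) (t : R) (w : O) : S -> R :=
 if w \in B then fun=> 1 else y t w.

Lemma modifE S (y : R -> O -> S -> R) t w : ~ B w -> modif y t w = y t w.
Proof. by move=> nB; rewrite /modif memNset. Qed.

Lemma modif_sub S (y : R -> O -> S -> R) i (t : R) : 0 <= t ->
 sub_meas (F t) (fun w => y t w i) -> sub_meas (augment F t) (fun w => modif y t w i).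
Proof.
move=> t0 hy A mA; have my := filt_meas hF t0 hy; split; last first.
 exists ((fun w => y t w i) @^-1` A); first exact: hy.
 by apply/seteqP; split => w /= [Aw nB]; split => //; move: Aw; rewrite modifE.
have -> : (fun w => modif y t w i) = (fun w => if w \in B then 1 else y t w i).
 by apply/funext => w; rewrite /modif; case: ifP.
rewrite -[X in measurable X]setTI; apply: measurable_fun_ifT => //.
apply: (measurable_fun_bool true) => /=.
rewrite setTI (_ : _ @^-1` _ = B)//; apply/seteqP; split => w /= h; first exact: set_mem.
exact: mem_set.
Qed.

End null_modification.

Section from_solution.
Context (R : realType) (d : nat) (a : sites d -> sites d -> R) (om : sites d -> R).
Hypotheses (ha : migration_rates a) (hom : admissible_weight a om).
Context disp (O : measurableType disp) (P : probability O R).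
Variables (kap rho : R) (u v : R -> O -> sites d -> R).
Hypothesis kap0 : 0 <= kap.
Hypothesis hsol : SBM_solution a om kap rho P u v.
Hypothesis hstart : homogeneous_start P u v.

(** The state space, path continuity and the initial value each hold off one null set for all times
    and sites; their union [B] is where the paths are replaced by the constant 1. The exceptional
    set of the equation depends on time and site, so that clause remains almost sure. *)
Lemma regularize : exists (K : R) F x W, regular_model P a om K kap rho F x W /\
 forall (t : R) i, 0 <= t ->
 [/\ measurable_fun setT (fun w => u t w i), measurable_fun setT (fun w => v t w i),
   {ae P, forall w, x ord0 t w i = u t w i} & {ae P, forall w, x ord_max t w i = v t w i}].
Proof.
have [F [W hD]] := hsol; have [K [K0 hK]] := weight_psum ha hom.
have [F0 hW hbr hu hv hst hp eu ev] := hD.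
have [N1 [mN1 PN1 hN1]] := hst; have [N2 [mN2 PN2 hN2]] := hp; have [N3 [mN3 PN3 hN3]] := hstart.
pose B := N1 `|` N2 `|` N3.
have mB : measurable B by do 2 apply: measurableU => //.
have PB : P B = 0%E.
 have h12 : P (N1 `|` N2) = 0%E by apply: null_set_setU.
 by apply: null_set_setU => //; exact: measurableU.
have nB w : ~ B w -> [/\ forall t : R, 0 <= t -> state_space om (u t w) /\ state_space om (v t w),
  path_continuous om (u^~ w) /\ path_continuous om (v^~ w) & forall i, u 0 w i = 1 /\ v 0 w i = 1].
 move=> h; split.
 - by apply: contrapT => hn; apply: h; left; left; exact: hN1.
 - by apply: contrapT => hn; apply: h; left; right; exact: hN2.
 - by apply: contrapT => hn; apply: h; right; exact: hN3.
pose y (n : 'I_2) := if n == ord0 then u else v.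
pose x n := modif B (y n).
have om0 i : 0 < om i := weight_gt0 hom i.
have a0 i j : 0 <= a i j := rates_ge0 ha i j.
have E1 : in_space om (fun=> 1 : R) by split => // ; apply: (eq_sm _ (om_sm hom)) => i; rewrite mulr1.
have yE n (t : R) w : ~ B w -> 0 <= t -> in_space om (y n t w).
 move=> h t0; have [hs _ _] := nB w h; have [h1 h2] := hs t t0.
 by rewrite /y; case: ifP => _; exact: (state_in_space hom).
have xE n (t : R) w : 0 <= t -> in_space om (x n t w).
 move=> t0; have [Bw|nBw] := pselect (B w); last by rewrite /x (modifE (y n) t nBw); exact: yE.
 by rewrite /x /modif mem_set.
have sy n i (t : R) : 0 <= t -> sub_meas (F t) (fun w => y n t w i).
 by move=> t0; rewrite /y; case: ifP => _; [exact: hu|exact: hv].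
exists K, (augment B F), x, W; split; last first.
 move=> t i t0; split.
 - exact: (filt_meas F0 t0 (hu i t t0)).
 - exact: (filt_meas F0 t0 (hv i t t0)).
 - by exists B; split => // w /= hw; apply: contrapT => h; apply: hw; rewrite /x modifE.
 - by exists B; split => // w /= hw; apply: contrapT => h; apply: hw; rewrite /x modifE.
split => //.
- exact: (om_sm hom).
- exact: augment_filtration.
- move=> n w t t0; have [Bw|nBw] := pselect (B w).
  rewrite (_ : (fun s => _) = fun=> 0); first exact: cvg_cst.
  apply/funext => s; rewrite /x /modif mem_set// /edist -[RHS](ssum0 R (sites d)).
  by apply: eq_ssum => i; rewrite subrr normr0 mul0r.
 rewrite (_ : (fun s => _) = (fun s => edist om (y n s w) (y n t w))); last first.
  by apply/funext => s; rewrite /x !modifE.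
 apply: (weighted_dist_cvg hom t0 (f := fun s => y n s w)); first by move=> s; exact: yE.
 by have [_ [h1 h2] _] := nB w nBw; rewrite /y; case: ifP.
- by move=> n i t t0; exact: (modif_sub mB F0 t0 (sy n i t t0)).
- by move=> n i; exact: augment_brownian.
- move=> n m i j t t0; rewrite (_ : (fun=> _) = (fun=> if i == j then if n == m then t else rho * t else 0)); first exact: hbr.
 by apply/funext => w; rewrite /cc; case: ifP => _; [case: ifP => _; rewrite ?mul1r|rewrite mul0r].
- move=> n i t t0; pose H (s : R) w := Num.sqrt (kap * u s w i * v s w i).
 have key (L : O -> R) : is_Ito_integral P H (W n i) t L ->
   {ae P, forall w, y n t w i = y n 0 w i + \int[lebesgue_measure]_(s in `[0, t]) migration a (y n s w) i + L w} ->
   exists (H : R -> O -> R) (L : O -> R),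
  [/\ is_Ito_integral P H (W n i) t L, forall r : R, 0 <= r -> measurable_fun [set: O] (H r)
  & {ae P, forall w, (forall r, 0 <= r <= t -> H r w = vol kap x i r w) /\
    x n t w i = 1 + \int[lebesgue_measure]_(r in `[0, t]) site_drift a x n i r w + L w}].
  move=> hI [N4 [mN4 PN4 hN4]]; exists H, L; split => //.
   move=> r r0; apply: (measurableT_comp (f := @Num.sqrt R)).
    by apply: continuous_measurable_fun; exact: sqrt_continuous.
   have mu' : measurable_fun setT (fun w => u r w i) := filt_meas F0 r0 (hu i r r0).
   have mv' : measurable_fun setT (fun w => v r w i) := filt_meas F0 r0 (hv i r r0).
   by apply: measurable_funM => //; apply: measurable_funM.
  exists (B `|` N4); split; first exact: measurableU. exact: null_set_setU.
  move=> w /= hw; apply: contrapT => hn; apply: hw.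
  have nBw : ~ B w by move=> Bw; apply: hn; left.
  have hw4 : y n t w i = y n 0 w i + \int[lebesgue_measure]_(s in `[0, t]) migration a (y n s w) i + L w.
   by apply: contrapT => h; apply: hn; right; exact: hN4.
  split. by move=> r _; rewrite /H /vol /x !modifE.
  rewrite {1}/x modifE// hw4; congr (_ + _ + _).
   by have [_ _ hs] := nB w nBw; rewrite /y; case: ifP => _; case: (hs i).
  apply: Rint_ext => s; rewrite /= in_itv/= => /andP[s0 _].
  by rewrite (migrationE ha hom i K0 hK (yE n s w nBw s0)) /site_drift /x !modifE.
 have : n = 0 \/ n = 1 by case: n {key} => [[|[|//]] hn]; [left|right]; exact: val_inj.
 case=> nE; subst n. have [L hI hL] := eu t i t0; exact: (key L hI hL).
 have [L hI hL] := ev t i t0; exact: (key L hI hL).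
Qed.

End from_solution.

(** * Comparison principle for the two-walker equation *)

Section comparison.
Context (R : realType) (S : countType) (a : S -> S -> R) (om : S -> R) (K : R).
Hypotheses (om0 : forall i, 0 < om i) (a0 : forall i j, 0 <= a i j) (K0 : 0 <= K).
Hypothesis hK : forall n j, psum (fun i => om i * a i j) n <= K * om j.
Local Notation mu := (@lebesgue_measure R).
Implicit Types G f : S -> S -> R.

(** The nonnegative part of the generator of two independent walkers, one in each argument. *)
Definition Pop f i j := ssum (fun k => a i k * f k j) + ssum (fun k => a j k * f i k).

Definition wsum G n m := psum (fun i => psum (fun j => om i * om j * G i j) m) n.

Let omw i : 0 <= om i := ltW (om0 i).

Lemma wsum_tr G n m : wsum (fun i j => G j i) n m = wsum G m n.
Proof.
rewrite /wsum psum_swap; apply: eq_psum => j; apply: eq_psum => i.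
by rewrite [om i * _]mulrC.
Qed.

Lemma le_wsum G G' n m : (forall i j, G i j <= G' i j) -> wsum G n m <= wsum G' n m.
Proof.
by move=> h; apply: le_psum => i; apply: le_psum => j; apply: ler_wpM2l => //; exact: mulr_ge0.
Qed.

Lemma le_wsum1 G i j : (forall i j, 0 <= G i j) ->
 om i * om j * G i j <= wsum G (pickle i).+1 (pickle j).+1.
Proof.
move=> G0; have p0 i' j' : 0 <= om i' * om j' * G i' j' by rewrite !mulr_ge0.
apply: le_trans (le_psum1 (f := fun j => om i * om j * G i j) j (p0 i)) _.
apply: (le_psum1 (f := fun i => psum (fun j => om i * om j * G i j) (pickle j).+1)) => i'.
exact: psum_ge0.
Qed.

(** For fixed [j] the sum over [i] is taken first, where the column bound of the weight applies; one
    walker's step costs a factor [K]. *)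
Lemma wsum_half G (B : R) : (forall i j, 0 <= G i j) -> (forall n m, wsum G n m <= B) ->
 (forall i j, sm (fun k => a i k * G k j)) ->
 forall n m, wsum (fun i j => ssum (fun k => a i k * G k j)) n m <= K * B.
Proof.
move=> G0 GB sG n m.
have smG j : sm (fun k => om k * G k j).
 apply: (ge0_sm (B := (om j)^-1 * B)) => [k|L]; first by rewrite mulr_ge0.
 rewrite mulrC ler_pdivlMr//; apply: le_trans (GB L (pickle j).+1).
 rewrite -psumZr; apply: le_psum => i.
 rewrite mulrAC; apply: (le_psum1 (f := fun j => om i * om j * G i j)) => j'.
 by rewrite !mulr_ge0.
have h1 j : psum (fun i => om i * ssum (fun k => a i k * G k j)) n <= K * ssum (fun k => om k * G k j).
 have sZ i : sm (fun k => om i * (a i k * G k j)) by exact: smZ.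
 rewrite (eq_psum (g := fun i => ssum (fun k => om i * (a i k * G k j)))); last by move=> i; rewrite -(ssumZ _ (sG i j)).
 have [s1 ->] := psum_ssum n sZ; rewrite -(ssumZ _ (smG j)); apply: le_ssum => //; first exact: smZ.
 move=> k; rewrite (eq_psum (g := fun i => G k j * (om i * a i k))); last by move=> i; ring.
 rewrite psumZ (_ : K * _ = G k j * (K * om k)); last by ring.
 exact: ler_wpM2l.
rewrite /wsum psum_swap.
have sO j : sm (fun k => om j * (om k * G k j)) by exact: smZ.
apply: (@le_trans _ _ (K * psum (fun j => ssum (fun k => om j * (om k * G k j))) m)).
 rewrite -psumZ; apply: le_psum => j.
 rewrite (eq_psum (g := fun i => om j * (om i * ssum (fun k => a i k * G k j)))); last by move=> i; ring.
 by rewrite psumZ (ssumZ _ (smG j)) mulrCA ler_wpM2l.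
apply: ler_wpM2l => //; have [s1 ->] := psum_ssum m sO; apply: ssum_le => // L.
apply: le_trans (GB L m); apply: eq_ler.
apply: eq_psum => i; apply: eq_psum => j; ring.
Qed.

Lemma wsum_delta G (B : R) n m : (forall i j, 0 <= G i j) -> (forall n m, wsum G n m <= B) ->
 wsum (fun i j => if i == j then G i j else 0) n m <= B.
Proof.
move=> G0 GB; apply: le_trans (GB n m); apply: le_wsum => i j.
by case: eqP => [->|].
Qed.

Variables (D : R -> S -> S -> R) (T k : R).
Hypotheses (T0 : 0 <= T) (k0 : 0 <= k).
Hypothesis D1 : forall s, 0 <= s <= T -> forall i j, sm (fun k => a i k * D s k j).
Hypothesis D2 : forall s, 0 <= s <= T -> forall i j, sm (fun k => a j k * D s i k).
Let h s i j := expR (2 * s) * (Pop (D s) i j + (if i == j then k * D s i j else 0)).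
Hypothesis D3 : forall i j, itg mu `[0, T] (fun s => h s i j).
Hypothesis D4 : forall i j t, 0 <= t <= T ->
 expR (2 * t) * D t i j <= \int[mu]_(s in `[0, t]) h s i j.
Hypothesis D5 : exists B : R, forall t n m, 0 <= t <= T ->
 wsum (fun i j => Num.max (D t i j) 0) n m <= B.

(** Gronwall for the weighted sums of the positive part of [D]. [Pop] and the diagonal term are
    monotone, so replacing [D] by its positive part on the right keeps the inequality; a vanishing
    bound on all weighted partial sums excludes a positive entry. *)
Lemma comparison t i j : 0 <= t <= T -> D t i j <= 0.
Proof.
pose G s i j := Num.max (D s i j) 0.
have G0 s i' j' : 0 <= G s i' j' by rewrite /G le_max lexx orbT.
have DG s i' j' : D s i' j' <= G s i' j' by rewrite /G le_max lexx.
pose q t (B : R) := forall n m, wsum (G t) n m <= B.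
have [B hB] := D5.
(* The two walkers contribute 2K and the diagonal [k]; the factor 2 makes the time integral of the
   exponential return half of the bound. *)
pose c := 2 * (2 * K + k).
have c0 : 0 <= c by rewrite mulr_ge0// addr_ge0// mulr_ge0.
have aG s : 0 <= s <= T -> forall i j, sm (fun k => a i k * G s k j).
 move=> sT i' j'; apply: (sm_dom (D1 sT i' j')) => k'; rewrite !normrM ler_wpM2l//.
 by rewrite /G; case: (leP (D s k' j') 0); rewrite ?normr0.
have aG' s : 0 <= s <= T -> forall i j, sm (fun k => a j k * G s i k).
 move=> sT i' j'; apply: (sm_dom (D2 sT i' j')) => k'; rewrite !normrM ler_wpM2l//.
 by rewrite /G; case: (leP (D s i' k') 0); rewrite ?normr0.
have step (A : R) : 0 <= A -> (forall t, 0 <= t <= T -> q t (A * expR (c * t))) ->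
  forall t, 0 <= t <= T -> q t (0 + A / 2 * expR (c * t)).
 move=> A0 qA s sT n m; rewrite add0r; have /andP[s0 sT'] := sT.
 have mD := mI `[0, s].
 (* The indicator is taken at the final time [s] and kept fixed under the integral: it turns the
    left side into the positive part and, being at most 1, preserves the upper bound of the
    integrand. *)
 pose th i j : R := if 0 <= D s i j then 1 else 0.
 have th01 i' j' : 0 <= th i' j' <= 1 by rewrite /th; case: ifP; rewrite ?lexx ?ler01.
 have GE i' j' : G s i' j' = th i' j' * D s i' j'.
  by rewrite /G /th; case: (leP 0 (D s i' j')) => hD; rewrite ?mul1r ?mul0r ?max_l// max_r// ltW.
 have hs i' j' : itg mu `[0, s] (fun r => h r i' j').
  apply: itgS (D3 i' j') => //.
  by move=> r /=; rewrite !in_itv/= => /andP[-> /le_trans->].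
 have sA (r : R) : `[0, s]%classic r ->
   wsum (fun i j => th i j * h r i j) n m <= (2 * K + k) * A * expR ((2 + c) * r).
  rewrite /= in_itv/= => /andP[r0 rs].
  have rT : 0 <= r <= T by rewrite r0 (le_trans rs).
  have e0 := expR_ge0 (2 * r).
  have -> : (2 * K + k) * A * expR ((2 + c) * r) = expR (2 * r) * (K * (A * expR (c * r)) + K * (A * expR (c * r)) + k * (A * expR (c * r))).
   by rewrite (mulrDl 2 c r) expRD; ring.
  apply: (@le_trans _ _ (expR (2 * r) * wsum (fun i j => ssum (fun k => a i k * G r k j) +
    ssum (fun k => a j k * G r i k) + k * (if i == j then G r i j else 0)) n m)).
   rewrite /wsum -psumZ; apply: le_psum => i'; rewrite -psumZ; apply: le_psum => j'.
   rewrite [leRHS]mulrCA; apply: ler_wpM2l; first exact: mulr_ge0.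
   rewrite /h [leLHS]mulrCA; apply: ler_wpM2l => //.
   have X0 : 0 <= ssum (fun k => a i' k * G r k j') + ssum (fun k => a j' k * G r i' k) + k * (if i' == j' then G r i' j' else 0).
    rewrite !addr_ge0//.
    - by apply: ssum_ge0 => [|k']; [exact: aG|rewrite mulr_ge0].
    - by apply: ssum_ge0 => [|k']; [exact: aG'|rewrite mulr_ge0].
    - by rewrite mulr_ge0//; case: ifP.
   have XY : Pop (D r) i' j' + (if i' == j' then k * D r i' j' else 0) <= ssum (fun k => a i' k * G r k j') + ssum (fun k => a j' k * G r i' k) + k * (if i' == j' then G r i' j' else 0).
    apply: lerD; first apply: lerD.
    - by apply: le_ssum; [exact: D1|exact: aG|move=> k'; rewrite ler_wpM2l].
    - by apply: le_ssum; [exact: D2|exact: aG'|move=> k'; rewrite ler_wpM2l].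
    - by case: ifP => _; rewrite ?mulr0// ler_wpM2l.
   have /andP[t0' t1'] := th01 i' j'.
   apply: (le_trans (ler_wpM2l t0' XY)); exact: ler_piMl.
  apply: ler_wpM2l => //.
  rewrite /wsum (_ : psum _ n = wsum (fun i j => ssum (fun k => a i k * G r k j)) n m +
    wsum (fun i j => ssum (fun k => a j k * G r i k)) n m + k * wsum (fun i j => if i == j then G r i j else 0) n m); last first.
   rewrite /wsum -psumZ -!psumD; apply: eq_psum => i'.
   by rewrite -psumZ -!psumD; apply: eq_psum => j'; rewrite !mulrDr [k * (_ * _)]mulrCA.
  apply: lerD; first apply: lerD.
  - by apply: wsum_half => //; [exact: qA|exact: aG].
  - rewrite (wsum_tr (fun i j => ssum (fun k => a i k * G r j k))).
   apply: (wsum_half (G := fun i j => G r j i)) => //. by move=> n' m'; rewrite wsum_tr; exact: qA.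
   by move=> i' j'; exact: aG'.
  - by apply: ler_wpM2l => //; apply: wsum_delta => //; exact: qA.
 have iw : itg mu `[0, s] (fun r => wsum (fun i j => th i j * h r i j) n m).
  by apply: itg_psum => // i'; apply: itg_psum => // j'; apply: itgZ => //; apply: itgZ.
 have e0 := expR_gt0 (2 * s).
 rewrite -(ler_pM2l e0).
 apply: (@le_trans _ _ (\int[mu]_(r in `[0, s]) wsum (fun i j => th i j * h r i j) n m)).
  rewrite /wsum (Rint_psum mD) => [|i']; last by apply: itg_psum => // j'; apply: itgZ => //; apply: itgZ.
  rewrite -psumZ; apply: le_psum => i'; rewrite (Rint_psum mD) => [|j']; last by apply: itgZ => //; apply: itgZ.
  rewrite -psumZ; apply: le_psum => j'.
  rewrite (RintegralZl _ mD (itgZ mD _ (hs i' j'))) (RintegralZl _ mD (hs i' j')).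
  rewrite mulrCA; apply: ler_wpM2l; first exact: mulr_ge0.
  have /andP[t0' _] := th01 i' j'.
  by rewrite GE mulrCA; apply: ler_wpM2l => //; exact: D4.
 apply: (@le_trans _ _ (\int[mu]_(r in `[0, s]) ((2 * K + k) * A * expR ((2 + c) * r)))).
  by apply: (le_Rintegral mD iw (itgZ mD _ (exp_itg (2 + c) s))).
 rewrite (RintegralZl _ mD (exp_itg (2 + c) s)).
 have := Rint_exp (2 + c) s0; rewrite (mulrDl 2 c s) expRD.
 have I0 : 0 <= \int[mu]_(r in `[0, s]) expR ((2 + c) * r) by apply: Rintegral_ge0 => r _; exact: expR_ge0.
 move: I0; move: (\int[mu]_(r in `[0, s]) _) => I I0 hI.
 have cI : c * I <= expR (2 * s) * expR (c * s) by have := mulr_ge0 (ler0n R 2) I0; move: hI; rewrite mulrDl => hI; lra.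
 rewrite (_ : expR (2 * s) * _ = A / 2 * (expR (2 * s) * expR (c * s))); last by ring.
 rewrite (_ : (2 * K + k) * A * I = A / 2 * (c * I)); last by rewrite /c; field.
 by apply: ler_wpM2l => //; rewrite divr_ge0.
move=> tT; have /andP[t0 _] := tT.
have key e : 0 < e -> q t ((2 * 0 + e) * expR (c * t)).
 move=> e0; apply: (gronwall_iter (q := q) (lexx 0) c0 T0 _ _ step tT e0).
  by move=> s B1 B2 hq B12 n m; exact: le_trans (hq n m) B12.
 by move=> s sT n m; exact: hB.
rewrite leNgt; apply/negP => Dp.
have w0 : 0 < om i * om j * G t i j by rewrite !mulr_gt0// /G lt_max Dp.
have ec := expR_gt0 (c * t).
have e0 : 0 < om i * om j * G t i j / (2 * expR (c * t)) by rewrite divr_gt0// mulr_gt0.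
have := key _ e0 (pickle i).+1 (pickle j).+1.
rewrite mulr0 add0r => hq; have := le_trans (le_wsum1 i j (G0 t)) hq.
move: w0; move: (om i * om j * G t i j) => W W0.
rewrite (_ : W / (2 * expR (c * t)) * expR (c * t) = W / 2); last by field; rewrite gt_eqF.
by lra.
Qed.

End comparison.

Lemma itg_expM (R : realType) (c t : R) (q : R -> R) : 0 <= c -> 
 itg (@lebesgue_measure R) `[0, t] q -> itg (@lebesgue_measure R) `[0, t] (fun s => expR (c * s) * q s).
Proof.
move=> c0 iq; have ie := exp_itg c t.
have mD := mI `[0, t].
apply: (itg_le mD _ _ (itgZ mD (expR (c * t)) (itg_norm mD iq))).
 by apply: measurable_funM; [exact (itg_meas ie)|exact (itg_meas iq)].
move=> s; rewrite /= in_itv/= => /andP[s0 st].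
by rewrite normrM ler_wpM2r// ger0_norm ?expR_ge0// ler_expR ler_wpM2l.
Qed.

(** * Mild solutions with a source *)

Section mild_solutions.
Context (R : realType) (S : countType) (a : S -> S -> R) (om : S -> R) (K T : R).
Hypotheses (om0 : forall i, 0 < om i) (a0 : forall i j, 0 <= a i j) (K0 : 0 <= K).
Hypothesis hK : forall n j, psum (fun i => om i * a i j) n <= K * om j.
Hypotheses (om_s : sm om) (a_s : forall i, sm (a i)) (T0 : 0 <= T).
Local Notation mu := (@lebesgue_measure R).
Implicit Types (f q : R -> S -> S -> R) (phi : S -> S -> R).

Let omw i : 0 <= om i := ltW (om0 i).

(** Integral form, after multiplication by exp(2t), of the equation df/dt = Pop f - 2f + q with
    initial value [phi]. The source [q] is kept apart because for the moments of u with u and v with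
    v it involves a different function, the moment of u with v. *)
Record mild f q phi : Prop := Mild {
 mild_row : forall s : R, 0 <= s <= T -> forall i j, sm (fun k => a i k * f s k j) ;
 mild_col : forall s : R, 0 <= s <= T -> forall i j, sm (fun k => a j k * f s i k) ;
 mild_itg : forall i j, itg mu `[0, T] (fun s => expR (2 * s) * f s i j) ;
 mild_itgP : forall i j, itg mu `[0, T] (fun s => expR (2 * s) * Pop a (f s) i j) ;
 mild_itgq : forall i j, itg mu `[0, T] (fun s => expR (2 * s) * q s i j) ;
 mild_eq : forall (t : R) i j, 0 <= t <= T -> expR (2 * t) * f t i j = phi i j +
   \int[mu]_(s in `[0, t]) (expR (2 * s) * Pop a (f s) i j) +
   \int[mu]_(s in `[0, t]) (expR (2 * s) * q s i j) ;
 mild_bd : exists B : R, forall (t : R) n m, 0 <= t <= T ->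
   wsum om (fun i j => `|f t i j|) n m <= B }.

Let sub0 (t : R) : 0 <= t <= T -> `[0, t]%classic `<=` `[0, T]%classic.
Proof. by move=> /andP[_ tT] s /=; rewrite !in_itv/= => /andP[-> /le_trans->]. Qed.

Let mD (t : R) : measurable (`[0, t]%classic : set (measurableTypeR R)).
Proof. exact: measurable_itv. Qed.

Lemma mild_lin (b c : R) f q phi f' q' phi' : mild f q phi -> mild f' q' phi' ->
 mild (fun s i j => b * f s i j + c * f' s i j) (fun s i j => b * q s i j + c * q' s i j)
  (fun i j => b * phi i j + c * phi' i j).
Proof.
move=> [r1 c1 i1 p1 q1 e1 [B1 b1]] [r2 c2 i2 p2 q2 e2 [B2 b2]].
have PE (s : R) i j : 0 <= s <= T -> Pop a (fun i j => b * f s i j + c * f' s i j) i j =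
  b * Pop a (f s) i j + c * Pop a (f' s) i j.
 move=> sT; have x1 := r1 s sT i j; have x2 := r2 s sT i j; have y1 := c1 s sT i j; have y2 := c2 s sT i j.
 rewrite /Pop (eq_ssum (g := fun k => b * (a i k * f s k j) + c * (a i k * f' s k j))); last by move=> k; ring.
 rewrite [X in _ + X](eq_ssum (g := fun k => b * (a j k * f s i k) + c * (a j k * f' s i k))); last by move=> k; ring.
 rewrite (ssumD (smZ b x1) (smZ c x2)) (ssumD (smZ b y1) (smZ c y2)).
 rewrite (ssumZ _ x1) (ssumZ _ x2) (ssumZ _ y1) (ssumZ _ y2); ring.
split.
- move=> s sT i j; apply: (eq_sm _ (smD (smZ b (r1 s sT i j)) (smZ c (r2 s sT i j)))) => k; ring.
- move=> s sT i j; apply: (eq_sm _ (smD (smZ b (c1 s sT i j)) (smZ c (c2 s sT i j)))) => k; ring.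
- move=> i j; apply: (eq_itg (mD T) _ (itgD (mD T) (itgZ (mD T) b (i1 i j)) (itgZ (mD T) c (i2 i j)))) => s _; ring.
- move=> i j; apply: (eq_itg (mD T) _ (itgD (mD T) (itgZ (mD T) b (p1 i j)) (itgZ (mD T) c (p2 i j)))) => s.
 by rewrite /= in_itv/= => sT; rewrite PE//; ring.
- move=> i j; apply: (eq_itg (mD T) _ (itgD (mD T) (itgZ (mD T) b (q1 i j)) (itgZ (mD T) c (q2 i j)))) => s _; ring.
- move=> t i j tT; have st := sub0 tT.
 have P1 := itgS (mD T) (mD t) st (p1 i j); have P2 := itgS (mD T) (mD t) st (p2 i j).
 have Q1 := itgS (mD T) (mD t) st (q1 i j); have Q2 := itgS (mD T) (mD t) st (q2 i j).
 rewrite (_ : expR _ * _ = b * (expR (2 * t) * f t i j) + c * (expR (2 * t) * f' t i j)); last by ring.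
 rewrite (e1 t i j tT) (e2 t i j tT).
 have -> : \int[mu]_(s in `[0, t]) (expR (2 * s) * Pop a (fun i j => b * f s i j + c * f' s i j) i j) =
   b * \int[mu]_(s in `[0, t]) (expR (2 * s) * Pop a (f s) i j) +
   c * \int[mu]_(s in `[0, t]) (expR (2 * s) * Pop a (f' s) i j).
  rewrite -(RintegralZl b (mD t) P1) -(RintegralZl c (mD t) P2).
  rewrite -(RintegralD (mD t) (itgZ (mD t) b P1) (itgZ (mD t) c P2)); apply: Rint_ext => s /st.
  by rewrite /= in_itv/= => sT; rewrite PE//; ring.
 have -> : \int[mu]_(s in `[0, t]) (expR (2 * s) * (b * q s i j + c * q' s i j)) =
   b * \int[mu]_(s in `[0, t]) (expR (2 * s) * q s i j) +
   c * \int[mu]_(s in `[0, t]) (expR (2 * s) * q' s i j).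
  rewrite -(RintegralZl b (mD t) Q1) -(RintegralZl c (mD t) Q2).
  by rewrite -(RintegralD (mD t) (itgZ (mD t) b Q1) (itgZ (mD t) c Q2)); apply: Rint_ext => s _; ring.
 ring.
- exists (`|b| * B1 + `|c| * B2) => t n m tT.
 apply: (le_trans (le_wsum om0 (G' := fun i j => `|b| * `|f t i j| + `|c| * `|f' t i j|) _ _ _)).
  by move=> i j; rewrite -!normrM ler_normD.
 have -> : wsum om (fun i j => `|b| * `|f t i j| + `|c| * `|f' t i j|) n m =
   `|b| * wsum om (fun i j => `|f t i j|) n m + `|c| * wsum om (fun i j => `|f' t i j|) n m.
  rewrite /wsum -!psumZ -psumD; apply: eq_psum => i.
  by rewrite -!psumZ -psumD; apply: eq_psum => j; ring.
 by apply: lerD; apply: ler_wpM2l => //; [exact: b1|exact: b2].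
Qed.

(** A source bounded by [k * f] on the diagonal and by 0 elsewhere is absorbed into the operator of
    [comparison]. *)
Lemma mild_le0 (k : R) f q phi : 0 <= k -> mild f q phi ->
 (forall i j, phi i j <= 0) ->
 (forall (s : R) i j, 0 <= s <= T -> q s i j <= if i == j then k * f s i j else 0) ->
 forall (t : R) i j, 0 <= t <= T -> f t i j <= 0.
Proof.
move=> k0 [r1 c1 i1 p1 q1 e1 [B1 b1]] f0 qle t i j.
have ik i' j' : itg mu `[0, T] (fun s => expR (2 * s) * (if i' == j' then k * f s i' j' else 0)).
 apply: (eq_itg (mD T) _ (itgZ (mD T) (if i' == j' then k else 0) (i1 i' j'))) => s _.
 by case: ifP => _; ring.
apply: (comparison om0 a0 K0 hK T0 k0 r1 c1) => {t i j}.
- move=> i j; apply: (eq_itg (mD T) _ (itgD (mD T) (p1 i j) (ik i j))) => s _; ring.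
- move=> i j t tT; rewrite (e1 t i j tT) -addrA.
 have st := sub0 tT.
 have P1 := itgS (mD T) (mD t) st (p1 i j); have Q1 := itgS (mD T) (mD t) st (q1 i j).
 have k1 := itgS (mD T) (mD t) st (ik i j).
 rewrite -(RintegralD (mD t) P1 Q1) -[leRHS]add0r; apply: lerD; first exact: f0.
 apply: (le_Rintegral (mD t) (itgD (mD t) P1 Q1)). apply: (eq_itg (mD t) _ (itgD (mD t) P1 k1)) => s _; ring.
 move=> s /st; rewrite /= in_itv/= => sT; rewrite -mulrDr; apply: ler_wpM2l; first exact: expR_ge0.
 by rewrite lerD2l; exact: qle.
- exists B1 => t n m tT; apply: le_trans (b1 t n m tT); apply: (le_wsum om0) => i j.
 by rewrite ge_max normr_ge0 ler_norm.
Qed.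

(** The source is the defect of [phi] from being an eigenfunction with eigenvalue [l]; its sign
    decides between a super- and a subsolution. *)
Lemma mild_exp (l B : R) phi : (forall i j, `|phi i j| <= B) ->
 mild (fun s i j => expR (l * s) * phi i j)
    (fun s i j => expR (l * s) * ((l + 2) * phi i j - Pop a phi i j)) phi.
Proof.
move=> hB.
have r1 i j : sm (fun k => a i k * phi k j).
 apply: (sm_dom (smZ B (a_s i))) => k; rewrite !normrM mulrC; apply: ler_wpM2r => //.
 exact: le_trans (hB k j) (ler_norm _).
have c1 i j : sm (fun k => a j k * phi i k).
 apply: (sm_dom (smZ B (a_s j))) => k; rewrite !normrM mulrC; apply: ler_wpM2r => //.
 exact: le_trans (hB i k) (ler_norm _).
have PE (s : R) i j : Pop a (fun i j => expR (l * s) * phi i j) i j = expR (l * s) * Pop a phi i j.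
 rewrite /Pop (eq_ssum (g := fun k => expR (l * s) * (a i k * phi k j))); last by move=> k; ring.
 rewrite [X in _ + X](eq_ssum (g := fun k => expR (l * s) * (a j k * phi i k))); last by move=> k; ring.
 by rewrite (ssumZ _ (r1 i j)) (ssumZ _ (c1 i j)) mulrDr.
have eE (s : R) : expR (2 * s) * expR (l * s) = expR ((l + 2) * s) by rewrite -expRD; congr expR; ring.
have ie (c : R) : itg mu `[0, T] (fun s => c * expR ((l + 2) * s)) := itgZ (mD T) c (exp_itg (l + 2) T).
split.
- move=> s sT i j; apply: (eq_sm _ (smZ (expR (l * s)) (r1 i j))) => k; ring.
- move=> s sT i j; apply: (eq_sm _ (smZ (expR (l * s)) (c1 i j))) => k; ring.
- by move=> i j; apply: (eq_itg (mD T) _ (ie (phi i j))) => s _; rewrite mulrA eE mulrC.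
- by move=> i j; apply: (eq_itg (mD T) _ (ie (Pop a phi i j))) => s _; rewrite PE mulrA eE mulrC.
- by move=> i j; apply: (eq_itg (mD T) _ (ie ((l + 2) * phi i j - Pop a phi i j))) => s _; rewrite mulrA eE mulrC.
- move=> t i j /andP[t0 tT]; have E := Rint_exp (l + 2) t0.
 have X := exp_itg (l + 2) t.
 have -> : \int[mu]_(s in `[0, t]) (expR (2 * s) * Pop a (fun i j => expR (l * s) * phi i j) i j) =
   Pop a phi i j * \int[mu]_(s in `[0, t]) expR ((l + 2) * s).
  rewrite -(RintegralZl _ (mD t) X); apply: Rint_ext => s _.
  by rewrite PE mulrA eE mulrC.
 have -> : \int[mu]_(s in `[0, t]) (expR (2 * s) * (expR (l * s) * ((l + 2) * phi i j - Pop a phi i j))) =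
   ((l + 2) * phi i j - Pop a phi i j) * \int[mu]_(s in `[0, t]) expR ((l + 2) * s).
  rewrite -(RintegralZl _ (mD t) X); apply: Rint_ext => s _.
  by rewrite mulrA eE mulrC.
 rewrite mulrA eE; move: E; move: (\int[mu]_(s in `[0, t]) expR ((l + 2) * s)) => I E.
 rewrite (_ : expR ((l + 2) * t) = (l + 2) * I + 1); last by rewrite E subrK.
 ring.
- exists (expR (`|l| * T) * `|B| * (ssum om * ssum om)) => t n m /andP[t0 tT].
 apply: (le_trans (le_wsum om0 (G' := fun i j => expR (`|l| * T) * `|B|) _ _ _)).
  move=> i j; rewrite normrM ger0_norm ?expR_ge0//; apply: ler_pM => //.
   rewrite ler_expR; apply: (@le_trans _ _ (`|l| * t)); first by apply: ler_wpM2r => //; exact: ler_norm.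
   exact: ler_wpM2l.
  exact: le_trans (hB i j) (ler_norm _).
 have -> : wsum om (fun _ _ => expR (`|l| * T) * `|B|) n m = expR (`|l| * T) * `|B| * (psum om n * psum om m).
  rewrite psum_mul /wsum -psumZ; apply: eq_psum => i.
  by rewrite -psumZ; apply: eq_psum => j; rewrite mulrC.
 apply: ler_wpM2l; first by rewrite mulr_ge0.
 by apply: ler_pM; (try exact: psum_ge0); exact: psum_le_ssum.
Qed.

End mild_solutions.

(** * Comparison of the second moments *)

Section second_moment_bounds.
Context disp (O : measurableType disp) (R : realType) (P : probability O R).
Context (S : countType) (a : S -> S -> R) (om : S -> R) (K kap rho : R).
Variables (F : R -> set (set O)) (x : 'I_2 -> R -> O -> S -> R) (W : 'I_2 -> S -> R -> O -> R).
Hypothesis M : regular_model P a om K kap rho F x W.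
Hypothesis a_s : forall i, sm (a i).
Hypotheses (rho0 : 0 < rho) (rho1 : rho <= 1).
Local Notation mu := (@lebesgue_measure R).
Local Notation mild T := (mild a om T).
Local Notation Mom := (Mom P x).
Local Notation Muv := (Mom ord0 ord_max).

Definition diag (c : R) (f : R -> S -> S -> R) (s : R) i j := if i == j then c * f s i j else 0.

Let f01 (s : R) i j := Muv i j s.
Let ce n m := if n == m :> 'I_2 then kap else kap * rho.

Lemma Mom_mild (T : nat) n m :
 mild T%:R (fun s i j => Mom n m i j s) (diag (ce n m) f01) (fun _ _ => 1).
Proof.
have T0 : 0 <= (T%:R : R) <= T%:R by rewrite ler0n lexx.
have MomC p q k l s : Mom p q k l s = Mom q p l k s by apply: eq_mean => w; rewrite mulrC.
have mD (t : R) := mI `[0, t].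
have gE i j (s : R) : mgen P a kap rho x n m i j s = Pop a (fun i j => Mom n m i j s) i j + diag (ce n m) f01 s i j.
 by rewrite /mgen /diag /f01; case: eqP => // ->.
have iq (t : R) i j : 0 <= t <= T%:R -> itg mu `[0, t] (fun s => expR (2 * s) * diag (ce n m) f01 s i j).
 move=> tT; apply: itg_expM => //; apply: (eq_itg (mD t) _ (itgZ (mD t) (if i == j then ce n m else 0) (Mom_itg M ord0 ord_max i j tT))).
 by move=> s _; rewrite /diag /f01; case: ifP => _; ring.
have ip (t : R) i j : 0 <= t <= T%:R -> itg mu `[0, t] (fun s => expR (2 * s) * Pop a (fun i j => Mom n m i j s) i j).
 move=> tT; have [i1 _] := moment_mild M n m i j tT.
 apply: (eq_itg (mD t) _ (itgB (mD t) i1 (iq t i j tT))) => s _.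
 by rewrite gE; ring.
split.
- by move=> s sT i j; case: (exp_Tm M n m i j sT).
- move=> s sT i j; have [h _] := exp_Tm M m n j i sT. by apply: (eq_sm _ h) => k; rewrite MomC.
- move=> i j; apply: itg_expM => //; exact (Mom_itg M n m i j T0).
- by move=> i j; exact: ip.
- by move=> i j; exact: iq.
- move=> t i j tT; have [_ ->] := moment_mild M n m i j tT.
 rewrite -addrA -(RintegralD (mD t) (ip t i j tT) (iq t i j tT)); congr (_ + _).
 by apply: Rint_ext => s _; rewrite gE mulrDr.
- eexists => t L L' tT; have /andP[t0 _] := tT.
 apply: (le_trans _ (psum_Mom M n m (maxn L L') tT)).
 have p0 i j : 0 <= om i * om j * Mom n m i j t by rewrite !mulr_ge0 ?(ltW (rm_om M _))//; apply: (Mom_ge0 M).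
 rewrite /wsum; apply: (@le_trans _ _ (psum (fun i => psum (fun j => om i * om j * Mom n m i j t) (maxn L L')) L)).
  apply: le_psum => i; rewrite (eq_psum (g := fun j => om i * om j * Mom n m i j t)); last first.
   by move=> j; rewrite ger0_norm//; apply: (Mom_ge0 M).
  by apply: psum_homo; [exact: p0|exact: leq_maxr].
 by apply: psum_homo; [move=> i; apply: psum_ge0; exact: p0|exact: leq_maxl].
Qed.

Let le0 (T : nat) (k : R) f q phi := @mild_le0 R S a om K T%:R (rm_om M) (rm_a M) (rm_K0 M) (rm_K M) (ler0n _ _) k f q phi.

Let nat_bd (t : R) : 0 <= t -> exists T : nat, 0 <= t <= T%:R.
Proof.
move=> t0; exists (Num.truncn t).+1; rewrite t0/=.
by apply/ltW/truncnS_gt.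
Qed.

Let kr0 : 0 <= kap * rho := mulr_ge0 (rm_kap M) (ltW rho0).

(** Both moments start from 1 and have diagonal sources kap rho E[uv] and kap E[uv]; since rho <= 1
    and E[uv] >= 0, the source of the difference is nonpositive. *)
Lemma mixed_le_second n i j (t : R) : 0 <= t -> Muv i j t <= Mom n n i j t.
Proof.
move=> t0; have [T tT] := nat_bd t0.
have := mild_lin (rm_om M) 1 (-1) (Mom_mild T ord0 ord_max) (Mom_mild T n n).
move=> /(le0 (lexx 0)) h; rewrite -subr_le0 -[X in X - _]mul1r -[X in _ + X]mulN1r.
apply: (h _ _ t i j tT) => [_ _|s i' j' sT]; first by rewrite mul1r mulN1r subrr.
rewrite /diag /ce eqxx/=; case: ifP => _; last by rewrite mulr0 mulr0 addr0.
rewrite mul0r mul1r mulN1r -mulrBl mulr_le0_ge0//. by rewrite subr_le0; apply: ler_piMr => //; exact: rm_kap M.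
by rewrite /f01; apply: (Mom_ge0 M); case/andP: sT.
Qed.

(** The factor rho equalizes the sources exactly, and lowers the initial value from 1 to rho <=
    1. *)
Lemma second_le_mixed n i j (t : R) : 0 <= t -> rho * Mom n n i j t <= Muv i j t.
Proof.
move=> t0; have [T tT] := nat_bd t0.
have := mild_lin (rm_om M) rho (-1) (Mom_mild T n n) (Mom_mild T ord0 ord_max).
move=> /(le0 (lexx 0)) h; rewrite -subr_le0 -[X in _ + X]mulN1r.
apply: (h _ _ t i j tT) => [_ _|s i' j' sT]; first by rewrite mulr1 mulr1 subr_le0.
rewrite /diag /ce eqxx/=; case: ifP => _; last by rewrite mulr0 mulr0 addr0.
by rewrite mul0r; apply: eq_ler; ring.
Qed.

(** The exponential of a supersolution dominates: the source of the difference is at most kap rho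
    times the difference on the diagonal, and nonpositive off it. *)
Lemma mixed_le (l B : R) (phi : S -> S -> R) : (forall i j, 1 <= phi i j) -> (forall i j, `|phi i j| <= B) ->
 (forall i j, Pop a phi i j + (if i == j then kap * rho * phi i j else 0) <= (l + 2) * phi i j) ->
 forall i j (t : R), 0 <= t -> Muv i j t <= expR (l * t) * phi i j.
Proof.
move=> p1 pB hp i j t t0; have [T tT] := nat_bd t0.
have := mild_lin (rm_om M) 1 (-1) (Mom_mild T ord0 ord_max) (mild_exp T%:R (rm_om M) (rm_sm M) a_s l pB).
move=> /(le0 kr0) h; rewrite -subr_le0 -[X in X - _]mul1r -[X in _ + X]mulN1r.
apply: (h _ _ t i j tT) => [i' j'|s i' j' sT]; first by rewrite mul1r mulN1r subr_le0.
rewrite /diag /ce/= /f01 !mul1r !mulN1r; have := hp i' j'; have e0 := expR_ge0 (l * s); case: ifP => _.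
 rewrite -subr_ge0 => /(mulr_ge0 e0) h2; rewrite -subr_ge0; apply: le_trans h2 _.
 by apply: eq_ler; ring.
by rewrite addr0 add0r oppr_le0 -subr_ge0 => /(mulr_ge0 e0).
Qed.

Lemma mixed_ge (l B : R) (phi : S -> S -> R) : (forall i j, phi i j <= 1) -> (forall i j, `|phi i j| <= B) ->
 (forall i j, (l + 2) * phi i j <= Pop a phi i j + (if i == j then kap * rho * phi i j else 0)) ->
 forall i j (t : R), 0 <= t -> expR (l * t) * phi i j <= Muv i j t.
Proof.
move=> p1 pB hp i j t t0; have [T tT] := nat_bd t0.
have := mild_lin (rm_om M) 1 (-1) (mild_exp T%:R (rm_om M) (rm_sm M) a_s l pB) (Mom_mild T ord0 ord_max).
move=> /(le0 kr0) h; rewrite -subr_le0 -[X in X - _]mul1r -[X in _ + X]mulN1r.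
apply: (h _ _ t i j tT) => [i' j'|s i' j' sT]; first by rewrite mul1r mulN1r subr_le0.
rewrite /diag /ce/= /f01 !mul1r !mulN1r; have := hp i' j'; have e0 := expR_ge0 (l * s); case: ifP => _.
 rewrite -subr_ge0 => /(mulr_ge0 e0) h2; rewrite -subr_ge0; apply: le_trans h2 _.
 by apply: eq_ler; ring.
by rewrite addr0 subr0 => h2; rewrite mulr_ge0_le0// subr_le0.
Qed.

End second_moment_bounds.

(** * Series indexed by natural numbers *)

Section nat_sums.
Context (R : realType).
Implicit Types f g : nat -> R.

Lemma psum_nat f n : psum f n = \sum_(k < n) f k.
Proof.
apply: eq_bigr => k _; rewrite /pickle_inv.
have -> : unpickle (val k) = Some (val k) by exact: (@pickleK nat).
by rewrite /= eqxx.
Qed.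

Lemma cvg_osum I (F : set_system I) {FF : Filter F} (h : I -> nat -> R) f N :
 (forall m, h k m @[k --> F] --> f m) -> \sum_(m < N) h k m @[k --> F] --> \sum_(m < N) f m.
Proof.
move=> hf; rewrite -psum_nat (_ : (fun k => _) = (fun k => psum (h k) N)); first exact: cvg_psum.
by apply/funext => k; rewrite psum_nat.
Qed.

Lemma psum_S f n : psum f n.+1 = f 0%N + psum (f \o succn) n.
Proof. by rewrite !psum_nat big_ord_recl. Qed.

Lemma sm_S f : sm (f \o succn) <-> sm f.
Proof.
split=> -[B fB].
 exists (`|f 0%N| + `|B|) => -[|n]. by rewrite psum_nat big_ord0 addr_ge0.
 by rewrite psum_S lerD2l; apply: le_trans (fB n) (ler_norm _).
exists B => n; apply: le_trans (fB n.+1); rewrite psum_S lerDr; exact: normr_ge0.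
Qed.

Lemma ssum_S f : sm f -> ssum f = f 0%N + ssum (f \o succn).
Proof.
move=> sf; apply: ssum_uniq => //.
have h := psum_cvg ((sm_S f).2 sf).
by rewrite -cvg_shiftS (funext (psum_S f)); apply: cvgD; [exact: cvg_cst|].
Qed.

Lemma sm_fin f N : (forall k, (N <= k)%N -> f k = 0) -> sm f.
Proof.
elim: N f => [|N IH] f fN; first by apply: (eq_sm _ (sm0 R nat)) => k; rewrite fN.
by apply/sm_S; apply: IH => k Nk; apply: fN.
Qed.

Lemma ssum_fin f N : (forall k, (N <= k)%N -> f k = 0) -> ssum f = \sum_(k < N) f k.
Proof.
elim: N f => [|N IH] f fN. by rewrite big_ord0 -[RHS](ssum0 R nat); apply: eq_ssum => k; rewrite fN.
rewrite (ssum_S (sm_fin fN)) (IH (f \o succn)) ?big_ord_recl// => k Nk.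
exact: fN.
Qed.

Lemma ssum_shift m f : sm f -> sm (fun n => if (m <= n)%N then f (n - m)%N else 0) /\
 ssum (fun n => if (m <= n)%N then f (n - m)%N else 0) = ssum f.
Proof.
move=> sf; elim: m => [|m [IH1 IH2]].
 have E n : f n = if (0 <= n)%N then f (n - 0)%N else 0 by rewrite subn0.
 by split; [exact: (eq_sm E)|apply: esym; exact: eq_ssum].
have s1 : sm (fun n => if (m < n)%N then f (n - m.+1)%N else 0) by apply/sm_S.
by split => //; rewrite (ssum_S s1)/= add0r.
Qed.

Lemma ssum_triangle (f : nat -> nat -> R) : (forall m l, 0 <= f m l) ->
 (forall m, sm (f m)) -> sm (fun m => ssum (f m)) ->
 sm (fun n => \sum_(m < n.+1) f m (n - m)%N) /\
 ssum (fun n => \sum_(m < n.+1) f m (n - m)%N) = ssum (fun m => ssum (f m)).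
Proof.
move=> f0 sf sF; pose F m n := if (m <= n)%N then f m (n - m)%N else 0.
have F0 m n : 0 <= F m n by rewrite /F; case: ifP.
have s1 m : sm (F m) by case: (ssum_shift m (sf m)).
have E1 m : ssum (F m) = ssum (f m) by case: (ssum_shift m (sf m)).
have s2 : sm (fun m => ssum (F m)) by apply: (eq_sm _ sF) => m; rewrite E1.
have [h1 h2 h3] := ssum_swap F0 s1 s2.
have E2 n : ssum (F^~ n) = \sum_(m < n.+1) f m (n - m)%N.
 rewrite (@ssum_fin _ n.+1) => [|k nk]; last by rewrite /F leqNgt nk.
 by apply: eq_bigr => k _; rewrite /F -ltnS ltn_ord.
by split; [exact: (eq_sm E2 h2)|rewrite -(eq_ssum E2) h3; exact: eq_ssum].
Qed.

Lemma ssum_cauchy f g : (forall n, 0 <= f n) -> (forall n, 0 <= g n) -> sm f -> sm g ->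
 sm (fun n => \sum_(m < n.+1) f m * g (n - m)%N) /\
 ssum (fun n => \sum_(m < n.+1) f m * g (n - m)%N) = ssum f * ssum g.
Proof.
move=> f0 g0 sf sg.
have E m : ssum (fun l => f m * g l) = ssum g * f m by rewrite (ssumZ _ sg) mulrC.
have [||| h1 h2] := @ssum_triangle (fun m l => f m * g l).
- by move=> m l; exact: mulr_ge0.
- by move=> m; exact: smZ.
- exact: (eq_sm (fun m => esym (E m)) (smZ _ sf)).
by split => //; rewrite h2 (eq_ssum E) (ssumZ _ sf) mulrC.
Qed.

Lemma geo_sm (x : R) : 0 <= x < 1 -> sm (fun n => x ^+ n).
Proof.
move=> /andP[x0 x1]; apply: (ge0_sm (B := (1 - x)^-1)) => n; first exact: exprn_ge0.
rewrite psum_nat -div1r ler_pdivlMr ?subr_gt0// mulrC.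
rewrite (_ : (1 - x) * _ = 1 - x ^+ n); last by rewrite -[RHS]opprB subrX1; ring.
by rewrite gerBl exprn_ge0.
Qed.

Lemma geo_ssum (x : R) : 0 <= x < 1 -> ssum (fun n => x ^+ n) = (1 - x)^-1.
Proof.
move=> x01; have s := geo_sm x01; have := ssum_S s.
rewrite expr0 (eq_ssum (f := (fun n => x ^+ n) \o succn) (g := fun n => x * x ^+ n)); last by move=> n; rewrite /= exprS.
rewrite (ssumZ _ s); move: (ssum _) => y h; have /andP[_ x1] := x01.
apply: (mulfI (x := 1 - x)); first by rewrite subr_eq0 gt_eqF.
by rewrite divff ?subr_eq0 ?gt_eqF// mulrBl mul1r {1}h; ring.
Qed.

Lemma exp_sm (x : R) : 0 <= x -> sm (fun n => x ^+ n / n`!%:R).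
Proof.
move=> x0; have h0 n : 0 <= x ^+ n / n`!%:R by rewrite divr_ge0// exprn_ge0.
apply: (ge0_sm (B := expR x)) => // n; rewrite psum_nat.
have := is_cvg_series_exp_coeff x => hc.
apply: (cvg_to_ge _ hc); exists n => // m /= nm.
rewrite /series/= big_mkord (big_ord_widen _ (fun k => x ^+ k / k`!%:R) nm).
by rewrite big_mkcond; apply: ler_sum => k _; case: ifP => // _; exact: h0.
Qed.

Lemma exp_ssum (x : R) : 0 <= x -> ssum (fun n => x ^+ n / n`!%:R) = expR x.
Proof.
move=> x0; apply: ssum_uniq; first exact: exp_sm.
rewrite (_ : psum _ = series (exp_coeff x)); first exact: is_cvg_series_exp_coeff.
by apply/funext => n; rewrite psum_nat /series/= big_mkord.
Qed.

End nat_sums.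

Lemma ssum1 (R : realType) (T : countType) (f : T -> R) y : (forall x, x != y -> f x = 0) ->
 sm f /\ ssum f = f y.
Proof.
move=> fy; have sf : sm f.
 exists `|f y| => n; apply: (@le_trans _ _ (psum (fun i => `|f i|) (maxn n (pickle y).+1))).
  by apply: psum_homo => //; exact: leq_maxl.
 by rewrite (@psum1 _ _ _ y) ?leq_maxr// => x /fy->; rewrite normr0.
split => //; apply: ssum_uniq => //; apply: (@cvg_near_cst _ _ _ _ \oo).
by exists (pickle y).+1 => // n /= yn; exact: psum1.
Qed.

(** * Jump chain of the difference walk and its renewal equation *)

Section walk.
Context (R : realType) (G : countZmodType) (q : G -> R).
Hypotheses (q0 : forall x, 0 <= q x) (q_s : sm q) (q1 : ssum q = 1).
Implicit Types (f h : G -> R) (e : G -> G) (x y z : G).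

Definition ns h := (forall x, 0 <= h x) /\ sm h.
Definition Cop e h x := ssum (fun z => q z * h (x + e z)).
Definition pair f h := ssum (fun x => f x * h x).

Lemma ns_le h x : ns h -> h x <= ssum h.
Proof. by move=> [h0 hs]; exact: le_ssum1. Qed.

Lemma ns_mul f h : ns f -> ns h -> ns (fun x => f x * h x).
Proof.
move=> nf nh; have [f0 fs] := nf; have [h0 hs] := nh; split; first by move=> x; exact: mulr_ge0.
apply: (sm_dom (smZ (ssum h) fs)) => x; rewrite !ger0_norm ?mulr_ge0//; last exact: ssum_ge0.
by rewrite mulrC ler_wpM2r// ns_le.
Qed.

Lemma ns_shift h z : ns h -> ns (fun x => h (x + z)) /\ ssum (fun x => h (x + z)) = ssum h.
Proof.
move=> [h0 hs]; have be : bijective (fun x : G => x + z).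
 by exists (fun x => x - z) => x; rewrite ?addrK ?subrK.
by have [s1 s2] := ssum_reindex be h0 hs; split.
Qed.

Let bdd (h : G -> R) := exists B : R, forall x, `|h x| <= B.

Lemma ns_bdd h : ns h -> bdd h.
Proof. by move=> nh; exists (ssum h) => x; rewrite ger0_norm ?ns_le//; case: nh. Qed.

Lemma Cop_sm e h x : bdd h -> sm (fun z => q z * h (x + e z)).
Proof.
move=> [B hB]; apply: (sm_dom (smZ B q_s)) => z; rewrite !normrM mulrC ler_wpM2r//.
exact: le_trans (hB _) (ler_norm _).
Qed.

Lemma Cop_ns e h : ns h -> ns (Cop e h) /\ ssum (Cop e h) = ssum h.
Proof.
move=> nh; have [h0 hs] := nh.
have f0 z x : 0 <= q z * h (x + e z) by exact: mulr_ge0.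
have E z : ssum (fun x => q z * h (x + e z)) = ssum h * q z.
 by have [[_ s1] s2] := ns_shift (e z) nh; rewrite (ssumZ _ s1) s2 mulrC.
have s1 z : sm (fun x => q z * h (x + e z)) by apply: smZ; case: (ns_shift (e z) nh) => -[].
have s2 : sm (fun z => ssum (fun x => q z * h (x + e z))) by apply: (eq_sm _ (smZ (ssum h) q_s)) => z; rewrite E.
have [h1 h2 h3] := ssum_swap f0 s1 s2; split; first split => //. by move=> x; apply: ssum_ge0; [exact: h1|].
by rewrite [LHS]h3 (eq_ssum E) (ssumZ _ q_s) q1 mulr1.
Qed.

Lemma CopD e f h : ns f -> ns h -> Cop e (fun x => f x + h x) = (fun x => Cop e f x + Cop e h x).
Proof.
move=> nf nh; apply/funext => x; rewrite /Cop -(ssumD (Cop_sm e x (ns_bdd nf)) (Cop_sm e x (ns_bdd nh))).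
by apply: eq_ssum => z; rewrite mulrDr.
Qed.

Lemma CopZ e (c : R) h : ns h -> Cop e (fun x => c * h x) = (fun x => c * Cop e h x).
Proof.
move=> nh; apply/funext => x; rewrite /Cop -(ssumZ _ (Cop_sm e x (ns_bdd nh))).
by apply: eq_ssum => z; rewrite mulrCA.
Qed.

Lemma Cop_comm e e' h : ns h -> Cop e (Cop e' h) = Cop e' (Cop e h).
Proof.
move=> nh; apply/funext => x; have [h0 _] := nh.
have f0 z y : 0 <= q z * (q y * h (x + e z + e' y)) by rewrite !mulr_ge0.
have s1 z : sm (fun y => q z * (q y * h (x + e z + e' y))) by apply: smZ; exact: Cop_sm (ns_bdd nh).
have E z : ssum (fun y => q z * (q y * h (x + e z + e' y))) = q z * Cop e' h (x + e z).
 by rewrite (ssumZ _ (Cop_sm e' (x + e z) (ns_bdd nh))).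
have nC := (Cop_ns e' nh).1.
have s2 : sm (fun z => ssum (fun y => q z * (q y * h (x + e z + e' y)))).
 by apply: (eq_sm _ (Cop_sm e x (ns_bdd nC))) => z; rewrite E.
have [h1 h2 h3] := ssum_swap f0 s1 s2.
rewrite {1}/Cop -(eq_ssum E) -h3 /Cop; apply: eq_ssum => y.
rewrite -(ssumZ _ (Cop_sm e (x + e' y) (ns_bdd nh))); apply: eq_ssum => z.
by rewrite mulrCA addrAC.
Qed.

Lemma pair_adj e f h : ns f -> ns h -> pair f (Cop e h) = pair (Cop (fun z => - e z) f) h.
Proof.
move=> nf nh; have [f0 fs] := nf; have [h0 hs] := nh.
pose X x z := q z * (f x * h (x + e z)).
have X0 x z : 0 <= X x z by rewrite /X !mulr_ge0.
have XE x z : f x * (q z * h (x + e z)) = X x z by rewrite /X mulrCA.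
have s1 x : sm (X x) by apply: (eq_sm (XE x)); apply: smZ; exact: Cop_sm (ns_bdd nh).
have E1 x : ssum (X x) = f x * Cop e h x by rewrite -(ssumZ _ (Cop_sm e x (ns_bdd nh))); apply: eq_ssum => z; rewrite XE.
have s2 : sm (fun x => ssum (X x)) by apply: (eq_sm _ (ns_mul nf (Cop_ns e nh).1).2) => x; rewrite E1.
have [h1 h2 h3] := ssum_swap X0 s1 s2.
pose Y x z := q z * f (x - e z) * h x.
have Y0 x z : 0 <= Y x z by rewrite /Y !mulr_ge0.
have t1 x : sm (Y x) by apply: smZr; exact (Cop_sm (fun z => - e z) x (ns_bdd nf)).
have F1 x : ssum (Y x) = Cop (fun z => - e z) f x * h x.
 rewrite [RHS]mulrC -(ssumZ _ (Cop_sm (fun z => - e z) x (ns_bdd nf))).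
 by apply: eq_ssum => z; rewrite /Y mulrC.
have t2 : sm (fun x => ssum (Y x)) by apply: (eq_sm _ (ns_mul (Cop_ns (fun z => - e z) nf).1 nh).2) => x; rewrite F1.
have [k1 k2 k3] := ssum_swap Y0 t1 t2.
rewrite /pair -(eq_ssum E1) -h3 -(eq_ssum F1) -k3; apply: eq_ssum => z.
have nYz : ns (Y^~ z) by split.
have [_ <-] := ns_shift (e z) nYz; apply: eq_ssum => x.
by rewrite /X /Y addrK mulrA.
Qed.

Definition del x : R := (x == 0)%:R.
(** On mass functions of the difference X1 - X2, [Aop] is a jump of the first walker and [Bop] a
    jump of the second. Their sum [Sop] doubles the total mass, which reflects the jump rate 2. *)
Definition Aop := Cop -%R.
Definition Bop := Cop id.
Definition Sop h x := Aop h x + Bop h x.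

Lemma ns_del : ns del /\ ssum del = 1.
Proof.
have [|s1 s2] := @ssum1 R G del 0; first by move=> x /negPf; rewrite /del => ->.
by split; [split => // x; rewrite ler0n|rewrite s2 /del eqxx].
Qed.

Lemma pair_del h : ns h -> pair h del = h 0.
Proof.
move=> nh; rewrite /pair; have [|_ ->] := @ssum1 R G (fun x => h x * del x) 0.
 by move=> x /negPf; rewrite /del => ->; rewrite mulr0.
by rewrite /del eqxx mulr1.
Qed.

Lemma ns_iter e n h : ns h -> ns (iter n (Cop e) h) /\ ssum (iter n (Cop e) h) = ssum h.
Proof.
move=> nh; elim: n => [|n [IH1 IH2]] //=.
by have [h1 ->] := Cop_ns e IH1.
Qed.

Lemma nsD f h : ns f -> ns h -> ns (fun x => f x + h x).
Proof. by move=> [f0 fs] [h0 hs]; split; [move=> x; exact: addr_ge0|exact: smD]. Qed.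

Lemma nsZ (c : R) h : 0 <= c -> ns h -> ns (fun x => c * h x).
Proof. by move=> c0 [h0 hs]; split; [move=> x; exact: mulr_ge0|exact: smZ]. Qed.

Lemma ns0 : ns (fun=> 0).
Proof. by split => //; exact: sm0. Qed.

Lemma ns_sum I (s : seq I) (h : I -> G -> R) : (forall i, ns (h i)) -> ns (fun x => \sum_(i <- s) h i x).
Proof.
move=> nh; split; first by move=> x; apply: sumr_ge0 => i _; case: (nh i).
by apply: sm_sum => i; case: (nh i).
Qed.

Lemma Sop_ns h : ns h -> ns (Sop h) /\ ssum (Sop h) = 2 * ssum h.
Proof.
move=> nh; have [[a1 a2] a3] := Cop_ns -%R nh; have [[b1 b2] b3] := Cop_ns id nh.
by split; [exact: (nsD (f := Aop h))|rewrite (ssumD a2 b2) a3 b3; ring].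
Qed.

Lemma SopD f h : ns f -> ns h -> Sop (fun x => f x + h x) = (fun x => Sop f x + Sop h x).
Proof.
by move=> nf nh; apply/funext => x; rewrite /Sop /Aop /Bop !CopD// addrACA.
Qed.

Lemma SopZ (c : R) h : ns h -> Sop (fun x => c * h x) = (fun x => c * Sop h x).
Proof. by move=> nh; apply/funext => x; rewrite /Sop /Aop /Bop !CopZ// mulrDr. Qed.

Lemma Sop0 : Sop (fun=> 0) = fun=> 0.
Proof.
have := SopZ 0 ns0; rewrite (_ : (fun _ : G => 0 * 0) = fun=> 0); last by apply/funext => x; rewrite mul0r.
by move=> E; apply/funext => x; rewrite {1}E mul0r.
Qed.

Lemma Sop_sum I (s : seq I) (h : I -> G -> R) : (forall i, ns (h i)) ->
 Sop (fun x => \sum_(i <- s) h i x) = (fun x => \sum_(i <- s) Sop (h i) x).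
Proof.
move=> nh; elim: s => [|i s IH].
 by rewrite (_ : (fun x => _) = fun=> 0) ?Sop0; apply/funext => x; rewrite big_nil.
rewrite (_ : (fun x => _) = (fun x => h i x + \sum_(j <- s) h j x)); last by apply/funext => x; rewrite big_cons.
rewrite SopD//; last exact: ns_sum.
by apply/funext => x; rewrite big_cons IH.
Qed.

(* [cn n x] is 2^n times the probability that X1 - X2 is at x after n jumps *)
Definition qn n := iter n Aop del.
Definition cn n := iter n Sop del.

Lemma ns_qn n : ns (qn n) /\ ssum (qn n) = 1.
Proof. by have [h1 h2] := ns_iter -%R n ns_del.1; split => //; rewrite h2 ns_del.2. Qed.

Lemma ns_cn n : ns (cn n) /\ ssum (cn n) = 2 ^+ n.
Proof.
elim: n => [|n [IH1 IH2]]; first by rewrite expr0; exact: ns_del.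
by have [h1 h2] := Sop_ns IH1; split => //; rewrite [LHS]h2 IH2 exprS.
Qed.

Lemma cn_ge0 n x : 0 <= cn n x. Proof. by case: (ns_cn n) => -[]. Qed.

Lemma cn_le n x : cn n x <= 2 ^+ n.
Proof. by have [h1 <-] := ns_cn n; exact: ns_le. Qed.

(** Mass function of the difference after [m] jumps of the first walker and [l] of the second; the
    order is immaterial because the two operators commute. *)
Definition corr m l := iter m Aop (iter l Bop del).

Lemma ns_corr m l : ns (corr m l).
Proof. by apply: (ns_iter _ _ _).1; apply: (ns_iter _ _ _).1; exact: ns_del.1. Qed.

Lemma Sop_corr m l x : Sop (corr m l) x = corr m.+1 l x + corr m l.+1 x.
Proof.
rewrite /Sop; congr (_ + _); rewrite /corr; elim: m x => // m IH x /=.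
rewrite /Bop /Aop Cop_comm; last exact: ns_corr.
by congr (Cop _ _ _); apply/funext => y; exact: IH.
Qed.

Lemma cn_corr n x : cn n x = \sum_(m < n.+1) 'C(n, m)%:R * corr m (n - m) x.
Proof.
elim: n x => [|n IH] x; first by rewrite big_ord_recr big_ord0/= add0r bin0 mul1r.
have -> : cn n.+1 x = Sop (fun x => \sum_(m < n.+1) 'C(n, m)%:R * corr m (n - m) x) x.
 by rewrite /cn/=; congr (Sop _ _); apply/funext.
rewrite Sop_sum; last by move=> m; apply: nsZ => //; exact: ns_corr.
rewrite (eq_bigr (fun m : 'I_n.+1 => 'C(n, m)%:R * corr m.+1 (n - m) x + 'C(n, m)%:R * corr m (n.+1 - m) x)); last first.
 move=> m _; rewrite (SopZ _ (ns_corr _ _)) Sop_corr mulrDr subSn// -ltnS; exact: ltn_ord.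
rewrite big_split/= addrC big_ord_recl [in RHS]big_ord_recl/= !bin0 ?subn0 -addrA; congr (_ + _).
rewrite [in RHS](eq_bigr (fun m : 'I_n.+1 => 'C(n, m.+1)%:R * corr m.+1 (n - m) x + 'C(n, m)%:R * corr m.+1 (n - m) x)); last first.
 by move=> m _; rewrite /bump/= add1n binS natrD mulrDl subSS.
rewrite big_split/=; congr (_ + _); rewrite [in RHS]big_ord_recr/= bin_small// mul0r addr0.
by apply: eq_bigr => m _; rewrite /bump/= add1n subSS.
Qed.

Lemma pair_iter l f h : ns f -> ns h -> pair f (iter l Aop h) = pair (iter l Bop f) h.
Proof.
move=> nf nh; elim: l f nf => [|l IH] f nf //=.
rewrite -[Bop (iter l Bop f)]/(iter l.+1 Bop f) iterSr -IH; last exact: (Cop_ns _ nf).1.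
rewrite /Aop pair_adj//; last by case: (ns_iter -%R l nh).
by rewrite (_ : (fun z => - - z) = id) //; apply/funext => z; rewrite opprK.
Qed.

Lemma pair_qn m l : pair (qn m) (qn l) = corr m l 0.
Proof.
have nm := (ns_qn m).1; rewrite pair_iter//; last exact: ns_del.1.
rewrite pair_del; last by case: (ns_iter id l nm).
suff -> : iter l Bop (qn m) = corr m l by [].
rewrite /corr; elim: m {nm} => //= m <-.
elim: l => //= l ->; rewrite /Bop /Aop Cop_comm//.
by case: (ns_iter id l (ns_qn m).1).
Qed.

(** Among n jumps, m belong to the first walker in binomially many arrangements, and the difference
    is at 0 when two independent walkers with m and n - m jumps meet. This is the link to the
    probabilistic definition of [pbar]. *)
Lemma cn0_pair n : cn n 0 = \sum_(m < n.+1) 'C(n, m)%:R * pair (qn m) (qn (n - m)).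
Proof. by rewrite cn_corr; apply: eq_bigr => m _; rewrite pair_qn. Qed.

Definition kill h x : R := if x == 0 then 0 else h x.
(* first-return coefficients, with Fr k standing for F_(k+1) *)
Definition Fr k := iter k (fun h => Sop (kill h)) (Sop del).

Lemma ns_kill h : ns h -> ns (kill h).
Proof.
move=> [h0 hs]; split; first by move=> x; rewrite /kill; case: ifP.
by apply: (sm_dom hs) => x; rewrite /kill; case: ifP => //; rewrite normr0.
Qed.

Lemma ns_Fr k : ns (Fr k).
Proof.
elim: k => [|k IH] /=; first exact: (Sop_ns ns_del.1).1.
exact: (Sop_ns (ns_kill IH)).1.
Qed.

Lemma killE h x : h x = h 0 * del x + kill h x.
Proof. by rewrite /kill /del; case: eqP => [->|]; rewrite ?mulr1 ?mulr0 ?addr0 ?add0r. Qed.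

(** Splitting the mass after n+1 jumps into its part at 0 and the rest: the part at 0 restarts the
    walk and yields the new term with [Fr 0], while a further jump carries each killed [Fr k] to
    [Fr k.+1]. *)
Lemma renewal n x : cn n.+1 x = \sum_(k < n.+1) Fr k x * cn (n - k) 0.
Proof.
elim: n x => [|n IH] x. by rewrite big_ord_recr big_ord0/= add0r /del eqxx mulr1.
have -> : cn n.+2 x = Sop (fun x => cn n.+1 0 * del x + \sum_(k < n.+1) cn (n - k) 0 * kill (Fr k) x) x.
 rewrite (_ : cn n.+2 x = Sop (cn n.+1) x)//; congr (Sop _ x).
 apply/funext => y; rewrite {1}(killE (cn n.+1) y); congr (_ + _).
 rewrite {1}/kill; have [->|y0] := eqVneq y 0. by rewrite big1 // => k _; rewrite /kill eqxx mulr0.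
 under [in RHS]eq_bigr do rewrite /kill (negPf y0).
 by rewrite IH; apply: eq_bigr => k _; rewrite mulrC.
have nk (k : 'I_n.+1) : ns (fun x => cn (n - k) 0 * kill (Fr k) x).
 by apply: nsZ; [exact: cn_ge0|apply: ns_kill; exact: ns_Fr].
rewrite SopD; [|by apply: nsZ; [exact: cn_ge0|exact: ns_del.1]|exact: ns_sum].
rewrite Sop_sum// (SopZ _ ns_del.1) [in RHS]big_ord_recl subn0; congr (_ + _); first by rewrite mulrC.
apply: eq_bigr => k _; rewrite lift0 subSS (SopZ _ (ns_kill (ns_Fr k))) mulrC.
by [].
Qed.

(** A jump by some z != 0 of one walker is undone by the same jump of the other, so a first return
    at the second jump has positive weight even for asymmetric rates. *)
Lemma Fr1_gt0 : q 0 < 1 -> 0 < Fr 1 0.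
Proof.
move=> q01; have [z [z0 qz]] : exists z, z != 0 /\ 0 < q z.
 apply: contrapT => h; have hq z : z != 0 -> q z = 0.
  move=> z0; apply/eqP; rewrite eq_le q0 andbT leNgt; apply/negP => qz; apply: h; by exists z.
 by have [_ E] := ssum1 hq; move: q01; rewrite -E q1 ltxx.
have qF : q z <= Fr 0 z.
 rewrite /Fr/= /Sop; apply: (@le_trans _ _ (Aop del z)); last first.
  by rewrite lerDl; case: (Cop_ns id ns_del.1) => -[].
 apply: le_trans (le_ssum1 (f := fun y => q y * del (z - y)) z _ _).
 - by rewrite /del subrr eqxx mulr1.
 - by move=> y; rewrite mulr_ge0// /del ler0n.
 - exact (Cop_sm -%R z (ns_bdd ns_del.1)).
apply: (@lt_le_trans _ _ (q z * kill (Fr 0) (0 + z))).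
 by rewrite mulr_gt0// add0r /kill (negPf z0); apply: lt_le_trans qF.
rewrite [leRHS]/= {2}/Sop; apply: (@le_trans _ _ (Bop (kill (Fr 0)) 0)).
 apply: (le_ssum1 (f := fun y => q y * kill (Fr 0) (0 + id y)) z).
 - by move=> y; rewrite mulr_ge0//; case: (ns_kill (ns_Fr 0)).
 - exact (Cop_sm id 0 (ns_bdd (ns_kill (ns_Fr 0)))).
by rewrite lerDr; case: (Cop_ns -%R (ns_kill (ns_Fr 0))) => -[].
Qed.

End walk.

Lemma inv_convex_lt (R : realType) (l x y : R) : 0 < x -> 0 < y -> x != y -> 0 < l < 1 ->
 (l * x + (1 - l) * y)^-1 < l * x^-1 + (1 - l) * y^-1.
Proof.
move=> x0 y0 xy /andP[l0 l1]; have l1' : 0 < 1 - l by rewrite subr_gt0.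
have A0 : 0 < l * x + (1 - l) * y by rewrite addr_gt0// mulr_gt0.
rewrite -div1r ltr_pdivrMr//.
have -> : (l * x^-1 + (1 - l) * y^-1) * (l * x + (1 - l) * y) = 1 + l * (1 - l) * (x - y) ^+ 2 * (x^-1 * y^-1).
 by field; rewrite !gt_eqF.
have d0 : 0 < (x - y) ^+ 2 by rewrite lt_neqAle sqr_ge0 eq_sym sqrf_eq0 subr_eq0 xy.
have X0 : 0 < x^-1 * y^-1 by rewrite mulr_gt0// invr_gt0.
by rewrite ltrDl; apply: mulr_gt0 => //; apply: mulr_gt0 => //; exact: mulr_gt0.
Qed.

(** Induction on the exponent: x^-n and x^-1 are ordered alike, so Chebyshev's sum inequality lets
    the product of the averages be bounded by the average of the products. *)
Lemma invn_convex (R : realType) (l x y : R) n : 0 < x -> 0 < y -> x != y -> 0 < l < 1 ->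
 (l * x + (1 - l) * y) ^- n <= l * x ^- n + (1 - l) * y ^- n.
Proof.
move=> x0 y0 xy l01; have base := ltW (inv_convex_lt x0 y0 xy l01); have /andP[/ltW l0 /ltW l1] := l01.
have l1' : 0 <= 1 - l by rewrite subr_ge0.
have A0 : 0 <= l * x + (1 - l) * y by rewrite addr_ge0// mulr_ge0// ltW.
have cheb (a b c d : R) : 0 <= (a - b) * (c - d) -> (l * a + (1 - l) * b) * (l * c + (1 - l) * d) <= l * (a * c) + (1 - l) * (b * d).
 move=> h; have h2 := mulr_ge0 (mulr_ge0 l0 l1') h; rewrite -subr_ge0; apply: le_trans h2 _.
 by apply: eq_ler; ring.
elim: n => [|n IH]; first by rewrite !expr0 invr1; lra.
rewrite !exprSr !invfM; apply: le_trans (cheb _ _ _ _ _); last first.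
 have [h|h] := leP x y.
  by apply: mulr_ge0; rewrite subr_ge0 lef_pV2 ?posrE ?exprn_gt0// lerXn2r// ?nnegrE ltW.
 by apply: mulr_le0; rewrite subr_le0 lef_pV2 ?posrE ?exprn_gt0// ?lerXn2r// ?nnegrE ?ltW.
by apply: ler_pM => //; rewrite invr_ge0 ?exprn_ge0.
Qed.

Lemma invn_lip (R : realType) (u v : R) n : 1 <= u -> 1 <= v -> `|u ^- n - v ^- n| <= n%:R * `|u - v|.
Proof.
move=> u1 v1; have u0 : 0 < u by apply: lt_le_trans u1. have v0 : 0 < v by apply: lt_le_trans v1.
elim: n => [|n IH]; first by rewrite !expr0 subrr normr0 mul0r.
rewrite !exprSr !invfM (_ : _ - _ = u^-1 * (u ^- n - v ^- n) + v ^- n * (u^-1 * v^-1 * (v - u))); last by field; rewrite !gt_eqF//= ?exprn_gt0.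
apply: (le_trans (ler_normD _ _)); rewrite -natr1 mulrDl mul1r; apply: lerD.
 rewrite normrM; apply: le_trans IH; apply: ler_piMl => //.
 by rewrite ger0_norm ?invf_le1// invr_ge0 ltW.
rewrite !normrM mulrA [`|u - v|]distrC; apply: ler_piMl => //.
rewrite !ger0_norm ?invr_ge0 ?exprn_ge0 ?(ltW u0) ?(ltW v0)//.
by rewrite mulr_ile1 ?mulr_ge0 ?mulr_ile1 ?invr_ge0 ?exprn_ge0 ?(ltW u0) ?(ltW v0)// invf_le1 ?exprn_gt0// exprn_ege1.
Qed.

(** * Green function, first returns and the function phi *)

Section resolvent.
Context (R : realType) (G : countZmodType) (q : G -> R).
Hypotheses (q0 : forall x, 0 <= q x) (q_s : sm q) (q1 : ssum q = 1).
Implicit Types (x y z : G) (l : R).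
Local Notation cn := (cn q).
Local Notation Sop := (Sop q).
Let b n := cn n 0.
Let F n := Fr q n 0.
Let c0 := cn_ge0 q0 q_s q1.
Let F0 n : 0 <= F n. Proof. by case: (ns_Fr q0 q_s q1 n) => h _; exact: h. Qed.

(** The resolvent at [l] of the walk with jump rate 2: the n-th jump chain law cn / 2^n has weight
    2^n / (l+2)^(n+1) in it. *)
Definition green l x := ssum (fun n => cn n x / (l + 2) ^+ n.+1).

Let l2_gt0 l : 0 <= l -> 0 < l + 2. Proof. by move=> l0; lra. Qed.

Lemma geo_l l : 0 < l -> sm (fun n => 2 ^+ n / (l + 2) ^+ n.+1) /\
 ssum (fun n => 2 ^+ n / (l + 2) ^+ n.+1) = l^-1.
Proof.
move=> l0; have l2 : 0 < l + 2 by apply: l2_gt0; exact: ltW.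
have E n : (l + 2)^-1 * (2 / (l + 2)) ^+ n = 2 ^+ n / (l + 2) ^+ n.+1 by rewrite exprMn exprVn exprS invfM mulrCA.
have x01 : 0 <= 2 / (l + 2) < 1 by rewrite divr_ge0 ?(ltW l2)//= ltr_pdivrMr// mul1r ltrDr.
have s := geo_sm x01; split; first by apply: (eq_sm E); exact: smZ.
rewrite -(eq_ssum E) (ssumZ _ s) (geo_ssum x01); field.
by rewrite !gt_eqF// (_ : l + 2 - 2 = l) ?gt_eqF//; ring.
Qed.

Lemma green_term_ge0 l n x : 0 <= l -> 0 <= cn n x / (l + 2) ^+ n.+1.
Proof. by move=> l0; rewrite divr_ge0 ?c0 ?exprn_ge0// ltW// l2_gt0. Qed.

Lemma green_sm l x : 0 < l -> sm (fun n => cn n x / (l + 2) ^+ n.+1).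
Proof.
move=> l0; apply: (sm_dom (geo_l l0).1) => n.
have l2 : 0 < l + 2 by apply: l2_gt0; exact: ltW.
rewrite ger0_norm ?green_term_ge0 ?(ltW l0)// ger0_norm ?divr_ge0 ?exprn_ge0 ?(ltW l2)//.
by apply: ler_wpM2r; [rewrite invr_ge0 exprn_ge0// ltW|exact: cn_le].
Qed.

Lemma green_ge0 l x : 0 < l -> 0 <= green l x.
Proof. by move=> l0; apply: ssum_ge0; [exact: green_sm|move=> n; apply: green_term_ge0; exact: ltW]. Qed.

Lemma green_le l x : 0 < l -> l * green l x <= 1.
Proof.
move=> l0; rewrite -ler_pdivlMl// mulr1 -(geo_l l0).2; apply: le_ssum; [exact: green_sm|exact: (geo_l l0).1|].
move=> n; apply: ler_wpM2r; last exact: cn_le.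
by rewrite invr_ge0 exprn_ge0// ltW// l2_gt0// ltW.
Qed.

Lemma green_ns l : 0 < l -> ns (green l).
Proof.
move=> l0; split; first by move=> x; exact: green_ge0.
have s1 n : sm (fun x => cn n x / (l + 2) ^+ n.+1) by apply: smZr; case: (ns_cn q0 q_s q1 n) => -[].
have s2 : sm (fun n => ssum (fun x => cn n x / (l + 2) ^+ n.+1)).
 apply: (eq_sm _ (geo_l l0).1) => n; have [[_ h1] h2] := ns_cn q0 q_s q1 n.
 by rewrite -h2 [LHS]mulrC -(ssumZ _ h1); apply: eq_ssum => x; rewrite mulrC.
by have [] := ssum_swap (fun n x => @green_term_ge0 l n x (ltW l0)) s1 s2.
Qed.

Lemma Cop_green e l x : 0 < l ->
 sm (fun n => Cop q e (cn n) x / (l + 2) ^+ n.+1) /\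
 ssum (fun n => Cop q e (cn n) x / (l + 2) ^+ n.+1) = Cop q e (green l) x.
Proof.
move=> l0; pose X z n := q z * (cn n (x + e z) / (l + 2) ^+ n.+1).
have X0 z n : 0 <= X z n by rewrite mulr_ge0// green_term_ge0// ltW.
have s1 z : sm (X z) by apply: smZ; exact: green_sm.
have E z : ssum (X z) = q z * green l (x + e z) by rewrite (ssumZ _ (green_sm (x + e z) l0)).
have s2 : sm (fun z => ssum (X z)) by apply: (eq_sm _ (Cop_sm q_s e x (ns_bdd (green_ns l0)))) => z; rewrite E.
have [h1 h2 h3] := ssum_swap X0 s1 s2.
have E2 n : ssum (X^~ n) = Cop q e (cn n) x / (l + 2) ^+ n.+1.
 rewrite [RHS]mulrC -(ssumZ _ (Cop_sm q_s e x (ns_bdd (ns_cn q0 q_s q1 n).1))).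
 by apply: eq_ssum => z; rewrite /X mulrA mulrC.
by split; [exact: (eq_sm E2 h2)|rewrite -(eq_ssum E2) h3 (eq_ssum E)].
Qed.

Lemma green_resolvent l x : 0 < l -> (l + 2) * green l x = del R x + Sop (green l) x.
Proof.
move=> l0; have l2 : 0 < l + 2 by apply: l2_gt0; exact: ltW.
rewrite -(ssumZ _ (green_sm x l0)) (ssum_S (smZ _ (green_sm x l0))).
congr (_ + _); first by rewrite expr1 mulrC divfK ?gt_eqF.
have [a1 a2] := Cop_green -%R x l0; have [b1 b2] := Cop_green id x l0.
rewrite /Sop /Aop /Bop -a2 -b2 -(ssumD a1 b1); apply: eq_ssum => n /=.
by rewrite -mulrDl exprS invfM mulrCA mulVKf// gt_eqF.
Qed.

(** Since [F n] belongs to the first return at jump n+1, psi(l) is l+2 times the first-return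
    transform U(l), and phi(l) = (l+2)(1 - U(l)). The shift leaves the term n = 0 constant in l. *)
Definition psi l := ssum (fun n => F n / (l + 2) ^+ n).
Definition phi l := l + 2 - psi l.

Let F_le n : F n <= b n.+1.
Proof.
rewrite /b /F (renewal q0 q_s q1) big_ord_recr/= subnn /cn/= /del eqxx mulr1 lerDr.
by apply: sumr_ge0 => k _; rewrite mulr_ge0//; [exact: F0|exact: c0].
Qed.

Let psi_term_ge0 l n : 0 <= l -> 0 <= F n / (l + 2) ^+ n.
Proof. by move=> l0; rewrite divr_ge0 ?exprn_ge0 ?F0//; apply/ltW/l2_gt0. Qed.

Let bz_sm l : 0 < l -> sm (fun n => b n / (l + 2) ^+ n).
Proof.
move=> l0; have l2 : l + 2 != 0 by rewrite gt_eqF// l2_gt0// ltW.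
apply: (eq_sm _ (smZ (l + 2) (green_sm 0 l0))) => n.
by rewrite exprS invfM mulrCA mulVKf.
Qed.

Let Fz_sm l : 0 < l -> sm (fun n => F n / (l + 2) ^+ n).
Proof.
move=> l0; have l2 := l2_gt0 (ltW l0).
apply: (sm_dom (smZ (l + 2) ((sm_S _).2 (bz_sm l0)))) => n /=.
rewrite ger0_norm ?psi_term_ge0 ?(ltW l0)// ger0_norm; last first.
 by rewrite mulr_ge0 ?(ltW l2)// divr_ge0 ?exprn_ge0 ?(ltW l2)//; exact: c0.
rewrite exprS invfM [leRHS]mulrCA mulVKf ?gt_eqF//.
by apply: ler_wpM2r; [rewrite invr_ge0 exprn_ge0// ltW|exact: F_le].
Qed.

(** The renewal equation is a convolution; its generating function at 1/(l+2) is the Cauchy product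
    of psi with the return series. *)
Lemma phi_green l : 0 < l -> phi l * green l 0 = 1.
Proof.
move=> l0; have l2 := l2_gt0 (ltW l0); have l2' : l + 2 != 0 by rewrite gt_eqF.
have bz0 n : 0 <= b n / (l + 2) ^+ n by rewrite divr_ge0 ?exprn_ge0 ?(ltW l2)//; exact: c0.
have [s1 s2] := ssum_cauchy (fun n => psi_term_ge0 n (ltW l0)) bz0 (Fz_sm l0) (bz_sm l0).
have Eg : ssum (fun n => b n / (l + 2) ^+ n) = (l + 2) * green l 0.
 by rewrite -(ssumZ _ (green_sm 0 l0)); apply: eq_ssum => n; rewrite exprS invfM mulrCA mulVKf.
have := ssum_S (bz_sm l0); rewrite Eg expr0 divr1 {1}/b /cn/= /del eqxx -[true%:R]/(1 : R).
have -> : ssum ((fun n => b n / (l + 2) ^+ n) \o succn) = (l + 2)^-1 * (psi l * ((l + 2) * green l 0)).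
 rewrite -Eg -s2 -(ssumZ _ s1); apply: eq_ssum => n /=.
 rewrite /b (renewal q0 q_s q1) exprS invfM mulrCA mulr_suml; congr (_ * _).
 apply: eq_bigr => k _; rewrite -mulrACA; congr (_ * _).
 by rewrite -invfM -exprD subnKC// -ltnS ltn_ord.
by rewrite [_^-1 * _]mulrCA mulKf// /phi => E; rewrite mulrBl E; ring.
Qed.

Lemma phi_gt0 l : 0 < l -> 0 < phi l.
Proof.
move=> l0; have g0 := green_ge0 0 l0; have := phi_green l0 => E.
by rewrite ltNge; apply/negP => p0; have := mulr_le0_ge0 p0 g0; rewrite E ler10.
Qed.

Let psum_psi_le N l : 0 < l -> psum (fun n => F n / (l + 2) ^+ n) N <= l + 2.
Proof.
move=> l0; apply: (@le_trans _ _ (psi l)).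
 by apply: psum_le_ssum; [move=> n; apply: psi_term_ge0; exact: ltW|exact: Fz_sm].
by have := phi_gt0 l0; rewrite /phi subr_gt0 => /ltW.
Qed.

Let psum_psi_lip N l l' : 0 <= l -> 0 <= l' ->
 `|psum (fun n => F n / (l + 2) ^+ n) N - psum (fun n => F n / (l' + 2) ^+ n) N| <=
 psum (fun n => F n * n%:R) N * `|l - l'|.
Proof.
move=> l0 l0'; rewrite -psumB; apply: (le_trans (norm_psum _ _)).
rewrite mulrC -psumZ; apply: le_psum => n; rewrite -mulrBr normrM (ger0_norm (F0 n)).
rewrite mulrCA ler_wpM2l// mulrC (_ : l - l' = (l + 2) - (l' + 2)); last by ring.
by apply: invn_lip; lra.
Qed.

(** Positivity of phi bounds the partial sums by l + 2 for l > 0, and finite partial sums are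
    Lipschitz in l, so the bound survives at l = 0. Recurrent and transient walks are treated
    alike. *)
Lemma psum_psi0 N : psum (fun n => F n / (0 + 2) ^+ n) N <= 2.
Proof.
apply/ler_addgt0Pr => e e0; pose C := psum (fun n => F n * n%:R) N.
have C0 : 0 <= C by apply: psum_ge0 => n; rewrite mulr_ge0.
pose l := e / (C + 1); have l0 : 0 < l by rewrite divr_gt0// ltr_wpDl.
have := psum_psi_lip N (lexx 0) (ltW l0); have := psum_psi_le N l0.
rewrite -/C sub0r normrN (gtr0_norm l0) => h1 h2.
have Cl : C * l + l = e by rewrite /l; field; rewrite gt_eqF// ltr_wpDl.
by have := ler_norm (psum (fun n => F n / (0 + 2) ^+ n) N - psum (fun n => F n / (l + 2) ^+ n) N); lra.
Qed.

Lemma psi_sm l : 0 <= l -> sm (fun n => F n / (l + 2) ^+ n).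
Proof.
move=> l0; apply: (sm_dom (ge0_sm (fun n => psi_term_ge0 n (lexx 0)) psum_psi0)) => n.
rewrite !ger0_norm ?psi_term_ge0//; apply: ler_wpM2l => //.
by rewrite lef_pV2 ?posrE ?exprn_gt0 ?l2_gt0// lerXn2r// ?nnegrE ?add0r ?lerDr// ltW ?l2_gt0.
Qed.

Lemma psi_anti l l' : 0 <= l -> l <= l' -> psi l' <= psi l.
Proof.
move=> l0 ll'; have l0' := le_trans l0 ll'.
apply: le_ssum; [exact: psi_sm|exact: psi_sm|] => n; apply: ler_wpM2l => //.
by rewrite lef_pV2 ?posrE ?exprn_gt0 ?l2_gt0// lerXn2r// ?nnegrE ?lerD2r// ltW ?l2_gt0.
Qed.

Lemma psi_ge0 l : 0 <= l -> 0 <= psi l.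
Proof. by move=> l0; apply: ssum_ge0; [exact: psi_sm|move=> n; exact: psi_term_ge0]. Qed.

Lemma psi_le2 l : 0 <= l -> psi l <= 2.
Proof.
move=> l0; apply: (le_trans (psi_anti (lexx 0) l0)); apply: ssum_le; first exact: psi_sm.
exact: psum_psi0.
Qed.

Lemma phi_le l : 0 <= l -> phi l <= l + 2.
Proof. by move=> l0; rewrite /phi gerBl psi_ge0. Qed.

Lemma phi_ge l : 0 <= l -> l <= phi l.
Proof. by move=> l0; rewrite /phi; have := psi_le2 l0; lra. Qed.

Lemma phi_incr l l' : 0 <= l -> l <= l' -> l' - l <= phi l' - phi l.
Proof. by move=> l0 ll'; rewrite /phi; have := psi_anti l0 ll'; lra. Qed.

(** The tail of the series for psi at any l >= 0 is at most its tail at 0, termwise; the remaining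
    finite sum is Lipschitz. *)
Lemma phi_unif e : 0 < e -> exists2 dl : R, 0 < dl & forall l l', 0 <= l -> 0 <= l' ->
 `|l - l'| < dl -> `|phi l - phi l'| <= e.
Proof.
move=> e0; have s0 := psi_sm (lexx 0).
have e4 : 0 < e / 4 by rewrite divr_gt0.
have [N hN] := (cvgn_eps _ _).1 (psum_cvg s0) _ e4.
pose C := psum (fun n => F n * n%:R) N.
have C0 : 0 <= C by apply: psum_ge0 => n; rewrite mulr_ge0.
have tail l : 0 <= l -> 0 <= psi l - psum (fun n => F n / (l + 2) ^+ n) N <= e / 4.
 move=> l0; rewrite subr_ge0 psum_le_ssum//=; [|by move=> n; exact: psi_term_ge0|exact: psi_sm].
 have sd : sm (fun n => F n / (0 + 2) ^+ n - F n / (l + 2) ^+ n) by apply: smB => //; exact: psi_sm.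
 have h : psum (fun n => F n / (0 + 2) ^+ n - F n / (l + 2) ^+ n) N <=
   ssum (fun n => F n / (0 + 2) ^+ n - F n / (l + 2) ^+ n).
  apply: psum_le_ssum => // n; rewrite subr_ge0; apply: ler_wpM2l => //.
  by rewrite lef_pV2 ?posrE ?exprn_gt0 ?l2_gt0// lerXn2r// ?nnegrE ?add0r ?lerDr// ltW ?l2_gt0.
 move: h; rewrite psumB (ssumB s0 (psi_sm l0)) -/(psi l) -/(psi 0) => h.
 have := hN N (leqnn N); rewrite -/(psi 0) => h2.
 by have := ler_norm (psi 0 - psum (fun n => F n / (0 + 2) ^+ n) N); move: h2; rewrite distrC; lra.
exists (Num.min 1 (e / 4 / (C + 1))); first by rewrite lt_min ltr01 divr_gt0// ltr_wpDl.
move=> l l' l0 l0'; rewrite lt_min => /andP[_ hl].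
have hl1 : (C + 1) * `|l - l'| <= e / 4 by rewrite mulrC -ler_pdivlMr ?ltr_wpDl//; exact: ltW.
have /andP[h1 h2] := tail l l0; have /andP[h3 h4] := tail l' l0'.
have := psum_psi_lip N l0 l0'; rewrite -/C ler_norml => /andP[h5 h6].
have := lexx `|l - l'|; rewrite ler_norml => /andP[h7 h8].
move: hl1; rewrite mulrDl mul1r => hl1.
by rewrite /phi ler_norml; apply/andP; split; lra.
Qed.

Lemma phi_surj s : phi 0 <= s -> exists2 l, 0 <= l & phi l = s.
Proof.
(* The absolute value extends phi continuously to the whole line. The search interval is [0, s]
   because phi(s) >= s. *)
move=> hs; pose f l := phi `|l|.
have s0 : 0 <= s by apply: le_trans hs; exact: phi_ge.
have fc : continuous f.
 move=> l; apply/cvgrPdist_le => e e0; have [dl dl0 h] := phi_unif e0.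
 near=> l'; apply: h => //; apply: le_lt_trans (ler_dist_dist _ _) _.
 near: l'; exact: cvgr_dist_lt.
have [] := @IVT R f 0 s s s0.
- exact: continuous_subspaceT.
- rewrite /f normr0 ger0_norm// ge_min hs/= le_max; apply/orP; right; exact: phi_ge.
- move=> l; rewrite in_itv/= => /andP[l0 _] E; exists l => //. by rewrite -E /f ger0_norm.
Unshelve. all: by end_near.
Qed.

(** Every term of psi is convex. The first term is constant, so strictness has to come from the
    second, which is a positive multiple of 1/(l+2). *)
Lemma phi_concave (l x y : R) : 0 < F 1%N -> 0 <= x -> 0 <= y -> x != y -> 0 < l < 1 ->
 l * phi x + (1 - l) * phi y < phi (l * x + (1 - l) * y).
Proof.
move=> F1 x0 y0 xy l01; have /andP[l0 l1] := l01.
have A0 : 0 <= l * x + (1 - l) * y by rewrite addr_ge0 ?mulr_ge0 ?subr_ge0// ltW.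
have E2 : l * x + (1 - l) * y + 2 = l * (x + 2) + (1 - l) * (y + 2) by ring.
suff : psi (l * x + (1 - l) * y) < l * psi x + (1 - l) * psi y by rewrite /phi; lra.
have sx := psi_sm x0; have sy := psi_sm y0; have sA := psi_sm A0.
have s2 := smD (smZ l sx) (smZ (1 - l) sy).
rewrite /psi -(ssumZ _ sx) -(ssumZ _ sy) -(ssumD (smZ l sx) (smZ (1 - l) sy)).
rewrite -subr_gt0 -(ssumB s2 sA).
have Ef (f u v : R) : l * (f * u) + (1 - l) * (f * v) = f * (l * u + (1 - l) * v) by ring.
have t0 n : 0 <= l * (F n / (x + 2) ^+ n) + (1 - l) * (F n / (y + 2) ^+ n) - F n / (l * x + (1 - l) * y + 2) ^+ n.
 rewrite subr_ge0 E2 Ef; apply: ler_wpM2l => //.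
 by apply: invn_convex => //; rewrite ?l2_gt0// (inj_eq (addIr _)).
apply: lt_le_trans (le_ssum1 1%N t0 (smB s2 sA)).
rewrite subr_gt0 E2 Ef ltr_pM2l// !expr1.
by apply: inv_convex_lt => //; rewrite ?l2_gt0// (inj_eq (addIr _)).
Qed.

End resolvent.

(** * Transition functions determined by their rates *)

(** Supremum argument for f(0) - e s <= f(s): the first hypothesis, a nonnegative lower right
    derivative, lets the inequality be prolonged, and the second, the absence of downward jumps from
    the left, lets it pass to the supremum. A transition function is known to be differentiable at
    time 0 only, and on one side. *)
Lemma dini_ge0 (R : realType) (f : R -> R) :
 (forall t e : R, 0 <= t -> 0 < e -> exists2 dl : R, 0 < dl & forall h, 0 < h -> h < dl -> f t - e * h <= f (t + h)) ->
 (forall t e : R, 0 < t -> 0 < e -> exists2 dl : R, 0 < dl & forall h, 0 < h -> h < dl -> h <= t -> f (t - h) - e <= f t) ->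
 forall t : R, 0 <= t -> f 0 <= f t.
Proof.
move=> fr fl T T0; apply/ler_addgt0Pr => e' e'0.
pose e := e' / (T + 1); have e0 : 0 < e by rewrite divr_gt0// ltr_wpDl.
have eT : e * T <= e' by rewrite /e mulrAC -mulrA ger_pMr// ler_pdivrMr ?ltr_wpDl// mul1r lerDl.
pose A := [set t : R | 0 <= t <= T /\ forall s : R, 0 <= s <= t -> f 0 - e * s <= f s].
have A0 : A 0.
 split; first by rewrite lexx.
 by move=> s; rewrite -eq_le => /eqP <-; rewrite mulr0 subr0.
have hA : has_sup A by split; [exists 0|exists T => t [/andP[]]].
pose c := sup A.
have c0 : 0 <= c by apply: (ub_le_sup hA.2).
have cT : c <= T by apply: ge_sup; [exists 0|move=> t [/andP[]]].
have ltc (s : R) : 0 <= s -> s < c -> f 0 - e * s <= f s.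
 move=> s0 sc; have cs : 0 < c - s by rewrite subr_gt0.
 have [t [_ At] ct] := sup_adherent cs hA; apply: At; rewrite s0 ltW//.
 by move: ct; rewrite -/c opprB addrCA subrr addr0.
have fc : f 0 - e * c <= f c.
 have [->|cn0] := eqVneq c 0; first by rewrite mulr0 subr0.
 have c1 : 0 < c by rewrite lt_neqAle eq_sym cn0.
 apply/ler_addgt0Pr => n n0; have [dl dl0 h] := fl c n c1 n0.
 pose k := Num.min (dl / 2) c.
 have k0 : 0 < k by rewrite lt_min c1 divr_gt0.
 have kd : k < dl by rewrite gt_min ltr_pdivrMr// ltr_pMr// (ltr_nat R 1 2).
 have kc : k <= c by rewrite ge_min lexx orbT.
 have := h k k0 kd kc; have := ltc (c - k); rewrite subr_ge0 gtrBl => /(_ kc k0).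
 have := mulr_gt0 e0 k0; rewrite mulrBr; lra.
suff E : T = c by move: eT; rewrite E; lra.
apply/eqP; rewrite eq_le cT andbT leNgt; apply/negP => cltT.
have [dl dl0 h] := fr c e c0 e0.
pose k := Num.min (dl / 2) (T - c).
have k0 : 0 < k by rewrite lt_min subr_gt0 cltT divr_gt0.
have kd : k < dl by rewrite gt_min ltr_pdivrMr// ltr_pMr// (ltr_nat R 1 2).
have kT : c + k <= T by rewrite -lerBrDl ge_min lexx orbT.
have : A (c + k).
 split; first by rewrite kT addr_ge0// ltW.
 move=> s /andP[s0 sck]; have [sc|cs] := ltP s c; first exact: ltc.
 have [->//|sn] := eqVneq s c.
 have sc0 : 0 < s - c by rewrite subr_gt0 lt_neqAle eq_sym sn.
 have scd : s - c < dl by apply: le_lt_trans kd; rewrite lerBlDl.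
 have := h _ sc0 scd; rewrite addrCA subrr addr0 mulrBr; lra.
by move=> /(ub_le_sup hA.2); rewrite -/c gerDl leNgt k0.
Qed.

Lemma cvg_right_eps (R : realType) (f : R -> R) (l : R) : f h @[h --> 0^'+] --> l ->
 forall e : R, 0 < e -> exists2 dl : R, 0 < dl & forall h, 0 < h -> h < dl -> `|l - f h| <= e.
Proof.
move=> /cvgrPdist_le fl e /fl[dl /= dl0 he]; exists dl => // h h0 hle; apply: he => //=.
by rewrite sub0r normrN gtr0_norm.
Qed.

Lemma exprB_le (R : realType) (t h : R) n : 0 <= t -> 0 <= h ->
 (t + h) ^+ n.+1 - t ^+ n.+1 <= n.+1%:R * h * (t + h) ^+ n.
Proof.
move=> t0 h0; elim: n => [|n IH]; first by rewrite !expr1 expr0; lra.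
have th : 0 <= t + h by rewrite addr_ge0.
rewrite (_ : _ - _ = t * ((t + h) ^+ n.+1 - t ^+ n.+1) + h * (t + h) ^+ n.+1); last by rewrite !exprS; ring.
apply: (@le_trans _ _ ((t + h) * (n.+1%:R * h * (t + h) ^+ n) + h * (t + h) ^+ n.+1)).
 rewrite lerD2r; apply: (le_trans (ler_wpM2l t0 IH)); rewrite ler_wpM2r ?lerDl//.
 by rewrite !mulr_ge0 ?exprn_ge0.
by apply: eq_ler; rewrite -[n.+2%:R]natr1 exprS; ring.
Qed.

Section transition.
Context (R : realType) (S : countType) (a : S -> S -> R) (p : R -> S -> S -> R).
Hypotheses (a0 : forall i j, 0 <= a i j) (a_s : forall i, sm (a i)) (a1 : forall i, ssum (a i) = 1).
Hypothesis p0 : forall (t : R) i j, 0 <= t -> 0 <= p t i j.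
Hypothesis p_s : forall (t : R) i, 0 <= t -> sm (p t i).
Hypothesis p1 : forall (t : R) i, 0 <= t -> ssum (p t i) = 1.
Hypothesis p00 : forall i j, p 0 i j = (i == j)%:R.
Hypothesis pCK : forall (s t : R) i j, 0 <= s -> 0 <= t ->
 sm (fun k => p s i k * p t k j) /\ ssum (fun k => p s i k * p t k j) = p (s + t) i j.
Hypothesis prate : forall i j, (p h i j - (i == j)%:R) / h @[h --> 0^'+] --> a i j - (i == j)%:R.

Let p_le1 (t : R) i j : 0 <= t -> p t i j <= 1.
Proof. by move=> t0; rewrite -(p1 i t0); apply: le_ssum1; [move=> k; exact: p0|exact: p_s]. Qed.

Let pdiag i k : p h i k @[h --> 0^'+] --> ((i == k)%:R : R).
Proof.
have h1 : (i == k)%:R + h * ((p h i k - (i == k)%:R) / h) @[h --> 0^'+] --> (i == k)%:R + 0 * (a i k - (i == k)%:R).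
 apply: cvgD; first exact: cvg_cst.
 apply: cvgM; last exact: prate.
 by apply: cvg_at_right_filter; exact: cvg_id.
rewrite mul0r addr0 in h1; apply: cvg_trans h1; apply: near_eq_cvg; near=> h.
by rewrite mulrC divfK ?gt_eqF// addrC subrK.
Unshelve. all: by end_near.
Qed.

(** The factor 1 + h, later bounded by exp(h), compensates the diagonal entry a(i,i) - 1 of the rate
    matrix, so that the limit is the nonnegative rate itself. *)
Let rate i k : ((1 + h) * p h i k - (i == k)%:R) / h @[h --> 0^'+] --> a i k.
Proof.
have h1 : (p h i k - (i == k)%:R) / h + p h i k @[h --> 0^'+] --> a i k - (i == k)%:R + (i == k)%:R.
 by apply: cvgD; [exact: prate|exact: pdiag].
rewrite subrK in h1; apply: cvg_trans h1; apply: near_eq_cvg; near=> h.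
by field; rewrite gt_eqF.
Unshelve. all: by end_near.
Qed.

Section step.
Variables (j : S) (N : nat) (al : nat -> S -> R).
Hypothesis al0 : forall m k, 0 <= al m k.
Hypothesis hal : forall (t : R) k, 0 <= t -> \sum_(m < N) t ^+ m / m`!%:R * al m k <= expR t * p t k j.

(** One step of the backward equation as an inequality: by Chapman-Kolmogorov over [0, h],
    restricted to finitely many first states, the function exp(t) p_t minus its candidate lower
    bound has a nonnegative lower right derivative. *)
Lemma exp_step i L (t : R) : 0 <= t ->
 (i == j)%:R + \sum_(m < N) t ^+ m.+1 / m.+1`!%:R * psum (fun k => a i k * al m k) L <= expR t * p t i j.
Proof.
pose be m := psum (fun k => a i k * al m k) L.
have be0 m : 0 <= be m by apply: psum_ge0 => k; rewrite mulr_ge0.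
pose Q (t : R) := \sum_(m < N) t ^+ m / m`!%:R * be m.
pose Y (t : R) := \sum_(m < N) t ^+ m.+1 / m.+1`!%:R * be m.
pose f (t : R) := expR t * p t i j - Y t.
have Qc : continuous Q.
 move=> s; apply: (cvg_osum (h := fun s m => s ^+ m / m`!%:R * be m) (f := fun m => s ^+ m / m`!%:R * be m)) => m; apply: cvgMr_tmp; apply: cvgMr_tmp; exact: exprn_continuous.
have YQ (s h : R) : 0 <= s -> 0 <= h -> Y (s + h) - Y s <= h * Q (s + h).
 move=> s0 h0; rewrite /Y /Q -sumrB mulr_sumr; apply: ler_sum => m _.
 rewrite -mulrBl -mulrBl !mulrA ler_wpM2r//.
 rewrite factS natrM invfM mulrA ler_wpM2r ?invr_ge0//.
 rewrite ler_pdivrMr ?ltr0n//; apply: le_trans (exprB_le _ s0 h0) _.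
 by apply: eq_ler; ring.
have f0 : f 0 = (i == j)%:R by rewrite /f /Y expR0 mul1r p00 big1 ?subr0// => m _; rewrite expr0n/= mul0r mul0r.
move=> t0; rewrite -lerBrDr -/(f t) -f0.
apply: dini_ge0 t0 => {t}.
(* The range is enlarged to include [i], so that the diagonal part of the difference quotient is
   fully present in the finite sum. *)
- move=> t e t0 e0; pose L' := maxn L (pickle i).+1.
 pose r (h : R) := expR t * psum (fun k => ((1 + h) * p h i k - (i == k)%:R) / h * p t k j) L' - Q (t + h).
 have rc : r h @[h --> 0^'+] --> expR t * psum (fun k => a i k * p t k j) L' - Q (t + 0).
  apply: cvgB. by apply: cvgMl_tmp; apply: cvg_psum => k; apply: cvgMr_tmp; exact: rate.
  apply: cvg_at_right_filter; apply: (@cvg_comp _ _ _ (fun h : R => t + h) Q _ (nbhs (t + 0))); last exact: Qc.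
  by apply: cvgD; [exact: cvg_cst|exact: cvg_id].
 have r0 : 0 <= expR t * psum (fun k => a i k * p t k j) L' - Q (t + 0).
  rewrite addr0 subr_ge0; apply: (@le_trans _ _ (psum (fun k => a i k * (expR t * p t k j)) L)); last first.
   rewrite -psumZ (eq_psum (g := fun k => expR t * (a i k * p t k j))); last by move=> k; rewrite mulrCA.
   by apply: psum_homo; [move=> k; rewrite !mulr_ge0 ?expR_ge0// p0|exact: leq_maxl].
  rewrite (_ : Q t = psum (fun k => a i k * \sum_(m < N) t ^+ m / m`!%:R * al m k) L).
   by apply: le_psum => k; apply: ler_wpM2l => //; exact: hal.
  rewrite /Q /be -(psum_nat (fun m => t ^+ m / m`!%:R * psum (fun k => a i k * al m k) L)) (eq_psum (g := fun m => psum (fun k => t ^+ m / m`!%:R * (a i k * al m k)) L)); last by move=> m; rewrite psumZ.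
  rewrite psum_swap; apply: eq_psum => k; rewrite psum_nat mulr_sumr.
  by apply: eq_bigr => m _; rewrite mulrCA.
 have [dl dl0 hd] := cvg_right_eps rc e0.
 exists dl => // h h0 hdl; have th : 0 <= t + h by rewrite addr_ge0// ltW.
 have hr : - e <= r h by have := hd h h0 hdl; rewrite distrC ler_norml => /andP[]; lra.
 have YQh := YQ t h t0 (ltW h0).
 have Eh : 1 + h <= expR h := expR_ge1Dx h.
 have [sC EC] := pCK i j (ltW h0) t0.
 have pp k : 0 <= p h i k * p t k j by rewrite mulr_ge0 ?p0// ltW.
 have P1 : psum (fun k => p h i k * p t k j) L' <= p (t + h) i j by rewrite addrC -EC; exact: psum_le_ssum.
 have P2 : expR t * ((1 + h) * psum (fun k => p h i k * p t k j) L') <= expR (t + h) * p (t + h) i j.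
  rewrite expRD -mulrA ler_wpM2l ?expR_ge0//; apply: ler_pM => //; first by rewrite addr_ge0// ltW.
  exact: psum_ge0.
 have P3 : h * (r h + Q (t + h)) = expR t * ((1 + h) * psum (fun k => p h i k * p t k j) L' - p t i j).
  rewrite /r subrK mulrCA -psumZ; congr (_ * _).
  have -> : p t i j = psum (fun k => (i == k)%:R * p t k j) L'.
   rewrite (@psum1 _ _ _ i) ?leq_maxr ?eqxx ?mul1r// => k /negPf; rewrite eq_sym => ->.
   by rewrite mul0r.
  rewrite -psumZ -psumB; apply: eq_psum => k.
  by field; rewrite gt_eqF.
 have := ler_wpM2l (ltW h0) hr; rewrite mulrN [h * e]mulrC => hr2.
 by rewrite (mulrDr h (r h)) (mulrBr (expR t)) in P3; rewrite /f; lra.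
- move=> t e t0 e0; pose B := expR t + Q t + 1.
 have c1 : expR t * (1 - p h i i) + h * Q t @[h --> 0^'+] --> expR t * (1 - (i == i)%:R) + 0 * Q t.
  apply: cvgD; first by apply: cvgMl_tmp; apply: cvgB; [exact: cvg_cst|exact: pdiag].
  by apply: cvgMr_tmp; apply: cvg_at_right_filter; exact: cvg_id.
 rewrite eqxx subrr mulr0 mul0r addr0 in c1.
 have [dl dl0 hd] := cvg_right_eps c1 e0.
 exists dl => // h h0 hdl ht; have th : 0 <= t - h by rewrite subr_ge0.
 have := hd h h0 hdl; rewrite sub0r normrN ler_norml => /andP[_ hb].
 have := YQ (t - h) h th (ltW h0); rewrite subrK => YQh.
 have [sC EC] := pCK i j (ltW h0) th.
 have pp k : 0 <= p h i k * p (t - h) k j by rewrite mulr_ge0 ?p0// ltW.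
 have P1 : p h i i * p (t - h) i j <= p t i j.
  by rewrite -[t in leRHS](subrK h) [t - h + h]addrC -EC; exact: (le_ssum1 (f := fun k => p h i k * p (t - h) k j)).
 have P2 : expR (t - h) * (p h i i * p (t - h) i j) <= expR t * p t i j.
  by apply: ler_pM => //; rewrite ?expR_ge0// ler_expR gerBl ltW.
 have P3 : expR (t - h) * ((1 - p h i i) * p (t - h) i j) <= expR t * (1 - p h i i).
  apply: ler_pM => //; rewrite ?expR_ge0//.
  - by rewrite mulr_ge0 ?p0// subr_ge0 p_le1// ltW.
  - by rewrite ler_expR gerBl ltW.
  - by rewrite ler_piMr ?p_le1// subr_ge0 p_le1// ltW.
 rewrite mulrBl mul1r mulrBr in P3.
 by rewrite /f; lra.
Qed.

End step.

Fixpoint an n i j : R := if n is n'.+1 then ssum (fun k => a i k * an n' k j) else (i == j)%:R.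

Lemma an_ge0_le1 n i j : 0 <= an n i j <= 1.
Proof.
elim: n i => [|n IH] i /=; first by case: (i == j); rewrite ?lexx ler01.
have s : sm (fun k => a i k * an n k j).
 apply: (sm_dom (a_s i)) => k; rewrite normrM ler_piMr//; have /andP[h1 h2] := IH k.
 by rewrite ger0_norm.
rewrite ssum_ge0//=; last by move=> k; rewrite mulr_ge0//; case/andP: (IH k).
rewrite -(a1 i); apply: le_ssum => // k; rewrite ler_piMr//; by case/andP: (IH k).
Qed.

Lemma an_sm n i j : sm (fun k => a i k * an n k j).
Proof.
apply: (sm_dom (a_s i)) => k; rewrite normrM ler_piMr//; have /andP[h1 h2] := an_ge0_le1 n k j.
by rewrite ger0_norm.
Qed.

Lemma an_row n i : sm (an n i) /\ ssum (an n i) = 1.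
Proof.
have an0 m k l : 0 <= an m k l by case/andP: (an_ge0_le1 m k l).
elim: n i => [|n IH] i.
 have [|h1 h2] := @ssum1 R S (an 0 i) i; first by move=> x /negPf; rewrite /= eq_sym => ->.
 by split => //; rewrite h2 /= eqxx.
have f0 k j : 0 <= a i k * an n k j by rewrite mulr_ge0.
have s1 k : sm (fun j => a i k * an n k j) by apply: smZ; case: (IH k).
have E k : ssum (fun j => a i k * an n k j) = a i k by rewrite (ssumZ _ (IH k).1) (IH k).2 mulr1.
have s2 : sm (fun k => ssum (fun j => a i k * an n k j)) by apply: (eq_sm _ (a_s i)).
have [h1 h2 h3] := ssum_swap f0 s1 s2.
by split => //=; rewrite [LHS]h3 (eq_ssum E).
Qed.

Lemma exp_lower N i j (t : R) : 0 <= t -> \sum_(m < N) t ^+ m / m`!%:R * an m i j <= expR t * p t i j.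
Proof.
elim: N i t => [|N IH] i t t0; first by rewrite big_ord0 mulr_ge0 ?expR_ge0// p0.
have an0 m k : 0 <= an m k j by case/andP: (an_ge0_le1 m k j).
have h L := exp_step an0 (fun t k => IH k t) i L t0.
rewrite big_ord_recl/= expr0 fact0 divr1 mul1r.
have hc : (i == j)%:R + \sum_(m < N) t ^+ m.+1 / m.+1`!%:R * psum (fun k => a i k * an m k j) L @[L --> \oo] -->
  (i == j)%:R + \sum_(m < N) t ^+ m.+1 / m.+1`!%:R * an m.+1 i j.
 apply: cvgD; first exact: cvg_cst.
 apply: (cvg_osum (h := fun L m => t ^+ m.+1 / m.+1`!%:R * psum (fun k => a i k * an m k j) L) (f := fun m => t ^+ m.+1 / m.+1`!%:R * an m.+1 i j)) => m.
 by apply: cvgMl_tmp; exact: psum_cvg (an_sm m i j).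
by apply: (cvg_to_le _ hc); exact: nearW.
Qed.

(** The Poisson mixture of the powers of [a] is a lower bound for p_t by [exp_lower]; both are
    probability distributions, so they are equal. *)
Theorem transitionE (t : R) i j : 0 <= t ->
 sm (fun m => t ^+ m / m`!%:R * an m i j) /\ p t i j = expR (- t) * ssum (fun m => t ^+ m / m`!%:R * an m i j).
Proof.
move=> t0; have an0 m k l : 0 <= an m k l by case/andP: (an_ge0_le1 m k l).
have c0 m : 0 <= t ^+ m / m`!%:R by rewrite divr_ge0 ?exprn_ge0.
pose X m k := t ^+ m / m`!%:R * an m i k.
have X0 m k : 0 <= X m k by rewrite mulr_ge0.
have s1 m : sm (X m) by apply: smZ; case: (an_row m i).
have E m : ssum (X m) = t ^+ m / m`!%:R by rewrite (ssumZ _ (an_row m i).1) (an_row m i).2 mulr1.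
have s2 : sm (fun m => ssum (X m)) by apply: (eq_sm _ (exp_sm t0)).
have [h1 h2 h3] := ssum_swap X0 s1 s2.
rewrite (eq_ssum E) (exp_ssum t0) in h3.
split; first exact: h1.
pose r k := expR (- t) * ssum (X^~ k).
have rp k : r k <= p t i k.
 rewrite /r expRN ler_pdivrMl ?expR_gt0//; apply: ssum_le; first exact: h1.
 by move=> N; rewrite psum_nat; exact: exp_lower.
have sr : sm r by exact: smZ.
have r1 : ssum r = 1 by rewrite (ssumZ _ h2) h3 -expRD addNr expR0.
have d0 : ssum (fun k => p t i k - r k) = 0 by rewrite (ssumB (p_s i t0) sr) p1// r1 subrr.
have d1 k : 0 <= p t i k - r k by rewrite subr_ge0.
have := le_ssum1 j d1 (smB (p_s i t0) sr); rewrite d0 => h.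
by apply/eqP; rewrite eq_le rp andbT -subr_le0.
Qed.

End transition.

(** * Laplace transforms of monomials *)

Section calculus.
Context (R : realType).
Local Notation mu := (@lebesgue_measure R).

Lemma FTC_tail (f F : R -> R) (a l : R) : (forall x, a <= x -> 0 <= f x) ->
 (forall x, a <= x -> {for x, continuous f}) ->
 (forall x, a <= x -> is_derive x 1 F (f x)) -> F x @[x --> +oo] --> l ->
 (\int[mu]_(x in `[a, +oo[) (f x)%:E = (l - F a)%:E)%E.
Proof.
move=> f0 fc dF Fl; rewrite EFinB; apply: ge0_continuous_FTC2y => //.
- by apply: continuous_in_subspaceT => x; rewrite inE/= in_itv/= andbT; exact: fc.
- by move=> x /ltW /dF[].
- have [h _] := dF a (lexx a); apply: cvg_at_right_filter.
 by have /derivable1_diffP/differentiable_continuous hc := h; exact (hc).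
- by move=> x; rewrite in_itv/= andbT => /ltW /dF h; rewrite derive1E; exact: derive_val.
Qed.

Lemma is_derive_scale (c x : R) : is_derive x 1 (fun t : R => c * t) c.
Proof.
have h := @is_deriveZ R R R id c x 1 1 (is_derive_id x 1).
by apply: (@is_derive_eq _ _ _ _ _ _ _ _ h); rewrite /GRing.scale/= mulr1.
Qed.

Lemma is_derive_monomial n (x : R) : is_derive x 1 (fun t : R => t ^+ n.+1 / n.+1`!%:R) (x ^+ n / n`!%:R).
Proof.
have h := @is_deriveX R R id n.+1 x 1 1 (is_derive_id x 1).
have h2 := @is_deriveZ R R R _ (n.+1`!%:R)^-1 x 1 _ h.
have E : (fun t : R => t ^+ n.+1 / n.+1`!%:R) = (n.+1`!%:R^-1 *: (fun t : R => t) ^+ n.+1).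
 by apply/funext => t; rewrite fctE mulrC.
rewrite E; apply: (@is_derive_eq _ _ _ _ _ _ _ _ h2).
rewrite /GRing.scale/= mulr1 factS natrM.
have : n`!%:R != 0 :> R by rewrite pnatr_eq0 -lt0n fact_gt0.
have : n.+1%:R != 0 :> R by rewrite pnatr_eq0.
by move: (n.+1%:R : R) (n`!%:R : R) (x ^+ n) => N M X N0 M0; field; rewrite ?N0 ?M0.
Qed.

Lemma is_derive_expM (c x : R) : is_derive x 1 (fun t => expR (c * t)) (c * expR (c * x)).
Proof.
have := is_derive1_comp (f := expR) (g := fun t => c * t) (is_derive_expR (c * x)) (is_derive_scale c x).
by rewrite mulrC.
Qed.

(** The next term of the exponential series, of order t^(n+1), beats t^n. *)
Lemma exp_poly_cvg0 (c : R) n : 0 < c -> t ^+ n / n`!%:R * expR (- c * t) @[t --> +oo] --> (0 : R).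
Proof.
move=> c0; apply: (@squeeze_cvgr _ _ _ _ (fun=> 0) (fun t => n.+1%:R / c ^+ n.+1 * t^-1)).
- near=> t; have t0 : 0 < t by near: t; exact: nbhs_pinfty_gt.
 rewrite mulr_ge0 ?expR_ge0 ?divr_ge0 ?exprn_ge0 ?(ltW t0)//= mulNr expRN.
 have ct : 0 < c * t by exact: mulr_gt0.
 have := expR_ge1Dxn n (ltW ct) => h.
 have h2 : (c * t) ^+ n.+1 / n.+1`!%:R <= expR (c * t) by apply: le_trans h; rewrite lerDr.
 rewrite ler_pdivrMr ?expR_gt0//; apply: (@le_trans _ _ (n.+1%:R / c ^+ n.+1 * t^-1 * ((c * t) ^+ n.+1 / n.+1`!%:R))); last first.
  by rewrite ler_wpM2l// !mulr_ge0 ?invr_ge0 ?exprn_ge0 ?(ltW c0)// (ltW t0).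
 rewrite exprMn factS natrM [t ^+ n.+1]exprS; apply: eq_ler.
 have : n`!%:R != 0 :> R by rewrite pnatr_eq0 -lt0n fact_gt0.
 have : n.+1%:R != 0 :> R by rewrite pnatr_eq0.
 have : c ^+ n.+1 != 0 by rewrite expf_neq0// gt_eqF.
 move: (c ^+ n.+1) (n.+1%:R : R) (n`!%:R : R) (t ^+ n) => C N M X C0 N0 M0.
 by field; rewrite C0 N0 M0 gt_eqF.
- exact: cvg_cst.
- rewrite -(mulr0 (n.+1%:R / c ^+ n.+1)); apply: cvgMl_tmp.
 by apply/gtr0_cvgV0; [near=> t; near: t; exact: nbhs_pinfty_gt|exact: cvg_id].
Unshelve. all: by end_near.
Qed.

Lemma laplace_monomial (c : R) n : 0 < c ->
 (\int[mu]_(t in `[0%R, +oo[) (t ^+ n / n`!%:R * expR (- c * t))%:E = (c ^- n.+1)%:E)%E.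
Proof.
move=> c0; pose u k (t : R) := t ^+ k / k`!%:R.
(* The antiderivative obtained by repeated integration by parts; it vanishes at infinity, and its
   value at 0 is minus the claimed integral. *)
pose E := fix E k : R -> R := match k with 0%N => fun t => - (u 0%N t * expR (- c * t) / c)
 | k'.+1 => fun t => - (u k'.+1 t * expR (- c * t) / c) + E k' t / c end.
have dE k (x : R) : is_derive x 1 (E k) (u k x * expR (- c * x)).
 have h0 := is_derive_expM (- c) x.
 elim: k => [|k IH].
  have h := @is_deriveZ R R R _ (- c^-1) x 1 _ h0.
  rewrite (_ : E 0%N = (- c^-1) *: (fun t => expR (- c * t))); last first.
   by apply/funext => t; rewrite fctE /= /u expr0 fact0 divr1 /GRing.scale/=; ring.
  apply: (@is_derive_eq _ _ _ _ _ _ _ _ h).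
  by rewrite /GRing.scale/= /u expr0 fact0 divr1 mul1r mulrA mulrNN mulVf ?gt_eqF// mul1r.
 have h1 := @is_deriveM R R _ _ x 1 _ _ (is_derive_monomial k x) h0.
 have h2 := @is_deriveD R R R _ _ x 1 _ _ (@is_deriveZ R R R _ (- c^-1) x 1 _ h1) (@is_deriveZ R R R _ (c^-1) x 1 _ IH).
 rewrite (_ : E k.+1 = (- c^-1) *: ((fun t => t ^+ k.+1 / k.+1`!%:R) * (fun t => expR (- c * t))) + c^-1 *: E k); last first.
  by apply/funext => t; rewrite !fctE /= /u /GRing.scale/=; ring.
 apply: (@is_derive_eq _ _ _ _ _ _ _ _ h2).
 rewrite /GRing.scale/= /u; move: (expR (- c * x)) (x ^+ k.+1 / _) (x ^+ k / _) => X Y Z.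
 by field; rewrite gt_eqF.
have E0 k : E k 0 = - c ^- k.+1.
 elim: k => [|k IH] /=; rewrite /u ?expr0n/= ?mulr0 ?expR0 ?fact0 ?divr1 ?mulr1 ?mul1r ?expr1//.
 by rewrite !mul0r oppr0 add0r IH mulNr [c ^+ k.+2]exprS invfM [_ * c^-1]mulrC.
have Ey k : E k x @[x --> +oo] --> (0 : R).
 have h m : - (u m x * expR (- c * x) / c) @[x --> +oo] --> (0 : R).
  by rewrite -oppr0; apply: cvgN; rewrite -(mul0r c^-1); apply: cvgMr_tmp; exact: exp_poly_cvg0.
 elim: k => [|k IH] /=; first exact: (h 0%N).
 rewrite -(addr0 0); apply: cvgD; first exact: (h k.+1).
 by rewrite -(mul0r c^-1); apply: cvgMr_tmp.
have -> : c ^- n.+1 = 0 - E n 0 by rewrite E0 opprK add0r.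
apply: FTC_tail => //.
- by move=> x x0; rewrite mulr_ge0 ?expR_ge0// divr_ge0// exprn_ge0.
- move=> x _; apply: continuousM; [apply: continuousM; [exact: exprn_continuous|exact: cvg_cst]|].
 apply: continuous_comp; last exact: continuous_expR.
 by apply: continuousM; [exact: cvg_cst|exact: cvg_id].
Qed.

End calculus.

(** * Return probability of the walk and its Laplace transform *)

Section walk_laplace.
Context (R : realType) (G : countZmodType) (q : G -> R).
Hypotheses (q0 : forall x, 0 <= q x) (q_s : sm q) (q1 : ssum q = 1).
Local Notation mu := (@lebesgue_measure R).
Local Notation cn := (cn q).
Local Notation green := (green q).

(* probability that X1 - X2 is back at 0 at time t >= 0, extended evenly *)
Definition wlk (t : R) := expR (- 2 * `|t|) * ssum (fun n => `|t| ^+ n / n`!%:R * cn n 0).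

Lemma wlk_sm (t : R) : sm (fun n => `|t| ^+ n / n`!%:R * cn n 0).
Proof.
have t2 : 0 <= 2 * `|t| by rewrite mulr_ge0.
apply: (sm_dom (exp_sm t2)) => n; have b0 := cn_ge0 q0 q_s q1 n 0.
have u0 : 0 <= `|t| ^+ n / n`!%:R by rewrite divr_ge0 ?exprn_ge0.
have h0 : 0 <= (2 * `|t|) ^+ n / n`!%:R by rewrite divr_ge0 ?exprn_ge0.
rewrite (ger0_norm h0) (ger0_norm (mulr_ge0 u0 b0)) (_ : (2 * `|t|) ^+ n / n`!%:R = `|t| ^+ n / n`!%:R * 2 ^+ n).
 by apply: ler_wpM2l => //; exact: cn_le.
by rewrite exprMn; ring.
Qed.

Lemma wlk_ge0 (t : R) : 0 <= wlk t.
Proof.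
rewrite mulr_ge0 ?expR_ge0// ssum_ge0//; first exact: wlk_sm.
by move=> n; rewrite mulr_ge0 ?divr_ge0 ?exprn_ge0//; exact: cn_ge0.
Qed.

Lemma wlk_le1 (t : R) : wlk t <= 1.
Proof.
rewrite /wlk mulNr expRN ler_pdivrMl ?expR_gt0// mulr1 -exp_ssum//.
apply: le_ssum; [exact: wlk_sm|exact: exp_sm|move=> n].
rewrite (_ : (2 * `|t|) ^+ n / n`!%:R = `|t| ^+ n / n`!%:R * 2 ^+ n). by apply: ler_wpM2l => //; exact: cn_le.
by rewrite exprMn; ring.
Qed.

Let term_meas n : measurable_fun [set: measurableTypeR R] (fun t : R => `|t| ^+ n / n`!%:R * cn n 0).
Proof.
apply: measurable_funM; last exact: measurable_cst.
apply: measurable_funM; last exact: measurable_cst.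
by apply: measurable_funX; exact: normr_measurable.
Qed.

Lemma wlk_meas : measurable_fun [set: measurableTypeR R] wlk.
Proof.
apply: measurable_funM. by apply: measurableT_comp => //; apply: measurable_funM => //; exact: normr_measurable.
apply: (@measurable_fun_cvg _ (measurableTypeR R) R setT (fun N (t : R) => psum (fun n => `|t| ^+ n / n`!%:R * cn n 0) N)).
- move=> N; rewrite (_ : (fun t => _) = (fun t : R => \sum_(n < N) `|t| ^+ n / n`!%:R * cn n 0)); last first.
  by apply/funext => t; rewrite psum_nat.
 by apply: measurable_sum => n; exact: term_meas.
- by move=> t _; exact: psum_cvg (wlk_sm t).
Qed.

Lemma laplace_wlk (l : R) : 0 < l ->
 (\int[mu]_(t in `[0%R, +oo[) (expR (- l * t) * wlk t)%:E = (green l 0)%:E)%E.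
Proof.
move=> l0; have l2 : 0 < l + 2 by rewrite addr_gt0.
have b0 n := cn_ge0 q0 q_s q1 n 0.
transitivity (\int[mu]_(t in `[0%R, +oo[) \sum_(n <oo) (t ^+ n / n`!%:R * expR (- (l + 2) * t) * cn n 0)%:E)%E.
 apply: eq_integral => t; rewrite inE/= in_itv/= andbT => t0.
 have h0 n : 0 <= t ^+ n / n`!%:R * expR (- (l + 2) * t) * cn n 0 by rewrite !mulr_ge0 ?expR_ge0 ?exprn_ge0.
 have E n : expR (- l * t) * expR (- 2 * `|t|) * (`|t| ^+ n / n`!%:R * cn n 0) = t ^+ n / n`!%:R * expR (- (l + 2) * t) * cn n 0.
  by rewrite -expRD ger0_norm// (_ : - l * t + - 2 * t = - (l + 2) * t); ring.
 have s : sm (fun n => t ^+ n / n`!%:R * expR (- (l + 2) * t) * cn n 0) by apply: (eq_sm E); apply: smZ; exact: wlk_sm.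
 rewrite nneseries_esumT ?(esum_ssum h0 s)// /wlk mulrA -(ssumZ _ (wlk_sm t)) (eq_ssum E)//.
rewrite integral_nneseries//; last 2 first.
- move=> n; apply/measurable_EFinP; apply: measurable_funM; last exact: measurable_cst.
 apply: measurable_funM; first by apply: measurable_funM; [exact: measurable_funX|exact: measurable_cst].
 by apply: measurableT_comp => //; apply: measurable_funM => //.
- by move=> n t; rewrite /= in_itv/= andbT => t0; rewrite lee_fin !mulr_ge0 ?expR_ge0 ?exprn_ge0.
have E n : (\int[mu]_(t in `[0%R, +oo[) (t ^+ n / n`!%:R * expR (- (l + 2) * t) * cn n 0)%:E = (cn n 0 / (l + 2) ^+ n.+1)%:E)%E.
 under eq_integral do rewrite mulrC EFinM.
 rewrite ge0_integralZl//; first by rewrite (laplace_monomial n l2).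
 - apply/measurable_EFinP; apply: measurable_funM; first by apply: measurable_funM; [exact: measurable_funX|exact: measurable_cst].
  by apply: measurableT_comp => //; apply: measurable_funM => //.
 - by move=> t; rewrite /= in_itv/= andbT => t0; rewrite lee_fin !mulr_ge0 ?expR_ge0 ?exprn_ge0.
 - by rewrite lee_fin.
under eq_eseriesr do rewrite E.
have h0 n : 0 <= cn n 0 / (l + 2) ^+ n.+1 by rewrite divr_ge0// exprn_ge0// ltW.
rewrite nneseries_esumT ?(esum_ssum h0 (green_sm q0 q_s q1 0 l0))//.
Qed.

End walk_laplace.

(** * Identification of the symmetrized return probability *)

Section return_probability.
Context (R : realType) (d : nat) (a : sites d -> sites d -> R).
Hypothesis ha : migration_rates a.
Variable pbar : R -> sites d -> sites d -> R.
Hypothesis hp : symmetrized_transition a pbar.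
Local Notation q := (a 0).
Local Notation G := (sites d).

Let q0 x : 0 <= q x := rates_ge0 ha 0 x.
Let a_s i : sm (a i) := rate_sm ha i.
Let a_1 i : ssum (a i) = 1 := rate_ssum ha i.

Lemma an_shift n i j : an a n i j = qn q n (j - i).
Proof.
elim: n i => [|n IH] i; first by rewrite /qn /= /del subr_eq0 eq_sym.
rewrite /= /qn /= /Aop /Cop -/(qn q n).
have be : bijective (fun z : G => z + i) by exists (fun z => z - i) => z; rewrite ?addrK ?subrK.
have f0 k : 0 <= a i k * an a n k j by rewrite mulr_ge0 ?(rates_ge0 ha)//; case/andP: (an_ge0_le1 (rates_ge0 ha) a_s a_1 n k j).
have [_ <-] := ssum_reindex be f0 (an_sm (rates_ge0 ha) a_s a_1 n i j).
by apply: eq_ssum => z; rewrite IH (rates_shift ha i) addrK opprD addrA addrAC.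
Qed.

(** exp(t) times the probability that a single walker started at 0 is at [k] at time [t], see
    [transition_ut]. *)
Definition ut (t : R) (k : G) := ssum (fun m => t ^+ m / m`!%:R * qn q m k).

Lemma transition_ut (p : R -> G -> G -> R) (t : R) k : transition_function p -> has_rates a p ->
 0 <= t -> p t 0 k = expR (- t) * ut t k.
Proof.
move=> [p0 p1 p00 pCK] pr t0.
have p_s (s : R) i : 0 <= s -> sm (p s i) by move=> s0; apply: esum_sm => [j|]; [exact: p0|rewrite p1// ltry].
have p_1 (s : R) i : 0 <= s -> ssum (p s i) = 1.
 by move=> s0; have := esum_ssum (fun j => p0 s i j s0) (p_s s i s0); rewrite p1// => -[].
have pC (s r : R) i j : 0 <= s -> 0 <= r -> sm (fun k => p s i k * p r k j) /\ ssum (fun k => p s i k * p r k j) = p (s + r) i j.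
 move=> s0 r0; have h0 l : 0 <= p s i l * p r l j by rewrite mulr_ge0 ?p0.
 have sC : sm (fun k => p s i k * p r k j) by apply: esum_sm => //; rewrite pCK// ltry.
 by split => //; have := esum_ssum h0 sC; rewrite pCK// => -[].
have [_ ->] := transitionE (rates_ge0 ha) a_s a_1 p0 p_s p_1 p00 pC pr 0 k t0.
by congr (_ * _); apply: eq_ssum => m; rewrite an_shift subr0.
Qed.

Lemma ut_sm (t : R) k : 0 <= t -> sm (fun m => t ^+ m / m`!%:R * qn q m k).
Proof.
move=> t0; apply: (sm_dom (exp_sm t0)) => m; have [nq q1] := ns_qn q0 (a_s 0) (a_1 0) m.
have u0 : 0 <= t ^+ m / m`!%:R by rewrite divr_ge0 ?exprn_ge0.
rewrite normrM (ger0_norm u0) ler_piMr// ger0_norm; last by case: nq.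
by rewrite -q1; exact: ns_le.
Qed.

(** Squaring the exponential series by a Cauchy product gives t^n/n! times a binomial sum, and
    summing over the meeting point [k] turns it into the formula of [cn0_pair]. *)
Lemma ut_sqr (t : R) : 0 <= t -> sm (fun k => ut t k * ut t k) /\
 ssum (fun k => ut t k * ut t k) = ssum (fun n => t ^+ n / n`!%:R * cn q n 0).
Proof.
move=> t0; pose e m := t ^+ m / m`!%:R.
have e0 m : 0 <= e m by rewrite divr_ge0 ?exprn_ge0.
have nq m := (ns_qn q0 (a_s 0) (a_1 0) m).1.
have q00 m k : 0 <= qn q m k by case: (nq m).
pose X n k := \sum_(m < n.+1) (e m * qn q m k) * (e (n - m)%N * qn q (n - m) k).
have X0 n k : 0 <= X n k by apply: sumr_ge0 => m _; apply: mulr_ge0; apply: mulr_ge0.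
have sk n (m : 'I_n.+1) : sm (fun k => (e m * qn q m k) * (e (n - m)%N * qn q (n - m) k)).
 by apply: (ns_mul _ _).2; apply: nsZ.
have s1 n : sm (X n) by apply: sm_sum => m; exact: sk.
have E n : ssum (X n) = e n * cn q n 0.
 rewrite /X (ssum_sum _ (fun m : 'I_n.+1 => sk n m)) (cn0_pair q0 (a_s 0) (a_1 0)) mulr_sumr.
 apply: eq_bigr => m _.
 have -> : e n * ('C(n, m)%:R * pair (qn q m) (qn q (n - m))) = e m * e (n - m)%N * pair (qn q m) (qn q (n - m)).
  rewrite mulrA; congr (_ * _); have mn : (m <= n)%N by rewrite -ltnS ltn_ord.
  have tE : t ^+ n = t ^+ m * t ^+ (n - m) by rewrite -exprD subnKC.
  rewrite /e -(bin_fact mn) !natrM tE.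
  have C0 : 'C(n, m)%:R != 0 :> R by rewrite pnatr_eq0 -lt0n bin_gt0.
  have m0 : m`!%:R != 0 :> R by rewrite pnatr_eq0 -lt0n fact_gt0.
  have n0 : (n - m)`!%:R != 0 :> R by rewrite pnatr_eq0 -lt0n fact_gt0.
  move: C0 m0 n0; move: (_%:R : R) (m`!%:R : R) ((n - m)`!%:R : R) (t ^+ m) (t ^+ (n - m)) => C u v x y C0 u0 v0.
  by field; rewrite ?C0 ?u0 ?v0.
 rewrite /pair -(ssumZ _ (ns_mul (nq m) (nq (n - m)%N)).2); apply: eq_ssum => k; ring.
have s2 : sm (fun n => ssum (X n)). apply: (eq_sm _ (wlk_sm q0 (a_s 0) (a_1 0) t)) => n; rewrite E ger0_norm//.
have [h1 h2 h3] := ssum_swap X0 s1 s2.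
have Ek k : ssum (X^~ k) = ut t k * ut t k.
 have f0 m : 0 <= e m * qn q m k by rewrite mulr_ge0.
 by case: (ssum_cauchy f0 f0 (ut_sm k t0) (ut_sm k t0)).
by split; [exact: (eq_sm Ek)|rewrite -(eq_ssum Ek) h3; exact: eq_ssum].
Qed.

(** Both walkers start at 0, and the difference is 0 exactly when they share a site k. These events
    are disjoint, and by independence each has probability the square of the one-walker transition
    probability. *)
Lemma pbar_wlk (t : R) : 0 <= t -> pbar t 0 0 = wlk q t.
Proof.
move=> t0; have [disp [T [Q [X1 [X2 [[M1 M2] hI [S1 S2] hpb]]]]]] := hp 0.
(* The Markov property with an empty history and times 0 and [t]; the start is only almost surely at
   0, so the complement is discarded as a null set. *)
have law (X : R -> T -> G) k : markov_with_rates a Q X -> Q [set w | X 0 w = 0] = 1%E ->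
  measurable [set w | X t w = k] /\ Q [set w | X t w = k] = (expR (- t) * ut t k)%:E.
 move=> [mX [p [tp rp mk]]] X0; split; first exact: mX.
 have := mk 0 t 0 k [::] (lexx 0) t0 (fun _ h => False_ind _ (notF h)).
 rewrite subr0 (_ : cylinder X [::] = setT); last first. by apply/seteqP; split => // w _ r; rewrite in_nil.
 rewrite !setTI X0 mul1e (transition_ut k tp rp t0) => <-.
 have m0 := mX 0 0 (lexx 0); have mt := mX t k t0.
 have n0 : Q (~` [set w | X 0 w = 0]) = 0%E by rewrite probability_setC// X0 subee.
 rewrite (measureDI Q mt m0) [X in (X + _)%E](_ : _ = 0%E) ?add0e 1?setIC//.
 by apply: (subset_measure0 _ _ _ n0) => //; [exact: measurableD|exact: measurableC].
have mk k : measurable ([set w | X1 t w = k] `&` [set w | X2 t w = k]).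
 by apply: measurableI; [case: (law X1 k M1 S1)|case: (law X2 k M2 S2)].
pose f k := (expR (- t) * ut t k) * (expR (- t) * ut t k).
have QE k : Q ([set w | X1 t w = k] `&` [set w | X2 t w = k]) = (f k)%:E.
 have cE (X : R -> T -> G) : [set w | X t w = k] = cylinder X [:: (t, k)].
  apply/seteqP; split => w /=; first by move=> E r; rewrite inE => /eqP->.
  by move=> h; have := h (t, k); rewrite inE eqxx => /(_ isT).
 have [_ h1] := law X1 k M1 S1; have [_ h2] := law X2 k M2 S2.
 rewrite EFinM -{1}h1 -h2 (cE X1) (cE X2) hI// => r; rewrite inE => /eqP->/=;
  by rewrite in_itv/= t0.
pose A n := if pickle_inv n is Some k then [set w | X1 t w = k] `&` [set w | X2 t w = k] else set0.
have mA n : measurable (A n) by rewrite /A; case: pickle_inv.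
have tA : trivIset setT A.
 apply/trivIsetP => i j _ _ ij; rewrite /A.
 case Ei : (pickle_inv i) => [k|]; last by rewrite set0I.
 case Ej : (pickle_inv j) => [l|]; last by rewrite setI0.
 apply/disj_set2P; rewrite /disj_set; apply/eqP; apply/seteqP; split => // w [[/= h1 _] [h2 _]].
 have kl : k = l by rewrite -h1 -h2.
 have := @pickle_invK G i; have := @pickle_invK G j; rewrite /ocancel Ei Ej kl/= => e1 e2.
 by move: ij; rewrite -e1 -e2 eqxx.
have UA : \bigcup_n A n = [set w | (X1 t w - X2 t w)%R = 0].
 apply/seteqP; split => w. by case=> n _; rewrite /A; case: pickle_inv => // k [/= -> ->]; rewrite subrr.
 move=> /eqP; rewrite subr_eq0 => /eqP h; exists (pickle (X1 t w)) => //.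
 by rewrite /A pickleK_inv; split.
have mU : measurable (\bigcup_n A n) by exact: bigcup_measurable.
have c1 : (\sum_(0 <= i < n) Q (A i))%E @[n --> \oo] --> (pbar t 0 0)%:E.
 by rewrite (hpb t 0 t0) -UA; exact (@measure_semi_sigma_additive _ _ _ Q A mA tA mU).
have [sf Ef] : sm f /\ ssum f = wlk q t.
 have [s1 E1] := ut_sqr t0.
 have Ek k : expR (- 2 * t) * (ut t k * ut t k) = f k. rewrite /f mulrACA -expRD; congr (expR _ * _); ring.
 split; first by apply: (eq_sm Ek); exact: smZ.
 rewrite -(eq_ssum Ek) (ssumZ _ s1) E1 /wlk ger0_norm//.
have c2 : (psum f n)%:E @[n --> \oo] --> (wlk q t)%:E by rewrite -Ef; apply: cvg_EFin; [exact: nearW|exact: psum_cvg].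
have E : (fun n => (psum f n)%:E) = (fun n => \sum_(0 <= i < n) Q (A i))%E.
 apply/funext => n; rewrite /psum big_mkord -sumEFin; apply: eq_bigr => i _.
 by rewrite /A; case: pickle_inv => [k|]; rewrite ?QE//= measure0.
rewrite -E in c1.
by apply: EFin_inj; rewrite -(cvg_lim _ c1)// -(cvg_lim _ c2).
Qed.

End return_probability.

(** * Laplace integrals on the half line *)

Section half_line.
Context (R : realType).
Local Notation mu := (@lebesgue_measure R).
Local Notation RR := (measurableTypeR R).
Local Notation D := (`[(0 : R), +oo[%classic : set RR).

Section laplace_calculus.

Lemma FTC_itv (f F : R -> R) (a b : R) : a <= b -> (forall x, a <= x <= b -> {for x, continuous f}) ->
 (forall x, a <= x <= b -> is_derive x 1 F (f x)) ->
 itg mu `[a, b] f /\ \int[mu]_(t in `[a, b]) f t = F b - F a.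
Proof.
move=> ab fc dF.
have cw : {within `[a, b], continuous f} by apply: continuous_in_subspaceT => x; rewrite inE/= in_itv/=; exact: fc.
have fi : itg mu `[a, b] f by apply: continuous_compact_integrable => //; exact: segment_compact.
split => //; move: ab; rewrite le_eqVlt => /predU1P[<-|ab]. by rewrite set_itv1 Rintegral_set1 subrr.
have Fc x : a <= x <= b -> {for x, continuous F} by move=> /dF[] /derivable1_diffP/differentiable_continuous.
apply: EFin_inj; rewrite (EFin_Rint (mI _) fi) EFinB; apply: continuous_FTC2 => //.
- split.
 + by move=> x; rewrite in_itv/= => /andP[h1 h2]; have [] := dF x; rewrite ?(ltW h1) ?(ltW h2).
 + by apply: cvg_at_right_filter; apply: Fc; rewrite lexx ltW.
 + by apply: cvg_at_left_filter; apply: Fc; rewrite lexx ltW.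
- move=> x; rewrite in_itv/= => /andP[h1 h2]; have h : is_derive x 1 F (f x) by apply: dF; rewrite !ltW.
 by rewrite derive1E; exact: derive_val.
Qed.

Lemma ge0_itg_fin (A : set RR) (f : R -> R) (l : R) : measurable A -> measurable_fun A f -> (forall x, A x -> 0 <= f x) ->
 (\int[mu]_(x in A) (f x)%:E = l%:E)%E -> itg mu A f /\ \int[mu]_(x in A) f x = l.
Proof.
move=> mA mf f0 E; split; first by apply: ge0_itg => //; rewrite E ltry.
by rewrite /Rintegral E.
Qed.

Lemma expM_meas (A : set RR) (l : R) : measurable_fun A (fun t : R => expR (- l * t)).
Proof. by apply: measurableT_comp => //; apply: measurable_funM. Qed.

Lemma exp_itgD (l : R) : 0 < l -> itg mu D (fun t => expR (- l * t)) /\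
 \int[mu]_(t in D) expR (- l * t) = l^-1.
Proof.
move=> l0; apply: ge0_itg_fin => //; first exact: expM_meas.
have := laplace_monomial 0 l0; rewrite expr1 => <-; apply: eq_integral => t _.
by rewrite expr0 fact0 divr1 mul1r.
Qed.

Lemma itg_ind (A B : set RR) (h : R -> R) : measurable A -> measurable B -> B `<=` A -> itg mu B h ->
 itg mu A (fun t => if t \in B then h t else 0) /\
 \int[mu]_(t in A) (if t \in B then h t else 0) = \int[mu]_(t in B) h t.
Proof.
move=> mA mB BA ih; have E : (fun t => if t \in B then h t else 0) = h \_ B by apply/funext => t; rewrite patchE.
rewrite E; split; last by rewrite -Rintegral_mkcondr (setIidr BA).
exact: itgS measurableT mA (@subsetT _ A) (itg_mkcond mB ih).
Qed.

Lemma inv_int (a b : R) : 0 < a -> a <= b ->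
 itg mu `[a, b] (fun t => t^-1) /\ \int[mu]_(t in `[a, b]) t^-1 = ln b - ln a.
Proof.
move=> a0 ab; apply: FTC_itv => // x /andP[ax _]; have x0 := lt_le_trans a0 ax.
 by apply: cvgV => //; rewrite gt_eqF.
exact: is_derive1_ln.
Qed.

Lemma is_derive_powR (b x : R) : 0 < x -> b != 1 ->
 is_derive x 1 (fun t => (1 - b)^-1 * t `^ (1 - b)) (x `^ (- b)).
Proof.
move=> x0 b1; have h := @is_deriveZ R R R _ ((1 - b)^-1) x 1 _ (is_derive1_powR (1 - b) x0).
apply: (@is_derive_eq _ _ _ _ _ _ _ _ h).
by rewrite /GRing.scale/= mulKf ?subr_eq0 1?eq_sym// addrAC subrr add0r.
Qed.

Lemma powR_cont (b x : R) : 0 < x -> {for x, continuous (fun t : R => t `^ b)}.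
Proof.
by move=> x0; have [/derivable1_diffP/differentiable_continuous h _] := is_derive1_powR b x0; exact (h).
Qed.

Lemma pow_int (a b B : R) : 0 < a -> a <= B -> b != 1 ->
 itg mu `[a, B] (fun t => t `^ (- b)) /\
 \int[mu]_(t in `[a, B]) t `^ (- b) = (1 - b)^-1 * B `^ (1 - b) - (1 - b)^-1 * a `^ (1 - b).
Proof.
move=> a0 aB b1; apply: (FTC_itv (F := fun t => (1 - b)^-1 * t `^ (1 - b))) => // x /andP[ax _]; have x0 := lt_le_trans a0 ax.
 exact: powR_cont.
exact: is_derive_powR.
Qed.

Lemma powRN_cvg0 (b : R) : 0 < b -> t `^ (- b) @[t --> +oo] --> (0 : R).
Proof.
move=> b0; apply/cvgrPdist_lt => e e0; near=> t.
have t0 : 0 < t by near: t; exact: nbhs_pinfty_gt.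
rewrite sub0r normrN ger0_norm ?powR_ge0// powRN invf_plt ?posrE ?powR_gt0//.
have tb : (e^-1 + 1) `^ b^-1 < t by near: t; exact: nbhs_pinfty_gt.
have e1 : 0 <= e^-1 + 1 by rewrite addr_ge0// invr_ge0 ltW.
have := gt0_ltr_powR b0 _ _ tb; rewrite !nnegrE powR_ge0 (ltW t0) -powRrM mulVf ?gt_eqF// powRr1// => /(_ isT isT).
by apply: lt_trans; rewrite ltrDl.
Unshelve. all: by end_near.
Qed.

Lemma pow_tail (al r : R) : 1 < al -> 0 < r ->
 (\int[mu]_(t in `[r, +oo[) (t `^ (- al))%:E = (r `^ (1 - al) / (al - 1))%:E)%E.
Proof.
move=> al1 r0; have al0 : al != 1 by rewrite gt_eqF.
rewrite (_ : r `^ (1 - al) / (al - 1) = 0 - (1 - al)^-1 * r `^ (1 - al)); last first.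
 have h1 : al - 1 != 0 by rewrite subr_eq0.
 have h2 : 1 - al != 0 by rewrite subr_eq0 eq_sym.
 by field; rewrite h1 h2.
apply: (FTC_tail (F := fun t => (1 - al)^-1 * t `^ (1 - al))).
- by move=> x _; exact: powR_ge0.
- by move=> x rx; apply: powR_cont; exact: lt_le_trans rx.
- by move=> x rx; apply: is_derive_powR => //; exact: lt_le_trans rx.
- rewrite -(mulr0 (1 - al)^-1); apply: cvgMl_tmp.
 rewrite (_ : 1 - al = - (al - 1)); last by rewrite opprB.
 by apply: powRN_cvg0; rewrite subr_gt0.
Qed.

Lemma powR_meas (b : R) : measurable_fun [set: RR] (fun t : R => t `^ b).
Proof. exact: measurable_powR. Qed.

Lemma expow_meas (A : set RR) (l b : R) : measurable_fun A (fun t : R => expR (- l * t) * t `^ b).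
Proof.
apply: (measurable_funS (@measurableT _ RR)) => //.
apply: measurable_funM; [exact: expM_meas|exact: powR_meas].
Qed.

(** An exhaustion of the open half line that avoids the singularity of t^-b at 0; the substitution t
    -> l t carries [F 1 n] onto [F l n]. *)
Let F (k : R) n := (`[k / n.+1%:R, +oo[%classic : set RR).
Let F_nd (k : R) : 0 <= k -> nondecreasing_seq (F k).
Proof.
move=> k0 m n mn; rewrite subsetEset => x; rewrite /F /= !in_itv/= !andbT; apply: le_trans.
by rewrite ler_wpM2l// lef_pV2 ?posrE// ler_nat.
Qed.
Let F_U (k : R) : 0 < k -> \bigcup_n F k n = (`]0, +oo[%classic : set RR).
Proof.
move=> k0; apply/seteqP; split => x.
 case=> n _; rewrite /F /= !in_itv/= !andbT; apply: lt_le_trans; exact: divr_gt0.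
rewrite /= in_itv/= andbT => x0; exists (Num.truncn (k / x)) => //.
rewrite /F /= in_itv/= andbT ler_pdivrMr// mulrC -ler_pdivrMr//.
by apply/ltW/truncnS_gt.
Qed.

(** On each set of the exhaustion the integrand is at most t^-b below 1 and exp(-t) above, which
    integrate to 1/(1-b) and 1 at most. *)
Lemma gamma_lt (b : R) : 0 < b < 1 ->
 (\int[mu]_(t in `]0%R, +oo[) (expR (- 1 * t) * t `^ (- b))%:E < +oo)%E.
Proof.
move=> /andP[b0 b1].
have h0 (A : set RR) x : (A x -> 0 <= (expR (- 1 * x) * x `^ (- b))%:E)%E.
 by move=> _; rewrite lee_fin mulr_ge0 ?expR_ge0 ?powR_ge0.
have hc := @ge0_nondecreasing_set_cvg_integral _ RR R (F 1) (fun t => (expR (- 1 * t) * t `^ (- b))%:E) mu (F_nd ler01)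
  (fun n => mI _) (fun n => proj2 (measurable_EFinP _ _) (@expow_meas (F 1 n) 1 (- b))) (fun n x => @h0 (F 1 n) x).
rewrite (F_U ltr01) in hc.
apply: (@le_lt_trans _ _ ((1 - b)^-1 + 1)%:E); last exact: ltry.
apply: (cvge_to_le hc); apply: nearW => n.
have n0 : 0 < 1 / n.+1%:R :> R by exact: divr_gt0.
have n1 : 1 / n.+1%:R <= 1 :> R by rewrite ler_pdivrMr// mul1r ler1n.
have [ip Ep] := pow_int n0 n1 (negbT (lt_eqF b1)).
have [ie Ee] := exp_itgD (@ltr01 R).
have sub1 : (`[1 / n.+1%:R, 1]%classic : set RR) `<=` F 1 n by move=> x; rewrite /F /= !in_itv/= => /andP[->].
have sub2 : F 1 n `<=` D by move=> x; rewrite /F /= !in_itv/= !andbT; apply: le_trans; exact: ltW.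
have [i1 E1] := itg_ind (mI _) (mI _) sub1 ip.
have i2 := itgS (mI _) (mI _) sub2 ie.
have dom (x : R) : 0 < x -> 1 / n.+1%:R <= x -> expR (- 1 * x) * x `^ (- b) <=
  (if x \in (`[1 / n.+1%:R, 1]%classic : set RR) then x `^ (- b) else 0) + expR (- 1 * x).
 move=> x0 nx; have p0 := powR_ge0 x (- b).
 have [x1|x1] := leP x 1.
  rewrite mem_set/= ?in_itv/= ?nx//; apply: (@le_trans _ _ (x `^ (- b))); last by rewrite lerDl.
  by apply: ler_piMl => //; rewrite mulN1r -expR0 ler_expR oppr_le0 ltW.
 rewrite memNset/= ?in_itv/= ?nx/= ?add0r; last by apply/negP; rewrite -ltNge.
 have h1 : 1 `^ b <= x `^ b by apply: ge0_ler_powR; rewrite ?nnegrE ?ltW.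
 by rewrite powR1 in h1; apply: ler_piMr => //; rewrite powRN invf_le1 ?powR_gt0.
have i3 : itg mu (F 1 n) (fun t => expR (- 1 * t) * t `^ (- b)).
 apply: (itg_le (mI _) _ _ (itgD (mI _) i1 i2)); first exact: expow_meas.
 move=> x; rewrite /F /= in_itv/= andbT => nx; have x0 : 0 < x := lt_le_trans n0 nx.
 by rewrite ger0_norm ?mulr_ge0 ?expR_ge0 ?powR_ge0//; exact: dom.
rewrite -(EFin_Rint (mI _) i3) lee_fin.
apply: (@le_trans _ _ (\int[mu]_(t in F 1 n) ((if t \in (`[1 / n.+1%:R, 1]%classic : set RR) then t `^ (- b) else 0) + expR (- 1 * t)))).
 apply: (le_Rintegral (mI _) i3 (itgD (mI _) i1 i2)) => x; rewrite /F /= in_itv/= andbT => nx.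
 by apply: dom => //; exact: lt_le_trans n0 nx.
rewrite (RintegralD (mI _) i1 i2) E1 Ep; apply: lerD.
 rewrite powR1 mulr1 gerBl mulr_ge0 ?powR_ge0// invr_ge0 subr_ge0 ltW//.
rewrite -[leRHS]invr1 -Ee.
have [j1 <-] := itg_ind (mI _) (mI _) sub2 i2.
apply: (le_Rintegral (mI _) j1 ie) => x _; case: ifP => // _; exact: expR_ge0.
Qed.

Let Jint (l b : R) : (\int[mu]_(t in `]0%R, +oo[) (expR (- l * t) * t `^ (- b))%:E)%E =
 (\int[mu]_(t in D) (expR (- l * t) * t `^ (- b))%:E)%E.
Proof. by apply: integral_itv_obnd_cbnd; apply/measurable_EFinP; exact: expow_meas. Qed.

(** Scaling of the Gamma integral. The substitution is made on the closed half lines of the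
    exhaustion, where the integrand is continuous, and the limit is taken on both sides. *)
Lemma laplace_pow (b l : R) : 0 < b < 1 -> 0 < l ->
 itg mu D (fun t => expR (- l * t) * t `^ (- b)) /\
 \int[mu]_(t in D) (expR (- l * t) * t `^ (- b)) = l `^ (b - 1) * Gamma (1 - b).
Proof.
move=> b01 l0; have l00 := ltW l0; have fin := gamma_lt b01.
have h0 (k : R) x : (0 <= (expR (- k * x) * x `^ (- b))%:E)%E by rewrite lee_fin mulr_ge0 ?expR_ge0 ?powR_ge0.
have hc (k m : R) (m0 : 0 < m) := @ge0_nondecreasing_set_cvg_integral _ RR R (F m) (fun t => (expR (- k * t) * t `^ (- b))%:E) mu (F_nd (ltW m0))
  (fun n => mI _) (fun n => proj2 (measurable_EFinP _ _) (@expow_meas (F m n) k (- b))) (fun n x _ => @h0 k x).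
have c1 := hc 1 l l0; have c2 := hc l 1 ltr01.
rewrite (F_U l0) in c1; rewrite (F_U ltr01) in c2.
have sub n : (\int[mu]_(t in F l n) (expR (- 1 * t) * t `^ (- b))%:E =
  (l `^ (1 - b))%:E * \int[mu]_(t in F 1 n) (expR (- l * t) * t `^ (- b))%:E)%E.
 have dF (x : R) : is_derive x 1 (fun t : R => l * t) l := is_derive_scale l x.
 have F1 : (fun t : R => l * t)^`()%classic = fun=> l by apply/funext => x; rewrite derive1E; exact: derive_val.
 have n0 : 0 < 1 / n.+1%:R :> R by exact: divr_gt0.
 have -> : F l n = `[l * (1 / n.+1%:R), +oo[%classic :> set RR by rewrite /F mulrA mulr1.
 rewrite (@increasing_ge0_integration_by_substitutiony _ (fun t => l * t) (fun t => expR (- 1 * t) * t `^ (- b)) (1 / n.+1%:R)) ?F1.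
 - rewrite -ge0_integralZl//; last 3 first.
  + exact: mI.
  + by apply/measurable_EFinP; exact: expow_meas.
  + by rewrite lee_fin powR_ge0.
  apply: eq_integral => x; rewrite inE/= in_itv/= andbT => nx; have x0 : 0 < x := lt_le_trans n0 nx.
  rewrite !fctE/= -EFinM; congr (_%:E); rewrite powRM ?(ltW x0)// mulrA mulN1r -mulNr.
  rewrite (_ : 1 - b = - b + 1); last by rewrite addrC.
  rewrite powRD; last by apply/implyP => _; rewrite gt_eqF.
  by rewrite powRr1//; ring.
 - by move=> x y _ _; rewrite ltr_pM2l.
 - by move=> x _; exact: cvg_cst.
 - exact: is_cvg_cst.
 - exact: is_cvg_cst.
 - split; first by move=> x _; case: (dF x).
  apply: cvg_at_right_filter; apply: cvgM; [exact: cvg_cst|exact: cvg_id].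
 - by apply: gt0_cvgMry; [exact: l0|exact: cvg_id].
 - apply: continuous_in_subspaceT => x; rewrite inE/= in_itv/= andbT => nx.
  have x0 : 0 < x by apply: lt_le_trans nx; exact: mulr_gt0.
  have h : {for x, continuous (fun t : R => expR (- 1 * t))}.
   by have [/derivable1_diffP/differentiable_continuous h _] := is_derive_expM (- 1) x; exact (h).
  exact (cvgM h (@powR_cont (- b) x x0)).
 - by move=> x _; rewrite mulr_ge0 ?expR_ge0 ?powR_ge0.
have E : ((l `^ (1 - b))%:E * \int[mu]_(t in D) (expR (- l * t) * t `^ (- b))%:E =
  \int[mu]_(t in `]0%R, +oo[) (expR (- 1 * t) * t `^ (- b))%:E)%E.
 rewrite -Jint -(cvg_lim _ c1)//; apply/esym/cvg_lim => //; rewrite (funext sub).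
 by apply: cvgeZl.
have p0 : 0 < l `^ (1 - b) by exact: powR_gt0.
have Jfin : (\int[mu]_(t in D) (expR (- l * t) * t `^ (- b))%:E < +oo)%E.
 rewrite ltNge leye_eq; apply/negP => /eqP Ey; by rewrite -E Ey gt0_muley ?lte_fin// ltxx in fin.
have mJ := @expow_meas D l (- b).
have iJ : itg mu D (fun t => expR (- l * t) * t `^ (- b)).
 by apply: (ge0_itg mJ _ Jfin) => x _; rewrite -lee_fin; exact: h0.
split => //.
have G1 : (Gamma (1 - b))%:E = (\int[mu]_(t in `]0%R, +oo[) (expR (- 1 * t) * t `^ (- b))%:E)%E.
 rewrite /Gamma /Rintegral fineK. by apply: eq_integral => x _; rewrite mulrC mulN1r addrAC subrr add0r.
 rewrite ge0_fin_numE; last by apply: integral_ge0 => x _; rewrite lee_fin mulr_ge0 ?powR_ge0 ?expR_ge0.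
 rewrite (_ : (\int[mu]_(x in _) _)%E = (\int[mu]_(t in `]0%R, +oo[) (expR (- 1 * t) * t `^ (- b))%:E)%E)//.
 by apply: eq_integral => x _; rewrite mulrC mulN1r addrAC subrr add0r.
have : (Gamma (1 - b))%:E = (l `^ (1 - b) * \int[mu]_(t in D) (expR (- l * t) * t `^ (- b)))%:E.
 by rewrite G1 -E EFinM (EFin_Rint (mI _) iJ).
move=> [->]; rewrite mulrA -powRD; last by apply/implyP => _; rewrite gt_eqF.
by rewrite addrA subrK subrr powRr0 mul1r.
Qed.

End laplace_calculus.

(** * Abelian theorems *)

Section abelian.

Let DP (t : R) : D t = (0 <= t) :> Prop.
Proof. by rewrite /= in_itv/= andbT. Qed.

Definition lap (f : R -> R) (l : R) := \int[mu]_(t in D) (expR (- l * t) * f t).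

Definition bounded_density (M : R) (f : R -> R) :=
 measurable_fun [set: RR] f /\ forall t : R, 0 <= t -> 0 <= f t <= M.

Variables (M : R) (f : R -> R).
Hypothesis bf : bounded_density M f.

Let fm (A : set RR) : measurable_fun A f.
Proof. by apply: (measurable_funS (@measurableT _ RR)) => //; case: bf. Qed.
Let f0 (t : R) : 0 <= t -> 0 <= f t. Proof. by move=> t0; have [_ /(_ t t0)/andP[]] := bf. Qed.
Let fM (t : R) : 0 <= t -> f t <= M. Proof. by move=> t0; have [_ /(_ t t0)/andP[]] := bf. Qed.
Let M0 : 0 <= M. Proof. exact: le_trans (f0 (lexx 0)) (fM (lexx 0)). Qed.

Lemma lap_meas (A : set RR) (l : R) : measurable_fun A (fun t => expR (- l * t) * f t).
Proof. by apply: measurable_funM; [exact: expM_meas|exact: fm]. Qed.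

Lemma lap_itg (l : R) : 0 < l -> itg mu D (fun t => expR (- l * t) * f t).
Proof.
move=> l0; have [ie _] := exp_itgD l0.
apply: (itg_le (mI _) (lap_meas _) _ (itgZ (mI _) M ie)) => t; rewrite DP => t0.
by rewrite ger0_norm ?mulr_ge0 ?expR_ge0 ?f0// mulrC ler_wpM2r ?expR_ge0 ?fM.
Qed.

Lemma lap_right0 : itg mu D f -> lap f l @[l --> 0^'+] --> \int[mu]_(t in D) f t.
Proof.
move=> i_f; apply/cvg_at_rightP => u [u0 uc].
apply: (proj2 (@Rint_dom_cvg _ RR R mu D (mI _) (fun n t => expR (- u n * t) * f t) f f _ _ _ _)) => //.
- by move=> n; exact: lap_meas.
- move=> t _; rewrite -[X in _ --> X]mul1r; apply: cvgMr_tmp.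
 rewrite -expR0; apply: (@cvg_comp _ _ _ (fun n => - u n * t) (@expR R) _ (nbhs 0)); last exact: continuous_expR.
 by rewrite -(mul0r t); apply: cvgMr_tmp; rewrite -oppr0; exact: cvgN.
- move=> n t; rewrite DP => t0; rewrite normrM !ger0_norm ?expR_ge0 ?f0//.
 by rewrite ler_piMl ?f0// -expR0 ler_expR mulNr oppr_le0 mulr_ge0// ltW.
Qed.

Lemma lap_bd_itg (C : R) : (forall l, 0 < l -> lap f l <= C) -> itg mu D f.
Proof.
move=> hC; have n0 n : 0 < n.+1%:R^-1 :> R by rewrite invr_gt0.
apply: (proj1 (@Rint_mono_cvg _ _ _ mu _ (mI _) (fun n t => expR (- n.+1%:R^-1 * t) * f t) f C _ _ _ _ _)).
- by move=> n; exact: lap_itg.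
- by move=> n t; rewrite DP => t0; rewrite mulr_ge0 ?expR_ge0 ?f0.
- move=> t; rewrite DP => t0 m n mn; rewrite ler_wpM2r ?f0// ler_expR ler_wpM2r// lerN2.
 by rewrite lef_pV2 ?posrE// ler_nat.
- move=> t _; rewrite -[X in _ --> X]mul1r; apply: cvgMr_tmp.
 rewrite -[X in _ --> X]expR0; apply: (@cvg_comp _ _ _ (fun n : nat => - (n.+1%:R : R)^-1 * t) (@expR R) _ (nbhs 0)); last exact: continuous_expR.
 rewrite -(mul0r t); apply: cvgMr_tmp; rewrite -oppr0; apply: cvgN.
 exact: cvg_harmonic.
- by move=> n; exact: hC.
Qed.

Lemma dom_int (h g : R -> R) : measurable_fun D h -> itg mu D g -> (forall t, 0 <= t -> `|h t| <= g t) ->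
 `|\int[mu]_(t in D) h t| <= \int[mu]_(t in D) g t.
Proof.
move=> mh ig hg; have ih : itg mu D h by apply: (itg_le (mI _) mh _ ig) => t; rewrite DP => /hg.
apply: le_trans (le_normr_Rintegral (mI _) ih) _.
by apply: (le_Rintegral (mI _) (itg_norm (mI _) ih) ig) => t; rewrite DP => /hg.
Qed.

Lemma pinfty_eps (h : R -> R) (c e : R) : h t @[t --> +oo] --> c -> 0 < e ->
 exists2 T : R, 1 <= T & forall t, T <= t -> `|c - h t| <= e.
Proof.
move=> /cvgrPdist_le hc /hc[T [_ hT]]; exists (Num.max 1 (T + 1)); first by rewrite le_max lexx.
move=> t; rewrite ge_max => /andP[_ Tt]; apply: hT; apply: lt_le_trans Tt.
by rewrite ltrDl.
Qed.

Let sub0T (T : R) : (`[0, T]%classic : set RR) `<=` D.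
Proof. by move=> t /=; rewrite !in_itv/= => /andP[->]. Qed.

(** Comparison with c t^-b, whose transform is exact. Beyond some T the error is a small multiple of
    t^-b; up to T it is an integral bounded independently of l, which the factor l^(1-b) sends to
    0. *)
Lemma abel_pow (b c : R) : 0 < b < 1 -> 0 <= c -> f t * t `^ b @[t --> +oo] --> c ->
 lap f l * l `^ (1 - b) @[l --> 0^'+] --> c * Gamma (1 - b).
Proof.
move=> b01 c0 hc; have /andP[b0 b1] := b01; pose Gm := Gamma (1 - b).
have G0 : 0 <= Gm by apply: Rintegral_ge0 => t _; rewrite mulr_ge0 ?powR_ge0 ?expR_ge0.
apply/cvgrPdist_le => e e0; pose e1 := e / 2 / (Gm + 1).
have e10 : 0 < e1 by rewrite !divr_gt0// ltr_wpDl.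
have e1G : e1 * Gm <= e / 2 by rewrite /e1 mulrAC ler_pdivrMr ?ltr_wpDl// ler_wpM2l ?divr_ge0 ?(ltW e0)// lerDl.
have [T T1 hT] := pinfty_eps hc e10; have T0 : 0 < T by apply: lt_le_trans T1.
have [ip Ep] := laplace_pow b01 (@ltr01 R).
have ipT : itg mu `[0, T] (fun t => t `^ (- b)).
 apply: (itg_le (mI _) _ _ (itgZ (mI _) (expR T) (itgS (mI _) (mI _) (@sub0T T) ip))).
  by apply: (measurable_funS (@measurableT _ RR)) => //; exact: powR_meas.
 move=> t; rewrite /= in_itv/= => /andP[t0 tT]; rewrite ger0_norm ?powR_ge0// mulrA -expRD.
 have h1 : 1 <= expR (T + - 1 * t) by rewrite -[leLHS]expR0 ler_expR mulN1r subr_ge0.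
 by rewrite ler_peMl ?powR_ge0.
have iM : itg mu `[0, T] (fun=> M) := itg_cst (mI _) (@fin_itv R 0 T) M.
have iC : itg mu `[0, T] (fun t => M + c * t `^ (- b)) := itgD (mI _) iM (itgZ (mI _) c ipT).
have [iC' EC] := itg_ind (mI _) (mI _) (@sub0T T) iC.
pose C := \int[mu]_(t in `[0, T]) (M + c * t `^ (- b)).
have key (l : R) : 0 < l -> `|lap f l - c * (l `^ (b - 1) * Gm)| <= e1 * (l `^ (b - 1) * Gm) + C.
 move=> l0; have [il El] := laplace_pow b01 l0.
 have icl := itgZ (mI _) c il; have iel := itgZ (mI _) e1 il.
 rewrite -El -(RintegralZl c (mI _) il) -(RintegralZl e1 (mI _) il) -(RintegralB (mI _) (lap_itg l0) icl).
 rewrite /C -EC -(RintegralD (mI _) iel iC').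
 apply: (dom_int (itg_meas (itgB (mI _) (lap_itg l0) icl)) (itgD (mI _) iel iC')).
 move=> t t0; have p0 := powR_ge0 t (- b); have x0 := expR_ge0 (- l * t).
 have x1 : expR (- l * t) <= 1 by rewrite -expR0 ler_expR mulNr oppr_le0 mulr_ge0// ltW.
 rewrite (_ : expR (- l * t) * f t - c * (expR (- l * t) * t `^ (- b)) = expR (- l * t) * (f t - c * t `^ (- b))); last by ring.
 rewrite normrM (ger0_norm x0); have [Tt|tT] := leP T t.
  have tp : 0 < t := lt_le_trans T0 Tt.
  have -> : f t - c * t `^ (- b) = - (c - f t * t `^ b) * t `^ (- b).
   by rewrite powRN; have := powR_gt0 b tp; move: (t `^ b) => y y0; field; rewrite gt_eqF.
  apply: (@le_trans _ _ (e1 * (expR (- l * t) * t `^ (- b)))).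
   rewrite normrM normrN (ger0_norm p0) mulrCA; apply: ler_wpM2r; first exact: mulr_ge0.
   exact: hT.
  rewrite lerDl; case: ifP => // _; by rewrite addr_ge0// mulr_ge0.
 rewrite mem_set; last by rewrite /= in_itv/= t0 ltW.
 apply: (@le_trans _ _ (M + c * t `^ (- b))); last by rewrite lerDr; exact: mulr_ge0 (ltW e10) (mulr_ge0 x0 p0).
 apply: (@le_trans _ _ `|f t - c * t `^ (- b)|); first exact: ler_piMl.
 apply: (le_trans (ler_normB _ _)); rewrite !ger0_norm ?mulr_ge0 ?f0//.
 by rewrite lerD2r fM.
near=> l; have l0 : 0 < l by near: l; exact: nbhs_right_gt.
have pl : C * l `^ (1 - b) <= e / 2.
 near: l; have : C * l `^ (1 - b) @[l --> 0^'+] --> C * 0.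
  by apply: cvgMl_tmp; apply: powR_cvg0; rewrite subr_gt0.
 rewrite mulr0 => /cvgrPdist_le/(_ (e / 2)) h.
 have := h ltac:(by rewrite divr_gt0); apply: filterS => l.
 by rewrite sub0r normrN => /(le_trans (ler_norm _)).
have p0 : 0 < l `^ (1 - b) by exact: powR_gt0.
have pp : l `^ (b - 1) * l `^ (1 - b) = 1.
 by rewrite -powRD ?addrA ?subrK ?subrr ?powRr0//; apply/implyP => _; rewrite gt_eqF.
have := key l l0; move: (l `^ (b - 1)) pp => y pp k.
rewrite (_ : c * Gamma (1 - b) - lap f l * l `^ (1 - b) = - ((lap f l - c * (y * Gm)) * l `^ (1 - b))); last first.
 rewrite mulrBl -[X in X - _](_ : c * (y * Gm) * l `^ (1 - b) = _); first by ring.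
 by rewrite -mulrA -[_ * Gm * _]mulrAC pp mul1r.
rewrite normrN normrM (gtr0_norm p0); apply: (le_trans (ler_wpM2r (ltW p0) k)).
rewrite mulrDl -mulrA -[y * Gm * _]mulrAC pp mul1r; lra.
Unshelve. all: by end_near.
Qed.

(** Comparison with c/t on [T, 1/l], whose integral is c (ln(1/l) - ln T). Replacing exp(-lt) by 1
    there costs at most c l per unit of t, since 1 - exp(-lt) <= lt, and beyond 1/l the integrand is
    at most (c + e1) l exp(-lt); both contributions stay bounded as l tends to 0. *)
Lemma abel_log (c : R) : 0 <= c -> f t * t @[t --> +oo] --> c ->
 lap f l / ln l^-1 @[l --> 0^'+] --> c.
Proof.
move=> c0 hc; apply/cvgrPdist_le => e e0; pose e1 := e / 2.
have e10 : 0 < e1 by rewrite divr_gt0.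
have [T T1 hT] := pinfty_eps hc e10; have T0 : 0 < T by apply: lt_le_trans T1.
have lnT : 0 <= ln T by rewrite ln_ge0.
(* In this order: the part before T, the replacement of the exponential by 1 on [T, 1/l], the part
   beyond 1/l, and the lower limit of the logarithmic integral. *)
pose C := M * T + c + c + e1 + c * ln T.
have iM : itg mu `[0, T] (fun=> M) := itg_cst (mI _) (@fin_itv R 0 T) M.
have [iM' EM] := itg_ind (mI _) (mI _) (@sub0T T) iM.
have key (l : R) : 0 < l -> T <= l^-1 -> `|lap f l - c * ln l^-1| <= e1 * ln l^-1 + C.
 move=> l0 Tl; have sub : (`[T, l^-1]%classic : set RR) `<=` D.
  by move=> t /=; rewrite !in_itv/= andbT => /andP[Tt _]; apply: le_trans Tt; exact: ltW.
 have [iv Ev] := inv_int T0 Tl; have [ie Ee] := exp_itgD l0.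
 have icl : itg mu `[T, l^-1] (fun=> c * l) := itg_cst (mI _) (@fin_itv R T l^-1) (c * l).
 have [iv' Ev'] := itg_ind (mI _) (mI _) sub iv.
 have [icl' Ecl] := itg_ind (mI _) (mI _) sub icl.
 have icv := itgZ (mI _) c iv'; have iev := itgZ (mI _) e1 iv'; have iee := itgZ (mI _) ((c + e1) * l) ie.
 have i3 := itgD (mI _) (itgD (mI _) iM' iev) (itgD (mI _) icl' iee).
 have := dom_int (itg_meas (itgB (mI _) (lap_itg l0) icv)) i3.
 rewrite (RintegralB (mI _) (lap_itg l0) icv) (RintegralD (mI _) (itgD (mI _) iM' iev) (itgD (mI _) icl' iee)).
 rewrite (RintegralD (mI _) iM' iev) (RintegralD (mI _) icl' iee) (RintegralZl _ (mI _) iv') (RintegralZl _ (mI _) iv') (RintegralZl _ (mI _) ie).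
 rewrite EM Ecl Ev' Ev Ee (Rint_cst_itv M (ltW T0)) (Rint_cst_itv (c * l) Tl) subr0.
 have -> : c * l * (l^-1 - T) = c - c * l * T by field; rewrite gt_eqF.
 rewrite mulfK ?gt_eqF// -/(lap f l) => k.
 have clT : 0 <= c * l * T by rewrite !mulr_ge0// ltW.
 have e1T : 0 <= e1 * ln T by rewrite mulr_ge0// ltW.
 have cT : 0 <= c * ln T by rewrite mulr_ge0.
 apply: (@le_trans _ _ (`|lap f l - c * (ln l^-1 - ln T)| + c * ln T)).
  rewrite -[X in _ <= _ + X](ger0_norm cT) (_ : lap f l - c * ln l^-1 = lap f l - c * (ln l^-1 - ln T) - c * ln T); last by ring.
  exact: ler_normB.
 apply: (@le_trans _ _ (M * T + e1 * (ln l^-1 - ln T) + (c - c * l * T + (c + e1)) + c * ln T)); last first.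
  by rewrite /C mulrBr; lra.
 rewrite lerD2r; apply: k => t t0.
 have x0 := expR_ge0 (- l * t).
 have x1 : expR (- l * t) <= 1 by rewrite -expR0 ler_expR mulNr oppr_le0 mulr_ge0// ltW.
 have x2 : 1 - l * t <= expR (- l * t) by have := expR_ge1Dx (- l * t); rewrite mulNr.
 have q0 : 0 <= (c + e1) * l * expR (- l * t) by rewrite !mulr_ge0 ?addr_ge0// ltW.
 have [Tt|tT] := leP T t.
  have tp : 0 < t := lt_le_trans T0 Tt.
  have tv : 0 < t^-1 by rewrite invr_gt0.
  have ft : `|f t - c * t^-1| <= e1 * t^-1.
   have -> : f t - c * t^-1 = - (c - f t * t) * t^-1 by field; rewrite gt_eqF.
   by rewrite normrM normrN (gtr0_norm tv) ler_pM2r//; exact: hT.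
  have m1 : 0 <= if t \in (`[0, T]%classic : set RR) then M else 0 by case: ifP.
  have [tl|lt'] := leP t l^-1.
   have mem : t \in (`[T, l^-1]%classic : set RR) by rewrite mem_set//= in_itv/= Tt.
   rewrite mem; apply: (@le_trans _ _ (e1 * t^-1 + c * l)); last by apply: lerD; rewrite ?lerDr ?lerDl.
   rewrite (_ : expR (- l * t) * f t - c * t^-1 = expR (- l * t) * (f t - c * t^-1) - c * t^-1 * (1 - expR (- l * t))); last by ring.
   apply: (le_trans (ler_normB _ _)); apply: lerD.
    rewrite normrM (ger0_norm x0); apply: le_trans ft; exact: ler_piMl.
   rewrite ger0_norm; last by rewrite !mulr_ge0 ?subr_ge0// ltW.
   rewrite (_ : c * l = c * t^-1 * (l * t)); last by field; rewrite gt_eqF.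
   by apply: ler_wpM2l; [rewrite mulr_ge0// ltW|lra].
  have mem : (t \in (`[T, l^-1]%classic : set RR)) = false by apply/negbTE; rewrite notin_setE/= in_itv/= => /andP[_]; rewrite leNgt lt'.
  rewrite mem !mulr0 subr0 addr0 add0r; apply: (@le_trans _ _ ((c + e1) * l * expR (- l * t))); last by rewrite lerDr.
  rewrite ger0_norm ?mulr_ge0 ?f0// mulrC ler_wpM2r//.
  apply: (@le_trans _ _ ((c + e1) * t^-1)). by have := ler_norm (f t - c * t^-1); rewrite mulrDl; lra.
  rewrite ler_wpM2l ?addr_ge0 ?(ltW e10)// -[leRHS]invrK lef_pV2 ?posrE ?invr_gt0//; exact: ltW.
 rewrite (mem_set (u := t) (A := (`[0, T]%classic : set RR))); last by rewrite /= in_itv/= t0 ltW.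
 have mem : (t \in (`[T, l^-1]%classic : set RR)) = false by apply/negbTE; rewrite notin_setE/= in_itv/= => /andP[]; rewrite leNgt tT.
 rewrite mem !mulr0 subr0 addr0 add0r ger0_norm ?mulr_ge0 ?f0//.
 apply: (@le_trans _ _ M); last by rewrite lerDl.
 by apply: le_trans (fM t0); rewrite ler_piMl ?f0.
near=> l; have l0 : 0 < l by near: l; exact: nbhs_right_gt.
pose B := Num.max 1 (C / e1).
have lB : expR B < l^-1.
 rewrite -[ltLHS]invrK ltf_pV2 ?posrE ?invr_gt0 ?expR_gt0//.
 by near: l; apply: nbhs_right_lt; rewrite invr_gt0 expR_gt0.
have Tl : T <= l^-1.
 rewrite -[leLHS]invrK lef_pV2 ?posrE ?invr_gt0//.
 by near: l; apply: nbhs_right_le; rewrite invr_gt0.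
have lnB : B < ln l^-1 by rewrite -ltr_expR lnK// posrE invr_gt0.
have ln1 : 0 < ln l^-1 by apply: le_lt_trans lnB; rewrite le_max ler01.
have lnC : C <= e1 * ln l^-1.
 rewrite mulrC -ler_pdivrMr//; apply/ltW; apply: le_lt_trans lnB; rewrite le_max lexx orbT//.
rewrite (_ : c - lap f l / ln l^-1 = - ((lap f l - c * ln l^-1) / ln l^-1)); last by field; rewrite gt_eqF.
rewrite normrN normrM (gtr0_norm (_ : 0 < (ln l^-1)^-1)) ?invr_gt0//.
rewrite ler_pdivrMr//; apply: (le_trans (key l l0 Tl)).
by rewrite (_ : e = e1 + e1) ?mulrDl ?lerD2l// /e1; field.
Unshelve. all: by end_near.
Qed.

End abelian.

(** * Tails of integrable densities *)

Section tails.

Let DP (t : R) : D t = (0 <= t) :> Prop.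
Proof. by rewrite /= in_itv/= andbT. Qed.

Definition tail (w : R -> R) (r : R) := \int[mu]_(t in D) (if r <= t then w t else 0).

Variable w : R -> R.
Hypotheses (wm : measurable_fun [set: RR] w) (w0 : forall t, 0 <= t -> 0 <= w t).
Hypothesis wi : itg mu D w.

Let wr_itg (r : R) : itg mu D (fun t => if r <= t then w t else 0).
Proof.
apply: (itg_le (mI _) _ _ wi).
 apply: (measurable_funS (@measurableT _ RR)) => //; apply: measurable_fun_ifT => //.
 by apply: measurable_fun_ler => //; exact: measurable_id.
by move=> t; rewrite DP => t0; case: ifP; rewrite ?normr0 ?ger0_norm ?w0.
Qed.

Lemma tail_anti (r s : R) : r <= s -> tail w s <= tail w r.
Proof.
move=> rs; apply: (le_Rintegral (mI _) (wr_itg s) (wr_itg r)) => t; rewrite DP => t0.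
by case: (leP s t) => [st|_]; [rewrite (le_trans rs st)|case: ifP => // _; exact: w0].
Qed.

Lemma tail_bounded : bounded_density (tail w 0) (tail w).
Proof.
split; first by apply: nonincreasing_measurable => // r s; exact: tail_anti.
move=> r r0; rewrite (tail_anti r0) andbT; apply: Rintegral_ge0 => t; rewrite DP => t0.
by case: ifP => // _; exact: w0.
Qed.

(** [K] is the primitive of [g] that vanishes at 0; both sides integrate w(t) g(r) over 0 <= r <=
    t. *)
Lemma tail_tonelli (g K : R -> R) : measurable_fun [set: RR] g -> (forall r, 0 <= g r) ->
 (forall t, 0 <= t -> itg mu `[0, t] g /\ \int[mu]_(r in `[0, t]) g r = K t) ->
 (\int[mu]_(t in D) (w t * K t)%:E = \int[mu]_(r in D) (g r * tail w r)%:E)%E.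
Proof.
move=> gm g0 hK; pose wD (t : R) := if 0 <= t then w t else 0.
pose ch (t r : R) : R := if (0 <= r) && (r <= t) then 1 else 0.
pose h (z : RR * RR) : R := wD z.1 * (g z.2 * ch z.1 z.2).
have wD0 t : 0 <= wD t by rewrite /wD; case: ifP => // /w0.
have ch0 t r : 0 <= ch t r by rewrite /ch; case: ifP.
have wDm : measurable_fun [set: RR] wD.
 by apply: measurable_fun_ifT => //; apply: measurable_fun_ler => //; exact: measurable_id.
have m1 := @measurable_fst _ _ RR RR; have m2 := @measurable_snd _ _ RR RR.
have chm : measurable_fun [set: RR * RR] (fun z : RR * RR => ch z.1 z.2).
 apply: measurable_fun_ifT => //; apply: measurable_and; apply: measurable_fun_ler => //.
have hm : measurable_fun [set: RR * RR] h.
 apply: measurable_funM; first exact: (measurableT_comp wDm m1).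
 by apply: measurable_funM => //; exact: (measurableT_comp gm m2).
have h0 z : (0 <= (h z)%:E)%E by rewrite lee_fin !mulr_ge0.
have hmE : measurable_fun [set: RR * RR] (EFin \o h) by exact/measurable_EFinP.
have F := @fubini_tonelli _ _ RR RR R mu mu (EFin \o h) hmE h0.
transitivity (\int[mu]_t \int[mu]_r (EFin \o h) (t, r))%E.
 rewrite integral_mkcond; apply: eq_integral => t _; rewrite patchE.
 have [t0|t0] := leP 0 t; last first.
  rewrite memNset /=; last by rewrite in_itv/= leNgt t0.
  by rewrite integral0_eq// => r _; rewrite /h /wD/= leNgt t0/= mul0r.
 rewrite mem_set /=; last by rewrite in_itv/= t0.
 have [ig <-] := hK t t0.
 rewrite -(RintegralZl (w t) (mI _) ig) (EFin_Rint (mI _) (itgZ (mI _) _ ig)) integral_mkcond.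
 apply: eq_integral => r _; rewrite patchE /h /wD /ch /= t0.
 case: ifPn => [|/negP hr]; first by rewrite inE/= in_itv/= => ->; rewrite mulr1.
 rewrite ifF ?mulr0//; apply/negbTE/negP => hr'; apply: hr; by rewrite inE/= in_itv/=.
rewrite F [RHS]integral_mkcond; apply: eq_integral => r _; rewrite patchE.
have [r0|r0] := leP 0 r; last first.
 rewrite memNset /=; last by rewrite in_itv/= leNgt r0.
 by rewrite integral0_eq// => t _; rewrite /h /ch/= leNgt r0/= !mulr0.
rewrite mem_set /=; last by rewrite in_itv/= r0.
rewrite -(RintegralZl (g r) (mI _) (wr_itg r)) (EFin_Rint (mI _) (itgZ (mI _) _ (wr_itg r))) [RHS]integral_mkcond.
apply: eq_integral => t _; rewrite patchE /h /wD /ch /= r0/=.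
have [t0|t0] := leP 0 t. by rewrite mem_set/= ?in_itv/= ?t0//; case: ifP => _; rewrite ?mulr1 ?mulr0// mulrC.
by rewrite memNset/= ?mul0r// in_itv/= leNgt t0.
Qed.

(** 1 - exp(-lt) is the integral of l exp(-lr) over [0, t]. The deficit of the transform from its
    value at 0 is thus a transform of the tail, to which the Abelian theorems apply again. *)
Lemma lap_tail (l : R) : 0 < l -> \int[mu]_(t in D) w t - lap w l = l * lap (tail w) l.
Proof.
move=> l0; have bt := tail_bounded.
have := @tail_tonelli (fun r => l * expR (- l * r)) (fun t => 1 - expR (- l * t)) _ _ _.
have il := lap_itg bt l0.
have ilw : itg mu D (fun t => expR (- l * t) * w t).
 apply: (itg_le (mI _) _ _ wi).
  apply: measurable_funM; first exact: expM_meas.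
  by apply: (measurable_funS (@measurableT _ RR)) => //.
 move=> t; rewrite DP => t0; rewrite ger0_norm ?mulr_ge0 ?expR_ge0 ?w0// ler_piMl ?w0//.
 by rewrite -expR0 ler_expR mulNr oppr_le0 mulr_ge0// ltW.
have i1 := itgB (mI _) wi ilw; have i2 := itgZ (mI _) l il.
rewrite /lap -(RintegralB (mI _) wi ilw) -(RintegralZl l (mI _) il) => T.
apply: EFin_inj; rewrite (EFin_Rint (mI _) i1) (EFin_Rint (mI _) i2).
have <- : (\int[mu]_(r in D) (l * expR (- l * r) * tail w r)%:E = \int[mu]_(x in D) (l * (expR (- l * x) * tail w x))%:E)%E.
 by apply: eq_integral => t _; rewrite mulrA.
rewrite -T.
- by apply: eq_integral => t _; rewrite mulrBr mulr1 [w t * _]mulrC.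
- by apply: measurable_funM => //; exact: expM_meas.
- by move=> r; rewrite mulr_ge0 ?expR_ge0// ltW.
- move=> t t0; have ie := exp_itg (- l) t; split; first exact: (itgZ (mI _)).
 rewrite (RintegralZl _ (mI _) ie); have := Rint_exp (- l) t0.
 by move: (\int[mu]_(r in _) _) => I; rewrite mulNr => E; rewrite -[l * I]opprK E opprB.
Qed.

Lemma tail_first_moment : (\int[mu]_(t in D) (t * w t)%:E = \int[mu]_(r in D) (tail w r)%:E)%E.
Proof.
have := @tail_tonelli (fun=> 1) id _ _ _ => T.
transitivity (\int[mu]_(t in D) (w t * t)%:E)%E; first by apply: eq_integral => t _; rewrite mulrC.
rewrite T//; first by apply: eq_integral => t _; rewrite mul1r.
move=> t t0; have ic := itg_cst (mI `[0, t]) (@fin_itv R 0 t) 1; split => //.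
by rewrite (Rint_cst_itv 1 t0) mul1r subr0.
Qed.

End tails.

(** * Tails under power decay *)

Section power_tails.
Variables (M c al : R) (w : R -> R).
Hypotheses (bw : bounded_density M w) (al1 : 1 < al) (c0 : 0 <= c).
Hypothesis wc : w t * t `^ al @[t --> +oo] --> c.

Let w0 t : 0 <= t -> 0 <= w t <= M. Proof. by move=> t0; have [_ ->] := bw. Qed.
Let wm (A : set RR) : measurable_fun A w.
Proof. by apply: (measurable_funS (@measurableT _ RR)) => //; case: bw. Qed.

Let pow_itg (r : R) : 0 < r -> itg mu `[r, +oo[ (fun t => t `^ (- al)) /\
 \int[mu]_(t in `[r, +oo[) t `^ (- al) = r `^ (1 - al) / (al - 1).
Proof.
move=> r0; apply: ge0_itg_fin; [exact: mI| |by move=> t _; exact: powR_ge0|exact: pow_tail].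
by apply: (measurable_funS (@measurableT _ RR)) => //; exact: powR_meas.
Qed.

Let subr (r : R) : 0 <= r -> (`[r, +oo[%classic : set RR) `<=` D.
Proof. by move=> r0 t; rewrite /= !in_itv/= !andbT; exact: le_trans. Qed.

Let near_pow (t e : R) : 0 < t -> `|c - w t * t `^ al| <= e -> `|w t - c * t `^ (- al)| <= e * t `^ (- al).
Proof.
move=> t0 h; have p0 := powR_gt0 al t0; rewrite powRN.
rewrite (_ : w t - c * (t `^ al)^-1 = - (c - w t * t `^ al) * (t `^ al)^-1); last by field; rewrite gt_eqF.
by rewrite normrM normrN [X in _ * X <= _]gtr0_norm ?invr_gt0// ler_wpM2r// invr_ge0 ltW.
Qed.

Lemma power_itg : itg mu D w.
Proof.
have [T T1 hT] := pinfty_eps wc (@ltr01 R); have T0 : 0 < T by apply: lt_le_trans T1.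
have [ip _] := pow_itg T0.
have [i1 _] := itg_ind (mI _) (mI _) (subr (ltW T0)) (itgZ (mI _) (c + 1) ip).
have sT : (`[0, T]%classic : set RR) `<=` D by move=> t /=; rewrite !in_itv/= => /andP[->].
have [i2 _] := itg_ind (mI _) (mI _) sT (itg_cst (mI _) (@fin_itv R 0 T) M).
pose g (t : R) := (if t \in (`[0, T]%classic : set RR) then M else 0) +
 (if t \in (`[T, +oo[%classic : set RR) then (c + 1) * t `^ (- al) else 0).
have i3 : itg mu D g by exact: (itgD (mI _) i2 i1).
have wD : measurable_fun D w by apply: (measurable_funS (@measurableT _ RR)) => //; case: bw.
apply: (@itg_le _ RR R mu D (mI _) w g wD _ i3) => t; rewrite /= in_itv/= andbT => t0; rewrite /g.
have /andP[wt0 wtM] := w0 t0; have M0 := le_trans wt0 wtM; have p0 := powR_ge0 t (- al).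
rewrite (ger0_norm wt0); have [Tt|tT] := leP T t; last first.
 rewrite mem_set/=; last by rewrite in_itv/= t0 ltW.
 by apply: (le_trans wtM); rewrite lerDl; case: ifP => // _; rewrite mulr_ge0// addr_ge0.
rewrite [X in _ <= _ + X]ifT; last by rewrite mem_set//= in_itv/= Tt.
apply: (@le_trans _ _ ((c + 1) * t `^ (- al))); last by rewrite lerDr; case: ifP.
have := near_pow (lt_le_trans T0 Tt) (hT t Tt); have := ler_norm (w t - c * t `^ (- al)).
by rewrite mulrDl; lra.
Qed.

Lemma power_tail : tail w r * r `^ (al - 1) @[r --> +oo] --> c / (al - 1).
Proof.
have a0 : 0 < al - 1 by rewrite subr_gt0.
apply/cvgrPdist_le => e e0; pose e1 := e * (al - 1).
have e10 : 0 < e1 by rewrite mulr_gt0.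
have [T T1 hT] := pinfty_eps wc e10; near=> r.
have Tr : T <= r by near: r; exact: near_ge.
have r0 : 0 < r by apply: lt_le_trans Tr; exact: lt_le_trans T1.
have [ip Ep] := pow_itg r0.
have iw := itgS (mI _) (mI _) (subr (ltW r0)) power_itg.
have Et : tail w r = \int[mu]_(t in `[r, +oo[) w t.
 have [_ <-] := itg_ind (mI _) (mI _) (subr (ltW r0)) iw; apply: Rint_ext => t _.
 by rewrite (_ : (t \in _) = (r <= t))//; apply/idP/idP; rewrite inE/= in_itv/= andbT.
have ic := itgZ (mI _) c ip.
have key : `|tail w r - c * (r `^ (1 - al) / (al - 1))| <= e1 * (r `^ (1 - al) / (al - 1)).
 rewrite Et -Ep -(RintegralZl c (mI _) ip) -(RintegralB (mI _) iw ic) -(RintegralZl e1 (mI _) ip).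
 have ib := itgB (mI _) iw ic.
 apply: le_trans (le_normr_Rintegral (mI _) ib) _.
 apply: (le_Rintegral (mI _) (itg_norm (mI _) ib) (itgZ (mI _) e1 ip)) => t.
 rewrite /= in_itv/= andbT => rt; apply: near_pow; first exact: lt_le_trans rt.
 by apply: hT; exact: le_trans rt.
have p0 : 0 < r `^ (al - 1) by exact: powR_gt0.
have pp : r `^ (1 - al) = (r `^ (al - 1))^-1 by rewrite -powRN opprB.
move: key; rewrite pp; move: p0; move: (r `^ (al - 1)) (tail w r) => y x y0 key.
rewrite (_ : c / (al - 1) - x * y = - ((x - c * (y^-1 / (al - 1))) * y)); last by field; rewrite !gt_eqF.
rewrite normrN normrM (gtr0_norm y0); apply: (le_trans (ler_wpM2r (ltW y0) key)).
by rewrite /e1; apply: eq_ler; field; rewrite !gt_eqF.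
Unshelve. all: by end_near.
Qed.

End power_tails.

(** * Asymptotics of the inverse of the reciprocal Laplace transform *)

Section inverse_laplace.

(** ln x is twice the logarithm of sqrt x, hence at most 2 sqrt x. *)
Lemma ln_div_cvg0 : ln x / x @[x --> +oo] --> (0 : R).
Proof.
apply/cvgrPdist_le => e e0; near=> x.
have x1 : 1 <= x by near: x; exact: near_ge.
have x0 : 0 < x by exact: lt_le_trans x1.
have s0 : 0 < Num.sqrt x by rewrite sqrtr_gt0.
have l0 : 0 <= ln x by rewrite ln_ge0.
rewrite sub0r normrN ger0_norm ?divr_ge0 ?(ltW x0)// ler_pdivrMr//.
have se : 2 / e <= Num.sqrt x by rewrite -(ger0_norm (_ : 0 <= 2 / e)) ?divr_ge0 ?(ltW e0)// -sqrtr_sqr ler_sqrt.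
have E : x = Num.sqrt x * Num.sqrt x by rewrite -expr2 sqr_sqrtr// ltW.
have lx : ln x = ln (Num.sqrt x) + ln (Num.sqrt x) by rewrite {1}E lnM// posrE.
have := ln_sublinear s0; move: se; rewrite ler_pdivrMr// => se h.
rewrite lx [X in e * X]E mulrA; apply: (@le_trans _ _ (2 * Num.sqrt x)); first by lra.
by apply: ler_wpM2r; [exact: ltW|rewrite mulrC].
Unshelve. all: by end_near.
Qed.

Lemma ln_inv_cvgy : ln l^-1 @[l --> (0 : R)^'+] --> +oo.
Proof.
apply/cvgryPge => A; near=> l.
have l0 : 0 < l by near: l; exact: nbhs_right_gt.
have lA : l <= expR (- A) by near: l; apply: nbhs_right_le; exact: expR_gt0.
by rewrite lnV ?posrE// lerNr -(expRK (- A)) ler_ln// posrE expR_gt0.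
Unshelve. all: by end_near.
Qed.

Lemma ln_inv_cvg0 : (ln l^-1)^-1 @[l --> (0 : R)^'+] --> (0 : R).
Proof.
apply/gtr0_cvgV0; last exact: ln_inv_cvgy.
by move/cvgryPgt : ln_inv_cvgy => /(_ 0).
Qed.

Let mul0p (x y : R -> R) (a b : R) : x t @[t --> 0^'+] --> a -> y t @[t --> 0^'+] --> b ->
 x t * y t @[t --> 0^'+] --> a * b.
Proof. by move=> h1 h2; exact: cvgM. Qed.

Let sub0p (x y : R -> R) (a b : R) : x t @[t --> 0^'+] --> a -> y t @[t --> 0^'+] --> b ->
 x t - y t @[t --> 0^'+] --> a - b.
Proof. by move=> h1 h2; exact: cvgB. Qed.

Let inv0p (x : R -> R) (a : R) : 0 < a -> x t @[t --> 0^'+] --> a -> (x t)^-1 @[t --> 0^'+] --> a^-1.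
Proof. by move=> a0 h; apply: cvgV => //; rewrite gt_eqF. Qed.

Let cst0p (a : R) : a @[t --> (0 : R)^'+] --> a. Proof. exact: cvg_cst. Qed.

Let uniq0p (x : R -> R) (a b : R) : x t @[t --> 0^'+] --> a -> x t @[t --> 0^'+] --> b -> a = b.
Proof. by move=> h1 h2; rewrite -(cvg_lim (@Rhausdorff R) h1) -(cvg_lim (@Rhausdorff R) h2). Qed.

Let near0p (x y : R -> R) (a : R) : (forall t : R, 0 < t -> y t = x t) -> x t @[t --> 0^'+] --> a -> y t @[t --> 0^'+] --> a.
Proof.
move=> h; apply: cvg_trans; apply: near_eq_cvg.
by apply: filterS (nbhs_right_gt (0 : R)) => t t0; rewrite h.
Qed.

Let powR_cvg1 (x : R -> R) (p : R) : x t @[t --> 0^'+] --> (1 : R) -> x t `^ p @[t --> 0^'+] --> (1 : R).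
Proof.
move=> hx; have F0 : Filter (0^'+ : set_system R) by typeclasses eauto.
have := @continuous_cvg _ _ _ _ F0 x (fun y : R => y `^ p) 1 (@powR_cont p 1 ltr01) hx.
by rewrite powR1.
Qed.

Let ratio_cvg1 (x : R -> R) (k : R) : 0 < k ->
 x t @[t --> 0^'+] --> k -> x t / k @[t --> 0^'+] --> (1 : R) /\ k / x t @[t --> 0^'+] --> (1 : R).
Proof.
move=> k0 hx; have ku : k != 0 by rewrite gt_eqF.
have h1 := mul0p hx (@cst0p k^-1); have h2 := mul0p (@cst0p k) (inv0p k0 hx).
by rewrite divff// in h1; rewrite divff// in h2.
Qed.

Lemma powR_div (x y p : R) : 0 <= x -> 0 < y -> (x / y) `^ p = x `^ p / y `^ p.
Proof.
move=> x0 y0; apply: (canRL (mulfK _)); first by rewrite gt_eqF// powR_gt0.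
by rewrite -powRM ?divr_ge0 ?(ltW y0)// divfK// gt_eqF.
Qed.

(** The integrand is bounded below by a positive constant on [1, 2]. *)
Lemma Gamma_gt0 (b : R) : 0 < b < 1 -> 0 < Gamma (1 - b).
Proof.
move=> b01; have [i E] := laplace_pow b01 (@ltr01 R); move: E; rewrite powR1 mul1r => <-.
pose C : R := expR (- 2) * 2 `^ (- b); have C0 : 0 < C by rewrite mulr_gt0 ?expR_gt0 ?powR_gt0.
have sI : (`[1, 2]%classic : set RR) `<=` D by move=> t; rewrite /= !in_itv/= andbT => /andP[t1 _]; exact: le_trans t1.
have [ic Ec] := itg_ind (mI _) (mI _) sI (itg_cst (mI _) (@fin_itv R 1 2) C).
have h12 : 1 <= 2 :> R by lra.
apply: (@lt_le_trans _ _ C) => //; rewrite (_ : C = C * (2 - 1)); last by rewrite (_ : 2 - 1 = 1 :> R) ?mulr1//; lra.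
rewrite -(Rint_cst_itv C h12) -Ec; apply: (le_Rintegral (mI _) ic i) => t; rewrite /= in_itv/= andbT => t0.
case: ifPn => [|_]; last by rewrite mulr_ge0 ?expR_ge0 ?powR_ge0.
rewrite inE/= in_itv/= => /andP[t1 t2]; have tp : 0 < t by apply: lt_le_trans t1.
apply: ler_pM; rewrite ?expR_ge0 ?powR_ge0//; first by rewrite ler_expR mulN1r lerN2.
by rewrite !powRN lef_pV2 ?posrE ?powR_gt0//; apply: ge0_ler_powR; rewrite ?nnegrE ?(ltW tp)//; case/andP: b01 => /ltW.
Qed.

Variables (w f : R -> R).
Hypotheses (bw : bounded_density 1 w) (lapE : forall l : R, 0 < l -> lap w l * f l = 1).
Hypotheses (f_incr : forall l l' : R, 0 <= l -> l <= l' -> l' - l <= f l' - f l).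
Hypotheses (f_cont : f l @[l --> 0^'+] --> f 0) (f00 : 0 <= f 0).

Let f_gt (l : R) : 0 < l -> f 0 < f l.
Proof. by move=> l0; have := f_incr (lexx 0) (ltW l0); lra. Qed.

Let f_gt0 (l : R) : 0 < l -> 0 < f l.
Proof. by move=> /f_gt; apply: le_lt_trans. Qed.

Let lapV (l : R) : 0 < l -> lap w l = (f l)^-1.
Proof.
by move=> l0; rewrite -[RHS]mul1r -(lapE l0) mulfK// gt_eqF// f_gt0.
Qed.

Let wm : measurable_fun [set: RR] w. Proof. by case: bw. Qed.
Let w0 (t : R) : 0 <= t -> 0 <= w t. Proof. by case: bw => _ h /h/andP[]. Qed.

Lemma transient_itg : 0 < f 0 -> itg mu D w /\ \int[mu]_(t in D) w t = (f 0)^-1.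
Proof.
move=> f0; have i : itg mu D w.
 apply: (lap_bd_itg bw (C := (f 0)^-1)) => l l0.
 have := f_gt l0; have := f_gt0 l0; rewrite lapV// => p1 p2; by rewrite lef_pV2 ?posrE ?ltW.
split => //; have c1 := lap_right0 bw i.
exact: (uniq0p c1 (near0p lapV (inv0p f0 f_cont))).
Qed.

Lemma itg_transient : itg mu D w -> 0 < f 0.
Proof.
move=> i; rewrite lt_def f00 andbT; apply/eqP => f0.
have c1 := mul0p (lap_right0 bw i) f_cont; rewrite f0 mulr0 in c1.
by have := uniq0p c1 (near0p lapE (@cst0p 1)) => /eqP; rewrite eq_sym oner_eq0.
Qed.

(** If f(0) were positive, [w] would be integrable and its transform would converge to a finite
    limit; multiplied by a factor tending to 0 it could not tend to k > 0. *)
Let recurrent (g : R -> R) (k : R) : 0 < k -> g l @[l --> 0^'+] --> (0 : R) ->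
 lap w l * g l @[l --> 0^'+] --> k -> f 0 = 0.
Proof.
move=> k0 hg h; apply/eqP; move: f00; rewrite le_eqVlt => /orP[/eqP <-//|/transient_itg[i _]].
have := uniq0p h (mul0p (lap_right0 bw i) hg); rewrite mulr0 => E.
by rewrite E ltxx in k0.
Qed.

Lemma inverse_power (b c : R) : 0 < b < 1 -> 0 < c -> w t * t `^ b @[t --> +oo] --> c ->
 f 0 = 0 /\ l / (c * Gamma (1 - b) * f l) `^ ((1 - b)^-1) @[l --> 0^'+] --> (1 : R).
Proof.
move=> b01 c0 wc; have h := abel_pow bw b01 (ltW c0) wc.
have k0 : 0 < c * Gamma (1 - b) by rewrite mulr_gt0 ?Gamma_gt0.
have b1 : 0 < 1 - b by rewrite subr_gt0; case/andP: b01.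
split; first by apply: (recurrent k0 _ h); exact: powR_cvg0.
have h2 : lap w l * l `^ (1 - b) / (c * Gamma (1 - b)) @[l --> 0^'+] --> (1 : R) by have [] := ratio_cvg1 k0 h.
apply: near0p (@powR_cvg1 _ ((1 - b)^-1) h2) => l l0; have fl := f_gt0 l0; rewrite lapV//.
rewrite (_ : (f l)^-1 * _ / _ = l `^ (1 - b) / (c * Gamma (1 - b) * f l)); last first.
 by move: fl k0; move: (f l) (c * _) => x y x0 y0; field; rewrite ?(gt_eqF x0) ?(gt_eqF y0).
rewrite (powR_div _ (powR_ge0 _ _) (mulr_gt0 k0 fl)); congr (_ / _).
by rewrite -powRrM divff ?gt_eqF// powRr1 ?ltW.
Unshelve. all: by end_near.
Qed.

(** Taking reciprocals in [abel_log] gives f(l) ln(1/l) -> 1/c. The result is stated as a small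
    error in ln l relative to 1/f(l), since exponentiating would destroy an asymptotic
    equivalence. *)
Lemma inverse_log (c : R) : 0 < c -> w t * t @[t --> +oo] --> c ->
 f 0 = 0 /\ f l * (ln l + (c * f l)^-1) @[l --> 0^'+] --> (0 : R).
Proof.
move=> c0 wc; have h := abel_log bw (ltW c0) wc.
split; first exact: (recurrent c0 ln_inv_cvg0 h).
have h2 := sub0p (@cst0p c^-1) (inv0p c0 h).
rewrite subrr in h2; apply: near0p h2 => l l0; have fl := f_gt0 l0.
by rewrite /= lapV// lnV ?posrE// !invfM !invrN !invrK mulrDr; field; rewrite ?(gt_eqF fl) ?(gt_eqF c0).
Unshelve. all: by end_near.
Qed.

Section transient.
Variables (c al : R).
Hypotheses (al1 : 1 < al) (c0 : 0 < c) (wc : w t * t `^ al @[t --> +oo] --> c).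

Let i_w : itg mu D w := power_itg bw al1 (ltW c0) wc.
Let f0 : 0 < f 0 := itg_transient i_w.
Let G := (f 0)^-1.
Let G0 : 0 < G. Proof. by rewrite invr_gt0. Qed.
Let T := lap (tail w).
Let bt : bounded_density (tail w 0) (tail w) := tail_bounded wm w0 i_w.
Let tc : tail w r * r `^ (al - 1) @[r --> +oo] --> c / (al - 1) := power_tail bw al1 (ltW c0) wc.
Let a0 : 0 < al - 1. Proof. by rewrite subr_gt0. Qed.
Let k0 : 0 < c / (al - 1). Proof. by rewrite divr_gt0. Qed.

(** By [lap_tail] the left side is 1/f(0) - 1/f(l). This converts the asymptotics of the tail
    transform into those of f(l) - f(0). *)
Let gap (l : R) : 0 < l -> l * T l = (f l - f 0) * G * lap w l.
Proof.
move=> l0; rewrite /T -(lap_tail wm w0 i_w l0) (transient_itg f0).2 lapV// -/G.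
by have := f_gt0 l0; rewrite /G => p; field; rewrite ?(gt_eqF p) ?(gt_eqF f0).
Qed.

Let lapG : lap w l / G @[l --> 0^'+] --> (1 : R).
Proof.
have h := lap_right0 bw i_w; rewrite (transient_itg f0).2 in h.
by have [] := ratio_cvg1 G0 h.
Qed.

Let pos (l : R) : 0 < l -> [/\ 0 < f l - f 0, 0 < lap w l & 0 < T l].
Proof.
move=> l0; have y0 : 0 < f l - f 0 by rewrite subr_gt0 f_gt.
have p0 : 0 < lap w l by rewrite lapV// invr_gt0 f_gt0.
by split => //; rewrite -(pmulr_rgt0 _ l0) gap// !mulr_gt0.
Qed.

(** The tail decays with exponent al - 1 in (0,1), so T(l) grows like l^(al-2) and, by [gap], f(l) -
    f(0) behaves like l^(al-1); a power of the ratio inverts this. *)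
Lemma inverse_lt2 : al < 2 -> l / ((f l - f 0) * G ^+ 2 * (al - 1) / (c * Gamma (2 - al)))
 `^ ((al - 1)^-1) @[l --> 0^'+] --> (1 : R).
Proof.
move=> al2; have b01 : 0 < al - 1 < 1 by rewrite a0/=; lra.
have h := abel_pow bt b01 (ltW k0) tc; have g0 := Gamma_gt0 b01.
have E : 1 - (al - 1) = 2 - al by ring.
rewrite E in h g0; have kk : 0 < c / (al - 1) * Gamma (2 - al) by rewrite mulr_gt0.
have h2 := mul0p (ratio_cvg1 kk h).2 lapG; rewrite mulr1 in h2.
apply: near0p (@powR_cvg1 _ ((al - 1)^-1) h2) => l l0; have gp := gap l0; have [y0 p0 T0] := pos l0.
rewrite /= -/(T l) [X in _ = X `^ _](_ : _ = l `^ (al - 1) / ((f l - f 0) * G ^+ 2 * (al - 1) / (c * Gamma (2 - al)))).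
 have q0 : 0 < (f l - f 0) * G ^+ 2 * (al - 1) / (c * Gamma (2 - al)) by rewrite divr_gt0 ?mulr_gt0 ?exprn_gt0.
 rewrite (powR_div _ (powR_ge0 _ _) q0); congr (_ / _).
 by rewrite -powRrM divff ?gt_eqF// powRr1 ?ltW.
have lE : l = l `^ (al - 1) * l `^ (2 - al).
 by rewrite -powRD ?(gt_eqF l0) ?implybT// -E [in RHS]addrC subrK powRr1// ltW.
have p1 := powR_gt0 (al - 1) l0; have p2 := powR_gt0 (2 - al) l0.
move: gp; rewrite {1}lE; move: p1 p2 T0 p0 y0 kk g0 G0.
move: (l `^ _) (l `^ _) (T l) (lap w l) (f l - f 0) (Gamma _) G => A B t q y g' G' A0 B0 t0 q0 y0 kk g0 G0' gp.
have -> : y = B * A * t / (G' * q) by rewrite gp; field; rewrite !gt_eqF.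
by field; rewrite !gt_eqF.
Unshelve. all: by end_near.
Qed.

(** The tail decays like c/r, so f(l) - f(0) = l ln(1/l) K(l) with K converging to a positive limit.
    Inversion requires the logarithm of 1/(f(l) - f(0)) in place of that of 1/l; their ratio differs
    from 1 by ln ln(1/l) / ln(1/l) and ln K(l) / ln(1/l), which vanish. *)
Lemma inverse_eq2 : al = 2 ->
 l / (G ^+ 2 / c * (f l - f 0) * (ln (f l - f 0)^-1)^-1) @[l --> 0^'+] --> (1 : R).
Proof.
move=> al2; have tc' : tail w r * r @[r --> +oo] --> c.
 have := tc; rewrite al2 (_ : 2 - 1 = 1 :> R); last by ring.
 rewrite divr1 => h; apply: cvg_trans h; apply: near_eq_cvg; near=> r; rewrite powRr1//.
have h := abel_log bt (ltW c0) tc'.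
pose K (l : R) := T l / ln l^-1 / (G * lap w l).
have hK : K l @[l --> 0^'+] --> c / (G * G).
 have hG := lap_right0 bw i_w; rewrite (transient_itg f0).2 -/G in hG.
 by apply: mul0p => //; apply: inv0p; [rewrite mulr_gt0|apply: mul0p].
have hlK : ln (K l) @[l --> 0^'+] --> ln (c / (G * G)).
 by apply: (continuous_cvg _ _ hK); apply: continuous_ln; rewrite divr_gt0 ?mulr_gt0.
have hlL : ln (ln l^-1) / ln l^-1 @[l --> (0 : R)^'+] --> (0 : R).
 exact: (cvg_comp _ _ ln_inv_cvgy ln_div_cvg0).
have hr : 1 - ln (ln l^-1) / ln l^-1 - ln (K l) * (ln l^-1)^-1 @[l --> 0^'+] --> (1 : R).
 have := sub0p (sub0p (@cst0p 1) hlL) (mul0p hlK ln_inv_cvg0).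
 by rewrite mulr0 !subr0.
have h2 := mul0p (mul0p (ratio_cvg1 c0 h).2 lapG) hr; rewrite !mulr1 in h2; apply: cvg_trans h2; apply: near_eq_cvg; near=> l.
have l0 : 0 < l by near: l; exact: nbhs_right_gt.
have L0 : 0 < ln l^-1 by near: l; move/cvgryPgt : ln_inv_cvgy => /(_ 0).
have gp := gap l0; have [y0 p0 T0] := pos l0.
have K0 : 0 < K l by rewrite !divr_gt0 ?mulr_gt0.
have yE : f l - f 0 = l * ln l^-1 * K l.
 rewrite /K; have -> : l * ln l^-1 * (T l / ln l^-1 / (G * lap w l)) = l * T l / (G * lap w l) by field; rewrite ?(gt_eqF L0) ?(gt_eqF G0) ?(gt_eqF p0).
 by rewrite gp; field; rewrite ?(gt_eqF G0) ?(gt_eqF p0).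
have E : ln (f l - f 0)^-1 = ln l^-1 - ln (ln l^-1) - ln (K l).
 have -> : ln (f l - f 0)^-1 = - ln (f l - f 0) by rewrite lnV// posrE.
 have lL : 0 < l * ln l^-1 by rewrite mulr_gt0.
 have -> : ln (f l - f 0) = ln (l * ln l^-1) + ln (K l) by rewrite yE lnM// posrE.
 have -> : ln (l * ln l^-1) = ln l + ln (ln l^-1) by rewrite lnM// posrE.
 by rewrite [X in _ = X - _ - _]lnV ?posrE//; ring.
rewrite /= -/(T l) E; rewrite {1}/K in yE; move: yE L0 K0 T0 p0 G0 y0.
move: (K l) => k; move: (ln (ln _)) (ln k) => LL lk.
move: (ln _) (T l) (lap w l) (f l - f 0) G => L t q y G' yE L0 K0 t0 q0 G0' y0.
have yE' : y = l * t / (G' * q) by rewrite yE; field; rewrite ?(gt_eqF L0) ?(gt_eqF G0') ?(gt_eqF q0).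
by rewrite invfM !invfM !invrK yE' !invfM !invrK; field; rewrite ?(gt_eqF L0) ?(gt_eqF G0') ?(gt_eqF q0) ?(gt_eqF t0) ?(gt_eqF l0) ?(gt_eqF c0).
Unshelve. all: by end_near.
Qed.

(** The tail is now integrable itself, with the first moment of [w] as its integral, so T(l) has a
    finite limit and f(l) - f(0) is linear in l to leading order. *)
Lemma inverse_gt2 : 2 < al ->
 l / (G ^+ 2 / fine (\int[mu]_(t in D) (t * w t)%:E) * (f l - f 0)) @[l --> 0^'+] --> (1 : R).
Proof.
move=> al2; have a1 : 1 < al - 1 by lra.
have it : itg mu D (tail w) := power_itg bt a1 (ltW k0) tc.
rewrite (tail_first_moment wm w0 i_w) -(EFin_Rint (mI _) it)/=; set H := \int[mu]_(r in D) tail w r.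
have hT : T l @[l --> 0^'+] --> H by exact: lap_right0 bt it.
have t0 (r : R) : 0 <= r -> 0 <= tail w r by case: bt => _ h /h/andP[].
(* The tail is positive at some S by its power asymptotics and decreases, so its integral is at
   least S times its value at S. *)
have H0 : 0 < H.
 have k2 : 0 < c / (al - 1) / 2 by rewrite divr_gt0.
 have [S S1 hS] := pinfty_eps tc k2; have S0 : 0 < S by apply: lt_le_trans S1.
 have tS : 0 < tail w S.
  have := hS S (lexx S); have := ler_norm (c / (al - 1) - tail w S * S `^ (al - 1)).
  rewrite lt_def t0 ?(ltW S0)// andbT => h1 h2; apply/eqP => E; move: h1 h2; rewrite E mul0r subr0.
  by move=> h1 h2; have := le_trans h1 h2; move: k2; set k := c / _; lra.
 have sI : (`[0, S]%classic : set RR) `<=` D by move=> t; rewrite /= !in_itv/= andbT => /andP[].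
 have [ic Ec] := itg_ind (mI _) (mI _) sI (itg_cst (mI _) (@fin_itv R 0 S) (tail w S)).
 apply: (@lt_le_trans _ _ (tail w S * (S - 0))); first by rewrite subr0 mulr_gt0.
 rewrite -(Rint_cst_itv _ (ltW S0)) -Ec; apply: (le_Rintegral (mI _) ic it) => t; rewrite /= in_itv/= andbT => tp.
 case: ifPn => [|_]; last exact: t0.
 by rewrite inE/= in_itv/= => /andP[_ tS']; exact: tail_anti.
have h2 := mul0p (ratio_cvg1 H0 hT).2 lapG; rewrite mulr1 in h2; apply: near0p h2 => l l0; have gp := gap l0; have [y0 p0 T0] := pos l0.
move: gp H0 T0 p0 G0 y0; rewrite /= -/(T l); clear hT; clearbody H.
move: H (T l) (lap w l) (f l - f 0) G => H' t q y G' gp H0 t0' q0 G0' y0.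
have -> : y = l * t / (G' * q) by rewrite gp; field; rewrite ?(gt_eqF G0') ?(gt_eqF q0).
by field; rewrite ?(gt_eqF G0') ?(gt_eqF q0) ?(gt_eqF t0') ?(gt_eqF l0) ?(gt_eqF H0).
Unshelve. all: by end_near.
Qed.

End transient.
End inverse_laplace.
End half_line.

(** * The exponent as the inverse of phi *)

Section exponent.
Context (R : realType) (d : nat) (a : sites d -> sites d -> R).
Hypothesis ha : migration_rates a.
Variable pbar : R -> sites d -> sites d -> R.
Hypothesis hp : symmetrized_transition a pbar.
Variables (rho : R) (rho0 : 0 < rho).
Local Notation q := (a 0).
Local Notation f := (phi (a 0)).
Local Notation w := (wlk (a 0)).
Local Notation mu := (@lebesgue_measure R).
Local Notation RR := (measurableTypeR R).
Local Notation D := (`[(0 : R), +oo[%classic : set RR).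

Let q0 x : 0 <= q x := rates_ge0 ha 0 x.
Let qs : sm q := rate_sm ha 0.
Let q1 : ssum q = 1 := rate_ssum ha 0.

Let bw : bounded_density 1 w.
Proof. by split; [exact: wlk_meas|move=> t _; rewrite wlk_ge0// wlk_le1]. Qed.

Let lapE (l : R) : 0 < l -> lap w l * f l = 1.
Proof.
move=> l0; rewrite -(phi_green q0 qs q1 l0) mulrC; congr (_ * _).
by rewrite /lap /Rintegral (laplace_wlk q0 qs q1 l0).
Qed.

Let f_incr (l l' : R) : 0 <= l -> l <= l' -> l' - l <= f l' - f l.
Proof. exact: phi_incr. Qed.

Let f00 : 0 <= f 0. Proof. exact: phi_ge. Qed.

Let f_cont : f l @[l --> 0^'+] --> f 0.
Proof.
apply/cvgrPdist_le => e e0; have [dl dl0 h] := phi_unif q0 qs q1 e0; near=> l.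
have l0 : 0 < l by near: l; exact: nbhs_right_gt.
by apply: (h 0 l (lexx 0) (ltW l0)); rewrite sub0r normrN gtr0_norm.
Unshelve. all: by end_near.
Qed.

Let GbarE : Gbar pbar = (\int[mu]_(t in D) (w t)%:E)%E.
Proof.
by apply: eq_integral => t; rewrite inE/= in_itv/= andbT => t0; rewrite (pbar_wlk ha hp).
Qed.

Let HbarE : Hbar pbar = (\int[mu]_(t in D) (t * w t)%:E)%E.
Proof.
by apply: eq_integral => t; rewrite inE/= in_itv/= andbT => t0; rewrite (pbar_wlk ha hp).
Qed.

Let Gbar_fin : 0 < f 0 -> Gbar pbar = ((f 0)^-1)%:E.
Proof.
move=> f0; have [i E] := transient_itg bw lapE f_incr f_cont f00 f0.
have mD := mI `[(0 : R), +oo[.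
by rewrite GbarE -E (EFin_Rint mD i).
Qed.

(** In the transient case Gbar is the limit 1/phi(0) of the transform. If phi(0) = 0, a finite Gbar
    would make the return probability integrable and force phi(0) > 0; so Gbar is infinite and its
    inverse is 0 by convention. *)
Lemma invGbar_phi : invGbar pbar = f 0.
Proof.
have [f0|f0] := ltP 0 (f 0). by rewrite /invGbar (Gbar_fin f0) inver gt_eqF ?invr_gt0//= invrK.
have -> : f 0 = 0 by apply/eqP; rewrite eq_le f0 f00.
suff E : Gbar pbar = +oo%E by rewrite /invGbar E invey.
apply/eqP; rewrite GbarE -leye_eq leNgt; apply/negP => h.
have wm : measurable_fun D w by apply: (measurable_funS (@measurableT _ RR)) => //; case: bw.
have i : itg mu D w.
 apply/integrableP; split; first exact/measurable_EFinP.
 apply: le_lt_trans h; apply: ge0_le_integral => //=.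
 - by apply/measurable_EFinP; exact: measurableT_comp.
 - exact/measurable_EFinP.
 - by move=> t _; rewrite lee_fin ger0_norm// wlk_ge0.
by have := itg_transient bw lapE f_cont f00 i; rewrite ltNge f0.
Qed.

(** Positivity of [c] is implicit in the equivalence: return probabilities are nonnegative, so for c
    <= 0 the quotient would be nonpositive, the convention for division by 0 included. *)
Lemma power_decay_wlk (c al : R) : power_decay pbar c al -> 0 < c /\ w t * t `^ al @[t --> +oo] --> c.
Proof.
rewrite /power_decay /asymp_equiv => h.
have c0 : 0 < c.
 rewrite ltNge; apply/negP => c0.
 have : (1 : R) <= 0; last by rewrite ler10.
 apply: (cvg_to_le _ h); near=> t.
 have t0 : 0 <= t by near: t; exact: near_ge.
 by rewrite (pbar_wlk ha hp)// mulr_ge0_le0 ?wlk_ge0// invr_le0 mulr_le0_ge0 ?powR_ge0.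
split => //; have h2 : (fun t => pbar t 0 0 / (c * t `^ (- al)) * c) t @[t --> +oo] --> c.
 by rewrite -[X in _ --> X]mul1r; apply: cvgM => //; exact: cvg_cst.
apply: cvg_trans h2; apply: near_eq_cvg; near=> t.
have t0 : 0 < t by near: t; apply: nbhs_pinfty_gt; exact: num_real.
have p0 := powR_gt0 al t0.
by rewrite (pbar_wlk ha hp) ?ltW// powRN; field; rewrite ?(gt_eqF p0) ?(gt_eqF c0).
Unshelve. all: by end_near.
Qed.

(** [g] is constrained on the supercritical range only and is arbitrary elsewhere. *)
Definition is_exponent (g : R -> R) := forall k, f 0 <= k * rho -> 0 <= g k /\ f (g k) = k * rho.

Lemma exponent_exists : exists g, is_exponent g.
Proof.
have h (k : R) : exists l, f 0 <= k * rho -> 0 <= l /\ f l = k * rho.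
 have [kr|kr] := boolP (f 0 <= k * rho); last by exists 0.
 by have [l l0 E] := phi_surj q0 qs q1 kr; exists l.
by have [g hg] := choice h; exists g => k; exact: hg.
Qed.

Lemma supercriticalE (k : R) : supercritical pbar rho k <-> f 0 <= k * rho.
Proof. by rewrite /supercritical invGbar_phi /= in_itv/= andbT ler_pdivrMr. Qed.

Variables (g : R -> R) (hg : is_exponent g).

(** If g at the midpoint were at least the average m of its values, monotonicity of phi would give
    phi(m) at most the averaged kappa rho, against strict concavity of phi. *)
Lemma exponent_convex : q 0 < 1 -> strictly_convex_on (supercritical pbar rho) g.
Proof.
move=> a1 x y l /supercriticalE sx /supercriticalE sy xy l01; have /andP[l0 l1] := l01.
have [gx Ex] := hg sx; have [gy Ey] := hg sy.
have sl : f 0 <= (l * x + (1 - l) * y) * rho.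
 by rewrite mulrDl -!mulrA -[f 0](_ : l * f 0 + (1 - l) * f 0 = _); [nra|ring].
have [gl El] := hg sl; have gxy : g x != g y.
 apply: contra_neq xy => E; apply: (mulIf (lt0r_neq0 rho0)).
 by rewrite -Ex -Ey E.
have := phi_concave q0 qs q1 (Fr1_gt0 q0 qs q1 a1) gx gy gxy l01.
rewrite Ex Ey => h; rewrite ltNge; apply/negP => h2.
have c0 : 0 <= l * g x + (1 - l) * g y by apply: addr_ge0; apply: mulr_ge0 => //; rewrite ?subr_ge0 ltW.
have := f_incr c0 h2; rewrite El; move: h h2; lra.
Qed.

Lemma exponent_le (k : R) : supercritical pbar rho k -> g k <= k * rho.
Proof. by move=> /supercriticalE/hg[g0 <-]; exact: phi_ge. Qed.

(** l <= phi(l) <= l + 2 puts g(k) between k rho - 2 and k rho, so the relative error is at most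
    2/(k rho). *)
Lemma exponent_infty : g k / (k * rho) @[k --> +oo] --> (1 : R).
Proof.
apply/cvgrPdist_le => e e0; near=> k.
have k1 : 1 <= k by near: k; exact: near_ge.
have ke : 2 / (e * rho) <= k by near: k; exact: near_ge.
have k0 : 0 < k by exact: lt_le_trans k1.
have kr : 0 < k * rho by exact: mulr_gt0.
have sk : f 0 <= k * rho by rewrite -ler_pdivrMr.
have [g0 E] := hg sk; have h1 := phi_ge q0 qs q1 g0; have h2 := phi_le q0 qs q1 g0; rewrite E in h1 h2.
have -> : 1 - g k / (k * rho) = (k * rho - g k) / (k * rho) by field; rewrite ?(gt_eqF k0) ?(gt_eqF rho0).
rewrite ger0_norm; last by apply: divr_ge0; [rewrite subr_ge0|exact: ltW].
rewrite ler_pdivrMr//; move: ke; rewrite ler_pdivrMr ?mulr_gt0// => ke.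
have -> : e * (k * rho) = k * (e * rho) by ring.
lra.
Unshelve. all: by end_near.
Qed.

(** Change of variable: phi grows at least with slope 1, so 0 < g(k) <= k rho - phi(0) to the right
    of the critical value, and limits at 0 from the right transfer through [g]. *)
Let g_right (F : set_system R) (h : R -> R) : h l @[l --> 0^'+] --> F ->
 h (g k) @[k --> (f 0 / rho)^'+] --> F.
Proof.
move=> hF; apply: (@cvg_comp _ _ _ g h _ (0^'+)) => //.
move=> U [e /= e0 hU]; rewrite /nbhs /=; near=> k; apply: hU => /=.
 have ke : k < f 0 / rho + e / rho by near: k; apply: nbhs_right_lt; rewrite ltrDl divr_gt0.
 have sk : f 0 < k * rho by rewrite -ltr_pdivrMr.
 have [g0 E] := hg (ltW sk); have := f_incr (lexx 0) g0; rewrite E.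
 rewrite sub0r normrN ger0_norm// subr0; move: ke; rewrite -mulrDl ltr_pdivlMr//; lra.
have sk : f 0 < k * rho by rewrite -ltr_pdivrMr.
have [g0 E] := hg (ltW sk); rewrite lt_def g0 andbT; apply: contraTneq sk => gk.
by rewrite -E gk ltxx.
Unshelve. all: by end_near.
Qed.

Let crit_eq (h h' : R -> R) (x : R) : (forall k, f 0 < k * rho -> f (g k) = k * rho -> h k = h' k) ->
 h k @[k --> (f 0 / rho)^'+] --> x -> h' k @[k --> (f 0 / rho)^'+] --> x.
Proof.
move=> E; apply: cvg_trans; apply: near_eq_cvg; apply: filterS (nbhs_right_gt (f 0 / rho)) => k.
by rewrite ltr_pdivrMr// => kf; have [_ gk] := hg (ltW kf); rewrite E.
Qed.

(** Here the walk is recurrent, phi(0) = 0, so the critical value is 0 and the limit at 0 is the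
    critical limit. *)
Lemma exponent_small_power (c al : R) : power_decay pbar c al -> 0 < al < 1 ->
 asymp_equiv 0^'+ g (fun k => (c * Gamma (1 - al) * (k * rho)) `^ ((1 - al)^-1)).
Proof.
move=> /power_decay_wlk[c0 wc] al01.
have [f0 h] := inverse_power bw lapE f_incr f_cont f00 al01 c0 wc.
have f0r : 0 = f 0 / rho by rewrite f0 mul0r.
rewrite /asymp_equiv f0r; apply: crit_eq (g_right h) => k _ E.
by rewrite E.
Qed.

Lemma exponent_small_log (c : R) : power_decay pbar c 1 ->
 exists2 r : R -> R, r k / k^-1 @[k --> 0^'+] --> (0 : R) &
  asymp_equiv 0^'+ g (fun k => expR (- (c * k * rho)^-1 + r k)).
Proof.
move=> /power_decay_wlk[c0 wc].
have wc1 : w t * t @[t --> +oo] --> c. apply: cvg_trans wc; apply: near_eq_cvg; near=> t; rewrite powRr1//.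
have [f0 h] := inverse_log bw lapE f_incr f_cont f00 c0 wc1.
have f0r : 0 = f 0 / rho by rewrite f0 mul0r.
(* With this remainder the exponential formula holds with equality for small k > 0; what has to be
   shown is that the remainder is o(1/k). *)
exists (fun k => ln (g k) + (c * (k * rho))^-1).
 have h2 := g_right h; rewrite [X in X^'+]f0r.
 have h3 : f (g k) * (ln (g k) + (c * f (g k))^-1) * rho^-1 @[k --> (f 0 / rho)^'+] --> (0 : R).
  by rewrite -[X in _ --> X](mul0r rho^-1); apply: cvgM => //; exact: cvg_cst.
 apply: crit_eq h3 => k; rewrite f0 pmulr_lgt0// => k0 E.
 by rewrite E invrK; field; rewrite ?(gt_eqF rho0) ?(gt_eqF k0) ?(gt_eqF c0).
rewrite /asymp_equiv [X in X^'+]f0r.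
have h1 : g k / g k @[k --> (f 0 / rho)^'+] --> (1 : R).
 apply: (g_right (h := fun l => l / l)).
 apply: (@cvg_trans _ ((1 : R) @[l --> (0 : R)^'+])); last exact: cvg_cst.
 apply: near_eq_cvg; apply: filterS (nbhs_right_gt (0 : R)) => l l0.
 by rewrite divff// gt_eqF.
apply: crit_eq h1 => k fk gE; congr (_ / _).
have [g0 _] := hg (ltW fk); rewrite -mulrA addrCA addNr addr0 lnK// posrE lt_def g0 andbT.
by apply: contraTneq fk => gk; rewrite -gE gk ltxx.
Unshelve. all: by end_near.
Qed.

Section transient_exponent.
Variables (c al : R).
Hypotheses (pd : power_decay pbar c al) (al1 : 1 < al).

Let c0 : 0 < c := (power_decay_wlk pd).1.
Let wc : w t * t `^ al @[t --> +oo] --> c := (power_decay_wlk pd).2.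

Lemma transient_phi : 0 < f 0.
Proof. exact: itg_transient bw lapE f_cont f00 (power_itg bw al1 (ltW c0) wc). Qed.

Lemma fine_Gbar : fine (Gbar pbar) = (f 0)^-1.
Proof. by rewrite (Gbar_fin transient_phi). Qed.

Let G := fine (Gbar pbar).
Let crit := invGbar pbar / rho.

Lemma crit_gt0 : 0 < crit.
Proof. by rewrite /crit invGbar_phi divr_gt0// transient_phi. Qed.

Lemma exponent_crit_lt2 : al < 2 -> asymp_equiv crit^'+ g (fun k =>
 ((k * rho - G^-1) * G ^+ 2 * (al - 1) / (c * Gamma (2 - al))) `^ ((al - 1)^-1)).
Proof.
move=> al2; rewrite /asymp_equiv /crit /G invGbar_phi fine_Gbar invrK.
apply: crit_eq (g_right (inverse_lt2 bw lapE f_incr f_cont f00 al1 c0 wc al2)) => k _ E.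
by rewrite E.
Qed.

Lemma exponent_crit_eq2 : al = 2 -> asymp_equiv crit^'+ g (fun k =>
 G ^+ 2 / c * (k * rho - G^-1) * (ln (k * rho - G^-1)^-1)^-1).
Proof.
move=> al2; rewrite /asymp_equiv /crit /G invGbar_phi fine_Gbar invrK.
apply: crit_eq (g_right (inverse_eq2 bw lapE f_incr f_cont f00 al1 c0 wc al2)) => k _ E.
by rewrite E.
Qed.

Lemma exponent_crit_gt2 : 2 < al -> asymp_equiv crit^'+ g (fun k =>
 G ^+ 2 / fine (Hbar pbar) * (k * rho - G^-1)).
Proof.
move=> al2; rewrite /asymp_equiv /crit /G invGbar_phi fine_Gbar invrK HbarE.
apply: crit_eq (g_right (inverse_gt2 bw lapE f_incr f_cont f00 al1 c0 wc al2)) => k _ E.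
by rewrite E.
Qed.

End transient_exponent.
End exponent.

(** * From moment bounds to the Lyapunov exponent *)

(** Constants disappear after taking the logarithm and dividing by t. An upper bound at every rate
    above [g] suffices, which matters because the supersolution degenerates at [g] itself. *)
Lemma lyapunov_cvg (R : realType) (g : R) (m : R -> R) :
 (exists2 c : R, 0 < c & forall t, 0 <= t -> c * expR (g * t) <= m t) ->
 (forall l, g < l -> exists C : R, forall t, 0 <= t -> m t <= C * expR (l * t)) ->
 ((t^-1)%:E * lne (m t)%:E)%E @[t --> +oo] --> g%:E.
Proof.
move=> [c c0 hc] hC.
have m0 t : 0 <= t -> 0 < m t by move=> t0; apply: lt_le_trans (hc t t0); rewrite mulr_gt0 ?expR_gt0.
have h : t^-1 * ln (m t) @[t --> +oo] --> g.
 apply/cvgrPdist_le => e e0; have e2 : 0 < e / 2 by rewrite divr_gt0.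
 have [C hC'] : exists C : R, forall t, 0 <= t -> m t <= C * expR ((g + e / 2) * t) by apply: hC; rewrite ltrDl.
 have C0 : 0 < C by have := lt_le_trans (m0 0 (lexx 0)) (hC' 0 (lexx 0)); rewrite mulr0 expR0 mulr1.
 near=> t.
 have t1 : 1 <= t by near: t; exact: near_ge.
 have tc : `|ln c| / e <= t by near: t; exact: near_ge.
 have tC : `|ln C| / (e / 2) <= t by near: t; exact: near_ge.
 have t0 : 0 < t by exact: lt_le_trans t1.
 have mt := m0 t (ltW t0).
 have L1 : ln c + g * t <= ln (m t).
  by rewrite -[g * t]expRK -lnM ?posrE ?expR_gt0// ler_ln ?posrE ?mulr_gt0 ?expR_gt0// hc// ltW.
 have L2 : ln (m t) <= ln C + (g + e / 2) * t.
  by rewrite -[_ * t]expRK -lnM ?posrE ?expR_gt0// ler_ln ?posrE ?mulr_gt0 ?expR_gt0// hC'// ltW.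
 move: tc tC; rewrite !ler_pdivrMr// => tc tC.
 have n1 := ler_norm (- ln c); have n2 := ler_norm (ln C); rewrite normrN in n1.
 have -> : g - t^-1 * ln (m t) = (g * t - ln (m t)) / t by field; rewrite gt_eqF.
 rewrite normrM [X in _ * X](gtr0_norm (_ : 0 < t^-1)) ?invr_gt0// ler_pdivrMr// ler_norml.
 by rewrite mulrDl in L2; apply/andP; split; lra.
apply: (@cvg_trans _ ((t^-1 * ln (m t))%:E @[t --> +oo])); last by apply: cvg_EFin => //; exact: nearW.
apply: near_eq_cvg; near=> t; rewrite lne_EFin//; apply: m0.
by near: t; exact: near_ge.
Unshelve. all: by end_near.
Qed.

Section walk_generator.
Context (R : realType) (G : countZmodType) (q : G -> R).
Hypotheses (q0 : forall x, 0 <= q x) (qs : sm q) (q1 : ssum q = 1).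

Let q_itg (h : G -> R) (B : R) (e : G -> G) : (forall x, 0 <= h x <= B) -> sm (fun z => q z * h (e z)).
Proof.
move=> hB; apply: (sm_dom (smZ B qs)) => z; have /andP[h0 hb] := hB (e z).
rewrite !normrM mulrC ler_wpM2r// !ger0_norm//; exact: le_trans hb.
Qed.

(** For functions of i - j the two-walker operator is the one-jump operator of the difference walk,
    by translation invariance of the rates. *)
Lemma Pop_shift (h : G -> R) (B : R) (i j : G) : (forall x, 0 <= h x <= B) ->
 Pop (fun i j => q (j - i)) (fun i j => h (i - j)) i j = Sop q h (i - j).
Proof.
move=> hB; have shift (k : G) (g : G -> R) : (forall x, 0 <= g x <= B) ->
  ssum (fun z => q (z - k) * g z) = ssum (fun z => q z * g (k + z)).
 move=> gB; have be : bijective (fun z : G => z - k) by exists (fun z => z + k) => z; rewrite ?addrK ?subrK.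
 have p0 z : 0 <= q z * g (k + z) by rewrite mulr_ge0//; case/andP: (gB (k + z)).
 have [_ <-] := ssum_reindex be p0 (@q_itg g B (fun z => k + z) gB).
 by apply: eq_ssum => z; rewrite [k + _]addrC subrK.
rewrite /Pop (shift j (fun z => h (i - z)) (fun z => hB _)) (shift i (fun z => h (z - j)) (fun z => hB _)).
rewrite addrC /Sop /Aop /Bop /Cop; congr (_ + _); apply: eq_ssum => z; congr (_ * h _). by rewrite opprD addrA.
by rewrite addrAC.
Qed.

Lemma Sop_affine (h : G -> R) (B c e : R) x : (forall x, 0 <= h x <= B) ->
 Sop q (fun y => c * h y + e) x = c * Sop q h x + 2 * e.
Proof.
move=> hB; rewrite /Sop /Aop /Bop /Cop.
have K (r : G -> G) : ssum (fun z => q z * (c * h (r z) + e)) = c * ssum (fun z => q z * h (r z)) + e.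
 have s1 := @q_itg h B r hB.
 rewrite -(ssumZ c s1) -[in RHS](mulr1 e) -q1 -(ssumZ e qs) -(ssumD (smZ c s1) (smZ e qs)).
 by apply: eq_ssum => z; ring.
by rewrite (K (fun z => x + - z)) (K (fun z => x + id z)); move: (ssum _) (ssum _) => A C; ring.
Qed.

Let f00 : 0 <= phi q 0. Proof. exact: phi_ge. Qed.

(** Above gam one has s < phi(l), so s times the Green function at 0 is below 1. This leaves room
    for an added constant, which makes the function bounded away from 0 and lets it dominate the
    initial value 1. *)
Lemma supersolution (s gam l : R) : 0 <= gam -> phi q gam = s -> gam < l ->
 exists h : G -> R, exists B : R, [/\ forall x, 1 <= h x <= B
 & forall x, Sop q h x + (if x == 0 then s * h x else 0) <= (l + 2) * h x].
Proof.
move=> g0 E gl; have l0 : 0 < l by exact: le_lt_trans gl.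
have s0 : 0 <= s by rewrite -E; apply: le_trans (phi_ge q0 qs q1 g0).
have gr0 := green_ge0 q0 qs q1 0 l0.
have sp : s < phi q l by have := phi_incr q0 qs q1 g0 (ltW gl); rewrite E; lra.
have sg : s * green q l 0 < 1.
 have := phi_green q0 qs q1 l0 => pg.
 by rewrite -pg ltr_pM2r// lt_def gr0 andbT; apply/eqP => gE; move: pg; rewrite gE mulr0 => /esym/eqP; rewrite oner_eq0.
(* With this choice s g + (s+1) e = 1, where g is the Green function at 0; so s (g + e) stays below
   1, the mass which the resolvent equation supplies at 0. *)
pose e := (1 - s * green q l 0) / (s + 1).
have e0 : 0 < e by rewrite divr_gt0 ?subr_gt0// ltr_wpDl.
have hB x : 0 <= green q l x <= l^-1.
 by rewrite green_ge0//=; have := green_le q0 qs q1 x l0; rewrite mulrC -ler_pdivlMr// div1r.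
exists (fun x => e^-1 * green q l x + 1), (e^-1 * l^-1 + 1); split => x.
 have /andP[h0 h1] := hB x.
 have ei := ltW e0; rewrite -invr_ge0 in ei.
 by rewrite lerDr mulr_ge0//= lerD2r ler_wpM2l.
rewrite (@Sop_affine (green q l) l^-1)// [leRHS]mulrDr mulrCA (green_resolvent q0 qs q1 x l0) /del.
case: eqP => [->|_]; last by rewrite addr0 mulr0n add0r lerD2l !mulr1 lerDr ltW.
rewrite mulr1n; have ei : e^-1 * e = 1 by rewrite mulVf// gt_eqF.
have E2 : s * green q l 0 + (s + 1) * e = 1 by rewrite /e; field; rewrite gt_eqF// ltr_wpDl.
have E3 : s * (e^-1 * green q l 0) + (s + 1) = e^-1.
 move: ei E2; move: e^-1 (green q l 0) => y g ye h.
 have -> : s * (y * g) + (s + 1) = y * (s * g + (s + 1) * e) + (s + 1) * (1 - y * e) by ring.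
 by rewrite h ye subrr mulr0 addr0 mulr1.
rewrite [s * _]mulrDr [e^-1 * (1 + _)]mulrDr !mulr1; move: E3.
by move=> E3; lra.
Qed.

(** At the root, phi(gam) times the Green function at 0 is 1, so the potential at 0 balances the
    delta term of the resolvent equation exactly; the factor gam keeps the function below 1. For gam
    = 0 the Green function may be infinite, and the constant 1 is used. *)
Lemma subsolution (s gam : R) : 0 <= gam -> phi q gam = s ->
 exists h : G -> R, [/\ forall x, 0 <= h x <= 1, 0 < h 0
 & forall x, (gam + 2) * h x <= Sop q h x + (if x == 0 then s * h x else 0)].
Proof.
move=> g0 E; have [gE|gn] := eqVneq gam 0.
 have s0 : 0 <= s by rewrite -E gE.
 exists (fun=> 1); split => // [x|x]; first by rewrite ler01 lexx.
 have z0 (y : G) : (0 : R) <= 0 <= (0 : R) by rewrite lexx.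
 have := @Sop_affine (fun=> 0) 0 0 1 x z0; rewrite !mul0r !add0r mulr1 => E1.
 by rewrite E1 gE add0r !mulr1 lerDl; case: ifP.
have gp : 0 < gam by rewrite lt_def gn.
have pg := phi_green q0 qs q1 gp; have gr x := green_ge0 q0 qs q1 x gp.
have hB x : 0 <= green q gam x <= gam^-1.
 by rewrite gr/=; have := green_le q0 qs q1 x gp; rewrite mulrC -ler_pdivlMr// div1r.
exists (fun x => gam * green q gam x + 0); split => [x||x].
- by rewrite addr0 mulr_ge0 ?(ltW gp)//= green_le.
- rewrite addr0 mulr_gt0// lt_def gr andbT; apply/eqP => gE; move: pg; rewrite gE mulr0 => /esym/eqP.
 by rewrite oner_eq0.
rewrite (@Sop_affine (green q gam) gam^-1)// mulr0 !addr0 mulrCA (green_resolvent q0 qs q1 x gp) /del mulrDr.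
rewrite addrC lerD2l; case: eqP => [->|_]; last by rewrite mulr0.
by rewrite mulrCA -E pg.
Qed.

Context disp (O : measurableType disp) (P : probability O R) (om : G -> R) (K kap rho : R).
Variables (F : R -> set (set O)) (x : 'I_2 -> R -> O -> G -> R) (W : 'I_2 -> G -> R -> O -> R).
Hypothesis M : regular_model P (fun i j => q (j - i)) om K kap rho F x W.
Hypotheses (rho0 : 0 < rho) (rho1 : rho <= 1).
Variable gam : R.
Hypotheses (gam0 : 0 <= gam) (gamE : phi q gam = kap * rho).

Let a_s (i : G) : sm (fun j => q (j - i)).
Proof.
have be : bijective (fun z : G => z - i) by exists (fun z => z + i) => z; rewrite ?addrK ?subrK.
by have [] := ssum_reindex be q0 qs.
Qed.

Lemma second_moment_le (l : R) : gam < l ->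
 exists C : R, forall n k t, 0 <= t -> Mom P x n n k k t <= C * expR (l * t).
Proof.
move=> gl; have [h [B [hB hs]]] := supersolution gam0 gamE gl.
exists (rho^-1 * h 0) => n k t t0.
have h0 y : 0 <= h y <= B by have /andP[h1 h2] := hB y; rewrite h2 (le_trans ler01 h1).
have U : Mom P x ord0 ord_max k k t <= expR (l * t) * h (k - k).
 apply: (@mixed_le _ _ _ _ _ _ _ _ _ _ _ _ _ M a_s rho0 l B (fun i j => h (i - j)) _ _ _ k k t t0) => i j.
 - by case/andP: (hB (i - j)).
 - by have /andP[h1 h2] := h0 (i - j); rewrite ger0_norm.
 - by rewrite (Pop_shift i j h0) -subr_eq0; exact: hs.
rewrite subrr in U; have V := second_le_mixed M rho1 n k k t0.
by rewrite -mulrA ler_pdivlMl// (le_trans V)// mulrC.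
Qed.

Lemma second_moment_ge :
 exists2 c : R, 0 < c & forall n k t, 0 <= t -> c * expR (gam * t) <= Mom P x n n k k t.
Proof.
have [h [hB hp hs]] := subsolution gam0 gamE.
exists (h 0) => // n k t t0; apply: (le_trans _ (mixed_le_second M rho1 n k k t0)).
rewrite mulrC -[X in h X](subrr k).
apply: (@mixed_ge _ _ _ _ _ _ _ _ _ _ _ _ _ M a_s rho0 gam 1 (fun i j => h (i - j)) _ _ _ k k t t0) => i j.
- by case/andP: (hB (i - j)).
- by have /andP[h1 h2] := hB (i - j); rewrite ger0_norm.
- by rewrite (Pop_shift i j hB) -subr_eq0; exact: hs.
Qed.

Lemma second_moment_lyapunov n k (y : R -> O -> R) :
 (forall t, 0 <= t -> measurable_fun setT (y t) /\ {ae P, forall w, x n t w k = y t w}) ->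
 is_second_Lyapunov P y gam.
Proof.
move=> hy; have h : ((t^-1)%:E * lne (Mom P x n n k k t)%:E)%E @[t --> +oo] --> gam%:E.
 apply: lyapunov_cvg; first by have [c c0 hc] := second_moment_ge; exists c => // t; exact: hc.
 by move=> l /second_moment_le[C hC]; exists C => t; exact: hC.
apply: cvg_trans h; apply: near_eq_cvg; near=> t.
have t0 : 0 <= t by near: t; exact: near_ge.
have [my ae] := hy t t0; congr (_ * lne _)%E.
(* The moment results are stated up to an integer horizon; any integer above [t] serves. *)
have [T tT] : exists T : nat, 0 <= t <= T%:R by exists (Num.truncn t).+1; rewrite t0/=; apply/ltW/truncnS_gt.
have [xL _] := dom_L2 M (dom_x M n k) tT; have [mx _] := xL.
have i2 := L2_mul measurableT xL xL.
rewrite unlock (EFin_Rint measurableT i2); apply: ae_eq_integral => //.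
- by apply/measurable_EFinP; apply: measurable_funM.
- by apply/measurable_EFinP; exact: measurable_funX.
- by apply: filterS ae => w /= E _; rewrite E expr2.
Unshelve. all: by end_near.
Qed.

End walk_generator.

Section lyapunov.
Context (R : realType) (d : nat) (a : sites d -> sites d -> R) (om : sites d -> R).
Hypotheses (ha : migration_rates a) (hom : admissible_weight a om).
Context disp (O : measurableType disp) (P : probability O R).
Variables (kap rho : R) (u v : R -> O -> sites d -> R).
Hypotheses (kap0 : 0 <= kap) (rho0 : 0 < rho) (rho1 : rho <= 1).
Hypothesis hsol : SBM_solution a om kap rho P u v.
Hypothesis hstart : homogeneous_start P u v.
Variable gam : R.
Hypotheses (gam0 : 0 <= gam) (gamE : phi (a 0) gam = kap * rho).

Lemma second_lyapunov k :
 is_second_Lyapunov P (fun t w => u t w k) gam /\ is_second_Lyapunov P (fun t w => v t w k) gam.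
Proof.
have [K [F [x [W [M hx]]]]] := regularize ha hom kap0 hsol hstart.
have aE : a = (fun i j => a 0 (j - i)) by apply/funext => i; apply/funext => j; exact: rates_shift ha i j.
rewrite aE in M.
have S n y := @second_moment_lyapunov R _ (a 0) (rates_ge0 ha 0) (rate_sm ha 0) (rate_ssum ha 0) _ O P om K kap rho F x W M rho0 rho1 gam gam0 gamE n k y.
by split; [apply: (S ord0)|apply: (S ord_max)] => t t0; have [m1 m2 a1 a2] := hx t k t0; split.
Qed.

End lyapunov.

Theorem proposition2p2 (R : realType) (d : nat) (hd : (0 < d)%N)
  (a : 'rV[int]_d -> 'rV[int]_d -> R) (ha : migration_rates a)
  (om : 'rV[int]_d -> R) (hom : admissible_weight a om)
  (rho : R) (hrho0 : 0 < rho) (hrho1 : rho <= 1)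
  (pbar : R -> 'rV[int]_d -> 'rV[int]_d -> R)
  (hpbar : symmetrized_transition a pbar)
  (disp : R -> measure_display)
  (Omega : forall kappa : R, measurableType (disp kappa))
  (P : forall kappa : R, probability (Omega kappa) R)
  (u v : forall kappa : R, R -> Omega kappa -> 'rV[int]_d -> R)
  (hsol : forall kappa : R, supercritical pbar rho kappa ->
     SBM_solution a om kappa rho (P kappa) (u kappa) (v kappa) /\
     homogeneous_start (P kappa) (u kappa) (v kappa)) :
  exists gamma2 : R -> R,
    (forall kappa : R, supercritical pbar rho kappa ->
       0 <= gamma2 kappa /\
       forall k : 'rV[int]_d,
         is_second_Lyapunov (P kappa) (fun t w => u kappa t w k) (gamma2 kappa) /\
         is_second_Lyapunov (P kappa) (fun t w => v kappa t w k) (gamma2 kappa)) /\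
    (* i; without migration (a i j = (i == j)) gamma2 is linear, hence a 0 0 < 1 *)
    (a 0 0 < 1 -> strictly_convex_on (supercritical pbar rho) gamma2) /\
    (* ii *)
    ((forall kappa : R, supercritical pbar rho kappa ->
        gamma2 kappa <= kappa * rho) /\
     gamma2 kappa / (kappa * rho) @[kappa --> +oo] --> (1 : R)) /\
    (* iii *)
    (forall c alpha : R, power_decay pbar c alpha ->
       (0 < alpha < 1 ->
          asymp_equiv 0^'+ gamma2
            (fun kappa => (c * Gamma (1 - alpha) * (kappa * rho))
                            `^ ((1 - alpha)^-1))) /\
       (alpha = 1 ->
          exists2 r : R -> R,
            r kappa / kappa^-1 @[kappa --> 0^'+] --> (0 : R) &
            asymp_equiv 0^'+ gamma2
              (fun kappa => expR (- (c * kappa * rho)^-1 + r kappa)))) /\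
    (* iv *)
    (forall c alpha : R, power_decay pbar c alpha -> 1 < alpha ->
       let G := fine (Gbar pbar) in
       let H := fine (Hbar pbar) in
       let crit := invGbar pbar / rho in
       0 < crit /\
       (alpha < 2 ->
          asymp_equiv crit^'+ gamma2
            (fun kappa =>
               ((kappa * rho - G^-1) * G ^+ 2 * (alpha - 1) / (c * Gamma (2 - alpha)))
                 `^ ((alpha - 1)^-1))) /\
       (alpha = 2 ->
          asymp_equiv crit^'+ gamma2
            (fun kappa => G ^+ 2 / c * (kappa * rho - G^-1)
                            * (ln (kappa * rho - G^-1)^-1)^-1)) /\
       (2 < alpha ->
          asymp_equiv crit^'+ gamma2
            (fun kappa => G ^+ 2 / H * (kappa * rho - G^-1)))).
Proof.
(* The function depends on the rates and on rho alone, so it is fixed before any of the solutions,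
   which may live on different probability spaces for different kappa. *)
have [gamma2 hg] := exponent_exists ha rho.
have sE k := supercriticalE ha hpbar hrho0 k.
exists gamma2; split; [|split; [|split; [|split]]].
- move=> kappa sk; have [hs hst] := hsol kappa sk; have kr := (sE kappa).1 sk.
  have [g0 gE] := hg kappa kr; split => // k.
  have f0 : 0 <= phi (a 0) 0 by apply: phi_ge => //; [exact: rates_ge0 ha 0|exact: rate_sm ha 0|exact: rate_ssum ha 0].
  have kap0 : 0 <= kappa by rewrite -(pmulr_lge0 _ hrho0); exact: le_trans kr.
  exact: (second_lyapunov ha hom kap0 hrho0 hrho1 hs hst g0 gE k).
- by move=> a1; exact: (exponent_convex ha hpbar hrho0 hg a1).
- split; first by move=> k; exact: (exponent_le ha hpbar hrho0 hg). exact: (exponent_infty ha hrho0 hg).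
- move=> c alpha pd; split; first by move=> al; exact: (exponent_small_power ha hpbar hrho0 hg pd al).
  by move=> al; rewrite al in pd; exact: (exponent_small_log ha hpbar hrho0 hg pd).
- move=> c alpha pd al G H crit; split; first exact: (crit_gt0 ha hpbar hrho0 pd al).
  split; [|split].
  + exact: (exponent_crit_lt2 ha hpbar hrho0 hg pd al).
  + exact: (exponent_crit_eq2 ha hpbar hrho0 hg pd al).
  + exact: (exponent_crit_gt2 ha hpbar hrho0 hg pd al).
Qed.
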